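(* Let $Q$ be an integral binary quadratic form whose $\mathrm{GL}_2(\mathbf{Z})$-equivalence class $[Q]$ equals $[T_K^{\perp\prime}]$ for some non-pure complex cubic field $K$. Let $[\gamma_Q]\subset\mathrm{GL}_2(\mathbf{Z})\backslash\mathfrak{H}$ be the image of the geodesic $\gamma_Q$, endowed with the measure $\mu_Q$ induced by the hyperbolic metric. For a $\mu_Q$-continuity set $W\subseteq[\gamma_Q]$ and $X>0$, let $N(Q;X,W)$ be the number of isomorphism classes of complex cubic fields $K$ with $[T_K^{\perp\prime}]=[Q]$, $\mathrm{sh}(K)\in W$ and $|\Delta(K)|<X$. Then \[\lim_{X\to\infty}\frac{N(Q;X,W)}{N(Q;X,[\gamma_Q])}=\frac{\mu_Q(W)}{\mu_Q([\gamma_Q])}.\] More precisely, there is a constant $C_Q>0$ (independent of $W$) such that $N(Q;X,W)=C_Q\,\mu_Q(W)\sqrt{X}+o(\sqrt{X})$.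
   Context: A complex cubic field has one real and two complex embeddings $\sigma_1,\sigma_2,\sigma_3$; it is pure if it is isomorphic to $\mathbf{Q}(\sqrt[3]{m})$ for some non-cube $m\in\mathbf{Q}$. With $\alpha^\perp:=3\alpha-\mathrm{Tr}(\alpha)$ and $1,\alpha_1,\alpha_2$ a $\mathbf{Z}$-basis of $\mathcal{O}_K$: $T_K^\perp(x,y)=\mathrm{Tr}((x\alpha_1^\perp+y\alpha_2^\perp)^2)$, $T_K^{\perp\prime}$ is it divided by the gcd of its coefficients; $M(x,y)=\sum_i|\sigma_i(x\alpha_1^\perp+y\alpha_2^\perp)|^2$; for positive definite $rx^2+sxy+ty^2$, $z=\frac{s}{2r}+i\frac{\sqrt{4rt-s^2}}{2r}$; $\mathrm{sh}(K)$ is the image of $z(M)$ in $\mathrm{GL}_2(\mathbf{Z})\backslash\mathfrak{H}$ (with $g$ acting by $z\mapsto\frac{az+b}{cz+d}$ if $\det g=1$, $z\mapsto\frac{a\bar z+b}{c\bar z+d}$ if $\det g=-1$), identified with a point of the Gauss domain $\{x+iy:0\le x\le\frac12,x^2+y^2\ge1\}$. For indefinite real $Q$, $\gamma_Q$ is the hyperbolic geodesic in $\mathfrak{H}$ joining the two points of $\mathbf{P}^1(\mathbf{R})=\mathbf{R}\cup\{\infty\}$ at which $Q$ vanishes. A $\mu_Q$-continuity set is a measurable set whose boundary has $\mu_Q$-measure $0$. *)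

(* Defs.v *)
From HB Require Import structures.
From mathcomp Require Import all_boot all_order all_algebra all_field.
From mathcomp Require Import complex.
From mathcomp Require Import all_classical all_reals all_analysis.

Set Implicit Arguments.
Unset Strict Implicit.
Unset Printing Implicit Defensive.

Import Order.TTheory GRing.Theory Num.Theory.
Import numFieldNormedType.Exports.

Local Open Scope classical_set_scope.
Local Open Scope ring_scope.

(* [BQF a b c] is a x^2 + b x y + c y^2. *)
Record bqf (A : Type) : Type := BQF { qa : A; qb : A; qc : A }.

Definition qeval (A : comNzRingType) (Q : bqf A) (x y : A) : A :=
  qa Q * x ^+ 2 + qb Q * x * y + qc Q * y ^+ 2.

Definition bqf_real (R : nzRingType) (Q : bqf int) : bqf R :=
  BQF (qa Q)%:~R (qb Q)%:~R (qc Q)%:~R.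

Definition primitive_part (Q : bqf int) : bqf int :=
  let g := gcdz (qa Q) (gcdz (qb Q) (qc Q)) in
  BQF (qa Q %/ g)%Z (qb Q %/ g)%Z (qc Q %/ g)%Z.

Definition GL2Z_equiv (Q Q' : bqf int) : Prop :=
  exists2 g : 'M[int]_2, g \in unitmx &
    forall x y : int, qeval Q' x y =
      qeval Q (g 0 0 * x + g 0 1 * y) (g 1 0 * x + g 1 1 * y).

Definition field_iso (K L : fieldExtType rat) : Prop :=
  exists f : {rmorphism K -> L}, bijective f.

Definition enumerates_embeddings (R : realType) (K : fieldExtType rat)
    (s : 'I_3 -> {rmorphism K -> R[i]}) : Prop :=
  (forall i j, s i =1 s j -> i = j) /\
  (forall t : {rmorphism K -> R[i]}, exists i, t =1 s i).

Definition real_embedding (R : realType) (K : fieldExtType rat)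
    (t : {rmorphism K -> R[i]}) : Prop :=
  forall x, complex.Im (t x) = 0.

Definition complex_cubic (R : realType) (K : fieldExtType rat) : Prop :=
  \dim {:K} = 3%N /\
  exists2 s : 'I_3 -> {rmorphism K -> R[i]}, enumerates_embeddings s &
    exists i, forall j, real_embedding (s j) <-> j = i.

Definition pure (K : fieldExtType rat) : Prop :=
  exists (m : rat) (L : fieldExtType rat) (theta : L),
    [/\ forall r : rat, r ^+ 3 <> m,
        theta ^+ 3 = m%:A,
        <<1%VS; theta>>%VS = fullv
      & field_iso K L].

Section CubicField.
Variable K : fieldExtType rat.
Implicit Types x alpha : K.

(* Trace of multiplication by alpha. *)
Definition Tr alpha : rat :=
  let e := vbasis {:K} in \sum_i coord e i (alpha * e`_i).

Definition perp alpha : K := alpha *+ 3 - (Tr alpha)%:A.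

Definition integer_of x : Prop := integralOver (intr : int -> K) x.

(* [1, alpha1, alpha2] is a Z-basis of the ring of integers of K. *)
Definition integral_basis alpha1 alpha2 : Prop :=
  let comb (n : int * int * int) : K :=
    n.1.1%:~R + alpha1 *~ n.1.2 + alpha2 *~ n.2 in
  injective comb /\ forall x, integer_of x <-> exists n, x = comb n.

Definition disc alpha1 alpha2 : rat :=
  let w := [tuple 1; alpha1; alpha2] in
  \det (\matrix_(i < 3, j < 3) Tr (tnth w i * tnth w j)).

Definition perp_comb alpha1 alpha2 (x y : int) : K :=
  perp alpha1 *~ x + perp alpha2 *~ y.

(* The GL_2(Z)-class of the primitive trace form of K is that of Q. *)
Definition trace_class (Q : bqf int) : Prop :=
  exists (alpha1 alpha2 : K) (T : bqf int),
    [/\ integral_basis alpha1 alpha2,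
        forall x y : int,
          (qeval T x y)%:~R = Tr (perp_comb alpha1 alpha2 x y ^+ 2)
      & GL2Z_equiv (primitive_part T) Q].

Definition absdisc_lt (R : realType) (X : R) : Prop :=
  exists2 alpha : K * K, integral_basis alpha.1 alpha.2 &
    `|ratr (disc alpha.1 alpha.2)| < X.

End CubicField.

Section HalfPlane.
Variable R : realType.
Implicit Types z w : R[i].

Definition upper_half_plane : set R[i] := [set z | 0 < complex.Im z].

Definition GL2Z_act (g : 'M[int]_2) z : R[i] :=
  let w := if \det g == 1 then z else conjc z in
  ((g 0 0)%:~R * w + (g 0 1)%:~R) / ((g 1 0)%:~R * w + (g 1 1)%:~R).

(* Strict fundamental domain for GL_2(Z): the quotient GL_2(Z)\H is identified
   with it throughout. GL_2(Z) acts through the group generated by the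
   reflections in its sides, so the quotient metric is the restriction of the
   hyperbolic distance. *)
Definition gauss_domain : set R[i] :=
  [set z | [/\ upper_half_plane z, 0 <= complex.Re z <= 2^-1
             & 1 <= complex.Re z ^+ 2 + complex.Im z ^+ 2]].

Definition quotient_image (A : set R[i]) : set R[i] :=
  gauss_domain `&`
  [set w | exists2 g : 'M[int]_2, g \in unitmx & exists2 z, A z & w = GL2Z_act g z].

Definition z_of (M : bqf R) : R[i] :=
  Complex (qb M / (2 * qa M))
          (Num.sqrt (4 * qa M * qc M - qb M ^+ 2) / (2 * qa M)).

Definition is_shape (K : fieldExtType rat) (w : R[i]) : Prop :=
  exists (alpha1 alpha2 : K) (s : 'I_3 -> {rmorphism K -> R[i]}) (M : bqf R),
    [/\ integral_basis alpha1 alpha2,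
        enumerates_embeddings s,
        forall x y : int, qeval M x%:~R y%:~R =
          \sum_(i < 3) Normc.normc (s i (perp_comb alpha1 alpha2 x y)) ^+ 2
      & quotient_image [set z_of M] w].

(* Points of P^1(R): [Some t] is t = (t : 1), [None] is infinity = (1 : 0).
   Using y/x or -x/y instead of x/y would move the geodesic by an element of
   GL_2(Z), hence would not change its image in the quotient. *)
Definition vanishes_at (Q : bqf R) (p : option R) : Prop :=
  if p is Some t then qeval Q t 1 = 0 else qeval Q 1 0 = 0.

Definition geodesic_joining (p q : option R) : set R[i] :=
  match p, q with
  | Some u, Some v =>
      upper_half_plane `&`
      [set z | (complex.Re z - (u + v) / 2) ^+ 2 + complex.Im z ^+ 2
               = ((u - v) / 2) ^+ 2]
  | Some u, None | None, Some u =>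
      upper_half_plane `&` [set z | complex.Re z = u]
  | None, None => set0
  end.

Definition geodesic (Q : bqf R) : set R[i] :=
  [set z | exists p q, [/\ p <> q, vanishes_at Q p, vanishes_at Q q
                         & geodesic_joining p q z]].

Definition geodesic_class (Q : bqf int) : set R[i] :=
  quotient_image (geodesic (bqf_real R Q)).

Definition arcosh (x : R) : R := ln (x + Num.sqrt (x ^+ 2 - 1)).

Definition hyp_dist z w : R :=
  arcosh (1 + Normc.normc (z - w) ^+ 2 / (2 * complex.Im z * complex.Im w)).

(* 0 is included so that the empty set has diameter 0. *)
Definition hyp_diam (A : set R[i]) : \bar R :=
  ereal_sup (0%E |` [set d | exists z w, [/\ A z, A w & d = (hyp_dist z w)%:E]]).

(* One-dimensional Hausdorff (outer) measure of the hyperbolic metric. *)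
Definition hyp_length (A : set R[i]) : \bar R :=
  ereal_sup [set l | exists2 delta : R, 0 < delta &
    l = ereal_inf [set (\sum_(0 <= k <oo) hyp_diam (U k))%E |
          U in [set U : (set R[i])^nat |
            [/\ forall k, U k `<=` upper_half_plane,
                forall k, (hyp_diam (U k) <= delta%:E)%E
              & A `<=` \bigcup_k U k]]]].

Definition mu (Q : bqf int) (W : set R[i]) : \bar R :=
  hyp_length (W `&` geodesic_class Q).

(* Boundary of W in the subspace Y; the topology of the complex plane is
   carried by R[i]^o. *)
Definition boundary_in (Y W : set R[i]^o) : set R[i] :=
  Y `&` closure W `&` closure (Y `\` W).

Definition mu_continuity_set (Q : bqf int) (W : set R[i]) : Prop :=
  [/\ W `<=` geodesic_class Q,
      <<s [set U : set R[i]^o | open U] >> W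
    & mu Q (boundary_in (geodesic_class Q) W) = 0%E].

End HalfPlane.

(* P, assumed isomorphism-invariant, holds for exactly n isomorphism classes. *)
Definition iso_class_count (P : fieldExtType rat -> Prop) (n : nat) : Prop :=
  exists F : 'I_n -> fieldExtType rat,
    [/\ forall i, P (F i),
        forall i j, field_iso (F i) (F j) -> i = j
      & forall K, P K -> exists i, field_iso K (F i)].

(* [get] selects the unique such n; it is a junk value only if there are
   infinitely many classes, which bounded discriminant rules out. *)
Definition num_iso_classes (P : fieldExtType rat -> Prop) : nat :=
  get (iso_class_count P).

Definition Ncount (R : realType) (Q : bqf int) (X : R) (W : set R[i]) : nat :=
  num_iso_classes (fun K =>
    [/\ complex_cubic R K, trace_class K Q,
        exists2 w, is_shape K w & W w
      & absdisc_lt K X]).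

(* Main.v *)
(* Write O_K as the cubic ring of an integral binary cubic form f (Delone-Faddeev). The trace form is then
   6 Hess(f), so [T'] = [Q] means that f can be chosen with Hess(f) = n Q, n > 0, and |disc| = n^2 D/3 with
   D = disc Q. Non-purity makes D > 0 a non-square; replacing Q by an equivalent form, all its coefficients are
   negative. Being apolar to Q is linear, so f is determined by its first two coefficients (a, b), and over R
   f = P (x - r1 y)^3 + P' (x - r2 y)^3 with r1, r2 the roots of Q. The shape of K is the class of
   e^(-t) (x - r1 y)^2 + e^t (x - r2 y)^2 with e^(3t) = P'/P, the point of parameter t on the geodesic of Q for
   hyperbolic arc length. In these coordinates n < B^2 and t1 <= t < t2 cut out a sector region in the (a, b)
   plane with area proportional to (t2 - t1) B^2.

   Maximality of the ring of f is a condition modulo p^3 at each p. A sieve gives a positive density: for large p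
   failure forces p^2 | n, and the tail is bounded by counting points with p | (a, b) and points near roots of
   Q modulo p^2. A reducible f maximal everywhere has n = 1, so only boundedly many must be discarded. Two
   fields are isomorphic if and only if their forms differ, up to sign, by an automorph of Q, and such automorphs
   act on t by isometries.

   By Gauss reduction this action is cocompact, and a fundamental segment is cut into finitely many arcs that embed
   isometrically in the Gauss domain; hence the Hausdorff measure of the quotient geodesic is Lebesgue measure on the
   arcs. A continuity set W is squeezed between finite unions of dyadic pieces: the total length of the pieces meeting
   both W and its complement tends to 0, because they shrink to the boundary of W. *)
From HB Require Import structures.
Require Import Defs.
From mathcomp Require Import all_boot all_order all_algebra all_field.
From mathcomp Require Import complex.
From mathcomp Require Import all_classical all_reals all_analysis.
From mathcomp Require Import ring lra zify.
Import Order.TTheory GRing.Theory Num.Theory.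
Import numFieldNormedType.Exports.
Local Open Scope classical_set_scope.
Local Open Scope ring_scope.
Set Implicit Arguments.
Unset Strict Implicit.
Unset Printing Implicit Defensive.

(** * Binary quadratic forms and Gauss reduction *)

(** The counting variable B is chosen so that |disc| < X becomes n < B^2 with X = B^4 D/3: fields
    correspond to lattice points of a planar region of size B, whose area has the order of sqrt(X).
    Negative coefficients make both roots of Q negative, so that n > 0 holds exactly on a cone
    inside the first quadrant and on its opposite; f and -f give the same ring, so pairs of naturals
    suffice. Two groups compete: isomorphism of fields is governed by the automorphs of Q, while the
    quotient geodesic is also divided by the matrices carrying Q to -Q. The isometries of the line
    coming from the two groups differ by an index c equal to 1 or 2, and each arc is counted c
    times. The constant has four factors: the area per unit of t, the density of maximal forms, c,
    and sqrt(3/D). Positivity of the density needs one maximal form to start from, and the given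
    field supplies it: congruences modulo small primes are frozen at that form and only large primes
    are sieved. Non-squareness of D keeps the outer coefficients of every form equivalent to Q away
    from 0, which leaves finitely many forms after reduction. *)

Record zmat := ZM { za : int; zb : int; zc : int; zd : int }.
Definition zdet g := za g * zd g - zb g * zc g.
Definition zmul g h := ZM (za g * za h + zb g * zc h) (za g * zb h + zb g * zd h)
  (zc g * za h + zd g * zc h) (zc g * zb h + zd g * zd h).
Definition zone := ZM 1 0 0 1.
Definition zinv g := ZM (zdet g * zd g) (- (zdet g * zb g)) (- (zdet g * zc g)) (zdet g * za g).
Definition unimod g := zdet g ^+ 2 = 1.

Lemma unimodP g : unimod g -> zdet g = 1 \/ zdet g = -1.
Proof. by move=> /eqP; rewrite sqrf_eq1 => /orP[]/eqP; [left|right]. Qed.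

Lemma zdetM g h : zdet (zmul g h) = zdet g * zdet h.
Proof. by rewrite /zdet /zmul /=; ring. Qed.

Lemma unimodM g h : unimod g -> unimod h -> unimod (zmul g h).
Proof. by rewrite /unimod zdetM exprMn => -> ->; rewrite mulr1. Qed.

Lemma unimod1 : unimod zone. Proof. by []. Qed.

Lemma unimodV g : unimod g -> unimod (zinv g).
Proof.
(* The determinant of [zinv g] is the cube of [zdet g], so 1 is written as the cube of
   [zdet g ^+ 2]. *)
rewrite /unimod => h; rewrite -[RHS](expr1n _ 3) -h /zdet /zinv /= /zdet; ring.
Qed.

Lemma zmulV g : unimod g -> zmul g (zinv g) = zone.
Proof.
move=> h; have e : zdet g * zdet g = 1 by rewrite -expr2.
by congr ZM; rewrite /= ?[in RHS](esym e) /zdet; ring.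
Qed.

Lemma zmulVg g : unimod g -> zmul (zinv g) g = zone.
Proof.
move=> h; have e : zdet g * zdet g = 1 by rewrite -expr2.
by congr ZM; rewrite /= ?[in RHS](esym e) /zdet; ring.
Qed.

Lemma zmulA g h k : zmul g (zmul h k) = zmul (zmul g h) k.
Proof. by congr ZM; rewrite /=; ring. Qed.

Lemma zmul1 g : zmul g zone = g.
Proof. by case: g => *; congr ZM; rewrite /=; ring. Qed.

Definition zm_of (m : 'M[int]_2) := ZM (m 0 0) (m 0 1) (m 1 0) (m 1 1).
Definition mx_of g : 'M[int]_2 :=
  \matrix_(i, j) (if i == 0 then if j == 0 then za g else zb g
                  else if j == 0 then zc g else zd g).

Lemma zm_ofK g : zm_of (mx_of g) = g.
Proof. by case: g => a b c d; rewrite /zm_of !mxE. Qed.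

Lemma det_zm m : \det m = zdet (zm_of m).
Proof.
rewrite (expand_det_row _ 0) !big_ord_recl big_ord0 /cofactor !det_mx11 !mxE /=.
rewrite /zdet /zm_of /= expr0 expr1 !mul1r addr0 mulN1r mulrN.
by congr (_ * m _ _ - m _ _ * m _ _); apply/val_inj.
Qed.

Lemma unitmx_zm m : m \in unitmx <-> unimod (zm_of m).
Proof.
rewrite unitmxE det_zm; split.
  by rewrite /unimod => /orP[]/eqP ->.
by move=> /unimodP[] ->.
Qed.

Lemma det_mx_of g : \det (mx_of g) = zdet g.
Proof. by rewrite det_zm zm_ofK. Qed.

(** * Unimodular substitutions in quadratic forms *)

Section Forms.
Variable A : comNzRingType.
Implicit Types M N : bqf A.
Local Notation "x %:A" := (x%:~R : A).

Definition qact M g : bqf A :=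
  BQF (qeval M (za g)%:~R (zc g)%:~R)
      (qa M * (za g)%:~R * (zb g)%:~R *+ 2
       + qb M * ((za g)%:~R * (zd g)%:~R + (zb g)%:~R * (zc g)%:~R)
       + qc M * (zc g)%:~R * (zd g)%:~R *+ 2)
      (qeval M (zb g)%:~R (zd g)%:~R).
Definition qdisc M := qb M ^+ 2 - qa M * qc M *+ 4.
(** Polar form of minus the discriminant: [qpol M M] is [- qdisc M]. For definite forms of
    discriminant -D, the quotient by D is the hyperbolic cosine of the distance of their points; for
    an indefinite M and a definite N, vanishing means that the point of N lies on the geodesic of M,
    up to the reflection in the imaginary axis. *)
Definition qpol M N := (qa M * qc N + qc M * qa N) *+ 2 - qb M * qb N.
Definition qscale (k : A) M := BQF (k * qa M) (k * qb M) (k * qc M).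

Lemma qactM M g h : qact M (zmul g h) = qact (qact M g) h.
Proof. by congr BQF; rewrite /qeval /= /qeval; ring. Qed.

Lemma qact1 M : qact M zone = M.
Proof. by case: M => *; congr BQF; rewrite /qeval /=; ring. Qed.

Lemma qactVK M g : unimod g -> qact (qact M g) (zinv g) = M.
Proof. by move=> h; rewrite -qactM zmulV// qact1. Qed.

Lemma qactKV M g : unimod g -> qact (qact M (zinv g)) g = M.
Proof. by move=> h; rewrite -qactM zmulVg// qact1. Qed.

Lemma qeval_act M g x y : qeval (qact M g) x y =
  qeval M ((za g)%:~R * x + (zb g)%:~R * y) ((zc g)%:~R * x + (zd g)%:~R * y).
Proof. by rewrite /qeval /= /qeval; ring. Qed.

Lemma unimodR g : unimod g ->
 ((za g)%:~R * (zd g)%:~R - (zb g)%:~R * (zc g)%:~R) ^+ 2 = 1 :> A.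
Proof.
move=> h; rewrite (_ : _ - _ = (zdet g)%:~R); last by rewrite rmorphB !rmorphM.
by rewrite -rmorphXn /= h.
Qed.

Lemma qdisc_act M g : unimod g -> qdisc (qact M g) = qdisc M.
Proof.
by move=> /unimodR h; rewrite -[RHS]mul1r -h /qdisc /= /qeval; ring.
Qed.

Lemma qpol_act M N g : unimod g -> qpol (qact M g) (qact N g) = qpol M N.
Proof.
by move=> /unimodR h; rewrite -[RHS]mul1r -h /qpol /= /qeval; ring.
Qed.

Lemma qact_scale k M g : qact (qscale k M) g = qscale k (qact M g).
Proof. by congr BQF; rewrite /qeval /= /qeval; ring. Qed.

End Forms.

Lemma qact_int (Q : bqf int) g : qact Q g =
  BQF (qeval Q (za g) (zc g))
      (qa Q * za g * zb g *+ 2 + qb Q * (za g * zd g + zb g * zc g)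
       + qc Q * zc g * zd g *+ 2)
      (qeval Q (zb g) (zd g)).
Proof. by rewrite /qact !intz. Qed.

Lemma qeval_inj (Q Q' : bqf int) : (forall x y, qeval Q x y = qeval Q' x y) -> Q = Q'.
Proof.
case: Q Q' => a b c [a' b' c'] h.
have := h 1 0; have := h 0 1; have := h 1 1; rewrite /qeval /= => h1 h2 h3.
by congr BQF; lia.
Qed.

Lemma GL2Z_equivP Q Q' : GL2Z_equiv Q Q' <-> exists2 g, unimod g & Q' = qact Q g.
Proof.
split=> [[g /unitmx_zm gu h]|[g gu ->]].
  exists (zm_of g) => //; apply: qeval_inj => x y; rewrite h qeval_act !intz.
  by [].
exists (mx_of g); first by apply/unitmx_zm; rewrite zm_ofK.
by move=> x y; rewrite qeval_act !intz !mxE.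
Qed.

(** * Definite forms, points of the half plane and the Gauss domain *)

Section RealForms.
Variable R : realType.
Implicit Types (M N : bqf R) (Q : bqf int).

Lemma bqf_realact Q g : bqf_real R (qact Q g) = qact (bqf_real R Q) g.
Proof. by congr BQF; rewrite /qeval /= ?intz; rewrite /qeval /=; ring. Qed.

Definition posdef M := 0 < qa M /\ qdisc M < 0.

Lemma qeval_pos M x y : posdef M -> (x != 0) || (y != 0) -> 0 < qeval M x y.
Proof.
case: M => a b c [/= a0 d0] xy; rewrite /qeval /=; rewrite /qdisc /= in d0.
have e : 4 * a * (a * x ^+ 2 + b * x * y + c * y ^+ 2) =
  (2 * a * x + b * y) ^+ 2 + (- (b ^+ 2 - a * c *+ 4)) * y ^+ 2 by ring.
have a4 : 0 < 4 * a by lra.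
rewrite -(pmulr_rgt0 _ a4) e; have [y0|y0] := eqVneq y 0.
  move: xy; rewrite y0 eqxx orbF => x0; rewrite !mulr0 addr0 expr0n mulr0 addr0.
  by rewrite exprn_even_gt0 //= !mulf_neq0// ?pnatr_eq0// gt_eqF.
by rewrite ltr_wpDl ?sqr_ge0// mulr_gt0 ?oppr_gt0// exprn_even_gt0.
Qed.

Lemma unimod_col g : unimod g -> (za g != 0) || (zc g != 0).
Proof.
move=> /unimodP h; rewrite -negb_and; apply/negP => /andP[/eqP a0 /eqP c0].
by move: h; rewrite /zdet a0 c0 mul0r mulr0 subr0 => -[].
Qed.

Lemma posdef_act M g : posdef M -> unimod g -> posdef (qact M g).
Proof.
move=> pM gu; split; last by rewrite qdisc_act//; case: pM.
by apply: qeval_pos => //; rewrite !intr_eq0; exact: unimod_col.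
Qed.

Lemma posdef_bound_y M x y : posdef M -> y ^+ 2 * - qdisc M <= 4 * qa M * qeval M x y.
Proof.
by case: M => a b c [/= a0 d0]; rewrite /qeval /qdisc /=; have := sqr_ge0 (2 * a * x + b * y); nra.
Qed.

Lemma posdef_c M : posdef M -> 0 < qc M.
Proof.
move=> pM; have := @qeval_pos M 0 1 pM; rewrite oner_neq0 orbT => /(_ isT).
by rewrite /qeval !expr0n /= !mulr0 mul0r !add0r expr1n mulr1.
Qed.

Lemma posdef_bound_x M x y : posdef M -> x ^+ 2 * - qdisc M <= 4 * qc M * qeval M x y.
Proof.
move=> pM; have := posdef_c pM; case: M pM => a b c [/= a0 d0] c0; rewrite /qeval /qdisc /=.
by have := sqr_ge0 (2 * c * y + b * x); nra.
Qed.

Lemma intrC (n : int) : (n%:~R : R[i]) = Complex n%:~R 0.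
Proof. by rewrite -(rmorph_int (real_complex R)). Qed.

(** From M(x, y) = r |x + z y|^2, the substitution g turns z into (d z + b) / (c z + a), up to
    conjugation of z when the determinant is -1; this is the matrix of that homography. *)
Definition zT g := ZM (zd g) (zb g) (zc g) (za g).

Lemma z_of_Im M : posdef M -> 0 < complex.Im (z_of M).
Proof.
case=> a0 d0 /=; rewrite divr_gt0 ?mulr_gt0// sqrtr_gt0.
by move: d0; rewrite /qdisc; lra.
Qed.

Lemma z_of_act M g : posdef M -> unimod g ->
  z_of (qact M g) = GL2Z_act (mx_of (zT g)) (z_of M).
Proof.
move=> pM gu; have pN := posdef_act pM gu.
have [r0 dM] := pM; have [r0' dN] := pN.
have hs : Num.sqrt (4 * qa (qact M g) * qc (qact M g) - qb (qact M g) ^+ 2) =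
   Num.sqrt (4 * qa M * qc M - qb M ^+ 2).
  by congr Num.sqrt; have := qdisc_act M gu; rewrite /qdisc; lra.
rewrite /z_of hs; set h := Num.sqrt _.
have h2 : h ^+ 2 = 4 * qa M * qc M - qb M ^+ 2.
  by rewrite sqr_sqrtr//; move: dM; rewrite /qdisc; lra.
have h0 : 0 < h by rewrite sqrtr_gt0; move: dM; rewrite /qdisc; lra.
rewrite /GL2Z_act det_mx_of !mxE /=.
have edet : zdet (zT g) = zdet g by rewrite /zdet /zT /=; ring.
rewrite edet.
(* Both branches are treated at once: the determinant [e] multiplies the imaginary part. *)
set w := (if _ then _ else _).
have [e [we e1]] : exists e : R, w = Complex (qb M / (2 * qa M)) (e * h / (2 * qa M)) /\ e = (zdet g)%:~R.
  rewrite /w; case: (unimodP gu) => -> /=; [exists 1|exists (-1)]; split => //.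
    by rewrite mul1r.
  by congr Complex; field; rewrite gt_eqF.
rewrite we !intrC.
have ee : e ^+ 2 = 1 by rewrite e1 -rmorphXn /= [X in X%:~R]gu.
have e1' : e = (za g)%:~R * (zd g)%:~R - (zb g)%:~R * (zc g)%:~R.
  by rewrite e1 /zdet; ring.
have r0n : qa M != 0 by rewrite gt_eqF.
have r0n' : qa (qact M g) != 0 by rewrite gt_eqF.
apply: (canRL (mulfK _)).
  rewrite eq_complex /=; apply/negP => /andP[/eqP h1 /eqP h3].
  have e0 : e != 0 by apply/eqP => e0; move: ee; rewrite e0 expr0n /= => /eqP; rewrite eq_sym oner_eq0.
  have c0 : (zc g)%:~R = 0 :> R.
    apply/eqP; move/eqP: h3; rewrite mul0r !addr0 !mulf_eq0 (negbTE e0) (gt_eqF h0) invr_eq0.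
    by rewrite mulf_eq0 pnatr_eq0 (negbTE r0n) !orbF.
  move: h1; rewrite c0 !mul0r subrr add0r => a0.
  by move: e0; rewrite e1' a0 c0 !(mul0r, mulr0) subrr eqxx.
have t : qc M = (h ^+ 2 + qb M ^+ 2) / (4 * qa M) by rewrite h2; field.
have rr : qa (qact M g) = qeval M (za g)%:~R (zc g)%:~R by [].
have ss : qb (qact M g) = qa M * (za g)%:~R * (zb g)%:~R *+ 2
       + qb M * ((za g)%:~R * (zd g)%:~R + (zb g)%:~R * (zc g)%:~R)
       + qc M * (zc g)%:~R * (zd g)%:~R *+ 2 by [].
rewrite /qeval in rr.
move: r0n' rr ss; set r' := qa (qact M g); set s' := qb (qact M g) => r0n' rr ss.
congr Complex.
  have -> : s' / (2 * r') * ((zc g)%:~R * (qb M / (2 * qa M)) - 0 * (e * h / (2 * qa M)) + (za g)%:~R) -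
     h / (2 * r') * ((zc g)%:~R * (e * h / (2 * qa M)) + 0 * (qb M / (2 * qa M)) + 0) =
     (s' * ((zc g)%:~R * qb M + 2 * qa M * (za g)%:~R) - e * h ^+ 2 * (zc g)%:~R) / (4 * qa M * r').
     by field; rewrite r0n r0n'.
  have -> : (zd g)%:~R * (qb M / (2 * qa M)) - 0 * (e * h / (2 * qa M)) + (zb g)%:~R =
    (2 * r' * ((zd g)%:~R * qb M + 2 * qa M * (zb g)%:~R)) / (4 * qa M * r').
    by field; rewrite r0n r0n'.
  by congr (_ / _); rewrite h2 e1' rr ss; ring.
have -> : s' / (2 * r') * ((zc g)%:~R * (e * h / (2 * qa M)) + 0 * (qb M / (2 * qa M)) + 0) +
   h / (2 * r') * ((zc g)%:~R * (qb M / (2 * qa M)) - 0 * (e * h / (2 * qa M)) + (za g)%:~R) =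
   h * (s' * e * (zc g)%:~R + (zc g)%:~R * qb M + 2 * qa M * (za g)%:~R) / (4 * qa M * r').
   by field; rewrite r0n r0n'.
have -> : (zd g)%:~R * (e * h / (2 * qa M)) + 0 * (qb M / (2 * qa M)) + 0 =
   h * (2 * r' * (zd g)%:~R * e) / (4 * qa M * r') by field; rewrite r0n r0n'.
congr (_ * _ / _).
transitivity (e * (s' * (zc g)%:~R + e * ((zc g)%:~R * qb M + 2 * qa M * (za g)%:~R))
  + (1 - e ^+ 2) * ((zc g)%:~R * qb M + 2 * qa M * (za g)%:~R)); first by ring.
rewrite ee subrr mul0r addr0 [RHS](_ : _ = e * (2 * r' * (zd g)%:~R)); last by ring.
by congr (_ * _); rewrite e1' rr ss; ring.
Qed.

Lemma gauss_z_of M : posdef M ->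
  gauss_domain (z_of M) <-> [/\ 0 <= qb M, qb M <= qa M & qa M <= qc M].
Proof.
move=> pM; have [a0 d0] := pM; have h0 := z_of_Im pM.
have e : complex.Re (z_of M) ^+ 2 + complex.Im (z_of M) ^+ 2 = qc M / qa M.
  rewrite /= !expr_div_n sqr_sqrtr; last by move: d0; rewrite /qdisc; lra.
  by field; rewrite gt_eqF.
rewrite /gauss_domain /= e; split.
  case=> _ /andP[]; rewrite pmulr_lge0 ?invr_gt0 ?mulr_gt0// => b0.
  rewrite ler_pdivrMr ?mulr_gt0// => b1; rewrite ler_pdivlMr// mul1r => c1.
  by split=> //; lra.
case=> b0 b1 c1; split => //; last by rewrite ler_pdivlMr// mul1r.
apply/andP; split; first by rewrite divr_ge0// mulr_ge0// ltW.
by rewrite ler_pdivrMr ?mulr_gt0//; lra.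
Qed.


Lemma finite_argmin (T : choiceType) (B : set T) (F : T -> R) :
  finite_set B -> B !=set0 -> exists2 x, B x & forall y, B y -> F x <= F y.
Proof.
move=> /finite_seqP[s ->]; elim: s => [[x]|x s ih _] //=.
have [s0|s0] := pselect ([set` s] !=set0); last first.
  exists x => /=; first by rewrite inE eqxx.
  by move=> z /=; rewrite inE => /orP[/eqP -> //|zs]; case: s0; exists z.
have [y ys hy] := ih s0.
have [xy|yx] := leP (F x) (F y).
  exists x => /=; first by rewrite inE eqxx.
  by move=> z; rewrite /= inE => /orP[/eqP -> //|zs]; apply: le_trans (hy _ zs).
exists y => /=; first by rewrite inE ys orbT.
by move=> z; rewrite /= inE => /orP[/eqP -> |zs]; [exact: ltW|exact: hy].
Qed.

Lemma finite_int_box (C : R) : finite_set [set x : int | `|x%:~R : R| <= C].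
Proof.
pose n := Num.trunc `|C|.
apply: (@sub_finite_set _ _ ((fun k : nat => k%:Z - n%:Z) @` `I_(n.*2.+1))); last first.
  exact: finite_image.
move=> x /= xC; have : `|x%:~R : R| <= `|C| by apply: le_trans xC _; exact: ler_norm.
rewrite -intr_norm => xn.
have {}xn : (`|x|%N <= n)%N.
  by rewrite /n truncn_ge_nat// -(ler_nat R) natr_absz.
by exists (absz (x + n%:Z)) => /=; lia.
Qed.

Lemma finite_int2_box (C : R) :
  finite_set [set x : int * int | `|x.1%:~R : R| <= C /\ `|x.2%:~R : R| <= C].
Proof.
have := finite_setX (finite_int_box C) (finite_int_box C).
by apply: sub_finite_set => -[x y].
Qed.

Lemma norm_le_of_sqr (x C : R) : x ^+ 2 <= C -> `|x| <= C + 1.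
Proof.
move=> xC; have := normr_ge0 x; rewrite -real_normK ?num_real// in xC.
by move: xC; set y := `|x|; nra.
Qed.

Lemma posdef_finite M v : posdef M ->
  finite_set [set x : int * int | qeval M x.1%:~R x.2%:~R <= v].
Proof.
move=> pM; have [a0 d0] := pM; have c0 := posdef_c pM.
pose C := (4 * (qa M + qc M) * `|v|) / (- qdisc M) + 1.
apply: sub_finite_set (finite_int2_box C) => -[x y] /= h.
have h2 : qeval M x%:~R y%:~R <= `|v| by apply: le_trans h _; exact: ler_norm.
have v0 := normr_ge0 v.
split; apply: norm_le_of_sqr; rewrite ler_pdivlMr ?oppr_gt0//.
  by apply: le_trans (posdef_bound_x _ y%:~R pM) _; nra.
by apply: le_trans (posdef_bound_y x%:~R _ pM) _; nra.
Qed.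

Lemma primitive_extend (x y : int) : gcdz x y = 1 ->
  exists2 g, unimod g & za g = x /\ zc g = y.
Proof.
move=> h; have [u [v e]] : exists u v, u * x + v * y = 1.
  by have [u [v]] := Bezoutz x y; exists u, v; lia.
by exists (ZM x (- v) y u) => //; rewrite /unimod /zdet /= (_ : _ - _ = 1) //; lia.
Qed.

(** A nonzero integral vector where M is minimal is primitive, hence the first column of a
    unimodular matrix. A shear then brings the middle coefficient into [-a, a], minimality gives a
    <= c, and a reflection makes the middle coefficient nonnegative. *)
Lemma gauss_reduction M : posdef M ->
  exists2 g, unimod g & gauss_domain (z_of (qact M g)).
Proof.
move=> pM; pose B := [set x : int * int | ((x.1 != 0) || (x.2 != 0)) /\ qeval M x.1%:~R x.2%:~R <= qa M].
have fB : finite_set B by apply: sub_finite_set (posdef_finite (qa M) pM) => x [].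
have B0 : B !=set0 by exists (1, 0); split=> //=; rewrite /qeval /=; lra.
have [[x y] [/= xy0 xyM] hmin] := finite_argmin (fun x : int * int => qeval M x.1%:~R x.2%:~R) fB B0.
have {}hmin u v : (u != 0) || (v != 0) -> qeval M x%:~R y%:~R <= qeval M u%:~R v%:~R.
  move=> uv; have [h|/ltW h] := leP (qeval M u%:~R v%:~R) (qa M); last exact: le_trans h.
  by apply: (hmin (u, v)).
have m0 : 0 < qeval M x%:~R y%:~R by apply: qeval_pos; rewrite // !intr_eq0.
(* Dividing the minimal vector by its gcd d would divide the value by d^2. *)
have g1 : gcdz x y = 1.
  set d := gcdz x y; have dx : (d %| x)%Z := dvdz_gcdl _ _.
  have dy : (d %| y)%Z := dvdz_gcdr _ _.
  have [x' ex] := dvdzP dx; have [y' ey] := dvdzP dy.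
  have d0 : d != 0 by rewrite gcdz_eq0 negb_and.
  have d_ge0 : 0 <= d by [].
  have := hmin x' y'.
  have -> : (x' != 0) || (y' != 0).
    by rewrite -negb_and; apply/negP => /andP[/eqP x0 /eqP y0]; move: xy0; rewrite ex ey x0 y0 !mul0r eqxx.
  move=> /(_ isT).
  have e : qeval M x%:~R y%:~R = d%:~R ^+ 2 * qeval M x'%:~R y'%:~R.
    by rewrite ex ey /qeval; ring.
  rewrite e in m0 *.
  have d1 : (1 : R) <= d%:~R by rewrite (ler_int _ 1 d); lia.
  have q0 : 0 < qeval M x'%:~R y'%:~R by move: m0; rewrite pmulr_rgt0// exprn_gt0//; lra.
  rewrite -[X in _ <= X -> _]mul1r ler_pM2r// => h; have : (d%:~R : R) <= 1 by nra.
  by rewrite (ler_int R d 1); lia.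
have [g0 g0u [ga gc]] := primitive_extend g1.
pose N := qact M g0; have pN : posdef N := posdef_act pM g0u.
have [a0 _] := pN.
(* The nearest integer to -b/2a. *)
pose k : int := - Num.floor (qb N / (2 * qa N) + 2^-1).
pose g2 := ZM 1 k 0 1.
have g2u : unimod g2 by rewrite /unimod /zdet /= mulr0 subr0 mulr1.
pose P := qact N g2.
have Pb : qb P = qb N + 2 * k%:~R * qa N by rewrite /P; case: (N) => *; rewrite /= ; ring.
have Pa : qa P = qa N by rewrite /P; case: (N) => *; rewrite /= /qeval /=; ring.
have a0' : 0 < 2 * qa N by lra.
have [k1 k2] : qb N / (2 * qa N) - 2^-1 <= - (k%:~R : R) /\ - k%:~R <= qb N / (2 * qa N) + 2^-1.
  rewrite /k rmorphN opprK; split; last exact: floor_le.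
  by have := floorD1_gt (qb N / (2 * qa N) + 2^-1); rewrite rmorphD /=; lra.
have Pbb : - qa N <= qb P <= qa N.
  rewrite Pb; have e : qb N = qb N / (2 * qa N) * (2 * qa N) by field; rewrite gt_eqF.
  by rewrite e; move: k1 k2; set w := qb N / _ => k1 k2; apply/andP; split; nra.
have Pc (u v : int) : (u != 0) || (v != 0) -> qa N <= qeval P u%:~R v%:~R.
  move=> uv; have -> : qa N = qeval M x%:~R y%:~R by rewrite /N /= ga gc.
  rewrite /P /N -qactM qeval_act -!rmorphM -!rmorphD; apply: hmin.
  set g := zmul g0 g2; have gu : unimod g by apply: unimodM.
  rewrite -negb_and; apply/negP => /andP[/eqP e1 /eqP e2].
  have /eqP := gu; rewrite sqrf_eq1 => /orP dg.
  have u0 : zdet g * u = 0 by transitivity (zd g * (za g * u + zb g * v) - zb g * (zc g * u + zd g * v)); [rewrite /zdet; ring|rewrite e1 e2 !mulr0 subrr].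
  have v0 : zdet g * v = 0 by transitivity (za g * (zc g * u + zd g * v) - zc g * (za g * u + zb g * v)); [rewrite /zdet; ring|rewrite e1 e2 !mulr0 subrr].
  have u00 : u = 0 by case: dg u0 => /eqP ->; rewrite ?mul1r ?mulN1r => /eqP; rewrite ?oppr_eq0 => /eqP.
  have v00 : v = 0 by case: dg v0 => /eqP ->; rewrite ?mul1r ?mulN1r => /eqP; rewrite ?oppr_eq0 => /eqP.
  by move: uv; rewrite u00 v00.
have Pcc : qa N <= qc P by have := Pc 0 1 isT; rewrite /qeval /=; lra.
have pP : posdef P by apply: posdef_act.
pose e : int := if 0 <= qb P then 1 else -1.
pose g3 := ZM 1 0 0 e.
have g3u : unimod g3 by rewrite /unimod /zdet /= /e; case: ifP.
exists (zmul g0 (zmul g2 g3)); first by do !apply: unimodM => //.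
rewrite qactM -/N qactM -/P; apply/gauss_z_of; first exact: posdef_act.
move: Pbb => /andP[Pb1 Pb2].
have e2 : (e%:~R : R) ^+ 2 = 1 by rewrite /e; case: ifP => _; rewrite ?rmorphN rmorph1 ?sqrrN expr1n.
have -> : qb (qact P g3) = qb P * e%:~R by case: (P) => *; rewrite /=; ring.
have -> : qa (qact P g3) = qa P by case: (P) => *; rewrite /= /qeval /=; ring.
have -> : qc (qact P g3) = qc P.
  transitivity (qc P * e%:~R ^+ 2); last by rewrite e2 mulr1.
  by case: (P) => *; rewrite /= /qeval /=; ring.
by rewrite Pa /e; case: ifPn => h; rewrite ?rmorphN rmorph1 ?mulr1 ?mulrN1; split=> //; move: h; rewrite -?ltNge; lra.
Qed.

(** With coefficients r, s, t the value is at least r (x^2 - |x y| + y^2) + (t - r) y^2, and both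
    x^2 - |x y| + y^2 and y^2 are at least 1. *)
Lemma reduced_min M (x y : int) : posdef M -> 0 <= qb M -> qb M <= qa M -> qa M <= qc M ->
  y != 0 -> qc M <= qeval M x%:~R y%:~R.
Proof.
case: M => r s t [/= r0 _] s0 sr rt y0; rewrite /qeval /=.
have y1 : 1 <= `|y| by rewrite -gtz0_ge1 normr_gt0.
have xy : 1 <= x ^+ 2 - `|x| * `|y| + y ^+ 2.
  by rewrite -(real_normK (num_real x)) -(real_normK (num_real y)); have := normr_ge0 x; nia.
have xyR : (1 : R) <= x%:~R ^+ 2 - `|x%:~R| * `|y%:~R| + y%:~R ^+ 2.
  by rewrite -!intr_norm -!rmorphXn -rmorphM -rmorphB -rmorphD (ler_int _ 1).
have y2 : (1 : R) <= y%:~R ^+ 2 by rewrite -rmorphXn (ler_int _ 1) /=; have := real_normK (num_real y); nia.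
have h : - (`|x%:~R| * `|y%:~R|) <= x%:~R * y%:~R :> R by rewrite -normrM lerNl ler_normr lexx orbT.
move: xyR y2 h; set X := (x%:~R : R); set Y := (y%:~R : R).
have : 0 <= `|X| * `|Y| by rewrite mulr_ge0.
set Z := `|X| * `|Y| => Z0 h1 h2 h3.
have : s * (X * Y) >= - (r * Z) by nra.
by rewrite -mulrA; nra.
Qed.

(** If [zc g] is nonzero, [reduced_min] applied to g and to its inverse gives a <= c <= a' <= c' <=
    a, so the outer coefficients agree and the discriminant fixes the middle one. Otherwise g is
    triangular with diagonal entries of absolute value 1 and b' = 2 a k + b or 2 a k - b, where b
    and b' both lie in [0, a]. *)
Lemma gauss_unique_form M g : posdef M -> unimod g ->
  gauss_domain (z_of M) -> gauss_domain (z_of (qact M g)) -> z_of (qact M g) = z_of M.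
Proof.
move=> pM gu; have pN := posdef_act pM gu.
move=> /(gauss_z_of pM)[b0 b1 b2] /(gauss_z_of pN)[b0' b1' b2'].
have dd := qdisc_act M gu.
have [a0 _] := pM; have [a0' _] := pN.
suff [ea eb] : qa (qact M g) = qa M /\ qb (qact M g) = qb M.
  have ec : qc (qact M g) = qc M.
    by move: dd; rewrite /qdisc ea eb => /addrI /oppr_inj; rewrite -!mulrnAr => /(mulfI (lt0r_neq0 a0)); lra.
  by rewrite /z_of ea eb ec.
have [c0|c0] := eqVneq (zc g) 0.
  have ad : za g * zd g = 1 \/ za g * zd g = -1.
    by have := unimodP gu; rewrite /zdet c0 mulr0 subr0.
  have a1 : (za g) ^+ 2 = 1.
    by move: ad; rewrite expr2; move: (za g) (zd g) => a d [h|h]; have : (a %| 1)%Z by [apply/dvdzP; exists d; lia | apply/dvdzP; exists (- d); lia]; rewrite dvdz1 => /eqP; lia.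
  have a1R : ((za g)%:~R : R) ^+ 2 = 1 by rewrite -rmorphXn /= a1.
  have ea : qa (qact M g) = qa M by rewrite /= /qeval c0 a1R; ring.
  split=> //; rewrite ea in b1' b2'.
  have eb : qb (qact M g) = 2 * qa M * (za g * zb g)%:~R + qb M * (za g * zd g)%:~R.
    by rewrite /= c0; ring.
  move: eb b0' b1'; set s' := qb (qact M g); set k := za g * zb g => eb b0' b1'.
  have kR : forall j : int, (k <= j) || (j + 1 <= k) by move=> j; lia.
  have kle j : k <= j -> (k%:~R : R) <= j%:~R by rewrite ler_int.
  have kge j : j + 1 <= k -> (j%:~R + 1 : R) <= k%:~R.
    by rewrite -(ler_int R) rmorphD.
  case: ad => ad; rewrite ad ?rmorphN rmorph1 in eb.
    have k0 : k = 0.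
      have [/kle|/kge] := orP (kR (-1)); first by rewrite rmorphN rmorph1 => kk; exfalso; nra.
      have [h _|/kge] := orP (kR 0); last by rewrite mulr0z => kk; exfalso; nra.
      by have := kR (-1); case/orP => [/kle|]; rewrite ?rmorphN ?rmorph1; [move=> kk; exfalso; nra|lia].
    by rewrite eb k0; ring.
  have [/kle|k0] := orP (kR (-1)); first by rewrite rmorphN rmorph1 => kk; exfalso; nra.
  have [|/kge] := orP (kR 1); last by rewrite rmorph1 => kk; exfalso; nra.
  move=> k1; have : k = 0 \/ k = 1 by lia.
  by case=> e; rewrite e ?mulr0z ?rmorph1 in eb; lra.
have h1 : qc M <= qa (qact M g) by apply: reduced_min.
have h2 : qc (qact M g) <= qa M.
  have := @reduced_min _ (za (zinv g)) (zc (zinv g)) pN b0' b1' b2'.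
  have -> : zc (zinv g) != 0 by rewrite /= oppr_eq0 mulf_neq0//; case: (unimodP gu) => ->.
  by move=> /(_ isT); rewrite -[X in _ <= X](_ : qa (qact (qact M g) (zinv g)) = _)// qactVK.
have ea : qa (qact M g) = qa M by lra.
have ec : qc (qact M g) = qc M by lra.
split=> //; move: dd; rewrite /qdisc ea ec => /addIr /eqP.
by rewrite eqrXn2// => /eqP.
Qed.

Lemma quotient_image_z_of M w : posdef M ->
  quotient_image [set z_of M] w <->
  gauss_domain w /\ exists2 g, unimod g & w = z_of (qact M g).
Proof.
move=> pM; rewrite /quotient_image; split=> -[gw [g gu]].
  case=> z /= -> e; split=> //; exists (zT (zm_of g)).
    move/unitmx_zm : gu; rewrite /unimod => <-; congr (_ ^+ 2).
    by rewrite /zdet /zT /=; ring.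
  rewrite z_of_act//; last by move/unitmx_zm : gu; rewrite /unimod => <-; congr (_ ^+ 2); rewrite /zdet /zT /=; ring.
  rewrite e; congr GL2Z_act; apply/matrixP => i j; rewrite !mxE /=.
  by case: i j => [[|[|]]//] hi [[|[|]]//] hj /=; congr (g _ _); apply/val_inj.
move=> e; split=> //; exists (mx_of (zT g)).
  by apply/unitmx_zm; rewrite zm_ofK /unimod -gu; congr (_ ^+ 2); rewrite /zdet /zT /=; ring.
by exists (z_of M) => //; rewrite e z_of_act.
Qed.

(** A nonzero leading coefficient excludes the vertical half-lines. Both sides describe the half
    circle of centre -b/2a whose squared radius is the discriminant over 4 a^2. *)
Lemma geodesicP (Q : bqf R) z : qa Q != 0 -> 0 < qdisc Q ->
  geodesic Q z <-> 0 < complex.Im z /\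
   qa Q * (complex.Re z ^+ 2 + complex.Im z ^+ 2) + qb Q * complex.Re z + qc Q = 0.
Proof.
case: Q => a b c /= a0 d0; rewrite /qdisc /= in d0; case: z => x y /=.
pose s := Num.sqrt (b ^+ 2 - a * c *+ 4).
have s2 : s ^+ 2 = b ^+ 2 - a * c *+ 4 by rewrite sqr_sqrtr// ltW.
have s0 : 0 < s by rewrite sqrtr_gt0.
pose u := (- b + s) / (2 * a); pose v := (- b - s) / (2 * a).
have ec : c = (b ^+ 2 - s ^+ 2) / (4 * a) by rewrite s2; field.
have root t : vanishes_at (BQF a b c) (Some t) <-> t = u \/ t = v.
  rewrite /vanishes_at /qeval /=.
  have -> : a * t ^+ 2 + b * t * 1 + c * 1 ^+ 2 = a * ((t - u) * (t - v)).
    by rewrite ec /u /v; field.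
  split=> [/eqP|]; first by rewrite !mulf_eq0 (negbTE a0) /= !subr_eq0 => /orP[]/eqP ->; [left|right].
  by move=> [] ->; rewrite subrr ?mul0r ?mulr0.
have noinf : ~ vanishes_at (BQF a b c) None.
  by rewrite /vanishes_at /qeval /= expr0n expr1n !mulr1 !mulr0 !addr0; apply/eqP.
have key : a * (x ^+ 2 + y ^+ 2) + b * x + c = a * ((x - (u + v) / 2) ^+ 2 + y ^+ 2 - ((u - v) / 2) ^+ 2).
  by rewrite ec /u /v; field.
have e0 (k : R) : a * k = 0 -> k = 0 by move/eqP; rewrite mulf_eq0 (negbTE a0) => /eqP.
split.
  case=> -[p|] [[q|]] [] pq // /root hp /root hq [/= y0 h].
  split=> //; rewrite key; suff -> : (x - (u + v) / 2) ^+ 2 + y ^+ 2 = ((u - v) / 2) ^+ 2 by rewrite subrr mulr0.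
  by case: hp hq pq h => -> [] -> //; rewrite [v + u]addrC -[v - u]opprB mulNr sqrrN.
case=> y0 h; exists (Some u), (Some v); split; [|by apply/root; left|by apply/root; right|].
  by case=> /eqP; rewrite -subr_eq0 (_ : u - v = s / a) ?mulf_eq0 ?invr_eq0 ?(negbTE a0) ?gt_eqF// /u /v; field.
by split => //=; move: h; rewrite key => /e0; lra.
Qed.

Lemma geodesic_classP (Q : bqf int) w : qa Q != 0 -> 0 < qdisc Q ->
  geodesic_class Q w <-> gauss_domain w /\
   exists M : bqf R, [/\ posdef M, qpol (bqf_real R Q) M = 0 &
     exists2 g, unimod g & w = z_of (qact M g)].
Proof.
move=> a0 d0.
have a0R : qa (bqf_real R Q) != 0 by rewrite /= intr_eq0.
have d0R : 0 < qdisc (bqf_real R Q).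
  rewrite (_ : qdisc _ = (qdisc Q)%:~R) ?ltr0z// /qdisc /=; ring.
(* [z_of] takes the real part s/2r and not -s/2r, so apolarity to Q puts the point of [qact M j],
   rather than that of M, on the geodesic. *)
pose j := ZM (-1) 0 0 1.
have ju : unimod j by [].
have z_ofN (x y : R) : 0 < y -> z_of (BQF 1 (2 * x) (x ^+ 2 + y ^+ 2)) = Complex x y.
  move=> y0; rewrite /z_of /=; congr Complex; first by field.
  rewrite (_ : _ - _ = (2 * y) ^+ 2); last by ring.
  by rewrite sqrtr_sqr gtr0_norm ?mulr_gt0//; field.
have pN (x y : R) : 0 < y -> posdef (BQF 1 (2 * x) (x ^+ 2 + y ^+ 2)).
  by move=> y0; split => //=; rewrite /qdisc /=; nra.
split.
  case=> gw [g gu [z /(geodesicP _ a0R d0R) [z0 hz] e]]; split=> //.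
  exists (BQF 1 (- (2 * complex.Re z)) (complex.Re z ^+ 2 + complex.Im z ^+ 2)).
  split; first by split => //=; rewrite /qdisc /=; nra.
    by rewrite /qpol /= in hz *; lra.
  pose N := BQF 1 (2 * complex.Re z) (complex.Re z ^+ 2 + complex.Im z ^+ 2).
  have eN : z_of N = z by rewrite z_ofN//; case: (z).
  have : quotient_image [set z_of N] w by split=> //; exists g => //; exists z.
  move/(quotient_image_z_of _ (pN _ _ z0)) => [_ [h hu ->]].
  exists (zmul j h); first exact: unimodM.
  by rewrite qactM; congr (z_of (qact _ h)); congr BQF; rewrite /qeval /=; ring.
case=> gw [M [pM hM [g gu e]]]; split=> //.
have [r0 dM] := pM.
pose z := z_of (qact M j).
have pJ : posdef (qact M j) by exact: posdef_act.
have e' : w = z_of (qact (qact M j) (zmul j g)).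
  by rewrite -qactM zmulA (_ : zmul j j = zone) //; rewrite e; congr z_of; rewrite /qact; congr BQF; rewrite /qeval /=; ring.
have : quotient_image [set z] w.
  by apply/quotient_image_z_of => //; split=> //; exists (zmul j g) => //; exact: unimodM.
case=> _ [h hu [y -> ey]]; exists h => //; exists z => //.
apply/geodesicP => //; split; first exact: z_of_Im.
have ha : qa (qact M j) = qa M by rewrite /= /qeval; ring.
have hb : qb (qact M j) = - qb M by rewrite /=; ring.
have hc : qc (qact M j) = qc M by rewrite /= /qeval; ring.
rewrite /z; clear ey e' z pJ; move: (qact M j) ha hb hc => N ha hb hc.
rewrite /= !expr_div_n sqr_sqrtr ha hb hc; last by rewrite /qdisc in dM; lra.
move: hM; rewrite /qpol /= => hM.
transitivity (((qa Q)%:~R * qc M + (qc Q)%:~R * qa M - (qb Q)%:~R * qb M / 2) / qa M).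
  by field; rewrite gt_eqF.
by rewrite (_ : _ - _ = 0) ?mul0r//; lra.
Qed.

Lemma hyp_dist_z_of M N D : posdef M -> posdef N -> qdisc M = - D -> qdisc N = - D ->
  hyp_dist (z_of M) (z_of N) = arcosh (qpol M N / D).
Proof.
move=> pM pN eM eN; have [r0 dM] := pM; have [r0' dN] := pN.
have D0 : 0 < D by rewrite -oppr_lt0 -eM.
rewrite /hyp_dist; congr arcosh.
have hM : 4 * qa M * qc M - qb M ^+ 2 = D by move: eM; rewrite /qdisc; lra.
have hN : 4 * qa N * qc N - qb N ^+ 2 = D by move: eN; rewrite /qdisc; lra.
rewrite /z_of hM hN /=.
set h := Num.sqrt D; have h2 : h ^+ 2 = D by rewrite sqr_sqrtr// ltW.
have h0 : 0 < h by rewrite sqrtr_gt0.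
rewrite sqr_sqrtr ?addr_ge0 ?sqr_ge0//.
have ec : qc M = (h ^+ 2 + qb M ^+ 2) / (4 * qa M) by rewrite h2 -hM; field; rewrite gt_eqF.
have ec' : qc N = (h ^+ 2 + qb N ^+ 2) / (4 * qa N) by rewrite h2 -hN; field; rewrite gt_eqF.
rewrite /qpol ec ec' -h2; field; rewrite !gt_eqF//=.
Qed.

Lemma arcosh_cosh (u : R) : arcosh ((expR u + expR (- u)) / 2) = `|u|.
Proof.
have main (v : R) : 0 <= v -> arcosh ((expR v + expR (- v)) / 2) = v.
  move=> v0; rewrite /arcosh (_ : _ - 1 = ((expR v - expR (- v)) / 2) ^+ 2); last first.
    have e : expR v * expR (- v) = 1 by rewrite expRxMexpNx_1.
    by rewrite -[X in _ - X]e; field.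
  rewrite sqrtr_sqr ger0_norm; last by rewrite divr_ge0// subr_ge0 ler_expR; lra.
  by rewrite -mulrDl addrCA [X in X / 2](_ : _ = expR v * 2) ?mulfK ?expRK//; ring.
have [u0|u0] := leP 0 u; first by rewrite main// ger0_norm.
by have := main (- u); rewrite opprK [expR (- u) + _]addrC ltr0_norm// => -> //; rewrite oppr_ge0 ltW.
Qed.

End RealForms.

(** * Cubic rings and their Hessians *)

Record bcf := BCF { fa : int; fb : int; fc : int; fd : int }.
Definition hess f : bqf int :=
  BQF (fb f ^+ 2 - 3 * fa f * fc f) (fb f * fc f - 9 * fa f * fd f)
      (fc f ^+ 2 - 3 * fb f * fd f).
Definition cdisc f : int := fb f ^+ 2 * fc f ^+ 2 - 4 * fa f * fc f ^+ 3
  - 4 * fb f ^+ 3 * fd f - 27 * fa f ^+ 2 * fd f ^+ 2 + 18 * fa f * fb f * fc f * fd f.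

Lemma qdisc_hess f : qdisc (hess f) = - 3 * cdisc f.
Proof. by rewrite /qdisc /cdisc /=; ring. Qed.

(* Multiplication table of the Delone-Faddeev ring of f in its normalised basis 1, w, t. *)
Definition cubic_rel (L : nzRingType) (f : bcf) (w t : L) :=
  [/\ w * t = - (fa f)%:~R * (fd f)%:~R,
      w ^+ 2 = - (fa f)%:~R * (fc f)%:~R + (fb f)%:~R * w - (fa f)%:~R * t
    & t ^+ 2 = - (fb f)%:~R * (fd f)%:~R + (fd f)%:~R * w - (fc f)%:~R * t].

Section CharPoly.
Variable A : comNzRingType.
Implicit Types (f : bcf) (u v w : A).
(* ce1, ce2, ce3: coefficients of the characteristic polynomial of u + v w + w t in that ring. *)
Definition ce1 f u v w := 3 * u + (fb f)%:~R * v - (fc f)%:~R * w.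
Definition ce2 f u v w := 3 * u ^+ 2 + 2 * u * ((fb f)%:~R * v - (fc f)%:~R * w) +
  ((fa f)%:~R * (fc f)%:~R * v ^+ 2 + (3 * (fa f)%:~R * (fd f)%:~R - (fb f)%:~R * (fc f)%:~R) * v * w
   + (fb f)%:~R * (fd f)%:~R * w ^+ 2).
Definition ce3 f u v w := u ^+ 3 + u ^+ 2 * ((fb f)%:~R * v - (fc f)%:~R * w) +
  u * ((fa f)%:~R * (fc f)%:~R * v ^+ 2 + (3 * (fa f)%:~R * (fd f)%:~R - (fb f)%:~R * (fc f)%:~R) * v * w
   + (fb f)%:~R * (fd f)%:~R * w ^+ 2) +
  ((fa f)%:~R ^+ 2 * (fd f)%:~R * v ^+ 3 + (2 * (fa f)%:~R * (fb f)%:~R * (fd f)%:~R - (fa f)%:~R * (fc f)%:~R ^+ 2) * v ^+ 2 * w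
   + ((fb f)%:~R ^+ 2 * (fd f)%:~R - 2 * (fa f)%:~R * (fc f)%:~R * (fd f)%:~R) * v * w ^+ 2 - (fa f)%:~R * (fd f)%:~R ^+ 2 * w ^+ 3).

Lemma cubic_rel_mul f (om th : A) u v w u' v' w' : cubic_rel f om th ->
  (u + v * om + w * th) * (u' + v' * om + w' * th) =
  (u * u' - (fa f)%:~R * (fc f)%:~R * (v * v') - (fa f)%:~R * (fd f)%:~R * (v * w' + w * v') - (fb f)%:~R * (fd f)%:~R * (w * w'))
  + (u * v' + v * u' + (fb f)%:~R * (v * v') + (fd f)%:~R * (w * w')) * om
  + (u * w' + w * u' - (fa f)%:~R * (v * v') - (fc f)%:~R * (w * w')) * th.
Proof.
case=> h1 h2 h3; transitivity (u * u' + (u * v' + v * u') * om + (u * w' + w * u') * th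
  + (v * v') * om ^+ 2 + (v * w' + w * v') * (om * th) + w * w' * th ^+ 2); first by ring.
by rewrite h1 h2 h3; ring.
Qed.

Lemma cubic_rel_charpoly f (om th : A) u v w : cubic_rel f om th ->
  let x := u + v * om + w * th in
  x ^+ 3 - ce1 f u v w * x ^+ 2 + ce2 f u v w * x - ce3 f u v w = 0.
Proof.
move=> h x; rewrite exprS expr2 /x (cubic_rel_mul _ _ _ _ _ _ h) (cubic_rel_mul _ _ _ _ _ _ h).
by rewrite /ce1 /ce2 /ce3; ring.
Qed.

End CharPoly.

Lemma ce_intr (A : comNzRingType) f (u v w : int) :
  (ce1 f u v w)%:~R = ce1 f u%:~R v%:~R w%:~R :> A /\
  (ce2 f u v w)%:~R = ce2 f u%:~R v%:~R w%:~R :> A /\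
  (ce3 f u v w)%:~R = ce3 f u%:~R v%:~R w%:~R :> A.
Proof. by rewrite /ce1 /ce2 /ce3 !intz; split; [|split]; ring. Qed.

Section Field.
Variable K : fieldExtType rat.
Implicit Types (x y al om th : K).

Definition zcomb al1 al2 (n : int * int * int) : K :=
  n.1.1%:~R + al1 *~ n.1.2 + al2 *~ n.2.

Lemma zcombE al1 al2 n : zcomb al1 al2 n = n.1.1%:~R + n.1.2%:~R * al1 + n.2%:~R * al2.
Proof. by rewrite /zcomb !mulrzl. Qed.

Lemma integral_basisE al1 al2 : integral_basis al1 al2 <->
  injective (zcomb al1 al2) /\ forall x, integer_of x <-> exists n, x = zcomb al1 al2 n.
Proof. by []. Qed.

Lemma integral_basis_change al1 al2 g (k1 k2 : int) : integral_basis al1 al2 -> unimod g ->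
  integral_basis ((za g)%:~R * al1 + (zc g)%:~R * al2 + k1%:~R)
    ((zb g)%:~R * al1 + (zd g)%:~R * al2 + k2%:~R).
Proof.
move=> /integral_basisE[inj sp] gu; apply/integral_basisE.
set b1 := _ + k1%:~R; set b2 := _ + k2%:~R.
have e (n : int * int * int) : zcomb b1 b2 n = zcomb al1 al2
   (n.1.1 + n.1.2 * k1 + n.2 * k2, za g * n.1.2 + zb g * n.2, zc g * n.1.2 + zd g * n.2).
  by rewrite !zcombE /b1 /b2 /=; ring.
have gg : zdet g * zdet g = 1 by rewrite -expr2.
split=> [m n|x].
  rewrite !e => /inj [e1 e2 e3].
  have d2 : zdet g * m.1.2 = zdet g * n.1.2.
    transitivity (zd g * (za g * m.1.2 + zb g * m.2) - zb g * (zc g * m.1.2 + zd g * m.2)).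
      by rewrite /zdet; ring.
    by rewrite e2 e3 /zdet; ring.
  have d3 : zdet g * m.2 = zdet g * n.2.
    transitivity (za g * (zc g * m.1.2 + zd g * m.2) - zc g * (za g * m.1.2 + zb g * m.2)).
      by rewrite /zdet; ring.
    by rewrite e2 e3 /zdet; ring.
  have {}d2 : m.1.2 = n.1.2 by rewrite -[LHS]mul1r -[RHS]mul1r -gg -!mulrA d2.
  have {}d3 : m.2 = n.2 by rewrite -[LHS]mul1r -[RHS]mul1r -gg -!mulrA d3.
  by move: e1; rewrite d2 d3 => /addIr /addIr h; move: d2 d3 h; clear; case: m n => [[m0 m1] m2] [[n0 n1] n2] /= -> -> ->.
rewrite sp; split=> -[n ->]; last by exists (n.1.1 + n.1.2 * k1 + n.2 * k2, za g * n.1.2 + zb g * n.2, zc g * n.1.2 + zd g * n.2); rewrite -e.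
pose v := zdet g * (zd g * n.1.2 - zb g * n.2); pose w := zdet g * (za g * n.2 - zc g * n.1.2).
exists (n.1.1 - v * k1 - w * k2, v, w); rewrite e /=; congr zcomb.
have ev : za g * v + zb g * w = n.1.2.
  by rewrite -[RHS]mul1r -gg /v /w /zdet; ring.
have ew : zc g * v + zd g * w = n.2.
  by rewrite -[RHS]mul1r -gg /v /w /zdet; ring.
by rewrite ev ew [LHS](_ : n = (n.1.1, n.1.2, n.2)); [congr (_, _, _); ring|case: (n) => -[]].
Qed.

Lemma integral_basis_shift al1 al2 (k1 k2 : int) : integral_basis al1 al2 ->
  integral_basis (al1 + k1%:~R) (al2 + k2%:~R).
Proof.
move=> /(@integral_basis_change _ _ zone k1 k2) /(_ unimod1) /=.
by rewrite !mulr1z !mulr0z !mul1r !mul0r addr0 add0r.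
Qed.

Lemma integral_basis_mem al1 al2 : integral_basis al1 al2 -> integer_of al1 /\ integer_of al2.
Proof.
move=> /integral_basisE[_ sp]; split; apply/sp; [exists (0, 1, 0)|exists (0, 0, 1)];
  by rewrite zcombE /=; ring.
Qed.

(** Each basis is integral over the other, and the two transition matrices are inverse to each other
    by uniqueness of coordinates, so their determinants are units of the integers. *)
Lemma integral_basis_transition al1 al2 be1 be2 : integral_basis al1 al2 ->
  integral_basis be1 be2 -> exists g k1 k2, [/\ unimod g,
   be1 = (za g)%:~R * al1 + (zc g)%:~R * al2 + k1%:~R &
   be2 = (zb g)%:~R * al1 + (zd g)%:~R * al2 + k2%:~R].
Proof.
move=> Ha Hb; have [bi1 bi2] := integral_basis_mem Hb; have [ai1 ai2] := integral_basis_mem Ha.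
have [inja spa] := Ha; have [injb spb] := Hb.
have [[[k1 a] c] e1] := (spa be1).1 bi1; have [[[k2 b] d] e2] := (spa be2).1 bi2.
have [[[l1 a'] c'] e1'] := (spb al1).1 ai1; have [[[l2 b'] d'] e2'] := (spb al2).1 ai2.
rewrite -/(zcomb _ _ _) !zcombE /= in e1 e2 e1' e2'.
exists (ZM a b c d), k1, k2; split; rewrite /= ?e1 ?e2; try ring.
have h1 : zcomb al1 al2 (0, 1, 0) = zcomb al1 al2 (l1 + a' * k1 + c' * k2, a * a' + b * c', c * a' + d * c').
  by rewrite !zcombE /=; transitivity al1; [ring|rewrite [LHS]e1' e1 e2; ring].
have h2 : zcomb al1 al2 (0, 0, 1) = zcomb al1 al2 (l2 + b' * k1 + d' * k2, a * b' + b * d', c * b' + d * d').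
  by rewrite !zcombE /=; transitivity al2; [ring|rewrite [LHS]e2' e1 e2; ring].
have [_ i1 i2] := inja _ _ h1; have [_ j1 j2] := inja _ _ h2.
have dd : zdet (ZM a b c d) * zdet (ZM a' b' c' d') = 1.
  by rewrite -zdetM /zmul /= /zdet /= -i1 -i2 -j1 -j2; ring.
rewrite /unimod; have : (zdet (ZM a b c d)) \is a GRing.unit.
  by apply/unitrP; exists (zdet (ZM a' b' c' d')); rewrite mulrC dd; split => //; rewrite mulrC.
by move=> /orP[]/eqP ->.
Qed.

(** If al1 al2 = n0 + n1 al1 + n2 al2, translating by -n2 and -n1 makes the product a rational
    integer. Associativity of om om th and om th th then forces the constant terms of the squares
    and of the product, which is the Delone-Faddeev table. *)
Lemma normalize_basis al1 al2 : integral_basis al1 al2 ->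
  exists f (k1 k2 : int), cubic_rel f (al1 + k1%:~R) (al2 + k2%:~R).
Proof.
move=> Ha; have [i1 i2] := integral_basis_mem Ha; have [_ sp] := Ha.
have [[[n0 n1] n2] e] := (sp (al1 * al2)).1 (integral_mul i1 i2).
rewrite -/(zcomb _ _ _) zcombE /= in e.
pose om := al1 + (- n2)%:~R; pose th := al2 + (- n1)%:~R.
have Hb : integral_basis om th by exact: integral_basis_shift.
have [inj sp'] := Hb; have [j1 j2] := integral_basis_mem Hb.
have e' : om * th = (n0 + n1 * n2)%:~R.
  by rewrite /om /th mulrDl !mulrDr e; ring.
have [[[m b] a] ea] := (sp' (om * om)).1 (integral_mul j1 j1).
have [[[l d] c] eb] := (sp' (th * th)).1 (integral_mul j2 j2).
rewrite -/(zcomb _ _ _) zcombE /= in ea; rewrite -/(zcomb _ _ _) zcombE /= in eb.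
set n := n0 + n1 * n2 in e'.
have h1 : zcomb om th (0, n, 0) = zcomb om th (b * n + a * l, a * d, m + a * c).
  rewrite !zcombE /=; transitivity ((om * om) * th); last by rewrite ea mulrDl mulrDl -!mulrA e' eb; ring.
  by rewrite -mulrA e'; ring.
have h2 : zcomb om th (0, 0, n) = zcomb om th (d * m + c * n, l + d * b, d * a).
  rewrite !zcombE /=; transitivity ((th * th) * om); last by rewrite eb mulrDl mulrDl -!mulrA [th * om]mulrC e' ea; ring.
  by rewrite -mulrA [th * om]mulrC e'; ring.
have [_ c1 c2] := inj _ _ h1; have [_ c3 _] := inj _ _ h2.
exists (BCF (- a) b (- c) d), (- n2), (- n1); rewrite -/om -/th; split => /=.
- by rewrite e' c1; ring.
- by rewrite expr2 ea (_ : m = - (a * c)) 1?(_ : l = - (d * b)); [ring|lia].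
- by rewrite expr2 eb (_ : l = - (d * b)); [ring|lia].
Qed.


Lemma io_subproof : {h : {rmorphism rat -> K} | forall u, h u = u%:A}.
Proof. by exists (GRing.in_alg K). Qed.

(* The embedding of Q in K, sealed so that simplification does not unfold it to scaling. *)
Definition io := sval io_subproof.

Lemma ioE (u : rat) : io u = u%:A.
Proof. exact: (svalP io_subproof). Qed.

Lemma io_int (n : int) : io n%:~R = n%:~R.
Proof. by rewrite rmorph_int. Qed.

Lemma io_scale (u : rat) x : u *: x = io u * x.
Proof. by rewrite ioE mulr_algl. Qed.

Lemma TrD x y : Tr (x + y) = Tr x + Tr y.
Proof. by rewrite /Tr -big_split; apply: eq_bigr => i _; rewrite mulrDl linearD. Qed.

Lemma TrZ (u : rat) x : Tr (io u * x) = u * Tr x.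
Proof.
by rewrite /Tr mulr_sumr; apply: eq_bigr => i _; rewrite -mulrA -io_scale linearZ.
Qed.

Lemma Tr_basis n (X : n.-tuple K) al : basis_of {:K} X ->
  Tr al = \sum_i coord X i (al * X`_i).
Proof.
move=> bX; rewrite /Tr; set e := vbasis _.
have eX i : e`_i = \sum_j coord X j e`_i *: X`_j by apply: coord_basis bX _; exact: memvf.
transitivity (\sum_(i < \dim {:K}) \sum_j coord X j e`_i * coord e i (al * X`_j)).
  apply: eq_bigr => i _; rewrite {1}eX mulr_sumr linear_sum /=; apply: eq_bigr => j _.
  by rewrite -scalerAr linearZ.
rewrite exchange_big /=; apply: eq_bigr => j _.
rewrite [in RHS](coord_vbasis (memvf (al * X`_j))) linear_sum /=; apply: eq_bigr => i _.
by rewrite linearZ /= mulrC.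
Qed.

Lemma integral_basis_basis al1 al2 : \dim {:K} = 3%N -> integral_basis al1 al2 ->
  basis_of {:K} [tuple 1; al1; al2].
Proof.
move=> d3 /integral_basisE[inj _]; rewrite basisEfree subvf /= d3 leqnn !andbT.
apply/freeP => k; rewrite !big_ord_recl big_ord0 addr0 /= => h.
set k0 := k _ in h; set k1 := k _ in h; set k2 := k _ in h.
have e (n d : int) (r : rat) : n%:~R = r * d%:~R :> rat -> (n%:~R : K) = io r * d%:~R.
  by move=> nr; rewrite -io_int nr rmorphM io_int.
have e0 := e _ _ _ (numqE k0); have e1 := e _ _ _ (numqE k1); have e2 := e _ _ _ (numqE k2).
(* A rational relation multiplied by its three denominators is an integral one. *)
have : zcomb al1 al2 (numq k0 * denq k1 * denq k2, numq k1 * denq k0 * denq k2,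
          numq k2 * denq k0 * denq k1) = zcomb al1 al2 (0, 0, 0).
  rewrite !zcombE /= !mulr0z !mul0r !addr0 !rmorphM /= e0 e1 e2.
  transitivity ((denq k0)%:~R * (denq k1)%:~R * (denq k2)%:~R * (io k0 * 1 + (io k1 * al1 + io k2 * al2))); first by ring.
  by rewrite -!io_scale h mulr0.
move/inj => -[/eqP h0 /eqP h1 /eqP h2].
have {}h0 : k0 = 0 by apply/eqP; rewrite -numq_eq0; move: h0; rewrite !mulf_eq0 !denq_eq0 !orbF.
have {}h1 : k1 = 0 by apply/eqP; rewrite -numq_eq0; move: h1; rewrite !mulf_eq0 !denq_eq0 !orbF.
have {}h2 : k2 = 0 by apply/eqP; rewrite -numq_eq0; move: h2; rewrite !mulf_eq0 !denq_eq0 !orbF.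
by case=> [[|[|[|//]]] hi]; [rewrite -[RHS]h0|rewrite -[RHS]h1|rewrite -[RHS]h2]; congr k; apply/val_inj.
Qed.

Lemma coord3 (al1 al2 : K) : basis_of {:K} [tuple 1; al1; al2] -> forall u v w (i : 'I_3),
  coord [tuple 1; al1; al2] i (io u + io v * al1 + io w * al2) = [:: u; v; w]`_i.
Proof.
move=> bX u v w i; have fX := basis_free bX.
pose k (j : 'I_3) := [:: u; v; w]`_j.
rewrite -[RHS]/(k i) -(coord_sum_free k i fX); congr coord.
by rewrite !big_ord_recl big_ord0 addr0 /k /= !io_scale mulr1 addrA.
Qed.

Lemma cubic_coords (al1 al2 : K) : basis_of {:K} [tuple 1; al1; al2] -> forall x,
  exists u v w, x = io u + io v * al1 + io w * al2.
Proof.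
move=> bX x; exists (coord [tuple 1; al1; al2] ord0 x), (coord [tuple 1; al1; al2] (lift ord0 ord0) x),
  (coord [tuple 1; al1; al2] (lift ord0 (lift ord0 ord0)) x).
rewrite {1}(coord_basis bX (memvf x)) !big_ord_recl big_ord0 addr0 /= !io_scale.
by rewrite mulr1 addrA.
Qed.

Lemma cubic_coords_inj (al1 al2 : K) : basis_of {:K} [tuple 1; al1; al2] ->
  forall u v w u' v' w', io u + io v * al1 + io w * al2 = io u' + io v' * al1 + io w' * al2 ->
  [/\ u = u', v = v' & w = w'].
Proof.
move=> bX u v w u' v' w' h; have c := coord3 bX.
split; [have := c u v w ord0|have := c u v w (lift ord0 ord0)|have := c u v w (lift ord0 (lift ord0 ord0))];
  by rewrite h c.
Qed.

Section Rel.
Variables (f : bcf) (om th : K).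
Hypotheses (bX : basis_of {:K} [tuple 1; om; th]) (rel : cubic_rel f om th).

(** If the first two coefficients vanish, the characteristic polynomial of [om] is a perfect cube,
    so that 3 [om] would be a rational integer. *)
Lemma hess_neq0 : hess f <> BQF 0 0 0.
Proof.
case=> e1 e2 _; have [h1 h2 _] := rel.
have c3 : om ^+ 3 = (fb f)%:~R * om ^+ 2 - (fa f * fc f)%:~R * om + (fa f ^+ 2 * fd f)%:~R.
  transitivity (om * om ^+ 2); first by ring.
  rewrite {1}h2; transitivity ((fb f)%:~R * om ^+ 2 - (fa f * fc f)%:~R * om - (fa f)%:~R * (om * th)); first by ring.
  by rewrite h1; ring.
have z1 : (fb f ^+ 2 - 3 * fa f * fc f)%:~R = 0 :> K by rewrite e1.
have z2 : (3 * fa f * (fb f * fc f - 9 * fa f * fd f))%:~R = 0 :> K by rewrite e2 mulr0.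
have : (3 * om - (fb f)%:~R) ^+ 3 = 0.
  transitivity ((9 * om - (fb f)%:~R) * (fb f ^+ 2 - 3 * fa f * fc f)%:~R - (3 * fa f * (fb f * fc f - 9 * fa f * fd f))%:~R
    + 27 * (om ^+ 3 - ((fb f)%:~R * om ^+ 2 - (fa f * fc f)%:~R * om + (fa f ^+ 2 * fd f)%:~R)) : K); first by ring.
  by rewrite z1 z2 c3; ring.
move/eqP; rewrite expf_eq0 /= subr_eq0 => /eqP e3.
have e : io 0 + io 3 * om + io 0 * th = io (fb f)%:~R + io 0 * om + io 0 * th.
  by rewrite !rmorph0 io_int (_ : io 3 = 3) ?rmorph_nat// e3; ring.
by have [_ /eqP] := cubic_coords_inj bX e.
Qed.

Lemma Tr_cubic (u v w : rat) : Tr (io u + io v * om + io w * th) = ce1 f u v w.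
Proof.
have c := coord3 bX.
have T1 : Tr (1 : K) = 3.
  rewrite (Tr_basis _ bX) !big_ord_recl big_ord0 /= !mul1r addr0.
  rewrite [X in coord _ _ X + _](_ : _ = io 1 + io 0 * om + io 0 * th); last by rewrite !rmorph0 rmorph1; ring.
  rewrite [X in _ + (coord _ _ X + _)](_ : _ = io 0 + io 1 * om + io 0 * th); last by rewrite !rmorph0 rmorph1; ring.
  rewrite [X in _ + (_ + coord _ _ X)](_ : _ = io 0 + io 0 * om + io 1 * th); last by rewrite !rmorph0 rmorph1; ring.
  by rewrite !c /=; ring.
case: rel => r1 r2 r3.
have Tom : Tr om = (fb f)%:~R.
  rewrite (Tr_basis _ bX) !big_ord_recl big_ord0 /= mulr1 addr0 -expr2 r1 r2.
  rewrite [X in coord _ _ X + _](_ : _ = io 0 + io 1 * om + io 0 * th); last by rewrite !rmorph0 rmorph1; ring.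
  rewrite [X in _ + (coord _ _ X + _)](_ : _ = io (- (fa f)%:~R * (fc f)%:~R) + io (fb f)%:~R * om + io (- (fa f)%:~R) * th); last by rewrite !rmorphM !rmorphN !io_int; ring.
  rewrite [X in _ + (_ + coord _ _ X)](_ : _ = io (- (fa f)%:~R * (fd f)%:~R) + io 0 * om + io 0 * th); last by rewrite !rmorphM !rmorphN !rmorph0 !io_int; ring.
  by rewrite !c /=; ring.
have Tth : Tr th = - (fc f)%:~R.
  rewrite (Tr_basis _ bX) !big_ord_recl big_ord0 /= mulr1 addr0 -expr2 [th * om]mulrC r1 r3.
  rewrite [X in coord _ _ X + _](_ : _ = io 0 + io 0 * om + io 1 * th); last by rewrite !rmorph0 rmorph1; ring.
  rewrite [X in _ + (_ + coord _ _ X)](_ : _ = io (- (fb f)%:~R * (fd f)%:~R) + io (fd f)%:~R * om + io (- (fc f)%:~R) * th); last by rewrite !rmorphM !rmorphN !io_int; ring.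
  rewrite [X in _ + (coord _ _ X + _)](_ : _ = io (- (fa f)%:~R * (fd f)%:~R) + io 0 * om + io 0 * th); last by rewrite !rmorphM !rmorphN !rmorph0 !io_int; ring.
  by rewrite !c /=; ring.
by rewrite !TrD !TrZ Tom Tth -[io u]mulr1 TrZ T1 /ce1; ring.
Qed.

Lemma Tr_cubic_mul (u v w u' v' w' : rat) :
  Tr ((io u + io v * om + io w * th) * (io u' + io v' * om + io w' * th)) =
  3 * u * u' + u * ((fb f)%:~R * v' - (fc f)%:~R * w') + u' * ((fb f)%:~R * v - (fc f)%:~R * w)
  + ((fb f)%:~R ^+ 2 - 2 * (fa f)%:~R * (fc f)%:~R) * v * v' - 3 * (fa f)%:~R * (fd f)%:~R * (v * w' + w * v')
  + ((fc f)%:~R ^+ 2 - 2 * (fb f)%:~R * (fd f)%:~R) * w * w'.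
Proof.
rewrite (cubic_rel_mul _ _ _ _ _ _ rel) -!io_int -!(rmorphM io) -!(rmorphB io, rmorphD io) -!(rmorphM io) -!(rmorphB io, rmorphD io).
by rewrite Tr_cubic /ce1; ring.
Qed.

Lemma perp_combE (x y : int) : perp_comb om th x y =
  io (- ((fb f)%:~R * x%:~R) + (fc f)%:~R * y%:~R) + io (3 * x%:~R) * om + io (3 * y%:~R) * th.
Proof.
have hom : Tr om = (fb f)%:~R.
  by rewrite [X in Tr X](_ : om = io 0 + io 1 * om + io 0 * th) ?Tr_cubic /ce1 ?rmorph0 ?rmorph1; ring.
have hth : Tr th = - (fc f)%:~R.
  by rewrite [X in Tr X](_ : th = io 0 + io 0 * om + io 1 * th) ?Tr_cubic /ce1 ?rmorph0 ?rmorph1; ring.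
rewrite /perp_comb /perp hom hth -!ioE !rmorphN !io_int -[X in X + _]mulrzl -[X in _ + X]mulrzl.
by rewrite !rmorphD !rmorphN !rmorphM /= !io_int (_ : io 3 = 3) ?rmorph_nat//; ring.
Qed.

Lemma Tr_perp_comb (x y : int) : Tr (perp_comb om th x y ^+ 2) = (qeval (qscale 6 (hess f)) x y)%:~R.
Proof. by rewrite perp_combE expr2 Tr_cubic_mul /qeval /=; ring. Qed.

Lemma disc_cubic (k1 k2 : int) : disc (om + k1%:~R) (th + k2%:~R) = (cdisc f)%:~R.
Proof.
have e0 : (1 : K) = io 1 + io 0 * om + io 0 * th by rewrite !rmorph0 rmorph1; ring.
have e1 : om + k1%:~R = io k1%:~R + io 1 * om + io 0 * th by rewrite !rmorph0 rmorph1 io_int; ring.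
have e2 : th + k2%:~R = io k2%:~R + io 0 * om + io 1 * th by rewrite !rmorph0 rmorph1 io_int; ring.
have T x y u v w u' v' w' (ex : x = io u + io v * om + io w * th) (ey : y = io u' + io v' * om + io w' * th) :
  Tr (x * y) = _ := etrans (congr1 _ (congr2 _ ex ey)) (Tr_cubic_mul u v w u' v' w').
rewrite /disc (expand_det_row _ 0) !big_ord_recl big_ord0 /cofactor !(expand_det_row _ 0).
rewrite !big_ord_recl !big_ord0 /cofactor !det_mx11 !mxE !(tnth_nth 0) /=.
rewrite (T _ _ _ _ _ _ _ _ e0 e0) (T _ _ _ _ _ _ _ _ e0 e1) (T _ _ _ _ _ _ _ _ e0 e2).
rewrite (T _ _ _ _ _ _ _ _ e1 e0) (T _ _ _ _ _ _ _ _ e1 e1) (T _ _ _ _ _ _ _ _ e1 e2).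
rewrite (T _ _ _ _ _ _ _ _ e2 e0) (T _ _ _ _ _ _ _ _ e2 e1) (T _ _ _ _ _ _ _ _ e2 e2).
by rewrite /cdisc /=; ring.
Qed.

End Rel.

Lemma perp_comb_change al1 al2 g (k1 k2 x y : int) :
  Tr (1 : K) = 3 ->
  perp_comb ((za g)%:~R * al1 + (zc g)%:~R * al2 + k1%:~R)
    ((zb g)%:~R * al1 + (zd g)%:~R * al2 + k2%:~R) x y =
  perp_comb al1 al2 (za g * x + zb g * y) (zc g * x + zd g * y).
Proof.
move=> T1; have Tk (k : int) : Tr (k%:~R : K) = 3 * k%:~R.
  by rewrite -io_int -[io _]mulr1 TrZ T1 mulrC.
have TM (k : int) (z : K) : Tr ((k%:~R : K) * z) = k%:~R * Tr z by rewrite -io_int TrZ.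
rewrite /perp_comb /perp !TrD !Tk !TM -!ioE !rmorphD !rmorphM /= !io_int.
rewrite -[X in X + _ = _]mulrzl -[X in _ + X = _]mulrzl -[X in _ = X + _]mulrzl -[X in _ = _ + X]mulrzl.
by rewrite (_ : io 3 = 3) ?rmorph_nat//; ring.
Qed.


Lemma Tr1 om th : basis_of {:K} [tuple 1; om; th] -> Tr (1 : K) = 3.
Proof.
move=> bX; have c := coord3 bX; rewrite (Tr_basis _ bX) !big_ord_recl big_ord0 /= !mul1r addr0.
rewrite [X in coord _ _ X + _](_ : _ = io 1 + io 0 * om + io 0 * th); last by rewrite !rmorph0 rmorph1; ring.
rewrite [X in _ + (coord _ _ X + _)](_ : _ = io 0 + io 1 * om + io 0 * th); last by rewrite !rmorph0 rmorph1; ring.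
rewrite [X in _ + (_ + coord _ _ X)](_ : _ = io 0 + io 0 * om + io 1 * th); last by rewrite !rmorph0 rmorph1; ring.
by rewrite !c /=; ring.
Qed.

(* Maximality at p of the ring of f: (u + v om + w th) / p is integral only if p divides v and w. *)
Definition pmax (f : bcf) (p : nat) := forall u v w : int,
  (p%:Z %| ce1 f u v w)%Z -> (p%:Z ^+ 2 %| ce2 f u v w)%Z -> (p%:Z ^+ 3 %| ce3 f u v w)%Z ->
  (p%:Z %| v)%Z /\ (p%:Z %| w)%Z.

Lemma integral_cubic x (r1 r2 r3 : int) :
  x ^+ 3 - r1%:~R * x ^+ 2 + r2%:~R * x - r3%:~R = 0 -> integer_of x.
Proof.
move=> h; exists ('X^3 - r1 *: 'X^2 + r2 *: 'X - r3%:P).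
  apply/monicP; rewrite -!mul_polyC.
  rewrite (_ : 'X^3 - _ + _ - _ = 'X^3 + (- r1%:P * 'X^2 + r2%:P * 'X - r3%:P)); last by ring.
  rewrite lead_coefDl ?lead_coefXn// size_polyXn ltnS.
  apply: leq_trans (size_polyD _ _) _; rewrite geq_max; apply/andP; split; last first.
    by rewrite size_polyN (leq_trans (size_polyC_leq1 _)).
  apply: leq_trans (size_polyD _ _) _; rewrite geq_max; apply/andP; split.
    rewrite -polyCN mul_polyC; apply: leq_trans (size_scale_leq _ _) _.
    by rewrite size_polyXn.
  by rewrite mul_polyC; apply: leq_trans (size_scale_leq _ _) _; rewrite size_polyX.
apply/rootP; rewrite !(rmorphB, rmorphD) /= !linearZ /= !map_polyXn map_polyX map_polyC /=.
by rewrite !hornerE /= -[RHS]h; ring.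
Qed.

(** The divisibilities say that (u + v om + w th) / p is a root of a monic integral cubic; being
    integral, it has integral coordinates. *)
Lemma pmax_of_basis f om th p : prime p -> cubic_rel f om th -> integral_basis om th -> pmax f p.
Proof.
move=> pp rel /integral_basisE[inj sp] u v w /dvdzP[r1 e1] /dvdzP[r2 e2] /dvdzP[r3 e3].
have p0 : (p%:R : K) != 0.
  by rewrite -(rmorph_nat io) fmorph_eq0 pnatr_eq0 -lt0n prime_gt0.
pose y := u%:~R + v%:~R * om + w%:~R * th.
have hy : y ^+ 3 - (ce1 f u v w)%:~R * y ^+ 2 + (ce2 f u v w)%:~R * y - (ce3 f u v w)%:~R = 0.
  have [-> [-> ->]] := ce_intr K f u v w.
  exact: cubic_rel_charpoly.
have /sp[[[a b] c] e] : integer_of (y / p%:R).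
  apply: (@integral_cubic _ r1 r2 r3).
  transitivity ((y ^+ 3 - (ce1 f u v w)%:~R * y ^+ 2 + (ce2 f u v w)%:~R * y - (ce3 f u v w)%:~R) / p%:R ^+ 3); last by rewrite hy mul0r.
  by rewrite e1 e2 e3; field.
rewrite -/(zcomb _ _ _) in e.
have : zcomb om th (u, v, w) = zcomb om th (p%:Z * a, p%:Z * b, p%:Z * c).
  transitivity (p%:R * (y / p%:R)); last by rewrite e !zcombE /=; ring.
  by rewrite zcombE /= /y; field.
by move=> /inj [_ -> ->]; rewrite !dvdz_mulr.
Qed.

Lemma root_io_cubic (c1 c2 c3 : rat) (y : K) : y ^+ 3 - io c1 * y ^+ 2 + io c2 * y - io c3 = 0 ->
  root (map_poly io ('X^3 - c1 *: 'X^2 + c2 *: 'X - c3%:P)) y.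
Proof.
move=> h; apply/rootP; rewrite !(rmorphB, rmorphD) /= !linearZ /= !map_polyXn map_polyX map_polyC /=.
by rewrite !hornerE /= -[RHS]h; ring.
Qed.

(* The characteristic polynomial is the minimal polynomial unless the element is rational, so Gauss's
   lemma applies. *)
Lemma integer_charpoly f om th : \dim {:K} = 3%N -> basis_of {:K} [tuple 1; om; th] -> cubic_rel f om th ->
  forall u v w : rat, integer_of (io u + io v * om + io w * th) ->
  exists r1 r2 r3 : int, [/\ ce1 f u v w = r1%:~R, ce2 f u v w = r2%:~R & ce3 f u v w = r3%:~R].
Proof.
move=> d3 bX rel u v w; set x := _ + _ => -[q qm qx].
pose mi := map_poly (intr : int -> rat).
(* Gauss's lemma: a monic rational divisor of [q] is proportional to an integral divisor, whose
   leading coefficient divides that of [q] and is therefore 1 or -1. *)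
have gauss (p : {poly rat}) : p \is monic -> p %| mi q -> exists p1, p = mi p1.
  move=> pm /dvdpP_rat_int[p1 [a a0 e] [r er]]; have : lead_coef q = 1 by apply/monicP.
  rewrite er lead_coefM => l1; have lu : lead_coef p1 \is a GRing.unit.
    by apply/unitrP; exists (lead_coef r); rewrite mulrC.
  case/orP: lu => /eqP l.
  - have : lead_coef p = 1 by apply/monicP.
    rewrite e lead_coefZ lead_coef_map_inj ?rmorph0//; last exact: intr_inj.
    by rewrite l mulr1 => ->; exists p1; rewrite scale1r.
  - have : lead_coef p = 1 by apply/monicP.
    rewrite e lead_coefZ lead_coef_map_inj ?rmorph0//; last exact: intr_inj.
    rewrite l rmorphN1 mulrN1 => /eqP; rewrite eqr_oppLR => /eqP ->; exists (- p1).
    by rewrite scaleN1r /mi rmorphN.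
have hx := cubic_rel_charpoly (io u) (io v) (io w) rel; rewrite /= -/x in hx.
have ei : [/\ ce1 f (io u) (io v) (io w) = io (ce1 f u v w), ce2 f (io u) (io v) (io w) = io (ce2 f u v w)
   & ce3 f (io u) (io v) (io w) = io (ce3 f u v w)].
  by split; rewrite /ce1 /ce2 /ce3; ring.
case: ei hx => -> -> -> hx.
pose chi : {poly rat} := 'X^3 - ce1 f u v w *: 'X^2 + ce2 f u v w *: 'X - (ce3 f u v w)%:P.
have sz : size ('X^3 + (- ce1 f u v w *: 'X^2 + ce2 f u v w *: 'X - (ce3 f u v w)%:P)) = 4%N /\
  lead_coef ('X^3 + (- ce1 f u v w *: 'X^2 + ce2 f u v w *: 'X - (ce3 f u v w)%:P)) = 1.
  have s3 : (size (- ce1 f u v w *: 'X^2 + ce2 f u v w *: 'X - (ce3 f u v w)%:P)%R < 4)%N.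
    rewrite ltnS; apply: leq_trans (size_polyD _ _) _; rewrite geq_max; apply/andP; split; last first.
      by rewrite size_polyN (leq_trans (size_polyC_leq1 _)).
    apply: leq_trans (size_polyD _ _) _; rewrite geq_max; apply/andP; split.
      by apply: leq_trans (size_scale_leq _ _) _; rewrite size_polyXn.
    by apply: leq_trans (size_scale_leq _ _) _; rewrite size_polyX.
  by rewrite size_polyDl size_polyXn// lead_coefDl ?lead_coefXn ?size_polyXn.
have echi : chi = 'X^3 + (- ce1 f u v w *: 'X^2 + ce2 f u v w *: 'X - (ce3 f u v w)%:P).
  by rewrite /chi scaleNr !addrA.
have chim : chi \is monic by apply/monicP; rewrite echi sz.2.
have szc : size chi = 4%N by rewrite echi sz.1.
have qK : map_poly (intr : int -> K) q = map_poly io (mi q).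
  by rewrite -map_poly_comp; apply: eq_map_poly => z /=; rewrite io_int.
have over (p : {poly rat}) : map_poly io p \is a polyOver 1%VS.
  by apply/polyOverP => i; rewrite coef_map /= ioE rpredZ// mem1v.
have rootchi : root (map_poly io chi) x.
  exact: root_io_cubic.
suff [p1 e1] : exists p1, chi = mi p1.
  have ci i : chi`_i = (p1`_i)%:~R by rewrite e1 coef_map.
  exists (- p1`_2), p1`_1, (- p1`_0); rewrite !rmorphN /= -!ci /chi.
  by rewrite !(coefD, coefB, coefN, coefZ, coefXn, coefX, coefC) /=; split; ring.
have [x1|xn1] := boolP (x \in (1%VS : {vspace K})).
  have /vlineP[r er] := x1; rewrite -ioE in er.
  have [p1 e1] : exists p1, 'X - r%:P = mi p1.
    apply: gauss; first exact: monicXsubC.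
    by rewrite dvdp_XsubCl -(fmorph_root io) -qK -er.
  have er0 : r = (- p1`_0)%:~R by rewrite rmorphN /= -(coef_map (intr : int -> rat)) -/mi -e1 coefB coefX coefC /=; ring.
  have [ru rv rw] : [/\ u = r, v = 0 & w = 0].
    apply: (cubic_coords_inj bX); rewrite -/x er !rmorph0; ring.
  have -> : chi = ('X - r%:P) ^+ 3.
    have h1 : ce1 f u v w = 3 * r by rewrite ru rv rw /ce1; ring.
    have h2 : ce2 f u v w = 3 * r ^+ 2 by rewrite ru rv rw /ce2; ring.
    have h3 : ce3 f u v w = r ^+ 3 by rewrite ru rv rw /ce3; ring.
    by rewrite /chi h1 h2 h3 -!mul_polyC; ring.
  by rewrite e1; exists (p1 ^+ 3); rewrite /mi rmorphXn.
apply: gauss => //; rewrite -(dvdp_map io) -qK.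
have dvdq : minPoly 1%VS x %| map_poly intr q by rewrite qK minPoly_dvdp ?over// -qK.
have dvdc : minPoly 1%VS x %| map_poly io chi by rewrite minPoly_dvdp ?over.
have szm : size (minPoly 1%VS x) = 4%N.
  rewrite size_minPoly; congr _.+1.
  have : (adjoin_degree 1%VS x %| 3)%N.
    rewrite -d3 adjoin_degreeE dimv1 divn1; apply: field_dimS; exact: subvf.
  rewrite dvdn_divisors// (_ : divisors 3 = [:: 1; 3]%N)// !inE => /orP[|]/eqP// d1.
  by move: xn1; rewrite -adjoin_deg_eq1 d1.
have /eqP <- // : minPoly 1%VS x == map_poly io chi.
rewrite -eqp_monic ?monic_minPoly ?map_monic//.
by rewrite -dvdp_size_eqp ?szm ?size_map_poly ?szc.
Qed.


Lemma natz_exp (A : pzRingType) (p j : nat) : ((p%:Z ^+ j)%:~R : A) = p%:R ^+ j.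
Proof. by elim: j => // j ih; rewrite !exprS intrM ih. Qed.

(** Strong induction on a common denominator N of an integral element. For a prime p dividing N, a
    multiple of the element has denominator p, and maximality at p shows that p divides V and W.
    What remains, U / p, is integral, so p^3 divides U^3 and p can be cancelled from the
    fraction. *)
Lemma integral_basis_of_pmax f om th : \dim {:K} = 3%N -> basis_of {:K} [tuple 1; om; th] ->
  cubic_rel f om th -> (forall p, prime p -> pmax f p) -> integral_basis om th.
Proof.
move=> d3 bX rel pm; apply/integral_basisE.
have zio n : zcomb om th n = io n.1.1%:~R + io n.1.2%:~R * om + io n.2%:~R * th.
  by rewrite zcombE !io_int.
have inj : injective (zcomb om th).
  move=> [[a b] c] [[a' b'] c']; rewrite !zio /= => /(cubic_coords_inj bX)[].
  by move=> /intr_inj -> /intr_inj -> /intr_inj ->.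
have zint n : integer_of (zcomb om th n).
  apply: (@integral_cubic _ (ce1 f n.1.1 n.1.2 n.2) (ce2 f n.1.1 n.1.2 n.2) (ce3 f n.1.1 n.1.2 n.2)).
  have [-> [-> ->]] := ce_intr K f n.1.1 n.1.2 n.2.
  by rewrite zcombE; exact: cubic_rel_charpoly.
split=> // x; split; last by case=> n ->; exact: zint.
have clear : forall N : nat, (0 < N)%N -> forall U V W : int,
   integer_of (zcomb om th (U, V, W) / N%:R) -> exists n, zcomb om th (U, V, W) / N%:R = zcomb om th n.
  move=> N; have [m] := ubnP N; elim: m N => // m ih N; rewrite ltnS => Nm N0 U V W.
  have [->|N1] := eqVneq N 1%N; first by exists (U, V, W); rewrite divr1.
  have N2 : (1 < N)%N by lia.
  set p := pdiv N; have pp : prime p := pdiv_prime N2.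
  have /dvdnP[M eN] : (p %| N)%N := pdiv_dvd N.
  have M0 : (0 < M)%N by lia.
  have MN : (M < N)%N by rewrite eN ltn_Pmulr// prime_gt1.
  have nz (k : nat) : (0 < k)%N -> (k%:R : K) != 0.
    by move=> k0; rewrite -(rmorph_nat io) fmorph_eq0 pnatr_eq0 -lt0n.
  have p0 := nz _ (prime_gt0 pp); have M0K := nz _ M0.
  have p0Q : (p%:R : rat) != 0 by rewrite pnatr_eq0 -lt0n prime_gt0.
  move=> hint.
  have hint2 : integer_of (zcomb om th (U, V, W) / p%:R).
    rewrite (_ : _ / _ = M%:~R * (zcomb om th (U, V, W) / N%:R)); last by rewrite eN natrM; field; rewrite p0 M0K.
    by apply: integral_mul => //; exact: integral_id.
  have ep (u v w : int) : zcomb om th (u, v, w) / p%:R =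
    io (u%:~R / p%:R) + io (v%:~R / p%:R) * om + io (w%:~R / p%:R) * th.
    by rewrite zio /= !fmorph_div /= !rmorph_nat; field.
  have dv (r k : int) (j : nat) : r%:~R / p%:R ^+ j = k%:~R :> rat -> (p%:Z ^+ j %| r)%Z.
    move=> h; apply/dvdzP; exists k; apply: (@intr_inj rat).
    apply: etrans (esym (intrM _ k (p%:Z ^+ j))).
    by rewrite natz_exp -h mulfVK ?expf_neq0.
  have div3 (u v w : int) : integer_of (zcomb om th (u, v, w) / p%:R) ->
     [/\ (p%:Z ^+ 1 %| ce1 f u v w)%Z, (p%:Z ^+ 2 %| ce2 f u v w)%Z & (p%:Z ^+ 3 %| ce3 f u v w)%Z].
    rewrite ep => /(integer_charpoly d3 bX rel)[r1 [r2 [r3 [e1 e2 e3]]]].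
    have [c1 [c2 c3]] := ce_intr rat f u v w.
    split; [apply: (dv _ r1)|apply: (dv _ r2)|apply: (dv _ r3)]; rewrite ?c1 ?c2 ?c3 -?e1 -?e2 -?e3;
      by rewrite /ce1 /ce2 /ce3; field.
  have [] := div3 _ _ _ hint2; rewrite expr1 => d1 d2 d3'.
  have [/dvdzP[V' eV] /dvdzP[W' eW]] := pm p pp U V W d1 d2 d3'.
  (* Obtained by subtracting the integral element V' om + W' th. *)
  have : integer_of (zcomb om th (U, 0, 0) / p%:R).
    rewrite (_ : _ / _ = zcomb om th (U, V, W) / p%:R - zcomb om th (0, V', W')).
      exact: integral_sub hint2 (zint _).
    by rewrite !zcombE /= eV eW; field.
  move/div3 => [_ _]; rewrite (_ : ce3 f U 0 0 = U ^+ 3); last by rewrite /ce3; ring.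
  move=> h3; have /dvdzP[U' eU] : (p%:Z %| U)%Z.
    have : (p%:Z %| U ^+ 3)%Z by apply: dvdz_trans h3; rewrite exprS dvdz_mulr.
    by rewrite !dvdzE /= abszX Euclid_dvdX // => /andP[].
  have e : zcomb om th (U, V, W) / N%:R = zcomb om th (U', V', W') / M%:R.
    by rewrite !zcombE /= eU eV eW eN natrM; field; rewrite p0 M0K.
  by rewrite e; apply: (ih M) => //; [exact: leq_trans MN Nm | rewrite -e].
have [u [v [w ->]]] := cubic_coords bX x.
pose N := (`|denq u| * `|denq v| * `|denq w|)%N.
have dq (r : rat) : ((`|denq r|%N)%:R : rat) = (denq r)%:~R by rewrite natr_absz gtr0_norm ?denq_gt0.
have dn (r : rat) : ((denq r)%:~R : rat) != 0 by rewrite intr_eq0 denq_eq0.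
have N0 : (0 < N)%N by rewrite !muln_gt0 !absz_gt0 !denq_eq0.
have -> : io u + io v * om + io w * th = zcomb om th (numq u * denq v * denq w, numq v * denq u * denq w, numq w * denq u * denq v) / N%:R.
  rewrite zio /= -(rmorph_nat io) /N !natrM !dq !rmorphM /= !numqE !rmorphM /=.
  have dK (r : rat) : ((denq r)%:~R : K) != 0 by rewrite -io_int fmorph_eq0 dn.
  by field; rewrite !dK.
exact: clear.
Qed.

Lemma rmorph_io (L : fieldType) (phi : {rmorphism K -> L}) u : phi (io u) = ratr u.
Proof. exact: (fmorph_eq_rat (phi \o io)). Qed.

(** The table determines all products, so the coordinatewise map is multiplicative. The map [io'] on
    the rationals is a parameter in order to serve both maps between cubic fields and complex
    embeddings. *)
Lemma cubic_hom f om th (L : fieldType) (io' : {rmorphism rat -> L}) (w t : L) :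
  basis_of {:K} [tuple 1; om; th] -> cubic_rel f om th -> cubic_rel f w t ->
  exists phi : {rmorphism K -> L},
    forall u v x : rat, phi (io u + io v * om + io x * th) = io' u + io' v * w + io' x * t.
Proof.
move=> bX rel rel'.
pose X := [tuple 1; om; th].
pose phi (x : K) := io' (coord X ord0 x) + io' (coord X (lift ord0 ord0) x) * w +
  io' (coord X (lift ord0 (lift ord0 ord0)) x) * t.
have hphi (u v x : rat) : phi (io u + io v * om + io x * th) = io' u + io' v * w + io' x * t.
  by rewrite /phi !(coord3 bX).
have add : {morph phi : x y / x - y}.
  by move=> x y; rewrite /phi !linearB !rmorphB /=; ring.
have ints (A : pzRingType) (h : {rmorphism rat -> A}) (n : int) : h n%:~R = n%:~R by rewrite rmorph_int.
have mul : monoid_morphism phi.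
  split.
    rewrite (_ : (1 : K) = io 1 + io 0 * om + io 0 * th); last by rewrite !rmorph0 rmorph1; ring.
    by rewrite hphi !rmorph0 rmorph1; ring.
  move=> x y; have [u [v [z ->]]] := cubic_coords bX x; have [u' [v' [z' ->]]] := cubic_coords bX y.
  rewrite !hphi (cubic_rel_mul _ _ _ _ _ _ rel) (cubic_rel_mul _ _ _ _ _ _ rel').
  rewrite -!(ints _ io) -!(ints _ io').
  by rewrite -!(rmorphM io) -!(rmorphB io, rmorphD io) -!(rmorphM io) -!(rmorphB io, rmorphD io) hphi; ring.
pose m1 := GRing.isZmodMorphism.Build K L phi add.
pose m2 := GRing.isMonoidMorphism.Build K L phi mul.
by exists (HB.pack phi m1 m2 : {rmorphism K -> L}).
Qed.

End Field.
Arguments io {K}.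

Lemma cubic_iso (K K' : fieldExtType rat) f (om th : K) (om' th' : K') :
  basis_of {:K} [tuple 1; om; th] -> cubic_rel f om th ->
  basis_of {:K'} [tuple 1; om'; th'] -> cubic_rel f om' th' -> field_iso K K'.
Proof.
move=> b r b' r'; have [phi hp] := cubic_hom (@io K') b r r'; have [psi hs] := cubic_hom (@io K) b' r' r.
exists phi, psi => x.
  by have [u [v [w ->]]] := cubic_coords b x; rewrite hp hs.
by have [u [v [w ->]]] := cubic_coords b' x; rewrite hs hp.
Qed.

Definition ceval f (x y : int) := fa f * x ^+ 3 + fb f * x ^+ 2 * y + fc f * x * y ^+ 2 + fd f * y ^+ 3.
(** Coefficients of f(a x + b y, c x + d y), expanded. *)
Definition cact f g := BCF (ceval f (za g) (zc g))
  (3 * fa f * za g ^+ 2 * zb g + fb f * (za g ^+ 2 * zd g + 2 * za g * zb g * zc g)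
    + fc f * (2 * za g * zc g * zd g + zb g * zc g ^+ 2) + 3 * fd f * zc g ^+ 2 * zd g)
  (3 * fa f * za g * zb g ^+ 2 + fb f * (2 * za g * zb g * zd g + zb g ^+ 2 * zc g)
    + fc f * (za g * zd g ^+ 2 + 2 * zb g * zc g * zd g) + 3 * fd f * zc g * zd g ^+ 2)
  (ceval f (zb g) (zd g)).
Definition cscale e f := BCF (e * fa f) (e * fb f) (e * fc f) (e * fd f).

Lemma hess_scale e f : hess (cscale e f) = qscale (e ^+ 2) (hess f).
Proof. by congr BQF; rewrite /=; ring. Qed.

(** The Hessian is a covariant of weight two: the identity holds with the factor [zdet g ^+ 2],
    which is 1. *)
Lemma hess_act f g : unimod g -> hess (cact f g) = qact (hess f) g.
Proof.
move=> gu; have e : qscale (zdet g ^+ 2) (qact (hess f) g) = qact (hess f) g.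
  by rewrite gu; case: (qact _ _) => *; congr BQF; rewrite /=; ring.
by rewrite -e qact_int; congr BQF; rewrite /qeval /ceval /zdet /= /ceval; ring.
Qed.

Section Transition.
Variable K : fieldExtType rat.
Implicit Types (om th : K).

(** The coordinates of om' th', om'^2 and th'^2 in the old basis give the six relations V1, ..., W3.
    Eliminating the translations k1 and k2 by Cramer's rule expresses [zdet g] times each
    coefficient of f', which explains the twist by the determinant. *)
Lemma cubic_rel_transition f f' om th om' th' g (k1 k2 : int) : cubic_rel f om th ->
  cubic_rel f' om' th' -> integral_basis om th -> unimod g ->
  om' = (za g)%:~R * om + (zc g)%:~R * th + k1%:~R ->
  th' = (zb g)%:~R * om + (zd g)%:~R * th + k2%:~R ->
  f' = cscale (zdet g) (cact f g).
Proof.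
move=> rel [r1 r2 r3] /integral_basisE[inj _] gu eo et.
have inj3 (a b c a' b' c' : int) : a%:~R + b%:~R * om + c%:~R * th = a'%:~R + b'%:~R * om + c'%:~R * th ->
   b = b' /\ c = c'.
  move=> h; have /inj[] : zcomb om th (a, b, c) = zcomb om th (a', b', c') by rewrite !zcombE.
  by move=> _ -> ->.
have eo' : om' = k1%:~R + (za g)%:~R * om + (zc g)%:~R * th by rewrite eo; ring.
have et' : th' = k2%:~R + (zb g)%:~R * om + (zd g)%:~R * th by rewrite et; ring.
have i1 (m : int) : (m%:~R : K) = m%:~R + (0 : int)%:~R * om + (0 : int)%:~R * th by rewrite mulr0z; ring.
have [V1 W1] : (k1 * zb g + k2 * za g + fb f * za g * zb g + fd f * zc g * zd g = 0) /\
   (k1 * zd g + k2 * zc g - fa f * za g * zb g - fc f * zc g * zd g = 0).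
  have [] := inj3 (k1 * k2 - fa f * fc f * (za g * zb g) - fa f * fd f * (za g * zd g + zc g * zb g) - fb f * fd f * (zc g * zd g))
     (k1 * zb g + za g * k2 + fb f * (za g * zb g) + fd f * (zc g * zd g))
     (k1 * zd g + zc g * k2 - fa f * (za g * zb g) - fc f * (zc g * zd g)) (- fa f' * fd f') 0 0; last by split; lia.
  transitivity (om' * th'); last by rewrite r1; ring.
  by rewrite eo' et' (cubic_rel_mul _ _ _ _ _ _ rel); ring.
have [V2 W2] : (2 * k1 * za g + fb f * za g ^+ 2 + fd f * zc g ^+ 2 = fb f' * za g - fa f' * zb g) /\
   (2 * k1 * zc g - fa f * za g ^+ 2 - fc f * zc g ^+ 2 = fb f' * zc g - fa f' * zd g).
  have [] := inj3 (k1 * k1 - fa f * fc f * (za g * za g) - fa f * fd f * (za g * zc g + zc g * za g) - fb f * fd f * (zc g * zc g))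
     (2 * k1 * za g + fb f * za g ^+ 2 + fd f * zc g ^+ 2) (2 * k1 * zc g - fa f * za g ^+ 2 - fc f * zc g ^+ 2)
     (- fa f' * fc f' + fb f' * k1 - fa f' * k2) (fb f' * za g - fa f' * zb g) (fb f' * zc g - fa f' * zd g); last by [].
  transitivity (om' ^+ 2); last by rewrite r2 eo' et'; ring.
  by rewrite [om' ^+ 2]expr2 eo' (cubic_rel_mul _ _ _ _ _ _ rel); ring.
have [V3 W3] : (2 * k2 * zb g + fb f * zb g ^+ 2 + fd f * zd g ^+ 2 = fd f' * za g - fc f' * zb g) /\
   (2 * k2 * zd g - fa f * zb g ^+ 2 - fc f * zd g ^+ 2 = fd f' * zc g - fc f' * zd g).
  have [] := inj3 (k2 * k2 - fa f * fc f * (zb g * zb g) - fa f * fd f * (zb g * zd g + zd g * zb g) - fb f * fd f * (zd g * zd g))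
     (2 * k2 * zb g + fb f * zb g ^+ 2 + fd f * zd g ^+ 2) (2 * k2 * zd g - fa f * zb g ^+ 2 - fc f * zd g ^+ 2)
     (- fb f' * fd f' + fd f' * k1 - fc f' * k2) (fd f' * za g - fc f' * zb g) (fd f' * zc g - fc f' * zd g); last by [].
  transitivity (th' ^+ 2); last by rewrite r3 eo' et'; ring.
  by rewrite [th' ^+ 2]expr2 et' (cubic_rel_mul _ _ _ _ _ _ rel); ring.
have gg : zdet g * zdet g = 1 by rewrite -expr2.
have fin (x y : int) : zdet g * x = y -> x = zdet g * y by move=> <-; rewrite mulrA gg mul1r.
have z0 (x y : int) : x = y -> x - y = 0 by move=> ->; rewrite subrr.
have {}V2 := z0 _ _ V2; have {}W2 := z0 _ _ W2; have {}V3 := z0 _ _ V3; have {}W3 := z0 _ _ W3.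
case: f' V2 W2 V3 W3 {r1 r2 r3} => a' b' c' d' /= V2 W2 V3 W3.
congr BCF; apply: fin; apply/eqP; rewrite -subr_eq0 /= /ceval /zdet.
- apply/eqP; apply: etrans (etrans (congr2 (fun x y : int => za g * y - zc g * x) V2 W2) _); rewrite /=; ring.
- apply/eqP; apply: etrans (etrans (congr2 +%R (congr2 (fun x y : int => zb g * y - zd g * x) V2 W2)
    (congr2 (fun x y : int => 2 * za g * y - 2 * zc g * x) V1 W1)) _); rewrite /=; ring.
- apply/eqP; apply: etrans (etrans (congr2 +%R (congr2 (fun x y : int => za g * y - zc g * x) V3 W3)
    (congr2 (fun x y : int => 2 * zb g * y - 2 * zd g * x) V1 W1)) _); rewrite /=; ring.
- apply/eqP; apply: etrans (etrans (congr2 (fun x y : int => zb g * y - zd g * x) V3 W3) _); rewrite /=; ring.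
Qed.

End Transition.

(** Primitivity as a Bezout identity: the multipliers are transported explicitly by a substitution,
    and they recover n linearly from the coefficients of n Q. *)
Definition primQ (Q : bqf int) := exists u0 u1 u2, u0 * qa Q + u1 * qb Q + u2 * qc Q = 1.

Lemma primQ_act Q g : unimod g -> primQ Q -> primQ (qact Q g).
Proof.
move=> gu [u0 [u1 [u2 e]]]; set P := qact Q g.
have hQ : qact P (zinv g) = Q by rewrite /P qactVK.
move: P (zinv g) hQ => P h hQ; rewrite -hQ qact_int /qeval /= in e.
move: e; set a := za h; set b := zb h; set c := zc h; set d := zd h => e.
exists (u0 * a ^+ 2 + u1 * a * b *+ 2 + u2 * b ^+ 2),
  (u0 * a * c + u1 * (a * d + b * c) + u2 * b * d),
  (u0 * c ^+ 2 + u1 * c * d *+ 2 + u2 * d ^+ 2).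
by rewrite -e; ring.
Qed.

Lemma primitive_partP (T : bqf int) : qa T != 0 \/ qb T != 0 \/ qc T != 0 ->
  exists2 n, 0 < n & T = qscale n (primitive_part T) /\ primQ (primitive_part T).
Proof.
case: T => a b c h; set n := gcdz a (gcdz b c).
have n0 : n != 0.
  by rewrite !gcdz_eq0 /=; case: h => [|[]] /= /negbTE ->; rewrite ?andbF.
have da : (n %| a)%Z := dvdz_gcdl _ _.
have db : (n %| b)%Z := dvdz_trans (dvdz_gcdr _ _) (dvdz_gcdl _ _).
have dc : (n %| c)%Z := dvdz_trans (dvdz_gcdr _ _) (dvdz_gcdr _ _).
exists n; first by rewrite lt0r n0.
rewrite /primitive_part /= -/n; split.
  by congr BQF; rewrite /= mulrC divzK.
have [u [v e1]] := Bezoutz a (gcdz b c); have [u' [v' e2]] := Bezoutz b c.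
exists u, (v * u'), (v * v') => /=; apply: (mulIf n0); rewrite mul1r.
by rewrite !mulrDl -!mulrA !divzK// -[RHS]e1 -e2; ring.
Qed.

Lemma primitive_part_scale n Q : 0 < n -> primQ Q -> primitive_part (qscale n Q) = Q.
Proof.
move=> n0 [u0 [u1 [u2 e]]]; have n0' : n != 0 by rewrite gt_eqF.
have g1 : gcdz (qa Q) (gcdz (qb Q) (qc Q)) = 1.
  have : (gcdz (qa Q) (gcdz (qb Q) (qc Q)) %| 1%R)%Z.
    rewrite -e; apply: rpredD; first apply: rpredD.
    - exact: dvdz_mull (dvdz_gcdl _ _).
    - exact: dvdz_mull (dvdz_trans (dvdz_gcdr _ _) (dvdz_gcdl _ _)).
    - exact: dvdz_mull (dvdz_trans (dvdz_gcdr _ _) (dvdz_gcdr _ _)).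
  by rewrite dvdz1 => /eqP h; rewrite -[LHS]gez0_abs ?h.
have gn : gcdz (n * qa Q) (gcdz (n * qb Q) (n * qc Q)) = n.
  have gm (x y : int) : gcdz (n * x) (n * y) = n * gcdz x y by rewrite -mulz_gcdr gez0_abs ?ltW.
  by rewrite !gm g1 mulr1.
by rewrite /primitive_part /= gn; case: Q {e g1 gn} => a b c; congr BQF; rewrite /= mulKz.
Qed.

Section TraceClass.
Variable K : fieldExtType rat.
Hypothesis d3 : \dim {:K} = 3%N.
Implicit Types (om th : K).

Lemma trace_class_act (Q : bqf int) g : unimod g -> trace_class K Q -> trace_class K (qact Q g).
Proof.
move=> gu [a1 [a2 [T [h1 h2 /GL2Z_equivP[g' gu' e]]]]]; exists a1, a2, T; split => //.
by apply/GL2Z_equivP; exists (zmul g' g); rewrite ?e ?qactM//; exact: unimodM.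
Qed.

Lemma rebase_cubic f om th g : integral_basis om th -> cubic_rel f om th -> unimod g ->
  exists om' th', [/\ integral_basis om' th', cubic_rel (cscale (zdet g) (cact f g)) om' th' &
    exists k1 k2 : int, om' = (za g)%:~R * om + (zc g)%:~R * th + k1%:~R /\
      th' = (zb g)%:~R * om + (zd g)%:~R * th + k2%:~R].
Proof.
move=> ib rel gu; have ib1 := integral_basis_change 0 0 ib gu.
have [f' [k1 [k2 rel']]] := normalize_basis ib1.
have ib2 := integral_basis_shift k1 k2 ib1.
set om' := _ + k1%:~R in rel' ib2; set th' := _ + k2%:~R in rel' ib2.
have e1 : om' = (za g)%:~R * om + (zc g)%:~R * th + k1%:~R by rewrite /om' mulr0z addr0.
have e2 : th' = (zb g)%:~R * om + (zd g)%:~R * th + k2%:~R by rewrite /th' mulr0z addr0.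
exists om', th'; split => //; last by exists k1, k2.
by rewrite -(cubic_rel_transition rel rel' ib gu e1 e2).
Qed.

(* The trace form in a normalised basis is 6 times the Hessian of the index form. *)
Lemma trace_class_cubic (Q : bqf int) : trace_class K Q -> primQ Q /\
  exists f om th n, [/\ integral_basis om th, cubic_rel f om th, 0 < n & hess f = qscale n Q].
Proof.
move=> [a1 [a2 [T [ib hT /GL2Z_equivP[g gu eQ]]]]].
have [f [k1 [k2 rel]]] := normalize_basis ib.
have ib' := integral_basis_shift k1 k2 ib.
set om := _ + k1%:~R in rel ib'; set th := _ + k2%:~R in rel ib'.
have bX := integral_basis_basis d3 ib'.
have T1 := Tr1 bX.
have eT : T = qscale 6 (hess f).
  apply: qeval_inj => x y; apply: (@intr_inj rat); rewrite hT -(Tr_perp_comb bX rel).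
  congr (Tr (_ ^+ 2)).
  have := @perp_comb_change _ a1 a2 zone k1 k2 x y T1; rewrite /= !mulr1z !mulr0z !mul1r !mul0r !addr0 !add0r.
  by move=> <-.
have Tn0 : qa T != 0 \/ qb T != 0 \/ qc T != 0.
  have [a0|] := eqVneq (qa T) 0; last by left.
  have [b0|] := eqVneq (qb T) 0; last by right; left.
  have [c0|] := eqVneq (qc T) 0; last by right; right.
  case: (hess_neq0 bX rel); move: a0 b0 c0; rewrite eT; case: (hess f) => a b c /= a0 b0 c0.
  by congr BQF; lia.
have [n n0 [eT' pT]] := primitive_partP Tn0.
have [u0 [u1 [u2 e]]] := pT.
(* The content of the Hessian, read off with the Bezout multipliers of the primitive part of T. *)
pose m := u0 * qa (hess f) + u1 * qb (hess f) + u2 * qc (hess f).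
have hT' : qscale n (primitive_part T) = qscale 6 (hess f) by rewrite -eT'.
have nm : n = 6 * m.
  have ea : n * qa (primitive_part T) = 6 * qa (hess f) := congr1 (@qa _) hT'.
  have eb : n * qb (primitive_part T) = 6 * qb (hess f) := congr1 (@qb _) hT'.
  have ec : n * qc (primitive_part T) = 6 * qc (hess f) := congr1 (@qc _) hT'.
  move: (primitive_part T) ea eb ec e => P ea eb ec e.
  transitivity (n * (u0 * qa P + u1 * qb P + u2 * qc P)); first by rewrite e mulr1.
  transitivity (u0 * (n * qa P) + u1 * (n * qb P) + u2 * (n * qc P)); first by ring.
  by rewrite ea eb ec /m; ring.
have m0 : 0 < m by lia.
have eh : hess f = qscale m (primitive_part T).
  move: hT'; rewrite nm; case: (hess f) (primitive_part T) => a b c [a' b' c'] [ea eb ec].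
  by congr BQF; rewrite /=; lia.
have [om' [th' [ib2 rel2 _]]] := rebase_cubic ib' rel gu.
split; first by rewrite eQ; exact: primQ_act.
exists (cscale (zdet g) (cact f g)), om', th', m; split => //.
rewrite hess_scale gu hess_act// eh qact_scale eQ.
by case: (qscale m _) => *; congr BQF; rewrite /=; ring.
Qed.

Lemma trace_class_of (Q : bqf int) f om th n : integral_basis om th -> cubic_rel f om th ->
  0 < n -> hess f = qscale n Q -> primQ Q -> trace_class K Q.
Proof.
move=> ib rel n0 eh pQ; exists om, th, (qscale (6 * n) Q); split => //.
  have bX := integral_basis_basis d3 ib.
  move=> x y; rewrite (Tr_perp_comb bX rel) eh; congr (_%:~R).
  by rewrite /qeval /=; ring.
apply/GL2Z_equivP; exists zone; first exact: unimod1.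
by rewrite qact1 primitive_part_scale//; lia.
Qed.

Lemma absdisc_cubic (R : realType) (X : R) f om th : integral_basis om th -> cubic_rel f om th ->
  absdisc_lt K X <-> `|(cdisc f)%:~R| < X.
Proof.
move=> ib rel; have bX := integral_basis_basis d3 ib.
split=> [[[a1 a2] /= ib1]|h].
  have [f' [k1 [k2 rel']]] := normalize_basis ib1.
  have ib2 := integral_basis_shift k1 k2 ib1; have b2 := integral_basis_basis d3 ib2.
  have := disc_cubic b2 rel' (- k1) (- k2).
  rewrite !rmorphN !addrK => ->.
  have [g [l1 [l2 [gu e1 e2]]]] := integral_basis_transition ib ib2.
  have ef := cubic_rel_transition rel rel' ib gu e1 e2.
  suff -> : cdisc f' = cdisc f by rewrite ratr_int.
  (* The two discriminants are compared through the Hessians, whose discriminants are -3 times those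
     of the cubic forms. *)
  have : qdisc (hess f') = qdisc (hess f).
    rewrite ef hess_scale gu hess_act// -[RHS](qdisc_act (hess f) gu).
    by rewrite /qdisc /=; ring.
  by rewrite !qdisc_hess; lia.
exists (om, th) => //=.
have := disc_cubic bX rel 0 0; rewrite !mulr0z !addr0 => ->.
by rewrite ratr_int.
Qed.

End TraceClass.

(** An isomorphism carries a normalised integral basis to one, with the same table. The transition
    matrix g to the second basis gives n' Q = n (Q o g); comparing discriminants yields n' = n, and
    then g fixes Q. *)
Lemma cubic_iso_automorph (K K' : fieldExtType rat) (Q : bqf int) f f' n n' (om th : K) (om' th' : K') :
  \dim {:K'} = 3%N -> integral_basis om th -> cubic_rel f om th -> integral_basis om' th' -> cubic_rel f' om' th' ->
  0 < n -> 0 < n' -> hess f = qscale n Q -> hess f' = qscale n' Q -> qdisc Q != 0 ->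
  field_iso K K' -> exists2 g, unimod g & [/\ qact Q g = Q, n' = n & f' = cscale (zdet g) (cact f g)].
Proof.
move=> d3 ib rel ib' rel' n0 n0' h h' dQ [phi [psi kp kq]].
have pint (z : int) : phi z%:~R = z%:~R by rewrite rmorph_int.
have ibp : integral_basis (phi om) (phi th).
  have [inj sp] := ib.
  have zp x : phi (zcomb om th x) = zcomb (phi om) (phi th) x.
    by rewrite !zcombE !rmorphD !rmorphM /= !pint.
  split=> [x y e|x].
    by apply: inj; apply: (can_inj kp); rewrite -!/(zcomb _ _ _) !zp.
  have intphi y : integer_of y -> integer_of (phi y).
    case=> p pm py; exists p => //.
    have -> : map_poly intr p = map_poly phi (map_poly intr p).
      by rewrite -map_poly_comp; apply: eq_map_poly => z /=; rewrite pint.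
    by rewrite fmorph_root.
  have intpsi y : integer_of y -> integer_of (psi y).
    case=> p pm py; exists p => //; rewrite -(fmorph_root phi) kq -map_poly_comp /=.
    by rewrite (eq_map_poly (g := intr)) // => z /=; rewrite pint.
  split=> [/intpsi/sp[y e]|[y ->]].
    by exists y; rewrite -/(zcomb _ _ _) -zp -[zcomb _ _ _]/(_ + _) -e kq.
  by rewrite -/(zcomb _ _ _) -zp; apply: intphi; apply/sp; exists y.
have relp : cubic_rel f (phi om) (phi th).
  by case: rel => r1 r2 r3; split; rewrite -?rmorphM -?rmorphXn ?r1 ?r2 ?r3 ?rmorphB ?rmorphD !rmorphM !rmorphN /= !pint.
have [g [l1 [l2 [gu e1 e2]]]] := integral_basis_transition ibp ib'.
have ef := cubic_rel_transition relp rel' ibp gu e1 e2.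
have eh : qscale n' Q = qscale n (qact Q g).
  rewrite -h' ef hess_scale gu hess_act// h qact_scale.
  by case: (qscale n _) => *; congr BQF; rewrite /=; ring.
have nn : n' = n.
  have : qdisc (qscale n' Q) = qdisc (qscale n (qact Q g)) by rewrite eh.
  have := qdisc_act Q gu; move: dQ; rewrite /qdisc /=.
  move: (qact Q g) => P dQ eP e.
  have : n' ^+ 2 * (qb Q ^+ 2 - qa Q * qc Q *+ 4) = n ^+ 2 * (qb Q ^+ 2 - qa Q * qc Q *+ 4).
    rewrite -{2}eP; move: e; lia.
  move/(mulIf dQ)/eqP; rewrite eqrXn2 ?ltW// => /eqP //.
exists g => //; split => //.
move: eh; rewrite nn; case: (Q) (qact Q g) => a b c [a' b' c'] [/= ea eb ec].
by congr BQF; apply: (mulfI (lt0r_neq0 n0)).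
Qed.

(** * Counting lattice points in sectors *)

Section Density.
Variable R : realType.

(** limsup F(B) / B^2 <= l, and below liminf F(B) / B^2 >= l. The two sides are kept apart because
    they are added, compared and approximated through different counting arguments. *)
Definition ub (F : R -> R) (l : R) := forall e, 0 < e ->
  exists B0, forall B, B0 <= B -> F B <= (l + e) * B ^+ 2.
Definition lb (F : R -> R) (l : R) := forall e, 0 < e ->
  exists B0, forall B, B0 <= B -> (l - e) * B ^+ 2 <= F B.

Lemma ub_add F G l l' : ub F l -> ub G l' -> ub (fun B => F B + G B) (l + l').
Proof.
move=> hF hG e e0; have e2 : 0 < e / 2 by lra.
have [B1 h1] := hF _ e2; have [B2 h2] := hG _ e2.
exists (Num.max B1 B2) => B; rewrite ge_max => /andP[/h1 + /h2]; nra.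
Qed.

Lemma lb_add F G l l' : lb F l -> lb G l' -> lb (fun B => F B + G B) (l + l').
Proof.
move=> hF hG e e0; have e2 : 0 < e / 2 by lra.
have [B1 h1] := hF _ e2; have [B2 h2] := hG _ e2.
exists (Num.max B1 B2) => B; rewrite ge_max => /andP[/h1 + /h2]; nra.
Qed.

Lemma ub_opp F l : ub F l -> lb (fun B => - F B) (- l).
Proof. by move=> h e e0; have [B0 h0] := h _ e0; exists B0 => B /h0; lra. Qed.

Lemma ub_le F G l : (exists B0, forall B, B0 <= B -> F B <= G B) -> ub G l -> ub F l.
Proof.
move=> [B1 h1] h e e0; have [B2 h2] := h _ e0.
by exists (Num.max B1 B2) => B; rewrite ge_max => /andP[/h1 + /h2]; lra.
Qed.

Lemma lb_le F G l : (exists B0, forall B, B0 <= B -> G B <= F B) -> lb G l -> lb F l.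
Proof.
move=> [B1 h1] h e e0; have [B2 h2] := h _ e0.
by exists (Num.max B1 B2) => B; rewrite ge_max => /andP[/h1 + /h2]; lra.
Qed.

Lemma ub_weak F l l' : l <= l' -> ub F l -> ub F l'.
Proof.
move=> ll h e e0; have [B0 h0] := h _ e0; exists B0 => B /h0 h1.
by apply: le_trans h1 _; rewrite ler_wpM2r ?sqr_ge0//; lra.
Qed.

Lemma lb_weak F l l' : l' <= l -> lb F l -> lb F l'.
Proof.
move=> ll h e e0; have [B0 h0] := h _ e0; exists B0 => B /h0 h1.
by apply: le_trans _ h1; rewrite ler_wpM2r ?sqr_ge0//; lra.
Qed.

Lemma ub_approx F l : (forall e, 0 < e -> ub F (l + e)) -> ub F l.
Proof.
move=> h e e0; have e2 : 0 < e / 2 by lra.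
by have [B0 h0] := h _ e2 _ e2; exists B0 => B /h0; rewrite -addrA -splitr.
Qed.

Lemma lb_approx F l : (forall e, 0 < e -> lb F (l - e)) -> lb F l.
Proof.
move=> h e e0; have e2 : 0 < e / 2 by lra.
have [B0 h0] := h _ e2 _ e2; exists B0 => B /h0.
by rewrite (_ : l - e / 2 - e / 2 = l - e)//; lra.
Qed.

Lemma ub_sum (I : Type) (s : seq I) (F : I -> R -> R) l : (forall i, ub (F i) (l i)) ->
  ub (fun B => \sum_(i <- s) F i B) (\sum_(i <- s) l i).
Proof.
move=> h; elim: s => [|i s ih].
  rewrite big_nil => e e0; exists 0 => B B0; rewrite big_nil add0r.
  by rewrite mulr_ge0 ?sqr_ge0// ltW.
rewrite big_cons; have := ub_add (h i) ih; apply: ub_le.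
by exists 0 => B _; rewrite big_cons.
Qed.

Lemma lb_sum (I : Type) (s : seq I) (F : I -> R -> R) l : (forall i, lb (F i) (l i)) ->
  lb (fun B => \sum_(i <- s) F i B) (\sum_(i <- s) l i).
Proof.
move=> h; elim: s => [|i s ih].
  rewrite big_nil => e e0; exists 0 => B B0; rewrite big_nil sub0r mulNr.
  by rewrite oppr_le0 mulr_ge0 ?sqr_ge0// ltW.
rewrite big_cons; have := lb_add (h i) ih; apply: lb_le.
by exists 0 => B _; rewrite big_cons.
Qed.

Lemma ub_linear K : ub (fun B => K * B) 0.
Proof.
move=> e e0; exists (Num.max 0 (K / e)) => B; rewrite ge_max => /andP[B0 KB].
rewrite add0r expr2 mulrA ler_wpM2r//.
by move: KB; rewrite ler_pdivrMr// mulrC.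
Qed.

Lemma lb_linear K : lb (fun B => K * B) 0.
Proof.
have := ub_opp (ub_linear (- K)); rewrite oppr0; apply: lb_le.
by exists 0 => B _; rewrite mulNr opprK.
Qed.

Lemma ub_const K : ub (fun B => K) 0.
Proof.
apply: (ub_le _ (ub_linear `|K|)); exists 1 => B B1.
by apply: le_trans (ler_norm K) _; rewrite ler_peMr.
Qed.

Lemma lb_const K : lb (fun B => K) 0.
Proof.
have := ub_opp (ub_const (- K)); rewrite oppr0; apply: lb_le.
by exists 0 => B _; rewrite opprK.
Qed.

Lemma ub_sqr K : ub (fun B => K * B ^+ 2) K.
Proof. by move=> e e0; exists 0 => B _; rewrite ler_wpM2r ?sqr_ge0//; lra. Qed.

Lemma lb_sqr K : lb (fun B => K * B ^+ 2) K.
Proof. by move=> e e0; exists 0 => B _; rewrite ler_wpM2r ?sqr_ge0//; lra. Qed.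

End Density.

(** * Counting pairs of naturals in a square *)

Section Count.
Implicit Types (P : nat -> nat -> bool) (N : nat).

Definition cnt N P := (\sum_(a < N) \sum_(b < N) P a b)%N.

Lemma cnt_le N P P' : (forall a b, (a < N)%N -> (b < N)%N -> P a b -> P' a b) -> (cnt N P <= cnt N P')%N.
Proof.
move=> h; apply: leq_sum => a _; apply: leq_sum => b _.
by have := h a b (ltn_ord a) (ltn_ord b); case: (P a b) => // /(_ isT) ->.
Qed.

Lemma cnt_or N P P1 P2 : (forall a b, (a < N)%N -> (b < N)%N -> P a b -> P1 a b || P2 a b) ->
  (cnt N P <= cnt N P1 + cnt N P2)%N.
Proof.
move=> h; rewrite /cnt -big_split; apply: leq_sum => a _; rewrite -big_split; apply: leq_sum => b _ /=.
by have := h a b (ltn_ord a) (ltn_ord b); case: (P a b) => // /(_ isT)/orP[] ->; rewrite ?addn1 ?leq_addr// leq_addl.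
Qed.

Lemma cnt_bigor (I : eqType) (s : seq I) N P (F : I -> nat -> nat -> bool) :
  (forall a b, (a < N)%N -> (b < N)%N -> P a b -> exists2 i, i \in s & F i a b) ->
  (cnt N P <= \sum_(i <- s) cnt N (F i))%N.
Proof.
move=> h; rewrite /cnt [leqRHS]exchange_big; apply: leq_sum => a _ /=.
rewrite [leqRHS]exchange_big; apply: leq_sum => b _ /=.
have := h a b (ltn_ord a) (ltn_ord b); case: (P a b) => // /(_ isT)[i si hi].
by rewrite (big_rem i) //= hi.
Qed.

Lemma cnt_disj (I : eqType) (s : seq I) N P (F : I -> nat -> nat -> bool) : uniq s ->
  (forall i a b, i \in s -> (a < N)%N -> (b < N)%N -> F i a b -> P a b) ->
  (forall i j a b, i \in s -> j \in s -> F i a b -> F j a b -> i = j) ->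
  (\sum_(i <- s) cnt N (F i) <= cnt N P)%N.
Proof.
move=> us hP hd; rewrite /cnt exchange_big; apply: leq_sum => a _ /=.
rewrite exchange_big; apply: leq_sum => b _ /=.
have [/hasP[i si hi]|/hasPn hn] := boolP (has (fun i => F i a b) s).
  rewrite (big_rem i) //= hi big1_seq ?addn0; first by rewrite (hP i).
  move=> j /= sj; have js := mem_rem sj; case e: (F j a b) => //.
  have ij := hd _ _ _ _ js si e hi; by move: sj; rewrite ij mem_rem_uniq// inE eqxx.
by rewrite big1_seq// => j /= /hn; case: (F j a b).
Qed.

Lemma cnt_card N P : cnt N P = #|[pred x : 'I_N * 'I_N | P x.1 x.2]|.
Proof.
rewrite /cnt pair_big /= -sum1_card [RHS]big_mkcond /=; apply: eq_bigr => x _.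
by rewrite inE; case: (P _ _).
Qed.

Lemma cnt_inj (T : finType) N P (h : nat -> nat -> T) :
  (forall a b a' b', (a < N)%N -> (b < N)%N -> (a' < N)%N -> (b' < N)%N ->
     P a b -> P a' b' -> h a b = h a' b' -> a = a' /\ b = b') -> (cnt N P <= #|T|)%N.
Proof.
move=> inj; rewrite cnt_card -(card_in_imset (f := fun x : 'I_N * 'I_N => h x.1 x.2)) ?max_card//.
move=> [a b] [a' b']; rewrite !inE /= => p p' e.
have [ea eb] := inj _ _ _ _ (ltn_ord a) (ltn_ord b) (ltn_ord a') (ltn_ord b') p p' e.
by congr (_, _); apply: val_inj.
Qed.

End Count.

(** * Lattice points of a triangle in a residue class *)

Section Rows.
Variable R : realType.
Variables (m : nat) (m0 : (0 < m)%N).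

Definition rcount (j n : nat) := (\sum_(b < n) (b == j %[mod m]))%N.

Lemma rcountE j n : (j < m)%N -> rcount j n = ((n + (m.-1 - j)) %/ m)%N.
Proof.
move=> jm; elim: n => [|n ih].
  by rewrite /rcount big_ord0 add0n divn_small//; lia.
rewrite /rcount big_ord_recr /= -/(rcount j n) ih addSn divnS// addnC; congr (_ + _)%N.
have -> : ((n + (m.-1 - j)).+1 = n + m - j)%N by lia.
congr nat_of_bool; rewrite -(eqn_modDr (m - j)) (_ : j + (m - j) = m)%N; last by lia.
by rewrite modnn addnBA ?(ltnW jm)//.
Qed.

Lemma rcount_bound j n : (j < m)%N -> `|(rcount j n)%:R - n%:R / m%:R| <= 1 :> R.
Proof.
move=> jm; have mR : (0 : R) < m%:R by rewrite ltr0n.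
have h1 : (m * rcount j n <= n + m)%N.
  by rewrite rcountE// mulnC; apply: leq_trans (leq_divM _ _) _; lia.
have h2 : (n <= m * rcount j n + m)%N.
  have := ltn_ceil (n + (m.-1 - j)) m0; rewrite -rcountE//; lia.
have {}h1 : m%:R * (rcount j n)%:R <= n%:R + m%:R :> R by rewrite -natrM -natrD ler_nat.
have {}h2 : n%:R <= m%:R * (rcount j n)%:R + m%:R :> R by rewrite -natrM -natrD ler_nat.
have e : n%:R = (n%:R / m%:R) * m%:R :> R by rewrite divfK// gt_eqF.
rewrite ler_norml; set x := n%:R / m%:R in e *; set y := (rcount j n)%:R in h1 h2 *.
by rewrite e in h1 h2; apply/andP; split; nra.
Qed.

Definition rowcount (j N : nat) (x : R) := (\sum_(b < N) ((b%:R < x)%R && (b == j %[mod m])))%N.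

Lemma rowcount_bound j N x : (j < m)%N -> 0 <= x -> x <= N%:R ->
  `|(rowcount j N x)%:R - x / m%:R| <= 2.
Proof.
move=> jm x0 xN; have mR : (1 : R) <= m%:R by rewrite ler1n.
pose n := `|Num.ceil x|%N.
have cx : (n%:R : R) = (Num.ceil x)%:~R by rewrite natr_absz ger0_norm// ceil_ge0; lra.
have nx : x <= n%:R by rewrite cx ceil_ge.
have nx1 : n%:R < x + 1.
  by have := ceilB1_lt x; rewrite cx rmorphB /=; lra.
have nN : (n <= N)%N by rewrite -ltnS -(ltr_nat R) -natr1; lra.
have bx (b : nat) : (b%:R < x) = (b < n)%N.
  apply/idP/idP => h; first by rewrite -(ltr_nat R); lra.
  have : (b.+1%:R : R) <= n%:R by rewrite ler_nat.
  by rewrite -natr1; lra.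
have -> : rowcount j N x = rcount j n.
  rewrite /rowcount /rcount -(subnKC nN) big_split_ord /= [X in (_ + X)%N]big1 ?addn0.
    by apply: eq_bigr => b _; rewrite bx ltn_ord.
  by move=> b _; rewrite bx /= ltnNge leq_addr.
have := rcount_bound n jm; rewrite !ler_norml => /andP[h1 h2].
have : x / m%:R <= n%:R / m%:R by rewrite ler_pM2r// invr_gt0; lra.
have : n%:R / m%:R <= x / m%:R + 1.
  rewrite -lerBlDl -mulrBl ler_pdivrMr; last by lra.
  by rewrite mul1r; lra.
by move=> h3 h4; apply/andP; split; lra.
Qed.

Definition rsum (i n : nat) := (\sum_(a < n) a * (a == i %[mod m]))%N.

Lemma rsum_abel i n : (rsum i n + \sum_(k < n) rcount i k.+1 = n * rcount i n)%N.
Proof.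
elim: n => [|n ih]; first by rewrite /rsum !big_ord0.
rewrite /rsum big_ord_recr /= -/(rsum i n) big_ord_recr /=.
have e : rcount i n.+1 = (rcount i n + (n == i %[mod m]))%N by rewrite /rcount big_ord_recr.
by rewrite addnACA ih e; lia.
Qed.

Lemma rsum_bound i n : (i < m)%N -> `|(rsum i n)%:R - n%:R ^+ 2 / (2 * m%:R)| <= 3 * n%:R :> R.
Proof.
move=> im; have mR : (1 : R) <= m%:R by rewrite ler1n.
have h := rcount_bound n im.
have hs : `|(\sum_(k < n) rcount i k.+1)%:R - n%:R ^+ 2 / (2 * m%:R)| <= 2 * n%:R :> R.
  elim: n {h} => [|n ih]; first by rewrite big_ord0 expr0n /= mul0r subr0 normr0 mulr0.
  rewrite big_ord_recr /= natrD; have := rcount_bound n.+1 im; move: ih.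
  rewrite !ler_norml -(natr1 n); set u := (\sum_(k < n) _)%:R; set v := (rcount _ _)%:R.
  set x := n%:R; have e : (x + 1) ^+ 2 / (2 * m%:R) = x ^+ 2 / (2 * m%:R) + (x + 1) / m%:R - 1 / (2 * m%:R).
    by field; lra.
  rewrite e; set c : R := 1 / (2 * m%:R); have : (0 <= c) && (c <= 1).
    by rewrite divr_ge0 ?mulr_ge0// ler_pdivrMr; lra.
  by move=> /andP[? ?] /andP[? ?] /andP[? ?]; apply/andP; split; lra.
have e : (rsum i n)%:R = n%:R * (rcount i n)%:R - (\sum_(k < n) rcount i k.+1)%:R :> R.
  by rewrite -natrM -(rsum_abel i n) natrD addrK.
rewrite e; have e2 : n%:R ^+ 2 / (2 * m%:R) = n%:R * (n%:R / m%:R) - n%:R ^+ 2 / (2 * m%:R) :> R.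
  by field; lra.
have n0 : (0 : R) <= n%:R by [].
rewrite {1}e2; move: h hs; rewrite !ler_norml.
set x := n%:R / m%:R; set y := _ ^+ 2 / _; set z := (rcount i n)%:R; set w := _%:R.
set k : R := n%:R in n0 *.
by move=> /andP[h1 h2] /andP[h3 h4]; apply/andP; split; nra.
Qed.

(** Points of a residue class in a triangle of area (s2 - s1) X^2 / 2 with a vertex at the
    origin. *)
Definition tri (i j : nat) (s1 s2 X : R) (a b : nat) :=
  [&& (0 < a)%N, a%:R < X, s1 * a%:R <= b%:R, b%:R < s2 * a%:R, a == i %[mod m] & b == j %[mod m]].

Lemma dist_sub (a b x y : R) : `|a - x| <= 2 -> `|b - y| <= 2 -> `|b - a - (y - x)| <= 4.
Proof. by rewrite !ler_norml => /andP[? ?] /andP[? ?]; apply/andP; split; lra. Qed.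

Lemma tri_arith (w d X k S T : R) : 1 <= w -> 0 <= d -> 1 <= X -> X <= k -> k < X + 1 ->
  `|S - d / w * T| <= 4 * k -> `|T - k ^+ 2 / (2 * w)| <= 3 * k -> `|S - d * X ^+ 2 / (2 * w ^+ 2)| <= (100 + 100 * d) * X.
Proof.
move=> w1 d0 X1 Xk kX1; rewrite !ler_norml => /andP[h1 h2] /andP[h3 h4].
have w0 : 0 < w by lra.
have [c0 c1] : 0 <= d / w /\ d / w <= d by split; [rewrite divr_ge0// ltW|rewrite ler_pdivrMr// ler_peMr].
have [y0 y1] : 0 <= (k ^+ 2 - X ^+ 2) / (2 * w) /\ (k ^+ 2 - X ^+ 2) / (2 * w) <= 2 * X.
  have h : 0 <= k ^+ 2 - X ^+ 2 <= 3 * X by rewrite subr_ge0; apply/andP; split; nra.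
  split; first by rewrite divr_ge0//; lra.
  by rewrite ler_pdivrMr ?mulr_gt0//; nra.
have -> : d * X ^+ 2 / (2 * w ^+ 2) = d / w * (k ^+ 2 / (2 * w)) - d / w * ((k ^+ 2 - X ^+ 2) / (2 * w)).
  by field; rewrite gt_eqF.
move: c0 c1 y0 y1 h1 h2 h3 h4; set c := d / w; set y := (k ^+ 2 - X ^+ 2) / _; set z := k ^+ 2 / _.
move=> c0 c1 y0 y1 h1 h2 h3 h4.
have q4 : c * y <= d * (2 * X) by apply: ler_pM.
have q3 : 0 <= c * y by apply: mulr_ge0.
have hT : T - z <= 6 * X by lra.
have hT' : - (6 * X) <= T - z by lra.
have cX : c * (6 * X) <= d * (6 * X) by rewrite ler_wpM2r//; lra.
have := ler_wpM2l c0 hT; have := ler_wpM2l c0 hT'.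
rewrite mulrN mulrBr => q1 q2.
have D0 : 0 <= d * X by rewrite mulr_ge0//; lra.
rewrite (_ : d * (6 * X) = 6 * (d * X)) in cX; last by ring.
rewrite (_ : d * (2 * X) = 2 * (d * X)) in q4; last by ring.
rewrite (_ : (100 + _) * X = 100 * X + 100 * (d * X)); last by ring.
move: (c * T) (c * z) (c * y) (c * (6 * X)) (d * X) D0 cX q1 q2 q3 q4 h1 h2 => cT cz cy cX D.
by clear -X1 Xk kX1; move=> *; apply/andP; split; lra.
Qed.

(** The row of abscissa a holds (s2 - s1) a / m points up to a bounded error, and the sum of the a <
    X in a class modulo m is X^2 / 2m up to O(X). The constants are generous. *)
Lemma tri_bound i j s1 s2 : (i < m)%N -> (j < m)%N -> 0 < s1 -> s1 <= s2 ->
  exists K, forall (X : R) (N : nat), 1 <= X -> X <= N%:R -> s2 * X <= N%:R ->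
   `|(cnt N (tri i j s1 s2 X))%:R - (s2 - s1) * X ^+ 2 / (2 * m%:R ^+ 2)| <= K * X.
Proof.
move=> im jm s10 s12; have mR : (1 : R) <= m%:R by rewrite ler1n.
exists (100 + 100 * (s2 - s1)) => X N X1 XN sXN.
pose n := `|Num.ceil X|%N.
have cx : (n%:R : R) = (Num.ceil X)%:~R by rewrite natr_absz ger0_norm// ceil_ge0; lra.
have nx : X <= n%:R by rewrite cx ceil_ge.
have nx1 : n%:R < X + 1.
  by have := ceilB1_lt X; rewrite cx rmorphB /=; lra.
have nN : (n <= N)%N by rewrite -ltnS -(ltr_nat R) -natr1; lra.
have bx (b : nat) : (b%:R < X) = (b < n)%N.
  apply/idP/idP => h; first by rewrite -(ltr_nat R); lra.
  have : (b.+1%:R : R) <= n%:R by rewrite ler_nat.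
  by rewrite -natr1; lra.
pose row (a : nat) : nat := (\sum_(b < N) [&& (s1 * a%:R <= b%:R)%R, (b%:R < s2 * a%:R)%R & b == j %[mod m]])%N.
have rowE (a : nat) : (row a + rowcount j N (s1 * a%:R) = rowcount j N (s2 * a%:R))%N.
  rewrite /row /rowcount -big_split; apply: eq_bigr => b _ /=.
  have [h|h] := leP (s1 * a%:R) b%:R; first by rewrite /= addn0.
  have -> : b%:R < s2 * a%:R by apply: lt_le_trans h _; rewrite ler_wpM2r.
  by [].
have row_bound (a : nat) : (a < n)%N -> `|(row a)%:R - (s2 - s1) * a%:R / m%:R| <= 4.
  move=> an; have aX : a%:R < X by rewrite bx.
  have a0 : (0 : R) <= a%:R by [].
  have a1 : s1 * a%:R <= s2 * a%:R by rewrite ler_wpM2r.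
  have a2 : s2 * a%:R <= N%:R.
    by apply: le_trans sXN; rewrite ler_wpM2l ?(ltW aX)//; exact: le_trans (ltW s10) s12.
  have a3 : 0 <= s1 * a%:R by rewrite mulr_ge0// ltW.
  have e : (row a)%:R = (rowcount j N (s2 * a%:R))%:R - (rowcount j N (s1 * a%:R))%:R :> R.
    by rewrite -rowE natrD addrK.
  rewrite e (_ : (s2 - s1) * a%:R / m%:R = s2 * a%:R / m%:R - s1 * a%:R / m%:R); last by rewrite -!mulrBl.
  exact: dist_sub (rowcount_bound jm a3 (le_trans a1 a2)) (rowcount_bound jm (le_trans a3 a1) a2).
have row0 : row 0%N = 0%N.
  by rewrite /row big1// => b _; rewrite mulr0n !mulr0; case: (ltP (b%:R : R) 0).
have cntE : cnt N (tri i j s1 s2 X) = (\sum_(a < n) row a * (a == i %[mod m]))%N.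
  rewrite /cnt -(subnKC nN) big_split_ord /= [X in (_ + X)%N]big1 ?addn0; last first.
    by move=> a _; rewrite big1// => b _; rewrite /tri bx [(n + _ < n)%N]ltnNge leq_addr /= andbF.
  rewrite subnKC//; apply: eq_bigr => a _; rewrite /tri bx ltn_ord.
  case: (posnP a) => [->|a0]; first by rewrite row0 mul0n big1.
  case: eqP => [_|_] /=; last by rewrite muln0 big1// => b _; rewrite !andbF.
  by rewrite muln1; apply: eq_bigr => b _.
rewrite cntE natr_sum.
have h1 : `|\sum_(a < n) ((row a * (a == i %[mod m]))%N%:R - (s2 - s1) / m%:R * (a * (a == i %[mod m]))%N%:R)| <= 4 * n%:R :> R.
  apply: le_trans (ler_norm_sum _ _ _) _.
  apply: (@le_trans _ _ (\sum_(a < n) (4 : R))); last by rewrite sumr_const card_ord mulr_natr.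
  apply: ler_sum => a _; case: (_ == _ %[mod m]); rewrite ?muln1 ?muln0 ?mulr0 ?subrr ?normr0//.
  by have := row_bound a (ltn_ord a); rewrite mulrAC.
rewrite sumrB -mulr_sumr -!natr_sum -/(rsum i n) in h1.
have h2 := rsum_bound n im.
by rewrite -natr_sum; apply: (tri_arith mR _ X1 nx nx1 h1 h2); rewrite subr_ge0.
Qed.

End Rows.

(** With a = e^(3 t1) and b = e^(3 t2), the right-hand side is the area over B^2 m^2 of the triangle
    containing a thin sector; the next lemma treats the triangle contained in it. *)
Lemma thin_value_exp (R : realType) (k d m a b : R) : 0 < k -> 0 < d -> 0 < m -> 0 < b -> 0 < a ->
  (2 * k * d * m ^+ 2)^-1 * (b / a - 1) =
  d * (b - a) / ((1 + a) * (1 + b)) / (2 * m ^+ 2) / (k * (d * (a / (1 + a))) * (d / (1 + b))).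
Proof. by move=> *; field; do !(apply/andP; split); lra. Qed.

Lemma thin_value_expN (R : realType) (k d m a b : R) : 0 < k -> 0 < d -> 0 < m -> 0 < b -> 0 < a ->
  (2 * k * d * m ^+ 2)^-1 * (1 - a / b) =
  d * (b - a) / ((1 + a) * (1 + b)) / (2 * m ^+ 2) / (k * (d * (b / (1 + b))) * (d / (1 + a))).
Proof. by move=> *; field; do !(apply/andP; split); lra. Qed.

Lemma inner_le (R : realType) (s1 s2 u v a b : R) : s1 <= u -> v <= s2 -> 0 < a -> u * a <= b -> b < v * a ->
  (u - s1) * a * ((s2 - v) * a) <= (b - s1 * a) * (s2 * a - b).
Proof. by move=> *; apply: ler_pM; rewrite ?mulr_ge0 ?subr_ge0 ?mulrBl//; lra. Qed.

Lemma outer_le (R : realType) (s1 s2 u v a b : R) : s1 < u -> v < s2 -> 0 < a -> u * a <= b -> b < v * a ->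
  (b - s1 * a) * (s2 * a - b) <= (v - s1) * a * ((s2 - u) * a).
Proof.
move=> su vs a0 ub bv; have h1 : s1 * a < u * a by rewrite ltr_pM2r.
have h2 : v * a < s2 * a by rewrite ltr_pM2r.
by apply: ler_pM; rewrite ?mulrBl; lra.
Qed.

(** * Lattice points of sectors bounded by a level of n *)

Section Sector.
Variable R : realType.
Variables (s1 s2 k T1 T2 : R).
Hypotheses (s10 : 0 < s1) (s12 : s1 < s2) (k0 : 0 < k) (T12 : T1 <= T2).

Ltac hs := pose proof s10; pose proof s12; pose proof k0; pose proof T12.

(** For the values [slo], [shi] and [kQ] of s1, s2 and k, this is the n in Hess(f) = n Q for the
    apolar form f with leading coefficients a, b. *)
Definition nform (a b : nat) : R := k * (b%:R - s1 * a%:R) * (s2 * a%:R - b%:R).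
(* b = slope t * a if and only if e^(3t) = (b - s1 a) / (s2 a - b). *)
Definition slope (t : R) := (s1 + s2 * expR (3 * t)) / (1 + expR (3 * t)).

Lemma slope_bounds t : s1 < slope t < s2.
Proof.
hs.
have e0 := expR_gt0 (3 * t); rewrite /slope ltr_pdivlMr ?ltr_pdivrMr; try lra.
by apply/andP; split; nra.
Qed.

Lemma slope_sub1 t : slope t - s1 = (s2 - s1) * (expR (3 * t) / (1 + expR (3 * t))).
Proof.
hs; have e0 := expR_gt0 (3 * t); rewrite /slope; field; lra. Qed.

Lemma slope_sub2 t : s2 - slope t = (s2 - s1) / (1 + expR (3 * t)).
Proof.
hs; have e0 := expR_gt0 (3 * t); rewrite /slope; field; lra. Qed.

Lemma slope_le t u : (slope t <= slope u) = (t <= u).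
Proof.
hs.
have e0 := expR_gt0 (3 * t); have e1 := expR_gt0 (3 * u).
have -> : (slope t <= slope u) = (expR (3 * t) <= expR (3 * u)).
  rewrite /slope ler_pdivrMr; last lra.
  rewrite mulrAC ler_pdivlMr; last lra.
  by apply/idP/idP; nra.
by rewrite ler_expR ler_pM2l.
Qed.

(** Lower bound of [nform a b] / a^2 between the slopes at T1 and T2. Hence a < B / sqrt(phi0) on
    the region, and a box of side proportional to B contains it. *)
Definition phi0 := k * (slope T1 - s1) * (s2 - slope T2).

Lemma phi0_gt0 : 0 < phi0.
Proof.
hs.
have /andP[? ?] := slope_bounds T1; have /andP[? ?] := slope_bounds T2.
by rewrite /phi0 !mulr_gt0// subr_gt0.
Qed.

Definition boxC := (1 + s2) * (1 + (Num.sqrt phi0)^-1).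
Definition box (B : R) : nat := (Num.trunc (boxC * B)).+1.

Lemma box_ge B : boxC * B <= (box B)%:R.
Proof. by rewrite /box -natr1; apply: ltW; rewrite natr1 truncnS_gt. Qed.

Definition inI (t1 t2 : R) (a b : nat) := (slope t1 * a%:R <= b%:R) && (b%:R < slope t2 * a%:R).
Definition region (t1 t2 B : R) (a b : nat) := [&& (0 < a)%N, inI t1 t2 a b & nform a b < B ^+ 2].

Lemma phimin_ge t1 t2 : T1 <= t1 -> t2 <= T2 ->
  phi0 <= k * (slope t1 - s1) * (s2 - slope t2).
Proof.
hs.
move=> h1 h2; have /andP[? ?] := slope_bounds T1; have /andP[? ?] := slope_bounds T2.
have /andP[? ?] := slope_bounds t1; have /andP[? ?] := slope_bounds t2.
have h3 : slope T1 <= slope t1 by rewrite slope_le.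
have h4 : slope t2 <= slope T2 by rewrite slope_le.
rewrite /phi0 -!mulrA ler_pM2l//; apply: ler_pM; lra.
Qed.

Lemma region_small t1 t2 B a b : T1 <= t1 -> t2 <= T2 -> 0 < B -> region t1 t2 B a b ->
  a%:R < B / Num.sqrt phi0 /\ b%:R < s2 * (B / Num.sqrt phi0).
Proof.
hs.
move=> h1 h2 B0 /and3P[a0 /andP[b1 b2] nB].
have aR : (0 : R) < a%:R by rewrite ltr0n.
have /andP[? ?] := slope_bounds t1; have /andP[? ?] := slope_bounds t2.
have sp : 0 < Num.sqrt phi0 by rewrite sqrtr_gt0 phi0_gt0.
have aX : a%:R < B / Num.sqrt phi0.
  rewrite ltr_pdivlMr// -(ltr_pXn2r (n := 2)) ?nnegrE ?mulr_ge0 ?ltW// exprMn sqr_sqrtr ?ltW ?phi0_gt0//.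
  apply: le_lt_trans nB.
  apply: (@le_trans _ _ (a%:R ^+ 2 * (k * (slope t1 - s1) * (s2 - slope t2)))).
    by rewrite ler_pM2l ?exprn_gt0// phimin_ge.
  rewrite /nform; rewrite [leLHS](_ : _ = k * ((slope t1 - s1) * a%:R * ((s2 - slope t2) * a%:R))); last by ring.
  rewrite -[leRHS]mulrA ler_pM2l//; apply: inner_le => //; exact: ltW.
by split => //; nra.
Qed.

Lemma box_bound B : 0 < B -> [/\ 0 <= B / Num.sqrt phi0, B / Num.sqrt phi0 <= (box B)%:R &
  s2 * (B / Num.sqrt phi0) <= (box B)%:R].
Proof.
hs; move=> B0; have sp : 0 < Num.sqrt phi0 by rewrite sqrtr_gt0 phi0_gt0.
have y0 : 0 <= B / Num.sqrt phi0 by rewrite divr_ge0 ?ltW.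
have hN := box_ge B; rewrite /boxC in hN.
have {}hN : (1 + s2) * (B + B / Num.sqrt phi0) <= (box B)%:R.
  by apply: le_trans hN; rewrite le_eqVlt; apply/orP; left; apply/eqP; ring.
have : 0 <= s2 * B by rewrite mulr_ge0; lra.
have : 0 <= s2 * (B / Num.sqrt phi0) by rewrite mulr_ge0; lra.
by move: y0 hN; move: (B / _) => y ? ? ? ?; split => //; lra.
Qed.

Lemma box_region t1 t2 B a b : T1 <= t1 -> t2 <= T2 -> 0 < B -> region t1 t2 B a b ->
  (a < box B)%N /\ (b < box B)%N.
Proof.
move=> h1 h2 B0 /(region_small h1 h2 B0)[aX bX]; have [_ b1 b2] := box_bound B0.
by split; rewrite -(ltr_nat R); [exact: lt_le_trans b1|exact: lt_le_trans b2].
Qed.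

Section Residue.
Variables (m i j : nat).
Hypotheses (m0 : (0 < m)%N) (im : (i < m)%N) (jm : (j < m)%N).

Definition cls (a b : nat) := (a == i %[mod m]) && (b == j %[mod m]).
Definition cK : R := (2 * k * (s2 - s1) * m%:R ^+ 2)^-1.

Lemma cK_ge0 : 0 <= cK.
Proof.
hs. rewrite invr_ge0 !mulr_ge0 ?exprn_ge0//; lra. Qed.

(** On the sector n is at least f a^2, where f combines the smallest values of the two linear
    factors, so the region lies in the triangle a < B / sqrt(f). The resulting density has the
    correct first order 3 (t2 - t1). *)
Lemma thin_ub t1 t2 : T1 <= t1 -> t1 <= t2 -> t2 <= T2 ->
  ub (fun B => (cnt (box B) (fun a b => cls a b && region t1 t2 B a b))%:R)
     (cK * (expR (3 * (t2 - t1)) - 1)).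
Proof.
hs.
move=> h1 h12 h2.
have mR : (1 : R) <= m%:R by rewrite ler1n.
have /andP[a1 a2] := slope_bounds t1; have /andP[a3 a4] := slope_bounds t2.
have s12' : slope t1 <= slope t2 by rewrite slope_le.
have S0 : 0 < slope t1 by lra.
have [K hK] := @tri_bound R m m0 i j _ _ im jm S0 s12'.
pose f := k * (slope t1 - s1) * (s2 - slope t2).
have f0 : 0 < f by rewrite !mulr_gt0// subr_gt0.
have sf : 0 < Num.sqrt f by rewrite sqrtr_gt0.
have fp : phi0 <= f by exact: phimin_ge.
have sp : 0 < Num.sqrt phi0 by rewrite sqrtr_gt0 phi0_gt0.
have sfp : (Num.sqrt f)^-1 <= (Num.sqrt phi0)^-1 by rewrite lef_pV2 ?posrE// ler_wsqrtr.
have -> : cK * (expR (3 * (t2 - t1)) - 1) = (slope t2 - slope t1) / (2 * m%:R ^+ 2) / f + 0.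
  rewrite addr0 /f slope_sub1 slope_sub2.
  have -> : slope t2 - slope t1 = (s2 - s1) * (expR (3 * t2) - expR (3 * t1)) / ((1 + expR (3 * t1)) * (1 + expR (3 * t2))).
    rewrite /slope; have := expR_gt0 (3 * t1); have := expR_gt0 (3 * t2) => ? ?; field.
    by apply/andP; split; lra.
  have -> : expR (3 * (t2 - t1)) = expR (3 * t2) / expR (3 * t1) by rewrite mulrBr expRB.
  have := expR_gt0 (3 * t1); have := expR_gt0 (3 * t2); set e1 := expR _; set e2 := expR _ => ? ?.
  by rewrite /cK; apply: thin_value_exp; rewrite ?subr_gt0 ?ltr0n.
apply: (ub_le _ (ub_add (@ub_sqr R _) (@ub_linear R (K / Num.sqrt f)))).
exists (Num.max 1 (Num.sqrt f)) => B; rewrite ge_max => /andP[B1 Bf].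
have B0 : 0 < B by lra.
pose X := B / Num.sqrt f.
have X1 : 1 <= X by rewrite ler_pdivlMr// mul1r.
have X2 : X ^+ 2 = B ^+ 2 / f by rewrite expr_div_n sqr_sqrtr// ltW.
have XN : X <= B / Num.sqrt phi0 by rewrite ler_pM2l.
have [y0 bb1 bb2] := box_bound B0.
have XN1 : X <= (box B)%:R by exact: le_trans bb1.
have XN2 : slope t2 * X <= (box B)%:R.
  by apply: le_trans bb2; apply: ler_pM => //; lra.
have := hK X (box B) X1 XN1 XN2; rewrite ler_norml => /andP[_ hc].
apply: (@le_trans _ _ (cnt (box B) (tri m i j (slope t1) (slope t2) X))%:R).
  rewrite ler_nat; apply: cnt_le => a b _ _ /andP[/andP[ca cb] /and3P[a0 /andP[b1 b2] nB]].
  rewrite /tri a0 b1 b2 ca cb !andbT /=.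
  have aR : (0 : R) < a%:R by rewrite ltr0n.
  rewrite ltr_pdivlMr// -(ltr_pXn2r (n := 2)) ?nnegrE ?mulr_ge0 ?ltW// exprMn sqr_sqrtr ?ltW//.
  apply: le_lt_trans nB.
  rewrite /nform [leLHS](_ : _ = k * ((slope t1 - s1) * a%:R * ((s2 - slope t2) * a%:R))); last by rewrite /f; ring.
  rewrite -[leRHS]mulrA ler_pM2l//; apply: ler_pM; nra.
move: hc; rewrite lerBlDl => /le_trans; apply; rewrite X2 /X.
by rewrite le_eqVlt; apply/orP; left; apply/eqP; field; rewrite !gt_eqF// ltr0n.
Qed.

(** The largest values of the two linear factors give n < f a^2, so the region contains a triangle
    with the same first order density. *)
Lemma thin_lb t1 t2 : T1 <= t1 -> t1 <= t2 -> t2 <= T2 ->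
  lb (fun B => (cnt (box B) (fun a b => cls a b && region t1 t2 B a b))%:R)
     (cK * (1 - expR (- (3 * (t2 - t1))))).
Proof.
hs.
move=> h1 h12 h2.
have mR : (1 : R) <= m%:R by rewrite ler1n.
have /andP[a1 a2] := slope_bounds t1; have /andP[a3 a4] := slope_bounds t2.
have s12' : slope t1 <= slope t2 by rewrite slope_le.
have S0 : 0 < slope t1 by lra.
have [K hK] := @tri_bound R m m0 i j _ _ im jm S0 s12'.
pose f := k * (slope t2 - s1) * (s2 - slope t1).
have f0 : 0 < f by rewrite !mulr_gt0// subr_gt0.
have sf : 0 < Num.sqrt f by rewrite sqrtr_gt0.
have fp : phi0 <= f.
  apply: le_trans (phimin_ge h1 h2) _; rewrite /f -!mulrA ler_pM2l//; apply: ler_pM; lra.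
have sp : 0 < Num.sqrt phi0 by rewrite sqrtr_gt0 phi0_gt0.
have sfp : (Num.sqrt f)^-1 <= (Num.sqrt phi0)^-1 by rewrite lef_pV2 ?posrE// ler_wsqrtr.
have -> : cK * (1 - expR (- (3 * (t2 - t1)))) = (slope t2 - slope t1) / (2 * m%:R ^+ 2) / f + 0.
  rewrite addr0 /f slope_sub1 slope_sub2.
  have -> : slope t2 - slope t1 = (s2 - s1) * (expR (3 * t2) - expR (3 * t1)) / ((1 + expR (3 * t1)) * (1 + expR (3 * t2))).
    rewrite /slope; have := expR_gt0 (3 * t1); have := expR_gt0 (3 * t2) => ? ?; field.
    by apply/andP; split; lra.
  have -> : expR (- (3 * (t2 - t1))) = expR (3 * t1) / expR (3 * t2) by rewrite -expRB; congr expR; ring.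
  have := expR_gt0 (3 * t1); have := expR_gt0 (3 * t2); set e1 := expR _; set e2 := expR _ => ? ?.
  by rewrite /cK; apply: thin_value_expN; rewrite ?subr_gt0 ?ltr0n.
apply: (lb_le _ (lb_add (@lb_sqr R _) (@lb_linear R (- K / Num.sqrt f)))).
exists (Num.max 1 (Num.sqrt f)) => B; rewrite ge_max => /andP[B1 Bf].
have B0 : 0 < B by lra.
pose X := B / Num.sqrt f.
have X1 : 1 <= X by rewrite ler_pdivlMr// mul1r.
have X2 : X ^+ 2 = B ^+ 2 / f by rewrite expr_div_n sqr_sqrtr// ltW.
have XN : X <= B / Num.sqrt phi0 by rewrite ler_pM2l.
have [y0 bb1 bb2] := box_bound B0.
have XN1 : X <= (box B)%:R by exact: le_trans bb1.
have XN2 : slope t2 * X <= (box B)%:R.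
  by apply: le_trans bb2; apply: ler_pM => //; lra.
have := hK X (box B) X1 XN1 XN2; rewrite ler_norml => /andP[hc _].
apply: (@le_trans _ _ (cnt (box B) (tri m i j (slope t1) (slope t2) X))%:R); last first.
  rewrite ler_nat; apply: cnt_le => a b _ _ /and5P[a0 aX b1 b2 /andP[ca cb]].
  rewrite /cls ca cb /region /inI a0 b1 b2 /=.
  have aR : (0 : R) < a%:R by rewrite ltr0n.
  have aX2 : a%:R ^+ 2 * f < B ^+ 2.
    rewrite -ltr_pdivlMr// -X2 ltr_pXn2r ?nnegrE//; lra.
  apply: le_lt_trans aX2.
  rewrite /nform [leRHS](_ : _ = k * ((slope t2 - s1) * a%:R * ((s2 - slope t1) * a%:R))); last by rewrite /f; ring.
  rewrite -[leLHS]mulrA ler_pM2l//; exact: outer_le.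
move: hc; rewrite lerBrDr => /(le_trans _); apply; rewrite X2 /X.
by rewrite le_eqVlt; apply/orP; left; apply/eqP; field; rewrite !gt_eqF// ltr0n.
Qed.

Definition tpart (t1 t2 : R) (n l : nat) := t1 + l%:R * ((t2 - t1) / n%:R).

Lemma tpart_step t1 t2 n l : tpart t1 t2 n l.+1 - tpart t1 t2 n l = (t2 - t1) / n%:R.
Proof. by rewrite /tpart -natr1; ring. Qed.

Lemma tpart_le t1 t2 n l l' : t1 <= t2 -> (l <= l')%N -> tpart t1 t2 n l <= tpart t1 t2 n l'.
Proof.
by move=> h ll; rewrite lerD2l ler_wpM2r ?ler_nat// divr_ge0// subr_ge0.
Qed.

Lemma tpart0 t1 t2 n : tpart t1 t2 n 0 = t1.
Proof. by rewrite /tpart mul0r addr0. Qed.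

Lemma tpartn t1 t2 n : (0 < n)%N -> tpart t1 t2 n n = t2.
Proof. by move=> n0; rewrite /tpart; field; rewrite pnatr_eq0 -lt0n. Qed.

Lemma tpart_find t1 t2 n (s : R) : (0 < n)%N -> slope t1 <= s -> s < slope t2 ->
  exists2 l, (l < n)%N & slope (tpart t1 t2 n l) <= s < slope (tpart t1 t2 n l.+1).
Proof.
move=> n0 h1 h2; have ex : exists l, s < slope (tpart t1 t2 n l) by exists n; rewrite tpartn.
case: (ex_minnP ex) => l hl hmin.
case: l hl hmin => [|l] hl hmin; first by move: hl; rewrite tpart0 ltNge h1.
exists l; first by have := hmin n; rewrite tpartn// => /(_ h2); lia.
rewrite hl andbT leNgt; apply/negP => /hmin; lia.
Qed.

Lemma tpart_bounds t1 t2 n l : t1 <= t2 -> (l < n)%N -> t1 <= tpart t1 t2 n l /\ tpart t1 t2 n l.+1 <= t2.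
Proof.
move=> h ln; have n0 : (0 < n)%N by lia.
by split; [rewrite -[leLHS](tpart0 t1 t2 n)|rewrite -[leRHS](tpartn t1 t2 n0)]; exact: tpart_le.
Qed.

(** Cutting the sector into n thin ones replaces e^L - 1 by n (e^(L/n) - 1), which tends to L. *)
Lemma sector_ub t1 t2 : T1 <= t1 -> t1 <= t2 -> t2 <= T2 ->
  ub (fun B => (cnt (box B) (fun a b => cls a b && region t1 t2 B a b))%:R) (cK * (3 * (t2 - t1))).
Proof.
move=> h1 h12 h2; apply: ub_approx => e e0.
set L := 3 * (t2 - t1); have L0 : 0 <= L by rewrite mulr_ge0// subr_ge0.
have cK0 := cK_ge0.
(* Large enough for L/n <= 1/2 and for 2 cK L^2 / n <= e, the two inequalities needed for the second
   order error. *)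
pose n := (Num.trunc (2 * L + 2 * cK * L ^+ 2 / e)).+1.
have nR : 2 * L + 2 * cK * L ^+ 2 / e < n%:R by rewrite truncnS_gt.
have n1 : (1 : R) <= n%:R by rewrite ler1n.
have q0 : 0 <= 2 * cK * L ^+ 2 / e.
  by have := mulr_ge0 cK0 (sqr_ge0 L) => ?; apply: divr_ge0; lra.
set x := L / n%:R.
have x0 : 0 <= x by rewrite divr_ge0//; lra.
have x1 : x <= 1 / 2 by rewrite ler_pdivrMr; lra.
have ex : expR x - 1 <= x + 2 * x ^+ 2.
  have := expR_ge1Dx (- x); rewrite expRN => h; have ep := expR_gt0 x.
  have : expR x * (1 - x) <= 1 by rewrite -ler_pdivlMl// mulr1; lra.
  by nra.
have main : ub (fun B => \sum_(l < n) (cnt (box B) (fun a b => cls a b && region (tpart t1 t2 n l) (tpart t1 t2 n l.+1) B a b))%:R)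
   (\sum_(l < n) (cK * (expR x - 1))).
  apply: ub_sum => l; have [b1 b2] := tpart_bounds h12 (ltn_ord l).
  have := @thin_ub (tpart t1 t2 n l) (tpart t1 t2 n l.+1) (le_trans h1 b1) (tpart_le _ h12 (leqnSn l)) (le_trans b2 h2).
  by rewrite tpart_step (_ : 3 * _ = x)// /x /L; ring.
apply: (ub_weak _ (ub_le _ main)).
  rewrite sumr_const card_ord -mulr_natl.
  have hx : n%:R * x = L by rewrite /x; field; lra.
  have hx2 : n%:R * x ^+ 2 * n%:R = L ^+ 2 by rewrite -hx; ring.
  have : cK * (n%:R * (expR x - 1)) <= cK * (L + 2 * (n%:R * x ^+ 2)).
    rewrite ler_wpM2l// -hx; nra.
  have : 2 * cK * (n%:R * x ^+ 2) <= e.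
    have : 2 * cK * L ^+ 2 <= e * n%:R by rewrite [e * _]mulrC -ler_pdivrMr//; lra.
    rewrite -hx2; rewrite [_ * (_ * n%:R)]mulrA ler_pM2r; lra.
  by rewrite (_ : n%:R * (cK * _) = cK * (n%:R * (expR x - 1))); [nra|ring].
exists 1 => B B1; rewrite -natr_sum ler_nat.
apply: (@cnt_bigor _ (index_enum 'I_n)) => a b _ _ /andP[cab /and3P[a0 /andP[c1 c2] nB]].
have aR : (0 : R) < a%:R by rewrite ltr0n.
have n0 : (0 < n)%N by [].
have [l ln /andP[d1 d2]] := @tpart_find t1 t2 n (b%:R / a%:R) n0 ltac:(by rewrite ler_pdivlMr) ltac:(by rewrite ltr_pdivrMr).
exists (Ordinal ln); first by rewrite mem_index_enum.
by rewrite cab /region /inI a0 nB andbT /= -ler_pdivlMr// -ltr_pdivrMr// d1 d2.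
Qed.

Lemma sector_lb t1 t2 : T1 <= t1 -> t1 <= t2 -> t2 <= T2 ->
  lb (fun B => (cnt (box B) (fun a b => cls a b && region t1 t2 B a b))%:R) (cK * (3 * (t2 - t1))).
Proof.
move=> h1 h12 h2; apply: lb_approx => e e0.
set L := 3 * (t2 - t1); have L0 : 0 <= L by rewrite mulr_ge0// subr_ge0.
have cK0 := cK_ge0.
pose n := (Num.trunc (cK * L ^+ 2 / e)).+1.
have nR : cK * L ^+ 2 / e < n%:R by rewrite truncnS_gt.
have n1 : (1 : R) <= n%:R by rewrite ler1n.
set x := L / n%:R.
have x0 : 0 <= x by rewrite divr_ge0//; lra.
have ex : x - x ^+ 2 <= 1 - expR (- x).
  have := expR_ge1Dx x => h; have ep := expR_gt0 x; rewrite expRN.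
  have : (expR x)^-1 <= (1 + x)^-1 by rewrite lef_pV2 ?posrE//; lra.
  have : (1 + x)^-1 <= 1 - x + x ^+ 2 by rewrite -[_^-1]mul1r ler_pdivrMr; nra.
  by lra.
have main : lb (fun B => \sum_(l < n) (cnt (box B) (fun a b => cls a b && region (tpart t1 t2 n l) (tpart t1 t2 n l.+1) B a b))%:R)
   (\sum_(l < n) (cK * (1 - expR (- x)))).
  apply: lb_sum => l; have [b1 b2] := tpart_bounds h12 (ltn_ord l).
  have := @thin_lb (tpart t1 t2 n l) (tpart t1 t2 n l.+1) (le_trans h1 b1) (tpart_le _ h12 (leqnSn l)) (le_trans b2 h2).
  by rewrite tpart_step (_ : 3 * _ = x)// /x /L; ring.
apply: (lb_weak _ (lb_le _ main)).
  rewrite sumr_const card_ord -mulr_natl.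
  have hx : n%:R * x = L by rewrite /x; field; lra.
  have hx2 : n%:R * x ^+ 2 * n%:R = L ^+ 2 by rewrite -hx; ring.
  have : cK * (L - (n%:R * x ^+ 2)) <= cK * (n%:R * (1 - expR (- x))).
    rewrite ler_wpM2l// -hx; nra.
  have : cK * (n%:R * x ^+ 2) <= e.
    have : cK * L ^+ 2 <= e * n%:R by rewrite [e * _]mulrC -ler_pdivrMr//; lra.
    rewrite -hx2; rewrite [_ * (_ * n%:R)]mulrA ler_pM2r; lra.
  by rewrite (_ : n%:R * (cK * _) = cK * (n%:R * (1 - expR (- x)))); [nra|ring].
exists 1 => B B1; rewrite -natr_sum ler_nat.
apply: (@cnt_disj _ (index_enum 'I_n)); first exact: index_enum_uniq.
  move=> l a b _ _ _ /andP[-> /and3P[a0 /andP[c1 c2] nB]].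
  have [b1 b2] := tpart_bounds h12 (ltn_ord l).
  have aR : (0 : R) < a%:R by rewrite ltr0n.
  rewrite /region /inI a0 nB andbT /=; apply/andP; split.
    by apply: le_trans c1; rewrite ler_pM2r// slope_le.
  by apply: lt_le_trans c2 _; rewrite ler_pM2r// slope_le.
move=> l l' a b _ _ /andP[_ /and3P[a0 /andP[c1 c2] _]] /andP[_ /and3P[_ /andP[c3 c4] _]].
have aR : (0 : R) < a%:R by rewrite ltr0n.
apply/val_inj; case: (ltngtP l l') => //= ll; exfalso.
  have : slope (tpart t1 t2 n l.+1) <= slope (tpart t1 t2 n l') by rewrite slope_le tpart_le.
  by rewrite -(ler_pM2r aR); lra.
have : slope (tpart t1 t2 n l'.+1) <= slope (tpart t1 t2 n l) by rewrite slope_le tpart_le.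
by rewrite -(ler_pM2r aR); lra.
Qed.

End Residue.

Definition periodic (m : nat) (g : nat -> nat -> bool) := forall a b, g a b = g (a %% m)%N (b %% m)%N.
(** Area of the part of the cone where n < 1, per unit of t. *)
Definition kappa : R := 3 / (2 * k * (s2 - s1)).

Lemma kappa_gt0 : 0 < kappa.
Proof. hs; rewrite /kappa divr_gt0 ?mulr_gt0//; lra. Qed.

Definition dens (m : nat) (g : nat -> nat -> bool) : R :=
  #|[pred x : 'I_m * 'I_m | g x.1 x.2]|%:R / m%:R ^+ 2.

Lemma region_ub m g t1 t2 : (0 < m)%N -> periodic m g -> T1 <= t1 -> t1 <= t2 -> t2 <= T2 ->
  ub (fun B => (cnt (box B) (fun a b => g a b && region t1 t2 B a b))%:R) (kappa * dens m g * (t2 - t1)).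
Proof.
move=> m0 pg h1 h12 h2.
have mR : (1 : R) <= m%:R by rewrite ler1n.
pose s := enum [pred x : 'I_m * 'I_m | g x.1 x.2].
have main := @ub_sum R _ s _ _ (fun x : 'I_m * 'I_m => sector_ub m0 (ltn_ord x.1) (ltn_ord x.2) h1 h12 h2).
have e : \sum_(x <- s) (cK m * (3 * (t2 - t1))) = kappa * dens m g * (t2 - t1).
  rewrite big_const_seq count_predT -cardE iter_addr_0 -mulr_natl /kappa /dens /cK.
  by hs; field; apply/andP; split; lra.
rewrite e in main; apply: ub_le main; exists 0 => B _; rewrite -natr_sum ler_nat.
apply: cnt_bigor => a b _ _ /andP[gab ->].
exists (Ordinal (ltn_pmod a m0), Ordinal (ltn_pmod b m0)).
  by rewrite mem_enum inE /= -pg.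
by rewrite /cls /= !modn_mod !eqxx.
Qed.

Lemma region_lb m g t1 t2 : (0 < m)%N -> periodic m g -> T1 <= t1 -> t1 <= t2 -> t2 <= T2 ->
  lb (fun B => (cnt (box B) (fun a b => g a b && region t1 t2 B a b))%:R) (kappa * dens m g * (t2 - t1)).
Proof.
move=> m0 pg h1 h12 h2.
have mR : (1 : R) <= m%:R by rewrite ler1n.
pose s := enum [pred x : 'I_m * 'I_m | g x.1 x.2].
have main := @lb_sum R _ s _ _ (fun x : 'I_m * 'I_m => sector_lb m0 (ltn_ord x.1) (ltn_ord x.2) h1 h12 h2).
have e : \sum_(x <- s) (cK m * (3 * (t2 - t1))) = kappa * dens m g * (t2 - t1).
  rewrite big_const_seq count_predT -cardE iter_addr_0 -mulr_natl /kappa /dens /cK.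
  by hs; field; apply/andP; split; lra.
rewrite e in main; apply: lb_le main; exists 0 => B _; rewrite -natr_sum ler_nat.
apply: cnt_disj; first exact: enum_uniq.
  move=> x a b; rewrite mem_enum inE => gx _ _ /andP[/andP[/eqP xa /eqP xb] ->]; rewrite andbT.
  by rewrite pg xa xb !modn_small.
move=> x y a b _ _ /andP[/andP[/eqP xa /eqP xb] _] /andP[/andP[/eqP ya /eqP yb] _].
rewrite xa !modn_small in ya; rewrite ?xb !modn_small in yb => //.
by case: x y xa xb ya yb => [x1 x2] [y1 y2] /= _ _ /val_inj -> /val_inj ->.
Qed.

End Sector.

(** * Maximality and divisibility of the Hessian *)

Section IntDvd.
Implicit Types (x y n : int).

Lemma dvdz_prodE (p : nat) x y : prime p -> (p%:Z %| x * y)%Z = (p%:Z %| x)%Z || (p%:Z %| y)%Z.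
Proof. by move=> pp; rewrite !dvdzE abszM Euclid_dvdM. Qed.

Lemma dvdz_primeX (p : nat) x k : prime p -> (p%:Z %| x ^+ k.+1)%Z = (p%:Z %| x)%Z.
Proof. by move=> pp; rewrite !dvdzE abszX Euclid_dvdX // andbT. Qed.

Lemma coprimez_prime (p : nat) x k : prime p -> ~~ (p%:Z %| x)%Z -> coprimez (p%:Z ^+ k) x.
Proof.
move=> pp h; rewrite /coprimez /gcdz abszX absz_nat.
by apply/eqP; congr Posz; apply/eqP; apply: coprimeXl; rewrite prime_coprime // -dvdzE.
Qed.

Lemma dvdz_cancel (p : nat) x y k : prime p -> ~~ (p%:Z %| y)%Z -> (p%:Z ^+ k %| x * y)%Z -> (p%:Z ^+ k %| x)%Z.
Proof. by move=> pp h; rewrite Gauss_dvdzl // coprimez_prime. Qed.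

Lemma dvdz_cube_sqr (p : nat) n : prime p -> (p%:Z ^+ 3 %| n ^+ 2)%Z -> (p%:Z ^+ 2 %| n)%Z.
Proof.
move=> pp h; have p0 : p%:Z != 0 by rewrite -lt0n prime_gt0.
have /dvdzP[m em] : (p%:Z %| n)%Z.
  by rewrite -(dvdz_primeX n 1 pp); apply: dvdz_trans h; rewrite exprS dvdz_mulr.
have : (p%:Z %| m ^+ 2)%Z.
  case/dvdzP: h => x ex; apply/dvdzP; exists x; apply: (mulIf (expf_neq0 2 p0)).
  by rewrite -exprMn -em ex; ring.
by rewrite dvdz_primeX // em expr2 => hm; apply: dvdz_mul.
Qed.

End IntDvd.

(** Says that the operator qc dx^2 - qb dx dy + qa dy^2, dual to Q, annihilates f; the two equations
    are the coefficients of x and y. *)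
Definition apolar (Q : bqf int) f :=
  qa Q * fc f - qb Q * fb f + 3 * qc Q * fa f = 0 /\
  3 * qa Q * fd f - qb Q * fc f + qc Q * fb f = 0.

Lemma apolar_of_hess (Q : bqf int) f n : n != 0 -> hess f = qscale n Q -> apolar Q f.
Proof.
move=> n0 h.
have h0 : n * qa Q = fb f ^+ 2 - 3 * fa f * fc f by have := congr1 (@qa _) h.
have h1 : n * qb Q = fb f * fc f - 9 * fa f * fd f by have := congr1 (@qb _) h.
have h2 : n * qc Q = fc f ^+ 2 - 3 * fb f * fd f by have := congr1 (@qc _) h.
split; apply: (mulfI n0); rewrite mulr0.
  transitivity ((n * qa Q) * fc f - (n * qb Q) * fb f + 3 * (n * qc Q) * fa f); first by ring.
  by rewrite h0 h1 h2; ring.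
transitivity (3 * (n * qa Q) * fd f - (n * qb Q) * fc f + (n * qc Q) * fb f); first by ring.
by rewrite h0 h1 h2; ring.
Qed.

(** Eliminating the last two coefficients of f gives qa^2 Hess(f) = N Q with N = Q(b, -3a).
    Primitivity of Q makes N / qa^2 an integer. *)
Lemma apolar_hess (Q : bqf int) f : qa Q != 0 -> primQ Q -> apolar Q f ->
  exists2 n, hess f = qscale n Q & qa Q ^+ 2 * n = qeval Q (fb f) (- 3 * fa f).
Proof.
move=> q0 [u0 [u1 [u2 e]]] [e1 e2].
have e1' : qa Q * fc f = qb Q * fb f - 3 * qc Q * fa f by lia.
have e2' : 3 * qa Q * fd f = qb Q * fc f - qc Q * fb f by lia.
set N := qeval Q _ _.
have eN : N = qa Q * fb f ^+ 2 - 3 * qb Q * fa f * fb f + 9 * qc Q * fa f ^+ 2.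
  by rewrite /N /qeval; ring.
have h0 : qa Q ^+ 2 * qa (hess f) = N * qa Q.
  transitivity (qa Q * (qa Q * fb f ^+ 2 - 3 * fa f * (qa Q * fc f))); first by rewrite /=; ring.
  by rewrite e1' eN; ring.
have h1 : qa Q ^+ 2 * qb (hess f) = N * qb Q.
  transitivity (qa Q * fb f * (qa Q * fc f) - 3 * fa f * qa Q * (3 * qa Q * fd f)); first by rewrite /=; ring.
  rewrite e2' (_ : _ - _ = qa Q * fb f * (qa Q * fc f) - 3 * fa f * (qb Q * (qa Q * fc f) - qa Q * qc Q * fb f)); last by ring.
  by rewrite e1' eN; ring.
have h2 : qa Q ^+ 2 * qc (hess f) = N * qc Q.
  transitivity ((qa Q * fc f) ^+ 2 - fb f * qa Q * (3 * qa Q * fd f)); first by rewrite /=; ring.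
  rewrite e2' (_ : _ - _ = (qa Q * fc f) ^+ 2 - fb f * (qb Q * (qa Q * fc f) - qa Q * qc Q * fb f)); last by ring.
  by rewrite e1' eN; ring.
pose n := u0 * qa (hess f) + u1 * qb (hess f) + u2 * qc (hess f).
have en : qa Q ^+ 2 * n = N.
  transitivity (u0 * (qa Q ^+ 2 * qa (hess f)) + u1 * (qa Q ^+ 2 * qb (hess f)) + u2 * (qa Q ^+ 2 * qc (hess f))).
    by rewrite /n; ring.
  rewrite h0 h1 h2; transitivity (N * (u0 * qa Q + u1 * qb Q + u2 * qc Q)); first by ring.
  by rewrite e mulr1.
exists n => //.
have q2 : qa Q ^+ 2 != 0 by rewrite expf_neq0.
have fin (x y : int) : qa Q ^+ 2 * x = N * y -> x = n * y.
  by move=> h; apply: (mulfI q2); rewrite h -en; ring.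
by move: (fin _ _ h0) (fin _ _ h1) (fin _ _ h2); case: (hess f) => *; congr BQF.
Qed.

Lemma dvdz_primQ (d n : int) Q : primQ Q -> (d %| n * qa Q)%Z -> (d %| n * qb Q)%Z -> (d %| n * qc Q)%Z -> (d %| n)%Z.
Proof.
move=> [u0 [u1 [u2 e]]] h0 h1 h2.
have -> : n = u0 * (n * qa Q) + u1 * (n * qb Q) + u2 * (n * qc Q).
  by transitivity (n * (u0 * qa Q + u1 * qb Q + u2 * qc Q)); [rewrite e mulr1|ring].
by rewrite !rpredD// dvdz_mull.
Qed.

(** The element (u + om) / p is integral. The cases follow the power of p in the leading coefficient
    a; in each, either the Hessian is visibly divisible by p^2, or p^3 divides n^2 D, which suffices
    since p does not divide D. *)
Lemma not_pmax_core f n Q (p : nat) u : prime p -> (3 < p)%N -> primQ Q -> ~~ (p%:Z %| qdisc Q)%Z ->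
  hess f = qscale n Q -> (p%:Z %| ce1 f u 1 0)%Z -> (p%:Z ^+ 2 %| ce2 f u 1 0)%Z ->
  (p%:Z ^+ 3 %| ce3 f u 1 0)%Z -> (p%:Z ^+ 2 %| n)%Z.
Proof.
move=> pp p3 pQ pD h.
have p_gt0 : (0 : int) < p%:Z by rewrite ltz_nat prime_gt0.
have h0 : n * qa Q = fb f ^+ 2 - 3 * fa f * fc f by have := congr1 (@qa _) h.
have h1 : n * qb Q = fb f * fc f - 9 * fa f * fd f by have := congr1 (@qb _) h.
have h2 : n * qc Q = fc f ^+ 2 - 3 * fb f * fd f by have := congr1 (@qc _) h.
have p3n : ~~ (p%:Z %| 3)%Z by rewrite dvdzE /= gtnNdvd.
have nD : n ^+ 2 * qdisc Q = (n * qb Q) ^+ 2 - 4 * (n * qa Q) * (n * qc Q) by rewrite /qdisc; ring.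
have nDc : n ^+ 2 * qdisc Q = - 3 * cdisc f by rewrite nD h0 h1 h2 /cdisc; ring.
case: f h h0 h1 h2 nDc => a b c d h /= h0 h1 h2 nDc.
have -> : ce1 (BCF a b c d) u 1 0 = 3 * u + b by rewrite /ce1 /= !intz; ring.
have -> : ce2 (BCF a b c d) u 1 0 = 3 * u ^+ 2 + 2 * u * b + a * c by rewrite /ce2 /= !intz; ring.
have -> : ce3 (BCF a b c d) u 1 0 = u ^+ 3 + u ^+ 2 * b + u * a * c + a ^+ 2 * d by rewrite /ce3 /= !intz; ring.
move=> d1 d2 d3.
have dH0 : (p%:Z ^+ 2 %| n * qa Q)%Z.
  rewrite h0 (_ : _ - _ = (3 * u + b) ^+ 2 - 3 * (3 * u ^+ 2 + 2 * u * b + a * c)); last by ring.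
  by apply: rpredB; [exact: dvdz_exp2r|exact: dvdz_mull].
(* If p does not divide a: the characteristic polynomial of u + om has discriminant a^2 times that
   of f, and its coefficients are divisible by p, p^2, p^3, so the discriminant is divisible by p^6;
   p^3 is enough here. *)
have [pa|pa] := boolP (p%:Z %| a)%Z; last first.
  have : (p%:Z ^+ 3 %| a ^+ 2 * (n ^+ 2 * qdisc Q))%Z.
    have [[x1 e1] [x2 e2] [x3 e3]] : [/\ exists x, 3 * u + b = x * p%:Z, exists x, 3 * u ^+ 2 + 2 * u * b + a * c = x * p%:Z ^+ 2 &
       exists x, u ^+ 3 + u ^+ 2 * b + u * a * c + a ^+ 2 * d = x * p%:Z ^+ 3].
      by split; apply/dvdzP.
    rewrite nDc (_ : a ^+ 2 * _ = - 3 * ((3 * u + b) ^+ 2 * (3 * u ^+ 2 + 2 * u * b + a * c) ^+ 2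
       - 4 * (3 * u ^+ 2 + 2 * u * b + a * c) ^+ 3
       - 4 * (3 * u + b) ^+ 3 * (u ^+ 3 + u ^+ 2 * b + u * a * c + a ^+ 2 * d)
       + 18 * (3 * u + b) * (3 * u ^+ 2 + 2 * u * b + a * c) * (u ^+ 3 + u ^+ 2 * b + u * a * c + a ^+ 2 * d)
       - 27 * (u ^+ 3 + u ^+ 2 * b + u * a * c + a ^+ 2 * d) ^+ 2)); last by rewrite /cdisc /=; ring.
    rewrite e1 e2 e3; apply/dvdzP; exists (- 3 * (x1 ^+ 2 * x2 ^+ 2 - 4 * x2 ^+ 3 - 4 * x1 ^+ 3 * x3 + 18 * x1 * x2 * x3 - 27 * x3 ^+ 2) * p%:Z ^+ 3).
    by ring.
  rewrite mulrA => /(dvdz_cancel pp pD); rewrite mulrC => hn.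
  by apply: dvdz_cube_sqr => //; apply: dvdz_cancel hn => //; rewrite (dvdz_primeX a 1 pp).
have pb : (p%:Z %| b)%Z.
  rewrite -(dvdz_primeX b 1 pp) (_ : b ^+ 2 = n * qa Q + 3 * a * c); last by rewrite h0; ring.
  apply: rpredD; first by apply: dvdz_trans dH0; rewrite expr2 dvdz_mulr.
  by rewrite dvdz_mulr// dvdz_mull.
have pu : (p%:Z %| u)%Z.
  have : (p%:Z %| 3 * u)%Z by rewrite (_ : 3 * u = 3 * u + b - b); [rewrite rpredB|ring].
  by rewrite (dvdz_prodE _ _ pp) (negbTE p3n).
have /dvdzP[a1 ea] := pa; have /dvdzP[b1 eb] := pb; have /dvdzP[u1 eu] := pu.
have pac : (p%:Z %| a1 * c)%Z.
  move: d2; rewrite ea eb eu => /dvdzP[x ex].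
  apply/dvdzP; exists (x - 3 * u1 ^+ 2 - 2 * u1 * b1); apply: (mulIf (lt0r_neq0 p_gt0)).
  by transitivity (x * p%:Z ^+ 2 - (3 * u1 ^+ 2 + 2 * u1 * b1) * p%:Z ^+ 2); [rewrite -ex|]; ring.
have pad : (p%:Z %| a1 ^+ 2 * d)%Z.
  move: d3; rewrite ea eb eu => /dvdzP[x ex]; have /dvdzP[y ey] := pac.
  apply/dvdzP; exists (x - u1 ^+ 3 - u1 ^+ 2 * b1 - u1 * y); apply: (mulIf (lt0r_neq0 p_gt0)); apply: (mulIf (lt0r_neq0 p_gt0)).
  transitivity (x * p%:Z ^+ 3 - (u1 ^+ 3 + u1 ^+ 2 * b1) * p%:Z ^+ 3 - u1 * (y * p%:Z) * p%:Z ^+ 2); [rewrite -ex -ey|]; ring.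
(* If p divides a exactly once, all four coefficients are divisible by p and the Hessian by p^2. *)
have [pa1|pa1] := boolP (p%:Z %| a1)%Z; last first.
  have pc : (p%:Z %| c)%Z by move: pac; rewrite (dvdz_prodE _ _ pp) (negbTE pa1).
  have pd : (p%:Z %| d)%Z by move: pad; rewrite (dvdz_prodE _ _ pp) (dvdz_primeX a1 1 pp) (negbTE pa1).
  apply: (dvdz_primQ pQ); rewrite ?h0 ?h1 ?h2; apply: rpredB.
  - exact: dvdz_exp2r.
  - by rewrite expr2; apply: dvdz_mul => //; exact: dvdz_mull.
  - by rewrite expr2; apply: dvdz_mul.
  - by rewrite expr2; apply: dvdz_mul => //; exact: dvdz_mull.
  - exact: dvdz_exp2r.
  - by rewrite expr2; apply: dvdz_mul => //; exact: dvdz_mull.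
have /dvdzP[a2 ea1] := pa1; have /dvdzP[x0 ex0] := dH0.
(* If p did not divide c, the last coefficient of the Hessian would make n a unit at p, against p
   dividing n^2 D. *)
have [pc|pc] := boolP (p%:Z %| c)%Z; last first.
  exfalso; have pn : ~~ (p%:Z %| n)%Z.
    apply/negP => pn; have : (p%:Z %| c ^+ 2)%Z.
      rewrite (_ : c ^+ 2 = n * qc Q + 3 * b * d); last by rewrite h2; ring.
      by apply: rpredD; [exact: dvdz_mulr|rewrite dvdz_mulr// dvdz_mull].
    by rewrite (dvdz_primeX c 1 pp) (negbTE pc).
  have : (p%:Z %| n ^+ 2 * qdisc Q)%Z.
    rewrite nD; apply: rpredB.
      by rewrite (dvdz_primeX _ 1 pp) h1; apply: rpredB; [exact: dvdz_mulr|rewrite dvdz_mulr// dvdz_mull].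
    by rewrite dvdz_mulr// dvdz_mull//; apply: dvdz_trans dH0; rewrite expr2 dvdz_mulr.
  by rewrite (dvdz_prodE _ _ pp) (dvdz_primeX n 1 pp) (negbTE pn) (negbTE pD).
have /dvdzP[c1 ec] := pc.
apply: dvdz_cube_sqr => //; apply: (dvdz_cancel pp pD); rewrite nD ex0 h1 h2 ea ea1 eb ec.
by apply/dvdzP; exists ((b1 * c1 - 9 * a2 * d) ^+ 2 * p%:Z - 4 * x0 * (c1 ^+ 2 * p%:Z - 3 * b1 * d)); ring.
Qed.

Definition cg (q x y : int) := exists k, x = y + q * k.

Lemma cg_refl q x : cg q x x. Proof. by exists 0; ring. Qed.
Lemma cg_add q x y x' y' : cg q x x' -> cg q y y' -> cg q (x + y) (x' + y').
Proof. by move=> [k ->] [l ->]; exists (k + l); ring. Qed.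
Lemma cg_opp q x x' : cg q x x' -> cg q (- x) (- x').
Proof. by move=> [k ->]; exists (- k); ring. Qed.
Lemma cg_mul q x y x' y' : cg q x x' -> cg q y y' -> cg q (x * y) (x' * y').
Proof. by move=> [k ->] [l ->]; exists (x' * l + k * y' + q * k * l); ring. Qed.
Lemma cg_exp q x x' n : cg q x x' -> cg q (x ^+ n) (x' ^+ n).
Proof.
by move=> h; elim: n => [|n ih]; [exact: cg_refl|rewrite !exprS; exact: cg_mul].
Qed.
Lemma cg_sym q x y : cg q x y -> cg q y x.
Proof. by move=> [k ->]; exists (- k); ring. Qed.
Lemma cg_dvd (q d x y : int) : (d %| q)%Z -> cg q x y -> (d %| x)%Z -> (d %| y)%Z.
Proof.
move=> dq [k ->] h; rewrite (_ : y = y + q * k - q * k); last by ring.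
by rewrite rpredB// dvdz_mulr.
Qed.

Definition cgf q f f' := [/\ cg q (fa f) (fa f'), cg q (fb f) (fb f'), cg q (fc f) (fc f') & cg q (fd f) (fd f')].

Lemma cg_ce q f f' u u' v v' w w' : cgf q f f' -> cg q u u' -> cg q v v' -> cg q w w' ->
  [/\ cg q (ce1 f u v w) (ce1 f' u' v' w'), cg q (ce2 f u v w) (ce2 f' u' v' w') & cg q (ce3 f u v w) (ce3 f' u' v' w')].
Proof.
move=> [ha hb hc hd] hu hv hw; rewrite /ce1 /ce2 /ce3 !intz.
by split; do ?[exact: cg_refl | assumption | apply: cg_add | apply: cg_opp | apply: cg_mul | apply: cg_exp].
Qed.

Lemma pmax_cg (p : nat) f f' : cgf (p%:Z ^+ 3) f f' -> pmax f p -> pmax f' p.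
Proof.
move=> [ha hb hc hd] pm u v w d1 d2 d3.
have hs : cgf (p%:Z ^+ 3) f' f by split; exact: cg_sym.
have [c1 c2 c3] := cg_ce hs (cg_refl _ u) (cg_refl _ v) (cg_refl _ w).
apply: (pm u v w).
- by apply: cg_dvd c1 d1; rewrite exprS dvdz_mulr.
- by apply: cg_dvd c2 d2; rewrite [_ ^+ 3]exprSr dvdz_mulr.
- exact: cg_dvd c3 d3.
Qed.

Lemma ce_scale f (l u v w : int) :
  [/\ ce1 f (l * u) (l * v) (l * w) = l * ce1 f u v w,
      ce2 f (l * u) (l * v) (l * w) = l ^+ 2 * ce2 f u v w &
      ce3 f (l * u) (l * v) (l * w) = l ^+ 3 * ce3 f u v w].
Proof. by rewrite /ce1 /ce2 /ce3 !intz; split; ring. Qed.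

Definition zshear (w : int) := ZM 1 0 w 1.
Lemma unimod_shear w : unimod (zshear w).
Proof. by rewrite /unimod /zdet /=; ring. Qed.

(** In the normalised basis of the sheared form, the first element is om + w th + w c + w^2 d; the
    translation explains u'. *)
Lemma ce_shear f (u w : int) :
  let u' := u - (w * fc f + w ^+ 2 * fd f) in
  [/\ ce1 f u 1 w = ce1 (cact f (zshear w)) u' 1 0,
      ce2 f u 1 w = ce2 (cact f (zshear w)) u' 1 0 &
      ce3 f u 1 w = ce3 (cact f (zshear w)) u' 1 0].
Proof. by rewrite /ce1 /ce2 /ce3 !intz /cact /ceval /=; split; ring. Qed.

Definition zswap := ZM 0 1 1 0.
Lemma ce_swap f (u v w : int) :
  [/\ ce1 f u v w = ce1 (cact f zswap) u (- w) (- v),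
      ce2 f u v w = ce2 (cact f zswap) u (- w) (- v) &
      ce3 f u v w = ce3 (cact f zswap) u (- w) (- v)].
Proof. by rewrite /ce1 /ce2 /ce3 !intz /cact /ceval /=; split; ring. Qed.

Lemma inverse_mod (p : nat) v k : prime p -> ~~ (p%:Z %| v)%Z -> exists l, cg (p%:Z ^+ k) (l * v) 1.
Proof.
move=> pp h; have := coprimez_prime k pp h => /coprimezP[[x y] /= e].
by exists y, (- x); rewrite -e; ring.
Qed.

(* A nonmaximal form can be moved by a shear so that the offending element is (u + om) / p. *)
Lemma not_pmax_shear (p : nat) f u v w : prime p -> ~~ (p%:Z %| v)%Z ->
  (p%:Z %| ce1 f u v w)%Z -> (p%:Z ^+ 2 %| ce2 f u v w)%Z -> (p%:Z ^+ 3 %| ce3 f u v w)%Z ->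
  exists l w' u', [/\ cg (p%:Z ^+ 3) (l * v) 1, w' = l * w & [/\ (p%:Z %| ce1 (cact f (zshear w')) u' 1 0)%Z,
    (p%:Z ^+ 2 %| ce2 (cact f (zshear w')) u' 1 0)%Z & (p%:Z ^+ 3 %| ce3 (cact f (zshear w')) u' 1 0)%Z]].
Proof.
move=> pp pv d1 d2 d3; have [l hl] := inverse_mod 3 pp pv.
exists l, (l * w), (l * u - (l * w * fc f + (l * w) ^+ 2 * fd f)); split=> //.
have [<- <- <-] := ce_shear f (l * u) (l * w).
have hf : cgf (p%:Z ^+ 3) f f by split; exact: cg_refl.
have [c1 c2 c3] := cg_ce hf (cg_refl _ (l * u)) hl (cg_refl _ (l * w)).
have [s1 s2 s3] := ce_scale f l u v w; rewrite s1 s2 s3 in c1 c2 c3.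
split.
- by apply: cg_dvd c1 (dvdz_mull _ d1); rewrite exprS dvdz_mulr.
- by apply: cg_dvd c2 (dvdz_mull _ d2); rewrite [_ ^+ 3]exprSr dvdz_mulr.
- exact: cg_dvd c3 (dvdz_mull _ d3).
Qed.

Lemma not_pmax_sqr f n Q (p : nat) : prime p -> (3 < p)%N -> primQ Q -> ~~ (p%:Z %| qdisc Q)%Z ->
  hess f = qscale n Q -> ~ pmax f p -> (p%:Z ^+ 2 %| n)%Z.
Proof.
move=> pp p3 pQ pD h npm.
have main f' Q' u v w : primQ Q' -> ~~ (p%:Z %| qdisc Q')%Z -> hess f' = qscale n Q' -> ~~ (p%:Z %| v)%Z ->
  (p%:Z %| ce1 f' u v w)%Z -> (p%:Z ^+ 2 %| ce2 f' u v w)%Z -> (p%:Z ^+ 3 %| ce3 f' u v w)%Z ->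
  (p%:Z ^+ 2 %| n)%Z.
  move=> pQ' pD' h' pv d1 d2 d3.
  have [l [w' [u' [_ _ [e1 e2 e3]]]]] := not_pmax_shear pp pv d1 d2 d3.
  have su := unimod_shear w'.
  apply: (@not_pmax_core (cact f' (zshear w')) n (qact Q' (zshear w')) p u') => //.
  - exact: primQ_act.
  - by rewrite qdisc_act.
  - by rewrite hess_act// h' qact_scale.
have [//|dn] := boolP (p%:Z ^+ 2 %| n)%Z.
case: npm => u v w d1 d2 d3.
have [pv|pv] := boolP (p%:Z %| v)%Z; last by have := main f Q u v w pQ pD h pv d1 d2 d3; rewrite (negbTE dn).
have [pw|pw] := boolP (p%:Z %| w)%Z; first by [].
have [s1 s2 s3] := ce_swap f u v w; rewrite s1 in d1; rewrite s2 in d2; rewrite s3 in d3.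
have := main (cact f zswap) (qact Q zswap) u (- w) (- v) _ _ _ _ d1 d2 d3.
rewrite (negbTE dn) => -> //.
- exact: primQ_act.
- by rewrite qdisc_act.
- by rewrite hess_act// h qact_scale.
- by rewrite rpredN.
Qed.

Lemma pmax_content f (p : nat) : prime p -> pmax f p -> (p%:Z %| fa f)%Z -> (p%:Z %| fb f)%Z ->
  (p%:Z %| fc f)%Z -> (p%:Z %| fd f)%Z -> False.
Proof.
move=> pp pm pa pb pc pd; have [] : (p%:Z %| 1)%Z /\ (p%:Z %| 0)%Z.
  apply: (pm 0 1 0).
  - by rewrite (_ : ce1 _ _ _ _ = fb f)// /ce1 !intz; ring.
  - rewrite (_ : ce2 _ _ _ _ = fa f * fc f); last by rewrite /ce2 !intz; ring.
    by rewrite expr2; exact: dvdz_mul.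
  - rewrite (_ : ce3 _ _ _ _ = fa f * fa f * fd f); last by rewrite /ce3 !intz; ring.
    by rewrite exprS expr2 mulrA; do 2?apply: dvdz_mul.
by rewrite dvdz1 /= => /eqP p1; move: pp; rewrite p1.
Qed.

(** Let p divide n. Moving the rational zero to (1, 0) modulo p^3 makes p^3 divide the leading
    coefficient; the first coefficient b^2 - 3 a c of the Hessian then forces p to divide b, and om
    / p is integral, against maximality at p. *)
Lemma reducible_pmax f n Q (x y : int) : (forall p, prime p -> pmax f p) -> hess f = qscale n Q -> 0 < n ->
  coprimez x y -> ceval f x y = 0 -> n = 1.
Proof.
move=> pm h n0 cxy fxy.
have main (p : nat) (f' : bcf) Q' (l u' : int) v w : prime p -> pmax f' p -> hess f' = qscale n Q' -> (p%:Z %| n)%Z ->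
  cg (p%:Z ^+ 3) (l * v) 1 -> ceval f' v w = 0 -> False.
  move=> pp pm' h' pn hl fvw; set W := l * w.
  have su := unimod_shear W.
  set g := cact f' (zshear W).
  have ga : (p%:Z ^+ 3 %| fa g)%Z.
    have : cg (p%:Z ^+ 3) (l ^+ 3 * ceval f' v w) (fa g).
      rewrite (_ : l ^+ 3 * _ = ceval f' (l * v) (l * w)); last by rewrite /ceval; ring.
      rewrite /g /= /ceval -/W.
      by do ?[exact: cg_refl | exact: hl | apply: cg_add | apply: cg_opp | apply: cg_mul | apply: cg_exp].
    by rewrite fvw mulr0 => /cg_dvd; apply.
  have gb : (p%:Z %| fb g)%Z.
    have e : fb g ^+ 2 = n * qa (qact Q' (zshear W)) + 3 * fa g * fc g.
      have : hess g = qscale n (qact Q' (zshear W)) by rewrite hess_act// h' qact_scale.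
      by move/(congr1 (@qa _)) => /= <-; ring.
    rewrite -(dvdz_primeX _ 1 pp) e; apply: rpredD; first exact: dvdz_mulr.
    by rewrite dvdz_mulr// dvdz_mull//; apply: dvdz_trans ga; rewrite exprS dvdz_mulr.
  have [s1 s2 s3] := ce_shear f' (W * fc f' + W ^+ 2 * fd f') W.
  rewrite subrr in s1 s2 s3.
  have [] := pm' (W * fc f' + W ^+ 2 * fd f') 1 W.
  - by rewrite s1 -/g (_ : ce1 _ _ _ _ = fb g)// /ce1 !intz; ring.
  - rewrite s2 -/g (_ : ce2 _ _ _ _ = fa g * fc g); last by rewrite /ce2 !intz; ring.
    by rewrite dvdz_mulr//; apply: dvdz_trans ga; rewrite [_ ^+ 3]exprSr dvdz_mulr.
  - rewrite s3 -/g (_ : ce3 _ _ _ _ = fa g * (fa g * fd g)); last by rewrite /ce3 !intz; ring.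
    by rewrite dvdz_mulr.
  by rewrite dvdz1 /= => /eqP p1; move: pp; rewrite p1.
apply/eqP; rewrite -[n == 1]negbK; apply/negP => n1.
have an1 : (1 < `|n|)%N by lia.
have pp := pdiv_prime an1; set p := pdiv _ in pp.
have pn : (p%:Z %| n)%Z by rewrite dvdzE /= pdiv_dvd.
have [px|px] := boolP (p%:Z %| x)%Z; last first.
  have [l hl] := inverse_mod 3 pp px.
  exact: (main p f Q l 0 x y pp (pm p pp) h pn hl fxy).
have py : ~~ (p%:Z %| y)%Z.
  apply/negP => py; have : (p%:Z %| gcdz x y)%Z by rewrite dvdz_gcd px.
  by rewrite (eqP cxy) dvdz1 /= => /eqP p1; move: pp; rewrite p1.
have [l hl] := inverse_mod 3 pp py.
apply: (main p (cact f zswap) (qact Q zswap) l 0 y x pp _ _ pn hl).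
- move=> u v w; have [s1 s2 s3] := ce_swap f u (- w) (- v); rewrite !opprK in s1 s2 s3.
  by rewrite -s1 -s2 -s3 => d1 d2 d3; have [] := pm p pp u (- w) (- v) d1 d2 d3; rewrite !rpredN.
- by rewrite hess_act// h qact_scale.
- by rewrite -[RHS]fxy /cact /ceval /=; ring.
Qed.

(** * Sieving for maximal forms *)

Lemma sum_inv_sqr (R : realType) (M n : nat) : (0 < M)%N ->
  \sum_(p <- index_iota M.+1 n) (p%:R ^+ 2)^-1 <= M%:R^-1 :> R.
Proof.
move=> M0; have [nM|Mn] := leqP n M.+1.
  by rewrite big_geq// invr_ge0.
rewrite -(subnKC (ltnW Mn)); move: (n - M.+1)%N => j {Mn n}.
have h : \sum_(M.+1 <= p < M.+1 + j) (p%:R ^+ 2)^-1 <= M%:R^-1 - (M + j)%:R^-1 :> R.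
  elim: j => [|j ih]; first by rewrite addn0 big_geq// addn0 subrr.
  rewrite addnS big_nat_recr ?leq_addr//=.
  have e : ((M.+1 + j)%:R : R) = (M + j)%:R + 1 by rewrite addSn natr1.
  rewrite addnS -addSn e; have x0 : (0 : R) < (M + j)%:R by rewrite ltr0n; lia.
  move: ih; set x : R := (M + j)%:R in x0 *; set S := \sum_(_ <= _ < _) _.
  have : (x + 1) ^- 2 <= x^-1 - (x + 1)^-1.
    rewrite (_ : x^-1 - _ = (x * (x + 1))^-1); last by field; apply/andP; split; lra.
    by rewrite lef_pV2 ?posrE ?exprn_gt0 ?mulr_gt0//; nra.
  by lra.
by apply: le_trans h _; rewrite gerBl invr_ge0.
Qed.

Section Sieve.
Variables (R : realType) (Q : bqf int).
Hypotheses (q0 : qa Q < 0) (q1 : qb Q < 0) (q2 : qc Q < 0) (D0 : 0 < qdisc Q) (pQ : primQ Q).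

Lemma apolar_uniq f f' : apolar Q f -> apolar Q f' -> fa f = fa f' -> fb f = fb f' -> f = f'.
Proof.
case: f f' => a b c d [a' b' c' d'] [/= e1 e2] [/= e3 e4] ea eb; subst a' b'.
have qn : qa Q != 0 by rewrite lt_eqF.
have ec : c = c' by apply: (mulfI qn); lia.
subst c'; congr BCF; apply: (mulfI qn); lia.
Qed.

(** Common denominator of the last two coefficients of an apolar form as linear functions of the
    first two: shifting those by multiples of [mQ] L shifts the others by multiples of L. *)
Definition mQ : int := 3 * qa Q ^+ 2.

Lemma mQ_gt0 : 0 < mQ.
Proof. by rewrite /mQ mulr_gt0// exprn_even_gt0//= lt_eqF. Qed.

Lemma apolar_shift f (L a b : int) : apolar Q f -> cg (mQ * L) a (fa f) -> cg (mQ * L) b (fb f) ->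
  exists f', [/\ fa f' = a, fb f' = b, apolar Q f' & cgf L f f'].
Proof.
move=> [e1 e2] [x ->] [y ->].
exists (BCF (fa f + mQ * L * x) (fb f + mQ * L * y)
   (fc f + 3 * qa Q * L * (qb Q * y - 3 * qc Q * x))
   (fd f + L * (qb Q * (qb Q * y - 3 * qc Q * x) - qa Q * qc Q * y))); split=> //.
- by split=> /=; [rewrite -[RHS]e1|rewrite -[RHS]e2]; rewrite /mQ; ring.
- split; [exists (- mQ * x)|exists (- mQ * y)|exists (- (3 * qa Q * (qb Q * y - 3 * qc Q * x)))|
    exists (- (qb Q * (qb Q * y - 3 * qc Q * x) - qa Q * qc Q * y))] => /=; ring.
Qed.

Definition good (P : nat -> Prop) (a b : nat) : bool := `[< exists f : bcf,
  [/\ fa f = a%:Z, fb f = b%:Z, apolar Q f & forall p, prime p -> P p -> pmax f p] >].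
Definition good_upto M := good (fun p => (p <= M)%N).
Definition good_all := good (fun _ => True).

(** Maximality at p depends on the coefficients modulo p^3, and every prime up to M divides M!. *)
Definition modulus M : nat := (`|mQ| * M`! ^ 3)%N.

Lemma modulus_gt0 M : (0 < modulus M)%N.
Proof. by rewrite muln_gt0 expn_gt0 fact_gt0 andbT absz_gt0 gt_eqF ?mQ_gt0. Qed.

Lemma modulusE M : ((modulus M)%:Z = mQ * (M`!)%:Z ^+ 3)%R.
Proof. by rewrite /modulus PoszM gez0_abs ?ltW ?mQ_gt0// natrXE. Qed.

Lemma good_cg M a b a' b' : cg (modulus M) a'%:Z a%:Z -> cg (modulus M) b'%:Z b%:Z ->
  good_upto M a b -> good_upto M a' b'.
Proof.
rewrite modulusE => ha hb /asboolP[f [ea eb ap pm]]; apply/asboolP.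
rewrite -ea in ha; rewrite -eb in hb.
have [f' [ea' eb' ap' [c1 c2 c3 c4]]] := apolar_shift ap ha hb.
exists f'; split=> // p pp pM; apply: pmax_cg (pm p pp pM).
have [j ej] : exists j, (M`!)%:Z ^+ 3 = p%:Z ^+ 3 * j.
  have /dvdnP[j ->] : (p %| M`!)%N by rewrite dvdn_fact// prime_gt0.
  by exists (j%:Z ^+ 3); rewrite PoszM; ring.
have tr x y : cg ((M`!)%:Z ^+ 3) x y -> cg (p%:Z ^+ 3) x y.
  by rewrite ej => -[l ->]; exists (j * l); ring.
by split; apply: tr.
Qed.

Lemma cg_modn (m a : nat) : cg m (a %% m)%N a /\ cg m a (a %% m)%N.
Proof.
have e : a%:Z = (a %% m)%N%:Z + m%:Z * (a %/ m)%N%:Z.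
  by rewrite {1}(divn_eq a m) PoszD PoszM; ring.
by split; [exists (- (a %/ m)%N%:Z)|exists (a %/ m)%N%:Z]; rewrite e; ring.
Qed.

Lemma good_periodic M : periodic (modulus M) (good_upto M).
Proof.
move=> a b; have [a1 a2] := cg_modn (modulus M) a; have [b1 b2] := cg_modn (modulus M) b.
by apply/idP/idP; apply: good_cg.
Qed.

Lemma good_all_upto M a b : good_all a b -> good_upto M a b.
Proof.
by move=> /asboolP[f [? ? ? pm]]; apply/asboolP; exists f; split=> // p pp _; exact: pm.
Qed.

(* Equals q0^2 n, where n is the content of the Hessian n Q of the form with leading coefficients a, b. *)
Definition Nab (a b : int) : int := qeval Q b (- 3 * a).

Lemma NabE a b : Nab a b = qa Q * b ^+ 2 - 3 * qb Q * a * b + 9 * qc Q * a ^+ 2.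
Proof. by rewrite /Nab /qeval; ring. Qed.

(** A prime above this bound divides none of 6, [qa Q] and [qdisc Q]; the factor 6 also makes the
    sum of 3 / p^2 over such primes at most 1/2. *)
Definition bigB : nat := absz (6 * qa Q * qdisc Q).
Definition big (p : nat) := (bigB < p)%N.

Lemma bigN p (x : int) : big p -> x != 0 -> (absz x <= bigB)%N -> ~~ (p%:Z %| x)%Z.
Proof. by move=> bp x0 hx; rewrite dvdzE gtnNdvd ?absz_gt0//; apply: leq_ltn_trans hx bp. Qed.

Lemma big_qa p : big p -> ~~ (p%:Z %| qa Q)%Z.
Proof.
move=> bp; apply: bigN => //; first by rewrite lt_eqF.
have ? : (0 < `|qdisc Q|)%N by lia.
by rewrite /bigB !abszM; nia.
Qed.

Lemma big_D p : big p -> ~~ (p%:Z %| qdisc Q)%Z.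
Proof.
move=> bp; apply: bigN => //; first by rewrite gt_eqF.
have ? : (0 < `|qa Q|)%N by lia.
by rewrite /bigB !abszM; nia.
Qed.

Lemma bigB_ge6 : (6 <= bigB)%N.
Proof.
have ? : (0 < `|qa Q|)%N by lia.
have ? : (0 < `|qdisc Q|)%N by lia.
by rewrite /bigB !abszM; nia.
Qed.

Lemma big_6 p : big p -> (6 < p)%N.
Proof.
have ? : (0 < `|qa Q|)%N by lia.
have ? : (0 < `|qdisc Q|)%N by lia.
by rewrite /big /bigB !abszM; nia.
Qed.

Lemma bad_prime f p : apolar Q f -> prime p -> big p -> ~ pmax f p ->
  (p%:Z ^+ 2 %| Nab (fa f) (fb f))%Z.
Proof.
move=> ap pp bp npm; have [n hn en] := apolar_hess (ltr0_neq0 q0) pQ ap.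
rewrite /Nab -en dvdz_mull//.
apply: (not_pmax_sqr pp _ pQ _ hn npm); last exact: big_D.
by apply: ltn_trans (big_6 bp).
Qed.

Lemma dvdz_prime2 p (x y : int) : prime p -> (p%:Z ^+ 2 %| x * y)%Z -> ~~ (p%:Z ^+ 2 %| x)%Z ->
  (p%:Z %| x)%Z && (p%:Z %| y)%Z || (p%:Z ^+ 2 %| y)%Z.
Proof.
move=> pp h nx; have [px|px] := boolP (p%:Z %| x)%Z; last first.
  by rewrite mulrC in h; rewrite (dvdz_cancel pp px h) orbT.
have [py|py] := boolP (p%:Z %| y)%Z; first by [].
by rewrite (dvdz_cancel pp py h) in nx.
Qed.

(** Modulo p^2 the zeros of [Nab] with a prime to p lie on at most two lines b = r a, since p does
    not divide the discriminant. The colour tells which line, and two points of one line have a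
    cross product divisible by p^2. *)
Lemma colour p : prime p -> big p -> exists chi : int -> int -> bool, forall a b a' b',
  (p%:Z ^+ 2 %| Nab a b)%Z -> ~~ (p%:Z %| a)%Z -> (p%:Z ^+ 2 %| Nab a' b')%Z -> ~~ (p%:Z %| a')%Z ->
  chi a b = chi a' b' -> (p%:Z ^+ 2 %| a * b' - a' * b)%Z.
Proof.
move=> pp bp.
(* Without a root of [Nab] 1 modulo p^2 there is no point to colour. *)
have [[r hr]|none] := pselect (exists r : int, (p%:Z ^+ 2 %| Nab 1 r)%Z); last first.
  exists (fun _ _ => true) => a b a' b' hN pa _ _; case: none.
  have [l [k e]] := inverse_mod 2 pp pa; exists (l * b).
  have -> : Nab 1 (l * b) = l ^+ 2 * Nab a b + p%:Z ^+ 2 * (- k * (9 * qc Q * (1 + l * a) - 3 * qb Q * l * b)).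
    transitivity (l ^+ 2 * Nab a b - (l * a - 1) * (9 * qc Q * (1 + l * a) - 3 * qb Q * l * b)); first by rewrite !NabE; ring.
    by rewrite e; ring.
  by apply: rpredD; [exact: dvdz_mull|exact: dvdz_mulr].
exists (fun a b => (p%:Z ^+ 2 %| b - r * a)%Z) => a b a' b' hN pa hN' pa' ec.
have [c|c] := boolP (p%:Z ^+ 2 %| b - r * a)%Z.
  rewrite c in ec; rewrite (_ : _ - _ = a * (b' - r * a') - a' * (b - r * a)); last by ring.
  by rewrite rpredB// dvdz_mull// -ec.
have c' : ~~ (p%:Z ^+ 2 %| b' - r * a')%Z by rewrite -ec.
have other u v : (p%:Z ^+ 2 %| Nab u v)%Z -> ~~ (p%:Z %| u)%Z -> ~~ (p%:Z ^+ 2 %| v - r * u)%Z ->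
    (p%:Z ^+ 2 %| qa Q * (v + r * u) - 3 * qb Q * u)%Z.
  move=> h pu nv; have : (p%:Z ^+ 2 %| (v - r * u) * (qa Q * (v + r * u) - 3 * qb Q * u))%Z.
    rewrite (_ : _ * _ = Nab u v - u ^+ 2 * Nab 1 r); last by rewrite !NabE; ring.
    by rewrite rpredB// dvdz_mull.
  move=> /(dvdz_prime2 pp)/(_ nv)/orP[/andP[x1 x2]|//]; exfalso.
  have : (p%:Z %| 9 * qdisc Q * u ^+ 2)%Z.
    rewrite (_ : _ * _ = ((qa Q * (v + r * u) - 3 * qb Q * u) - qa Q * (v - r * u)) ^+ 2 - 4 * qa Q * u ^+ 2 * Nab 1 r); last by rewrite NabE /qdisc; ring.
    apply: rpredB; first by rewrite (dvdz_primeX _ 1 pp) rpredB// dvdz_mull.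
    by rewrite dvdz_mull//; apply: dvdz_trans hr; rewrite expr2 dvdz_mulr.
  rewrite (dvdz_prodE _ _ pp) (dvdz_primeX u 1 pp) (negbTE pu) orbF (dvdz_prodE _ _ pp) (negbTE (big_D bp)) orbF.
  by apply/negP; rewrite (_ : 9 = 3 ^+ 2)// (dvdz_primeX 3 1 pp) dvdzE gtnNdvd//=; apply: ltn_trans (big_6 bp).
have h1 := other a b hN pa c; have h2 := other a' b' hN' pa' c'.
apply: (dvdz_cancel pp (big_qa bp)).
rewrite (_ : _ * qa Q = a * (qa Q * (b' + r * a') - 3 * qb Q * a') - a' * (qa Q * (b + r * a) - 3 * qb Q * a)); last by ring.
by rewrite rpredB// dvdz_mull.
Qed.

Lemma bad_both p a b : prime p -> big p -> (p%:Z ^+ 2 %| Nab a b)%Z -> (p%:Z %| a)%Z -> (p%:Z %| b)%Z.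
Proof.
move=> pp bp h pa; have : (p%:Z %| qa Q * b ^+ 2)%Z.
  rewrite (_ : _ * _ = Nab a b + (3 * qb Q * b - 9 * qc Q * a) * a); last by rewrite NabE; ring.
  by rewrite rpredD ?dvdz_mull//; apply: dvdz_trans h; rewrite expr2 dvdz_mulr.
by rewrite (dvdz_prodE _ _ pp) (negbTE (big_qa bp)) (dvdz_primeX b 1 pp).
Qed.

Lemma poszX (p n : nat) : ((p ^ n)%N%:Z = p%:Z ^+ n)%R.
Proof. by elim: n => // n ih; rewrite expnS PoszM ih -exprS. Qed.

Lemma dvdz_subn (q a b : nat) : (q%:Z %| a%:Z - b%:Z)%Z = (a == b %[mod q])%N.
Proof. by rewrite -eqz_mod_dvd !modz_nat eqz_nat. Qed.

Lemma eq_of_mod_div (d a a' : nat) : a = a' %[mod d] -> (a %/ d)%N = (a' %/ d)%N -> a = a'.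
Proof. by move=> h1 h2; rewrite (divn_eq a d) (divn_eq a' d) h1 h2. Qed.

Lemma inord_eq (n a b : nat) : (a < n)%N -> (b < n)%N -> (inord a : 'I_n.-1.+1) = inord b -> a = b.
Proof.
move=> an bn; have n0 : (0 < n)%N by lia.
by move=> /(congr1 val); rewrite /= !inordK ?prednK.
Qed.

Lemma ltn_divLR' (a d u : nat) : (a < d * u)%N -> (a %/ d < u)%N.
Proof. by case: d => [|d] h; [rewrite mul0n in h|rewrite ltn_divLR// mulnC]. Qed.

Lemma coprime_modulus M p : prime p -> big p -> (M < p)%N -> coprime (modulus M) p.
Proof.
move=> pp bp Mp; rewrite coprime_sym /modulus coprimeMr; apply/andP; split.
  rewrite prime_coprime// /mQ expr2 !abszM !Euclid_dvdM// orbb negb_or.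
  have := big_qa bp; rewrite dvdzE /= => ->; rewrite andbT gtnNdvd//.
  by apply: ltn_trans (big_6 bp).
apply: coprimeXr; rewrite prime_coprime//; apply/negP.
elim: M Mp => [|M ih] Mp; first by rewrite dvdn1 => /eqP p1; move: pp; rewrite p1.
by rewrite factS Euclid_dvdM// gtnNdvd//= => /ih; apply; exact: ltnW.
Qed.

Lemma fact_dvd (m n : nat) : (m <= n)%N -> (m`! %| n`!)%N.
Proof.
elim: n => [|n ih]; first by rewrite leqn0 => /eqP ->.
by rewrite leq_eqVlt => /orP[/eqP -> //|/ih h]; rewrite factS dvdn_mull.
Qed.

Definition badp p (a b : nat) := (p%:Z ^+ 2 %| Nab a b)%Z.

(** By the Chinese remainder theorem, conditions modulo p are independent of the class modulo m0.
    When p does not divide a, the abscissa is free and the ordinate is fixed modulo p^2 by the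
    colour: 2 u^2 / p^2 points. Otherwise p divides both coordinates: u^2 / p^2 points. *)
Lemma badp_count M0 i j (u v p : nat) : prime p -> big p -> (M0 < p)%N -> u = (p ^ 2 * v)%N ->
  (cnt (modulus M0 * u) (fun a b => cls (modulus M0) i j a b && badp p a b) * p ^ 2 <= 3 * u ^ 2)%N.
Proof.
move=> pp bp Mp uv; set m0 := modulus M0; have m0_gt0 : (0 < m0)%N := modulus_gt0 M0.
have p0 := prime_gt0 pp.
case: (posnP v) => [v0|v0].
  by rewrite uv v0 !muln0 /cnt big_ord0 mul0n.
have u0 : (0 < u)%N by rewrite uv muln_gt0 expn_gt0 p0.
have cop : coprime m0 p := coprime_modulus pp bp Mp.
have [chi hchi] := colour pp bp.
have dz (x : nat) : (p%:Z %| x%:Z)%Z = (p %| x)%N by rewrite dvdzE.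
pose P1 a b := [&& cls m0 i j a b, badp p a b & ~~ (p %| a)%N].
pose P2 a b := [&& cls m0 i j a b, badp p a b & (p %| a)%N].
have h1 : (cnt (m0 * u) P1 <= 2 * u * v)%N.
  rewrite -(_ : #|{: bool * 'I_u.-1.+1 * 'I_v.-1.+1}| = (2 * u * v)%N); last first.
    by rewrite !card_prod card_bool !card_ord !prednK.
  apply: (@cnt_inj _ (m0 * u) P1 (fun a b => (chi a b, inord (a %/ m0), inord (b %/ (m0 * p ^ 2))))).
  move=> a b a' b' am bm am' bm' /and3P[/andP[/eqP ca /eqP cb] hb pa] /and3P[/andP[/eqP ca' /eqP cb'] hb' pa'].
  case=> ec e1 e2.
  have {e1} ea : a = a'.
    apply: (@eq_of_mod_div m0); first by rewrite ca ca'.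
    by apply: inord_eq e1; apply: ltn_divLR'.
  subst a'; split=> //.
  have bm2 (x : nat) : (x < m0 * u)%N -> (x %/ (m0 * p ^ 2) < v)%N.
    by move=> h; apply: ltn_divLR'; rewrite -mulnA -uv.
  apply: (@eq_of_mod_div (m0 * p ^ 2)); last by apply: inord_eq e2; exact: bm2.
  apply/eqP; rewrite chinese_remainder ?coprimeXr//; apply/andP; split; first by rewrite cb cb'.
  have := hchi _ _ _ _ hb _ hb' _ ec; rewrite dz => /(_ pa pa).
  rewrite -mulrBr mulrC => /(dvdz_cancel pp); rewrite dz => /(_ pa).
  by rewrite eq_sym -dvdz_subn poszX.
have h2 : (cnt (m0 * u) P2 <= (p * v) * (p * v))%N.
  have pv0 : (0 < p * v)%N by rewrite muln_gt0 p0.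
  rewrite -(_ : #|{: 'I_(p * v).-1.+1 * 'I_(p * v).-1.+1}| = (p * v * (p * v))%N); last first.
    by rewrite !card_prod !card_ord !prednK.
  apply: (@cnt_inj _ (m0 * u) P2 (fun a b => (inord (a %/ (m0 * p)), inord (b %/ (m0 * p))))).
  have key (x x' y : nat) : (x < m0 * u)%N -> (x' < m0 * u)%N -> x = y %[mod m0] -> x' = y %[mod m0] ->
     (p %| x)%N -> (p %| x')%N -> (inord (x %/ (m0 * p)) : 'I_(p * v).-1.+1) = inord (x' %/ (m0 * p)) -> x = x'.
    move=> xm xm' c c' d d' e; have bm2 (z : nat) : (z < m0 * u)%N -> (z %/ (m0 * p) < p * v)%N.
      by move=> h; apply: ltn_divLR'; rewrite (_ : m0 * p * (p * v) = m0 * u)%N// uv; ring.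
    apply: (@eq_of_mod_div (m0 * p)); last by apply: inord_eq e; exact: bm2.
    apply/eqP; rewrite chinese_remainder// c c' eqxx /=.
    by rewrite (eqP (d : _ == _)) (eqP (d' : _ == _)).
  move=> a b a' b' am bm am' bm' /and3P[/andP[/eqP ca /eqP cb] hb pa] /and3P[/andP[/eqP ca' /eqP cb'] hb' pa'] [e1 e2].
  split; first exact: (key _ _ _ am am' ca ca' pa pa' e1).
  have pb : (p %| b)%N by have := bad_both pp bp hb; rewrite !dz => /(_ pa).
  have pb' : (p %| b')%N by have := bad_both pp bp hb'; rewrite !dz => /(_ pa').
  exact: (key _ _ _ bm bm' cb cb' pb pb' e2).
have : (cnt (m0 * u) (fun a b => cls m0 i j a b && badp p a b) <= cnt (m0 * u) P1 + cnt (m0 * u) P2)%N.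
  by apply: cnt_or => a b _ _ /andP[h h']; rewrite /P1 /P2 h h' /= orNb.
move=> /leq_trans/(_ (leq_add h1 h2)) h3.
apply: (@leq_trans ((2 * u * v + p * v * (p * v)) * p ^ 2)); first by rewrite leq_mul2r h3 orbT.
by rewrite uv; apply: eq_leq; ring.
Qed.

Lemma cnt_cls m i j u : (i < m)%N -> (j < m)%N -> cnt (m * u) (cls m i j) = (u ^ 2)%N.
Proof.
move=> im jm; have m0 : (0 < m)%N by lia.
have rc l : (l < m)%N -> rcount m l (m * u) = u.
  move=> lm; rewrite rcountE// mulnC divnMDl// divn_small ?addn0//; lia.
have -> : cnt (m * u) (cls m i j) = (rcount m i (m * u) * rcount m j (m * u))%N.
  rewrite /cnt /rcount big_distrl; apply: eq_bigr => a _; rewrite big_distrr; apply: eq_bigr => b _.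
  by rewrite /cls /=; case: (a == _ %[mod _]); case: (b == _ %[mod _]).
by rewrite !rc.
Qed.

(** The class of (a0, b0) modulo m0 is good at all primes up to [bigB]. Larger primes remove a
    proportion of at most the sum of 3 / p^2, that is at most 1/2, whatever M is; hence the bound 1
    / (2 m0^2). *)
Lemma dens_good a0 b0 : good_all a0 b0 -> exists2 d : R, 0 < d &
  forall M, (bigB <= M)%N -> d <= dens R (modulus M) (good_upto M).
Proof.
move=> g0; set m0 := modulus bigB; have m0_gt0 : (0 < m0)%N := modulus_gt0 _.
have b6 := bigB_ge6.
have mR : (0 : R) < m0%:R by rewrite ltr0n.
exists (2 * m0%:R ^+ 2)^-1; first by rewrite invr_gt0 mulr_gt0 ?exprn_gt0.
move=> M hM; set m := modulus M.
have [u um] : exists u, m = (m0 * u)%N.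
  have /dvdnP[k ek] : (bigB`! %| M`!)%N by rewrite fact_dvd.
  by exists (k ^ 3)%N; rewrite /m /m0 /modulus ek expnMn; ring.
have u0 : (0 < u)%N by have := modulus_gt0 M; rewrite -/m um muln_gt0 => /andP[].
pose i := (a0 %% m0)%N; pose j := (b0 %% m0)%N.
have im : (i < m0)%N by rewrite ltn_pmod.
have jm : (j < m0)%N by rewrite ltn_pmod.
pose s := [seq p <- index_iota bigB.+1 M.+1 | prime p].
have h1 : (cnt m (cls m0 i j) <= cnt m (good_upto M) + \sum_(p <- s) cnt m (fun a b => cls m0 i j a b && badp p a b))%N.
  apply: (@leq_trans (cnt m (good_upto M) + cnt m (fun a b => cls m0 i j a b && ~~ good_upto M a b))).
    by apply: cnt_or => a b _ _ h; rewrite h /=; exact: orbN.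
  rewrite leq_add2l.
  apply: (@cnt_bigor _ s m (fun a b => cls m0 i j a b && ~~ good_upto M a b) (fun p a b => cls m0 i j a b && badp p a b)).
  move=> a b _ _ /andP[h ng].
  have : good_upto bigB a b.
    have /andP[/eqP ha /eqP hb] := h; have g1 := good_all_upto bigB g0.
    have tr x x0 : x = x0 %% m0 %[mod m0] -> cg m0 x%:Z x0%:Z.
      move=> e; exists ((x %/ m0)%N%:Z - (x0 %/ m0)%N%:Z).
      by rewrite {1}(divn_eq x m0) e modn_mod {2}(divn_eq x0 m0) !PoszD !PoszM; ring.
    by apply: good_cg g1; apply: tr.
  move=> /asboolP[f [ea eb ap pm]].
  have [p [pp pM np]] : exists p, [/\ prime p, (p <= M)%N & ~ pmax f p].
    apply: contrapT => hn; case/negP: ng; apply/asboolP; exists f; split=> // p pp pM.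
    by apply: contrapT => np; apply: hn; exists p.
  have bp : (bigB < p)%N by rewrite ltnNge; apply/negP => pb; apply: np; exact: pm.
  exists p; first by rewrite mem_filter pp mem_index_iota bp.
  by rewrite h /badp -ea -eb; apply: bad_prime.
rewrite um cnt_cls// in h1.
have h2 (p : nat) : p \in s -> ((cnt m (fun a b => cls m0 i j a b && badp p a b))%:R <= 3 * u%:R ^+ 2 * (p%:R ^+ 2)^-1 :> R).
  rewrite mem_filter mem_index_iota => /and3P[pp bp pM].
  have [v uv] : exists v, u = (p ^ 2 * v)%N.
    have /dvdnP[k ek] : (p * bigB`! %| M`!)%N.
      apply: (@dvdn_trans p`!); last by rewrite fact_dvd.
      case: p bp pp {pM} => // p bp _; rewrite factS dvdn_pmul2l// fact_dvd//.
    have : (m0 * u = m0 * (p ^ 2 * (p * k ^ 3)))%N by rewrite -um /m /m0 /modulus ek !expnMn; ring.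
    by move=> /eqP; rewrite eqn_pmul2l// => /eqP ->; exists (p * k ^ 3)%N.
  have := badp_count i j pp bp bp uv; rewrite -/m0 -um => h.
  rewrite ler_pdivlMr ?exprn_gt0 ?ltr0n ?prime_gt0//.
  by rewrite -!natrX -!natrM ler_nat.
have {h1} h1 : u%:R ^+ 2 <= (cnt m (good_upto M))%:R + 3 * u%:R ^+ 2 * (bigB%:R)^-1 :> R.
  rewrite -um in h1.
  have : u%:R ^+ 2 <= (cnt m (good_upto M))%:R + \sum_(p <- s) (cnt m (fun a b => cls m0 i j a b && badp p a b))%:R :> R.
    by rewrite -natrX -natr_sum -natrD ler_nat.
  move=> /le_trans; apply; rewrite lerD2l.
  apply: (@le_trans _ _ (\sum_(p <- s) (3 * u%:R ^+ 2 * (p%:R ^+ 2)^-1))).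
    by rewrite big_seq [leRHS]big_seq; apply: ler_sum.
  rewrite -mulr_sumr ler_wpM2l ?mulr_ge0 ?exprn_ge0//.
  apply: le_trans (@sum_inv_sqr R bigB M.+1 _); last by lia.
  by rewrite big_filter [leRHS](bigID prime) /= lerDl sumr_ge0// => p _; rewrite invr_ge0 exprn_ge0.
have h3 : (bigB%:R)^-1 <= 6^-1 :> R by rewrite lef_pV2 ?posrE ?ltr0n ?ler_nat//; lia.
rewrite /dens -cnt_card -/m.
have uR : (0 : R) < u%:R by rewrite ltr0n.
have mE : m%:R = m0%:R * u%:R :> R by rewrite um natrM.
rewrite mE exprMn ler_pdivlMr ?mulr_gt0 ?exprn_gt0//.
rewrite [leLHS](_ : _ = u%:R ^+ 2 / 2); last by field; lra.
have : u%:R ^+ 2 * bigB%:R^-1 <= u%:R ^+ 2 * 6^-1 :> R by rewrite ler_wpM2l ?exprn_ge0.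
by lra.
Qed.

Let sD : R := Num.sqrt (qdisc Q)%:~R.
(** [slo] and [shi] are the zeros b/a of the quadratic form [Nab]. As the coefficients of Q are
    negative, both are positive and the sign + gives the smaller one. *)
Definition slo : R := 3 * ((qb Q)%:~R + sD) / (2 * (qa Q)%:~R).
Definition shi : R := 3 * ((qb Q)%:~R - sD) / (2 * (qa Q)%:~R).
Definition kQ : R := - (qa Q)%:~R^-1.

Lemma sD_gt0 : 0 < sD. Proof. by rewrite sqrtr_gt0 ltr0z. Qed.
Lemma sqr_sD : sD ^+ 2 = (qb Q)%:~R ^+ 2 - 4 * (qa Q)%:~R * (qc Q)%:~R.
Proof. by rewrite sqr_sqrtr ?ler0z ?ltW// /qdisc; ring. Qed.

Lemma slo_gt0 : 0 < slo.
Proof.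
have a0 : (qa Q)%:~R < 0 :> R by rewrite ltrz0.
have b0 : (qb Q)%:~R < 0 :> R by rewrite ltrz0.
have c0 : (qc Q)%:~R < 0 :> R by rewrite ltrz0.
have s0 := sD_gt0; have s2 := sqr_sD.
have : sD < - (qb Q)%:~R.
  by rewrite -(ltr_pXn2r (n := 2)) ?nnegrE ?ltW ?oppr_gt0// sqrrN s2; nra.
by move=> h; rewrite /slo nmulr_rgt0 ?invr_lt0; nra.
Qed.

Lemma slo_shi : slo < shi.
Proof.
have a0 : (qa Q)%:~R < 0 :> R by rewrite ltrz0.
have s0 := sD_gt0.
by rewrite /slo /shi ltr_nM2r ?invr_lt0; nra.
Qed.

Lemma kQ_gt0 : 0 < kQ.
Proof. by rewrite /kQ oppr_gt0 invr_lt0 ltrz0. Qed.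

Lemma nform_Nab (a b : nat) : (qa Q)%:~R ^+ 2 * nform slo shi kQ a b = (Nab a b)%:~R.
Proof.
have a0 : (qa Q)%:~R != 0 :> R by rewrite intr_eq0 lt_eqF.
have s2 := sqr_sD.
transitivity ((qa Q)%:~R * b%:R ^+ 2 - 3 * (qb Q)%:~R * b%:R * a%:R
    + 9 * ((qb Q)%:~R ^+ 2 - sD ^+ 2) / (4 * (qa Q)%:~R) * a%:R ^+ 2).
  by rewrite /nform /kQ /slo /shi; field.
by rewrite s2 NabE; field.
Qed.

Lemma nform_hess f n (a b : nat) : fa f = a -> fb f = b -> apolar Q f -> hess f = qscale n Q ->
  nform slo shi kQ a b = n%:~R.
Proof.
move=> ea eb ap hn; have q0n : qa Q != 0 by rewrite lt_eqF.
have [n' hn' en'] := apolar_hess q0n pQ ap.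
have nn : n = n'.
  move: hn'; rewrite hn => -[h _ _]; exact: (mulIf q0n h).
apply: (@mulfI _ ((qa Q)%:~R ^+ 2)); first by rewrite expf_neq0// intr_eq0.
by rewrite nform_Nab nn -rmorphXn -rmorphM /= en' ea eb.
Qed.


Lemma small_intr (z : int) : `|z%:~R| < 1 :> R -> z = 0.
Proof. by rewrite -intr_norm ltrz1; lia. Qed.

Lemma mul_divS (N p : nat) : (p < N)%N -> ((N %/ p).+1 * p <= 2 * N)%N.
Proof. by move=> pN; rewrite mulSn; have := leq_divM N p; lia. Qed.

Lemma cnt_both N p : (cnt N (fun a b => (p %| a)%N && (p %| b)%N) <= (N %/ p).+1 * (N %/ p).+1)%N.
Proof.
rewrite -(_ : #|{: 'I_(N %/ p).+1 * 'I_(N %/ p).+1}| = ((N %/ p).+1 * (N %/ p).+1)%N); last first.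
  by rewrite card_prod !card_ord.
have hx (z : nat) : (z < N)%N -> (z %/ p < (N %/ p).+1)%N by move=> zN; rewrite ltnS leq_div2r// ltnW.
apply: (@cnt_inj _ N _ (fun a b => (inord (a %/ p), inord (b %/ p)))).
have key (x x' : nat) : (x < N)%N -> (x' < N)%N -> (p %| x)%N -> (p %| x')%N ->
   (inord (x %/ p) : 'I_(N %/ p).+1) = inord (x' %/ p) -> x = x'.
  move=> xB xB' d d' /(congr1 (@nat_of_ord _)); rewrite !inordK ?hx// => e.
  by rewrite -(divnK d) -(divnK d') e.
move=> a b a' b' am bm am' bm' /andP[pa pb] /andP[pa' pb'] [e1 e2].
by split; [exact: key e1|exact: key e2].
Qed.

(** * The tail of the sieve *)

Section Tail.
Variables T1 T2 : R.
Hypothesis T12 : T1 <= T2.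
Let rg := region slo shi kQ T1 T2.
Let bx := box slo shi kQ T1 T2.
Let ph := phi0 slo shi kQ T1 T2.

(** A box of side N > l has at most (2N / l)^2 points with both coordinates divisible by l; the
    bound follows from N <= 2 [boxC] B by summing 1 / l^2 over l > M. *)
Lemma tail_both M : (0 < M)%N ->
  ub (fun B => (cnt (bx B) (fun a b => [&& rg B a b & [exists l : 'I_(bx B), [&& prime l, (M < l)%N, (l %| a)%N & (l %| b)%N]]]))%:R)
     (16 * boxC slo shi kQ T1 T2 ^+ 2 / M%:R).
Proof.
move=> M0; set C := boxC _ _ _ _ _.
have MR : (0 : R) < M%:R by rewrite ltr0n.
have s1 := slo_gt0; have s12 := slo_shi.
have C0 : 0 < C.
  by rewrite /C /boxC mulr_gt0 ?addr_gt0 ?invr_gt0 ?sqrtr_gt0 ?phi0_gt0 ?kQ_gt0//; apply: lt_trans s12.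
apply: (ub_le _ (@ub_sqr R _)); exists (Num.max 1 (C^-1)) => B; rewrite ge_max => /andP[B1 BC].
have B0 : 0 < B by lra.
have CB1 : 1 <= C * B by rewrite -ler_pdivrMl// mulr1.
have bxB : (bx B)%:R <= 2 * (C * B).
  rewrite /bx /box -natr1 -/C; have := @Num.Theory.trunc_itv R (C * B).
  by rewrite -/C; have /andP[h _] := truncn_itv (ltW (mulr_gt0 C0 B0)); lra.
pose s := [seq p <- index_iota M.+1 (bx B) | prime p].
have h1 : (cnt (bx B) (fun a b => [&& rg B a b & [exists l : 'I_(bx B), [&& prime l, (M < l)%N, (l %| a)%N & (l %| b)%N]]])
   <= \sum_(p <- s) cnt (bx B) (fun a b => (p %| a)%N && (p %| b)%N))%N.
  apply: (@cnt_bigor _ s (bx B) _ (fun p a b => (p %| a)%N && (p %| b)%N)) => a b _ _ /andP[_ /existsP[l /and4P[pl Ml la lb]]].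
  by exists (nat_of_ord l); rewrite ?la ?lb// mem_filter pl mem_index_iota Ml ltn_ord.
have h2 (p : nat) : p \in s -> (cnt (bx B) (fun a b => (p %| a)%N && (p %| b)%N))%:R <= 4 * (bx B)%:R ^+ 2 * (p%:R ^+ 2)^-1 :> R.
  rewrite mem_filter mem_index_iota => /and3P[pp pM pB].
  have p0 : (0 < p)%N := prime_gt0 pp.
  have pR : (0 : R) < p%:R by rewrite ltr0n.
  have c1 := cnt_both (bx B) p.
  have c2 : ((bx B %/ p).+1 * p <= 2 * bx B)%N.
    exact: mul_divS.
  rewrite ler_pdivlMr ?exprn_gt0//.
  have {}c1 : (cnt (bx B) (fun a b => (p %| a)%N && (p %| b)%N))%:R <= (bx B %/ p).+1%:R ^+ 2 :> R.
    by rewrite -natrX ler_nat -mulnn.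
  have {}c2 : (bx B %/ p).+1%:R * p%:R <= 2 * (bx B)%:R :> R by rewrite -!natrM ler_nat.
  apply: (@le_trans _ _ (((bx B %/ p).+1%:R * p%:R) ^+ 2)).
    by rewrite exprMn ler_wpM2r ?exprn_ge0.
  rewrite [leRHS](_ : _ = (2 * (bx B)%:R) ^+ 2); last by ring.
  by rewrite ler_pXn2r ?nnegrE ?mulr_ge0.
have {}h1 : (cnt (bx B) (fun a b => [&& rg B a b & [exists l : 'I_(bx B), [&& prime l, (M < l)%N, (l %| a)%N & (l %| b)%N]]]))%:R
   <= \sum_(p <- s) (4 * (bx B)%:R ^+ 2 * (p%:R ^+ 2)^-1) :> R.
  apply: (@le_trans _ _ (\sum_(p <- s) (cnt (bx B) (fun a b => (p %| a)%N && (p %| b)%N))%:R)).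
    by rewrite -natr_sum ler_nat.
  by rewrite big_seq [leRHS]big_seq; apply: ler_sum.
apply: le_trans h1 _; rewrite -mulr_sumr.
have h3 : \sum_(p <- s) (p%:R ^+ 2)^-1 <= M%:R^-1 :> R.
  apply: le_trans (@sum_inv_sqr R M (bx B) M0).
  by rewrite big_filter [leRHS](bigID prime) /= lerDl sumr_ge0// => p _; rewrite invr_ge0 exprn_ge0.
apply: (@le_trans _ _ (4 * (bx B)%:R ^+ 2 * M%:R^-1)).
  by rewrite ler_wpM2l// mulr_ge0 ?exprn_ge0.
rewrite (_ : 16 * C ^+ 2 / M%:R * B ^+ 2 = 4 * (2 * (C * B)) ^+ 2 / M%:R); last by field; lra.
by rewrite ler_pM2r ?invr_gt0// ler_pM2l// ler_pXn2r ?nnegrE ?mulr_ge0//; lra.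
Qed.

Lemma region_slope B a b : rg B a b -> (0 < a)%N /\ slo * a%:R < b%:R /\ b%:R < shi * a%:R.
Proof.
move=> /and3P[a0 /andP[b1 b2] _]; split=> //.
have aR : (0 : R) < a%:R by rewrite ltr0n.
have s12 := slo_shi.
have hb := slope_bounds slo_gt0 slo_shi kQ_gt0 T12.
have /andP[x1 x2] := hb T1; have /andP[x3 x4] := hb T2.
split; first by apply: lt_le_trans b1; rewrite ltr_pM2r.
by apply: lt_trans b2 _; rewrite ltr_pM2r.
Qed.

Lemma region_n B f n (a b : nat) : 0 < B -> fa f = a -> fb f = b -> apolar Q f -> hess f = qscale n Q ->
  rg B a b -> 0 < n /\ n%:~R < B ^+ 2 :> R.
Proof.
move=> B0 ea eb ap hn r; rewrite -(nform_hess ea eb ap hn); have [a0 [x1 x2]] := region_slope r.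
split; last by case/and3P: r.
rewrite -(ltr0z R) -(nform_hess ea eb ap hn) /nform !mulr_gt0 ?subr_gt0 ?kQ_gt0//.
Qed.

(** Apolarity makes the gcd g of a and b divide [mQ] c and [mQ] d. The four coefficients have no
    common prime, by maximality at primes up to M and by the exclusion of larger ones, so g divides
    [mQ]. *)
Lemma gcd_bound M f (a b : nat) : fa f = a -> fb f = b -> (0 < a)%N -> apolar Q f ->
  (forall p, prime p -> (p <= M)%N -> pmax f p) -> (forall l, prime l -> (M < l)%N -> (l %| a)%N -> (l %| b)%N -> False) ->
  (gcdn a b <= `|mQ|)%N.
Proof.
move=> ea eb a0 [e1 e2] pm hl; set g := gcdn a b.
have g0 : (0 < g)%N by rewrite gcdn_gt0 a0.
have ga : (g%:Z %| fa f)%Z by rewrite ea dvdzE /= dvdn_gcdl.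
have gb : (g%:Z %| fb f)%Z by rewrite eb dvdzE /= dvdn_gcdr.
have gc : (g%:Z %| qa Q * fc f)%Z.
  rewrite (_ : _ * _ = qb Q * fb f - 3 * qc Q * fa f); last by lia.
  by rewrite rpredB// dvdz_mull.
have gd : (g%:Z %| mQ * fd f)%Z.
  rewrite (_ : _ * _ = qb Q * (qa Q * fc f) - qa Q * qc Q * fb f); last first.
    rewrite /mQ; transitivity (qa Q * (3 * qa Q * fd f)); first by ring.
    by rewrite (_ : 3 * qa Q * fd f = qb Q * fc f - qc Q * fb f); [ring|lia].
  by rewrite rpredB// dvdz_mull.
pose e := gcdn (gcdn a b) (gcdn `|fc f| `|fd f|).
have e1' : e = 1%N.
  apply/eqP/negPn/negP => ne; have e0 : (0 < e)%N by rewrite gcdn_gt0 g0.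
  have pl : prime (pdiv e) by rewrite pdiv_prime//; lia.
  have := pdiv_dvd e; rewrite {2}/e !dvdn_gcd => /andP[/andP[la lb] /andP[lc ld]].
  have [lM|lM] := leqP (pdiv e) M; last exact: hl pl lM la lb.
  by apply: (pmax_content pl (pm _ pl lM)); rewrite ?ea ?eb dvdzE.
have gg : (g %| `|mQ| * e)%N.
  rewrite /e !muln_gcdr !dvdn_gcd; apply/andP; split; apply/andP; split.
  - by rewrite dvdn_mull// dvdn_gcdl.
  - by rewrite dvdn_mull// dvdn_gcdr.
  - have : (g%:Z %| mQ * fc f)%Z.
      by rewrite (_ : _ * _ = 3 * qa Q * (qa Q * fc f)); [rewrite dvdz_mull|rewrite /mQ; ring].
    by rewrite dvdzE abszM.
  - by move: gd; rewrite dvdzE abszM.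
by rewrite e1' muln1 in gg; apply: dvdn_leq gg; rewrite absz_gt0 gt_eqF ?mQ_gt0.
Qed.

Lemma cross_inj (a b a' b' : nat) : (0 < a)%N -> (0 < a')%N -> (a * b' = a' * b)%N -> gcdn a b = gcdn a' b' -> a = a' /\ b = b'.
Proof.
move=> a0 a0' e g; have ga : (a * gcdn a' b' = a' * gcdn a b)%N.
  by rewrite !muln_gcdr e [(a * a')%N]mulnC.
have g0 : (0 < gcdn a' b')%N by rewrite gcdn_gt0 a0'.
have ea : a = a' by move/eqP: ga; rewrite g eqn_pmul2r// => /eqP.
by subst a'; split=> //; move/eqP: e; rewrite eqn_pmul2l// => /eqP.
Qed.

Definition tailp M p (B : R) a b := [&& rg B a b, good_upto M a b, ~~ (p %| a)%N, badp p a b &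
   ~~ [exists l : 'I_(bx B), [&& prime l, (M < l)%N, (l %| a)%N & (l %| b)%N]]].

(** A point is determined by its colour, its gcd and the bin of its slope: two points with the same
    data have a cross product divisible by p^2 and smaller than p^2, hence zero, so they are
    proportional, and equal gcds make them equal. *)
Lemma tailp_count M p B : prime p -> big p -> 0 < B ->
  (cnt (bx B) (tailp M p B))%:R <= 2 * (`|mQ|.+1)%:R * ((shi - slo) / ph * B ^+ 2 * (p%:R ^+ 2)^-1 + 1) :> R.
Proof.
move=> pp bp B0; have p0 : (0 : R) < p%:R by rewrite ltr0n prime_gt0.
have s1 := slo_gt0; have s12 := slo_shi; have kQ0 := kQ_gt0.
have php : 0 < ph by rewrite /ph phi0_gt0.
set Y := (shi - slo) / ph * B ^+ 2 * (p%:R ^+ 2)^-1.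
have Y0 : 0 <= Y by rewrite !mulr_ge0 ?invr_ge0 ?exprn_ge0//; lra.
(* Since [nb] exceeds Y, two points of the region whose slopes lie in one of [nb] equal bins have a
   cross product below p^2 in absolute value. *)
pose nb := (Num.trunc Y).+1.
have nbY : Y < nb%:R by rewrite truncnS_gt.
have nbY1 : nb%:R <= Y + 1 by rewrite -natr1 lerD2r; have /andP[] := truncn_itv Y0.
have nbR : (0 : R) < nb%:R by rewrite ltr0n.
have [chi hchi] := colour pp bp.
pose bin (a b : nat) : nat := Num.trunc ((b%:R / a%:R - slo) / (shi - slo) * nb%:R).
suff h : (cnt (bx B) (tailp M p B) <= 2 * `|mQ|.+1 * nb)%N.
  apply: (@le_trans _ _ (2 * `|mQ|.+1 * nb)%:R); first by rewrite ler_nat.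
  by rewrite !natrM ler_wpM2l// mulr_ge0.
rewrite -(_ : #|{: bool * 'I_(`|mQ|.+1) * 'I_nb}| = (2 * `|mQ|.+1 * nb)%N); last first.
  by rewrite !card_prod card_bool !card_ord.
apply: (@cnt_inj _ _ _ (fun a b => (chi a b, inord (gcdn a b), inord (bin a b)))).
have aux a b : (a < bx B)%N -> (b < bx B)%N -> tailp M p B a b -> [/\ (0 < a)%N, (gcdn a b <= `|mQ|)%N, (bin a b < nb)%N,
   a%:R < B / Num.sqrt ph :> R & (bin a b)%:R <= (b%:R / a%:R - slo) / (shi - slo) * nb%:R < (bin a b)%:R + 1].
  move=> am bm /and5P[r g pa hb nl]; have [a0 [x1 x2]] := region_slope r.
  have aR : (0 : R) < a%:R by rewrite ltr0n.
  have y1 : 0 < (b%:R / a%:R - slo) / (shi - slo).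
    by rewrite divr_gt0 ?subr_gt0// ltr_pdivlMr.
  have y2 : (b%:R / a%:R - slo) / (shi - slo) < 1.
    by rewrite ltr_pdivrMr ?subr_gt0// mul1r ltrD2r ltr_pdivrMr.
  have y3 : 0 <= (b%:R / a%:R - slo) / (shi - slo) * nb%:R by rewrite mulr_ge0// ltW.
  have /andP[t1 t2] := truncn_itv y3.
  split=> //.
  - case/asboolP: g => f [ea eb ap pm]; apply: (gcd_bound ea eb a0 ap pm) => l pl Ml la lb.
    have lB : (l < bx B)%N by apply: leq_ltn_trans (dvdn_leq a0 la) am.
    by case/existsP: nl; exists (Ordinal lB); rewrite pl Ml la lb.
  - rewrite -(ltr_nat R); apply: le_lt_trans t1 _.
    by rewrite gtr_pMl.
  - by have [] := region_small s1 s12 kQ0 T12 (lexx _) (lexx _) B0 r.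
  - by rewrite t1 natr1.
move=> a b a' b' am bm am' bm' ht ht' [ec eg eb].
have [a0 g0 b0 aX /andP[u1 u2]] := aux a b am bm ht.
have [a0' g0' b0' aX' /andP[u1' u2']] := aux a' b' am' bm' ht'.
have {}eg : gcdn a b = gcdn a' b' by move: eg => /(congr1 val) /=; rewrite !inordK.
have {}eb : bin a b = bin a' b' by move: eb => /(congr1 val) /=; rewrite !inordK.
apply: cross_inj eg => //; apply/eqP; rewrite -(eqr_nat R) !natrM -subr_eq0.
move/and5P: ht => [_ _ pa hb _]; move/and5P: ht' => [_ _ pa' hb' _].
have dz (x : nat) : (p%:Z %| x%:Z)%Z = (p %| x)%N by rewrite dvdzE.
have := hchi _ _ _ _ hb _ hb' _ ec; rewrite !dz => /(_ pa pa') /dvdzP[z ez].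
have {hchi ec} cr : `|a%:R * b'%:R - a'%:R * b%:R| < p%:R ^+ 2 :> R.
  have aR : (0 : R) < a%:R by rewrite ltr0n.
  have aR' : (0 : R) < a'%:R by rewrite ltr0n.
  set x := b%:R / a%:R in u1 u2; set x' := b'%:R / a'%:R in u1' u2'.
  have bE : b%:R = x * a%:R by rewrite /x divfK// gt_eqF.
  have bE' : b'%:R = x' * a'%:R by rewrite /x' divfK// gt_eqF.
  have d1 : `|(x' - x) / (shi - slo) * nb%:R| < 1.
    rewrite (_ : _ * _ = (x' - slo) / (shi - slo) * nb%:R - (x - slo) / (shi - slo) * nb%:R); last by field; lra.
    by rewrite ltr_norml; rewrite eb in u1 u2; lra.
  rewrite bE bE' (_ : _ - _ = (x' - x) * (a%:R * a'%:R)); last by ring.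
  rewrite normrM [X in _ * X]ger0_norm ?mulr_ge0//.
  have d2 : `|x' - x| * nb%:R < shi - slo.
    move: d1; rewrite !normrM normfV (gtr0_norm nbR) (@gtr0_norm _ (shi - slo)) ?subr_gt0//.
    by rewrite mulrAC ltr_pdivrMr ?subr_gt0// mul1r.
  have d3 : a%:R * a'%:R <= B ^+ 2 / ph.
    rewrite (_ : B ^+ 2 / ph = (B / Num.sqrt ph) * (B / Num.sqrt ph)); last first.
      by rewrite -expr2 expr_div_n sqr_sqrtr// ltW.
    by apply: ler_pM => //; apply: ltW.
  have d4 : (shi - slo) * (B ^+ 2 / ph) < nb%:R * p%:R ^+ 2.
    by rewrite -ltr_pdivrMr ?exprn_gt0//; move: nbY; rewrite /Y; congr (_ < _); field; lra.
  apply: le_lt_trans (ler_wpM2l (normr_ge0 _) d3) _.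
  rewrite -(ltr_pM2l nbR); apply: le_lt_trans d4.
  rewrite mulrA [nb%:R * _]mulrC; apply: ler_wpM2r; last exact: ltW.
  by apply: divr_ge0; [exact: sqr_ge0|exact: ltW].
have ez' : a%:R * b'%:R - a'%:R * b%:R = z%:~R * p%:R ^+ 2 :> R.
  by rewrite -(natz_exp _ p 2) -[RHS]rmorphM /= -ez rmorphB !rmorphM.
rewrite ez' normrM [X in _ * X]ger0_norm ?exprn_ge0// in cr.
have {}cr : `|z%:~R| < 1 :> R by rewrite -[ltRHS](@mulfV _ (p%:R ^+ 2)) ?ltr_pdivlMr ?exprn_gt0 ?expf_neq0 ?gt_eqF.
by rewrite ez' (small_intr cr) mul0r.
Qed.

Definition tailC := 16 * boxC slo shi kQ T1 T2 ^+ 2 + 2 * (`|mQ|.+1)%:R * ((shi - slo) / ph).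

(** A prime p > M at which maximality fails satisfies p^2 | n and n < B^2, so only primes up to B
    occur. Summing [tailp_count] gives O(B^2 / M) from the terms B^2 / p^2 and O(B) from the terms
    1. *)
Lemma tail M : (bigB <= M)%N ->
  ub (fun B => (cnt (bx B) (fun a b => [&& good_upto M a b, ~~ good_all a b & rg B a b]))%:R) (tailC / M%:R).
Proof.
move=> hM; have M0 : (0 < M)%N by have := bigB_ge6; lia.
have MR : (0 : R) < M%:R by rewrite ltr0n.
have s12 := slo_shi.
have php : 0 < ph by rewrite /ph phi0_gt0// ?slo_gt0 ?kQ_gt0.
set K : R := 2 * (`|mQ|.+1)%:R.
have K0 : 0 <= K by rewrite /K mulr_ge0.
have main := ub_add (tail_both M0) (ub_add (@ub_sqr R (K * ((shi - slo) / ph) / M%:R)) (@ub_linear R (2 * K))).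
have e : 16 * boxC slo shi kQ T1 T2 ^+ 2 / M%:R + (K * ((shi - slo) / ph) / M%:R + 0) = tailC / M%:R.
  by rewrite addr0 -mulrDl.
rewrite e in main; apply: ub_le main; exists 1 => B B1.
have B0 : 0 < B by lra.
set E := fun a b : nat => _ && [exists _, _].
pose s := [seq p <- index_iota M.+1 (Num.trunc B).+1 | prime p].
have h1 : (cnt (bx B) (fun a b => [&& good_upto M a b, ~~ good_all a b & rg B a b]) <=
  cnt (bx B) E + \sum_(p <- s) cnt (bx B) (tailp M p B))%N.
  apply: (@leq_trans (cnt (bx B) E + cnt (bx B) (fun a b => [&& good_upto M a b, ~~ good_all a b, rg B a b & ~~ E a b]))).
    by apply: cnt_or => a b _ _ /and3P[-> -> ->] /=; exact: orbN.
  rewrite leq_add2l; apply: (@cnt_bigor _ s (bx B) _ (fun p => tailp M p B)) => a b am bm /and4P[g ng r nE].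
  have [a0 [x1 x2]] := region_slope r.
  rewrite /E r /= in nE.
  have /asboolP[f [ea eb ap pm]] := g.
  have [p [pp np]] : exists p, prime p /\ ~ pmax f p.
    apply: contrapT => hn; case/negP: ng; apply/asboolP; exists f; split=> // p pp _.
    by apply: contrapT => np; apply: hn; exists p.
  have Mp : (M < p)%N by rewrite ltnNge; apply/negP => pM; apply: np; exact: pm.
  have bp : big p by apply: leq_ltn_trans hM Mp.
  have bad : badp p a b by rewrite /badp -ea -eb; apply: bad_prime.
  have pa : ~~ (p %| a)%N.
    apply/negP => pa; have pb : (p %| b)%N.
      by have := bad_both pp bp bad; rewrite !dvdzE /=; apply.
    have pB : (p < bx B)%N by apply: leq_ltn_trans (dvdn_leq a0 pa) am.
    by case/existsP: nE; exists (Ordinal pB); rewrite pp Mp pa pb.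
  exists p; last by rewrite /tailp r g pa bad.
  rewrite mem_filter pp mem_index_iota Mp /=.
  have [n hn en] := apolar_hess (ltr0_neq0 q0) pQ ap.
  have [n0 nB] := region_n B0 ea eb ap hn r.
  have : (p%:Z ^+ 2 %| n)%Z.
    have qp : ~~ (p%:Z %| qa Q ^+ 2)%Z by rewrite (dvdz_primeX _ 1 pp) big_qa.
    by apply: (dvdz_cancel pp qp); rewrite mulrC en ea eb.
  move=> /dvdzP[z ez]; rewrite ltnS.
  have pn : p%:R ^+ 2 <= n%:~R :> R.
    rewrite -(natz_exp _ p 2) ler_int ez ler_peMl ?exprn_ge0//.
    have : 0 < z * p%:Z ^+ 2 by rewrite -ez.
    by rewrite pmulr_lgt0 ?exprn_gt0 ?ltz_nat ?prime_gt0//; lia.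
  have pB : p%:R < B by rewrite -(ltr_pXn2r (n := 2)) ?nnegrE//; [exact: le_lt_trans nB|lra].
  have : (p%:R : R) < (Num.trunc B).+1%:R by apply: lt_trans pB _; rewrite truncnS_gt.
  by rewrite ltr_nat ltnS.
have {h1}h1 : (cnt (bx B) (fun a b => [&& good_upto M a b, ~~ good_all a b & rg B a b]))%:R <=
  (cnt (bx B) E)%:R + \sum_(p <- s) (cnt (bx B) (tailp M p B))%:R :> R.
  by rewrite -natr_sum -natrD ler_nat.
apply: le_trans h1 _; rewrite lerD2l.
apply: (@le_trans _ _ (\sum_(p <- s) (K * ((shi - slo) / ph * B ^+ 2) * (p%:R ^+ 2)^-1 + K))).
  rewrite big_seq [leRHS]big_seq; apply: ler_sum => p.
  rewrite mem_filter mem_index_iota => /and3P[pp Mp _].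
  have bp : big p by apply: leq_ltn_trans hM Mp.
  apply: le_trans (tailp_count M pp bp B0) _.
  by rewrite -/K le_eqVlt; apply/orP; left; apply/eqP; ring.
rewrite big_split /= -mulr_sumr; apply: lerD.
  have h3 : \sum_(p <- s) (p%:R ^+ 2)^-1 <= M%:R^-1 :> R.
    apply: le_trans (@sum_inv_sqr R M (Num.trunc B).+1 M0).
    by rewrite big_filter [leRHS](bigID prime) /= lerDl sumr_ge0// => p _; rewrite invr_ge0 exprn_ge0.
  apply: (@le_trans _ _ (K * ((shi - slo) / ph * B ^+ 2) * M%:R^-1)).
    rewrite ler_wpM2l// mulr_ge0// mulr_ge0 ?sqr_ge0// divr_ge0//; [lra|exact: ltW].
  by rewrite le_eqVlt; apply/orP; left; apply/eqP; ring.
have -> : \sum_(i <- s) K = (size s)%:R * K by rewrite big_const_seq count_predT iter_addr_0 mulr_natl.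
rewrite (_ : 2 * K * B = 2 * B * K); last by ring.
rewrite ler_wpM2r//.
have : (size s <= (Num.trunc B).+1)%N.
  by rewrite size_filter; apply: leq_trans (count_size _ _) _; rewrite size_iota; lia.
rewrite -(ler_nat R) -natr1 => /le_trans; apply.
by have /andP[h _] := truncn_itv (ltW B0); lra.
Qed.

End Tail.

(** The density is the infimum over M of the densities of the periodic sets [good_upto M]. Each M
    gives an upper bound; the tail, of density O(1 / M), gives the lower bound. *)
Lemma good_density a0 b0 : good_all a0 b0 -> exists2 d : R, 0 < d &
  forall T1 T2, T1 <= T2 ->
   let F B := (cnt (box slo shi kQ T1 T2 B) (fun a b => good_all a b && region slo shi kQ T1 T2 B a b))%:R : R in
   ub F (kappa slo shi kQ * d * (T2 - T1)) /\ lb F (kappa slo shi kQ * d * (T2 - T1)).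
Proof.
move=> g0; have [d0 d00 hd0] := dens_good g0.
pose dn M := dens R (modulus M) (good_upto M).
pose S := [set x : R | exists2 M, (bigB <= M)%N & x = dn M].
have hS : has_inf S.
  split; first by exists (dn bigB); exists bigB.
  by exists d0 => x [M hM ->]; exact: hd0.
exists (inf S).
  by apply: lt_le_trans d00 _; apply: lb_le_inf hS.1 _ => x [M hM ->]; exact: hd0.
move=> T1 T2 T12 F; have kp := kappa_gt0 slo_gt0 slo_shi kQ_gt0 T12.
set kap := kappa _ _ _ in kp *.
have kT : 0 <= kap * (T2 - T1) by apply: mulr_ge0; [exact: ltW|rewrite subr_ge0].
split.
  apply: ub_approx => e e0.
  have e1 : 0 < e / (kap * (T2 - T1) + 1) by rewrite divr_gt0//; lra.
  have [x [M hM ->] hx] := inf_adherent e1 hS.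
  apply: (@ub_weak _ _ (kap * dn M * (T2 - T1))).
    rewrite mulrAC [kap * inf S * _]mulrAC; apply: (@le_trans _ _ (kap * (T2 - T1) * (inf S + e / (kap * (T2 - T1) + 1)))).
      by rewrite ler_wpM2l// ltW.
    rewrite mulrDr lerD2l mulrCA; apply: ler_piMr; first exact: ltW.
    by rewrite ler_pdivrMr; lra.
  apply: (ub_le _ (region_ub slo_gt0 slo_shi kQ_gt0 T12 (modulus_gt0 M) (good_periodic M) (lexx T1) T12 (lexx T2))).
  exists 0 => B _; rewrite ler_nat; apply: cnt_le => a b _ _ /andP[g ->]; rewrite andbT.
  exact: good_all_upto.
apply: lb_approx => e e0.
set Ct := tailC T1 T2.
pose M := maxn bigB (Num.trunc (`|Ct| / e)).+1.
have hM : (bigB <= M)%N by rewrite leq_maxl.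
have MR : (0 : R) < M%:R by rewrite ltr0n (leq_trans _ (leq_maxr _ _)).
have eM : Ct / M%:R <= e.
  rewrite ler_pdivrMr// mulrC -ler_pdivrMr//.
  apply: (@le_trans _ _ (`|Ct| / e)); first by rewrite ler_pM2r ?invr_gt0// ler_norm.
  by apply: ltW; apply: lt_le_trans (truncnS_gt _) _; rewrite ler_nat leq_maxr.
have tl := ub_opp (tail T12 hM).
have := lb_add (region_lb slo_gt0 slo_shi kQ_gt0 T12 (modulus_gt0 M) (good_periodic M) (lexx T1) T12 (lexx T2)) tl.
move=> h; apply: (@lb_weak _ _ (kap * dn M * (T2 - T1) + - (Ct / M%:R))).
  rewrite lerD ?lerN2// mulrAC [leRHS]mulrAC ler_wpM2l//.
  by apply: ge_inf; [exact: hS.2|exists M].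
apply: (lb_le _ h); exists 0 => B _; rewrite lerBlDr -natrD ler_nat.
by apply: cnt_or => a b _ _ /andP[g r]; rewrite g r !andbT /=; exact: orbN.
Qed.

End Sieve.

(** * Fields attached to lattice points *)

Lemma size_cubic (c1 c2 c3 : rat) : size ('X^3 - c1 *: 'X^2 + c2 *: 'X - c3%:P) = 4%N.
Proof.
rewrite -!addrA size_polyDl size_polyXn//.
rewrite (leq_ltn_trans (size_polyD _ _))// gtn_max size_polyN ltnS (leq_trans (size_scale_leq _ _)) ?size_polyXn//=.
rewrite (leq_ltn_trans (size_polyD _ _))// gtn_max size_polyN ltnS (leq_trans (size_scale_leq _ _)) ?size_polyX//=.
by rewrite (leq_ltn_trans (size_polyC_leq1 _)).
Qed.

Lemma cubic_horner (c1 c2 c3 x : rat) :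
  ('X^3 - c1 *: 'X^2 + c2 *: 'X - c3%:P).[x] = x ^+ 3 - c1 * x ^+ 2 + c2 * x - c3.
Proof. by rewrite !hornerE. Qed.

Lemma basis_of_span3 (K : fieldExtType rat) (om th : K) : \dim {:K} = 3%N ->
  (forall x, x \in span [:: 1; om; th]) -> basis_of {:K} [tuple 1; om; th].
Proof.
move=> d3 h; rewrite basisEdim d3 /= andbT; apply/subvP => x _; exact: h.
Qed.

(** The cubic is the characteristic polynomial of om, irreducible for want of a rational root. A
    root z is adjoined and the relation for om^2 is solved for the second basis element t. *)
Lemma field_of_cubic f : fa f != 0 ->
  (forall x : rat, x ^+ 3 - (fb f)%:~R * x ^+ 2 + (fa f * fc f)%:~R * x - (fa f ^+ 2 * fd f)%:~R != 0) ->
  exists (K : fieldExtType rat) (om th : K),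
    [/\ \dim {:K} = 3%N, basis_of {:K} [tuple 1; om; th] & cubic_rel f om th].
Proof.
move=> a0 nr.
pose p : {poly rat} := 'X^3 - (fb f)%:~R *: 'X^2 + (fa f * fc f)%:~R *: 'X - (fa f ^+ 2 * fd f)%:~R%:P.
have ip : irreducible_poly p.
  by apply: cubic_irreducible; rewrite ?size_cubic// => x; rewrite rootE cubic_horner.
have [K dK [z rz fz]] := irredp_FAdjoin ip.
have d3 : \dim {:K} = 3%N by rewrite dK size_cubic.
have aK : (fa f)%:~R != 0 :> K.
  by rewrite -(@io_int K) fmorph_eq0 intr_eq0.
have ez : z ^+ 3 - (fb f)%:~R * z ^+ 2 + (fa f * fc f)%:~R * z - (fa f ^+ 2 * fd f)%:~R = 0.
  have em : map_poly (GRing.in_alg K) p = map_poly (@io K) p by apply: eq_map_poly => u; rewrite ioE.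
  move: rz; rewrite rootE em /p !(rmorphB, rmorphD) /= !linearZ_LR /= map_polyC map_polyX !map_polyXn /=.
  by rewrite !hornerE /= !io_int => /eqP <-; ring.
pose t := (- z ^+ 2 + (fb f)%:~R * z - (fa f * fc f)%:~R) / (fa f)%:~R.
have ta : (fa f)%:~R * t = - z ^+ 2 + (fb f)%:~R * z - (fa f * fc f)%:~R by rewrite /t mulrC divfK.
have ez' : z ^+ 3 = (fb f)%:~R * z ^+ 2 - (fa f * fc f)%:~R * z + (fa f ^+ 2 * fd f)%:~R.
  by apply/eqP; rewrite -subr_eq0 -[X in _ == X]ez; apply/eqP; ring.
have zt : z * t = - (fa f)%:~R * (fd f)%:~R.
  apply: (mulfI aK); rewrite mulrCA ta mulrBr mulrDr mulrN -exprS ez'; ring.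
have rel : cubic_rel f z t.
  split=> //; first by rewrite [(fa f)%:~R * t]ta; ring.
  apply: (mulfI aK); rewrite expr2 mulrA ta.
  transitivity (- z * (z * t) + (fb f)%:~R * (z * t) - (fa f * fc f)%:~R * t); first by ring.
  rewrite zt; transitivity ((fa f)%:~R * (fd f)%:~R * z - (fa f)%:~R * (fb f)%:~R * (fd f)%:~R - (fc f)%:~R * ((fa f)%:~R * t)); first by ring.
  by ring.
exists K, z, t; split=> //; apply: basis_of_span3 => // x.
set V := span _.
have V1 : 1 \in V by rewrite memv_span// inE eqxx.
have Vz : z \in V by rewrite memv_span// !inE eqxx orbT.
have Vt : t \in V by rewrite memv_span// !inE eqxx !orbT.
have Vs (u : rat) v : v \in V -> io u * v \in V by move=> h; rewrite -io_scale memvZ.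
have Vi (u : int) v : v \in V -> u%:~R * v \in V by move=> h; rewrite -(@io_int K) Vs.
have Vm v : v \in V -> v * z \in V.
  move=> hv; have -> : v = \sum_(i < 3) coord [tuple 1; z; t] i v *: [tuple 1; z; t]`_i.
    by rewrite -coord_span.
  rewrite !big_ord_recl big_ord0 addr0 /= !mulrDl -!scalerAl mul1r !rpredD// memvZ//.
    by case: rel => _ e _; rewrite -expr2 e rpredB ?rpredD//; [rewrite -rmorphN -rmorphM /= -[_%:~R]mulr1 Vi|exact: Vi|exact: Vi].
  by rewrite mulrC zt -rmorphN -rmorphM /= -[_%:~R]mulr1 Vi.
have Ve i : z ^+ i \in V by elim: i => [|i ih]; rewrite ?expr0// exprSr Vm.
have : x \in <<1; z>>%VS by rewrite fz memvf.
move=> /Fadjoin_polyP[q /polyOverP qo ->]; rewrite horner_coef; apply: rpred_sum => i _.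
by have /vlineP[k ->] := qo i; rewrite -scalerAl mul1r memvZ.
Qed.

(** A rational root x gives the zero (-x/a : 1) of f, which [reducible_pmax] excludes for n > 1. *)
Lemma no_root_of_pmax f n Q : fa f != 0 -> (forall p, prime p -> pmax f p) -> hess f = qscale n Q -> 1 < n ->
  forall x : rat, x ^+ 3 - (fb f)%:~R * x ^+ 2 + (fa f * fc f)%:~R * x - (fa f ^+ 2 * fd f)%:~R != 0.
Proof.
move=> a0 pm hn n1 x; apply/eqP => ex.
have aK : (fa f)%:~R != 0 :> rat by rewrite intr_eq0.
pose y : rat := - x / (fa f)%:~R.
have xy : x = - (fa f)%:~R * y by rewrite /y; field.
have dy0 : (denq y)%:~R != 0 :> rat by rewrite intr_eq0 denq_neq0.
have ey : y = (numq y)%:~R / (denq y)%:~R by rewrite divq_num_den.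
have cv : ceval f (numq y) (denq y) = 0.
  apply/eqP; rewrite -(intr_eq0 rat); apply/eqP.
  transitivity ((denq y)%:~R ^+ 3 * ((fa f)%:~R * y ^+ 3 + (fb f)%:~R * y ^+ 2 + (fc f)%:~R * y + (fd f)%:~R) : rat).
    by move: dy0 ey; move: (numq y) (denq y) => u v v0 ->; rewrite /ceval; field.
  rewrite [X in _ * X](_ : _ = 0) ?mulr0//; apply: (mulfI aK); apply: (mulfI aK); rewrite !mulr0.
  by rewrite -[RHS]oppr0 -[in RHS]ex xy; ring.
have cop : coprimez (numq y) (denq y) by rewrite /coprimez; have := coprime_num_den y; rewrite /coprime /gcdz => /eqP ->.
have n0 : 0 < n by lia.
by have := reducible_pmax pm hn n0 cop cv; lia.
Qed.

Lemma size_cubicL (L : fieldType) (c1 c2 c3 : L) : size ('X^3 - c1 *: 'X^2 + c2 *: 'X - c3%:P) = 4%N.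
Proof.
rewrite -!addrA size_polyDl size_polyXn//.
rewrite (leq_ltn_trans (size_polyD _ _))// gtn_max size_polyN ltnS (leq_trans (size_scale_leq _ _)) ?size_polyXn//=.
rewrite (leq_ltn_trans (size_polyD _ _))// gtn_max size_polyN ltnS (leq_trans (size_scale_leq _ _)) ?size_polyX//=.
by rewrite (leq_ltn_trans (size_polyC_leq1 _)).
Qed.

Lemma root_cubicL (L : fieldType) (c1 c2 c3 y : L) : y ^+ 3 - c1 * y ^+ 2 + c2 * y - c3 = 0 ->
  root ('X^3 - c1 *: 'X^2 + c2 *: 'X - c3%:P) y.
Proof. by move=> h; apply/rootP; rewrite !hornerE /= -[RHS]h; ring. Qed.

Section Embeddings.
Variables (R : realType) (K : fieldExtType rat) (f : bcf) (om th : K).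
Hypotheses (a0 : fa f != 0) (bX : basis_of {:K} [tuple 1; om; th]) (rel : cubic_rel f om th).
Local Notation C := R[i].

Lemma rel_char (L : comNzRingType) (w t : L) : cubic_rel f w t ->
  w ^+ 3 - (fb f)%:~R * w ^+ 2 + ((fa f)%:~R * (fc f)%:~R) * w - (fa f)%:~R ^+ 2 * (fd f)%:~R = 0.
Proof.
move=> h; have := cubic_rel_charpoly 0 1 0 h.
rewrite /ce1 /ce2 /ce3 mul1r mul0r add0r addr0 => <-; ring.
Qed.

Lemma rel_morph (L : comNzRingType) (phi : {rmorphism K -> L}) : cubic_rel f (phi om) (phi th).
Proof.
case: rel => e1 e2 e3; split.
- by rewrite -rmorphM e1 rmorphM rmorphN !rmorph_int.
- by rewrite -rmorphXn /= e2 !(rmorphB, rmorphD, rmorphM, rmorphN) /= !rmorph_int.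
- by rewrite -rmorphXn /= e3 !(rmorphB, rmorphD, rmorphM, rmorphN) /= !rmorph_int.
Qed.

Lemma embedding_eq (phi psi : {rmorphism K -> C}) : phi om = psi om -> phi =1 psi.
Proof.
move=> e; have aC : (fa f)%:~R != 0 :> C by rewrite intr_eq0.
have et : phi th = psi th.
  have [_ e1 _] := rel_morph phi; have [_ e2 _] := rel_morph psi.
  apply: (mulfI aC); apply: oppr_inj; apply: (addrI (- (fa f)%:~R * (fc f)%:~R + (fb f)%:~R * phi om)).
  by rewrite -e1 e e2.
move=> x; have [u [v [w ->]]] := cubic_coords bX x.
by rewrite !rmorphD !rmorphM /= !rmorph_io e et.
Qed.

Variables (w t : 'I_3 -> C).
Hypotheses (wi : injective w) (wt : forall k, cubic_rel f (w k) (t k)).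

Lemma embeddings : exists s : 'I_3 -> {rmorphism K -> C},
  [/\ enumerates_embeddings s, forall k, s k om = w k & forall k, s k th = t k].
Proof.
have ex (k : 'I_3) : exists phi : {rmorphism K -> C}, phi om = w k /\ phi th = t k.
  have [phi h] := cubic_hom (ratr : {rmorphism rat -> C}) bX rel (wt k).
  exists phi; split.
    by have := h 0 1 0; rewrite !rmorph0 !rmorph1 !mul0r !mul1r !add0r !addr0.
  by have := h 0 0 1; rewrite !rmorph0 !rmorph1 !mul0r !mul1r !add0r.
have [s hs] := choice ex; exists s; split; [|by move=> k; case: (hs k)..].
split=> [i j e|phi]; first by apply: wi; rewrite -(hs i).1 -(hs j).1.
have [k ek] : exists k, phi om = w k.
  apply: contrapT => hn; pose p : {poly C} := 'X^3 - (fb f)%:~R *: 'X^2 + ((fa f)%:~R * (fc f)%:~R) *: 'X - ((fa f)%:~R ^+ 2 * (fd f)%:~R)%:P.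
  have sp : size p = 4%N by rewrite size_cubicL.
  have := @max_poly_roots _ p (phi om :: [seq w k | k <- enum 'I_3]).
  rewrite sp -size_poly_eq0 sp /= size_map -cardE card_ord => /(_ isT).
  have rt (z z' : C) : cubic_rel f z z' -> root p z.
    by move=> /rel_char/root_cubicL.
  rewrite (rt _ _ (rel_morph phi)) /=.
  have -> : all (root p) [seq w k | k <- enum 'I_3].
    by apply/allP => _ /mapP[k _ ->]; apply: rt (wt k).
  move=> /(_ isT); rewrite map_inj_uniq// enum_uniq andbT.
  have -> : phi om \notin [seq w k | k <- enum 'I_3].
    by apply/mapP => -[k _ e]; apply: hn; exists k.
  by move=> /(_ isT).
by exists k; apply: embedding_eq; rewrite ek (hs k).1.
Qed.

End Embeddings.

(** * Embeddings by Cardano's formulas *)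

Section CubeRoots.
Variable R : realType.
Local Notation C := R[i].
(** The cube roots of unity; the index 0 will be that of the real embedding. *)
Definition zet (k : 'I_3) : C := tnth [tuple 1; Complex (- (1 / 2)) (Num.sqrt 3 / 2); Complex (- (1 / 2)) (- (Num.sqrt 3 / 2))] k.

Lemma sqrt3_sqr : Num.sqrt 3 ^+ 2 = 3 :> R.
Proof. by rewrite sqr_sqrtr. Qed.

Lemma zetE (k : 'I_3) : [\/ k = 0, k = 1 | k = 2%:R].
Proof. by case: k => -[|[|[|//]]] h; [apply: Or31|apply: Or32|apply: Or33]; apply: val_inj. Qed.

Lemma cmulE (x y x' y' : R) : Complex x y * Complex x' y' = Complex (x * x' - y * y') (x * y' + y * x').
Proof. by []. Qed.

Lemma zet0 : zet 0 = 1. Proof. by []. Qed.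
Lemma zet1 : zet 1 = Complex (- (1 / 2)) (Num.sqrt 3 / 2). Proof. by []. Qed.
Lemma zet2 : zet 2%:R = Complex (- (1 / 2)) (- (Num.sqrt 3 / 2)). Proof. by []. Qed.

Lemma zet_sqr0 : zet 0 ^+ 2 = 1. Proof. by rewrite zet0 expr1n. Qed.
Lemma zet_sqr1 : zet 1 ^+ 2 = zet 2%:R.
Proof.
rewrite expr2 zet1 zet2 cmulE; congr Complex; last by field.
transitivity (1 / 4 - Num.sqrt 3 ^+ 2 / 4 : R); [by field|by rewrite sqrt3_sqr; field].
Qed.
Lemma zet_sqr2 : zet 2%:R ^+ 2 = zet 1.
Proof.
rewrite expr2 zet1 zet2 cmulE; congr Complex; last by field.
transitivity (1 / 4 - Num.sqrt 3 ^+ 2 / 4 : R); [by field|by rewrite sqrt3_sqr; field].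
Qed.
Lemma zet12 : zet 1 * zet 2%:R = 1.
Proof.
rewrite zet1 zet2 cmulE; congr Complex; last by field.
transitivity (1 / 4 + Num.sqrt 3 ^+ 2 / 4 : R); [by field|by rewrite sqrt3_sqr; field].
Qed.

Lemma zet_sqr k : zet k * (zet k ^+ 2) = 1 /\ (zet k ^+ 2) ^+ 2 = zet k.
Proof.
case: (zetE k) => ->; rewrite ?zet_sqr0 ?zet_sqr1 ?zet_sqr2.
- by rewrite zet0 mulr1.
- by rewrite zet12.
- by rewrite mulrC zet12 zet_sqr1.
Qed.

End CubeRoots.

(** For f = p^3 (x - r y)^3 + p'^3 (x - r' y)^3 the roots are given by radicals: u is a cube root of
    unity, v its square, and X, Y are the Lagrange resolvents of om. Each relation is checked on the
    components along 1, u and v. *)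
Lemma cubic_rel_root (L : numFieldType) f (p p' r r' u v : L) : u * v = 1 -> v ^+ 2 = u -> u ^+ 2 = v ->
  (fa f)%:~R = p ^+ 3 + p' ^+ 3 -> (fb f)%:~R = - 3 * (r * p ^+ 3 + r' * p' ^+ 3) ->
  (fc f)%:~R = 3 * (r ^+ 2 * p ^+ 3 + r' ^+ 2 * p' ^+ 3) -> (fd f)%:~R = - (r ^+ 3 * p ^+ 3 + r' ^+ 3 * p' ^+ 3) ->
  let X := 3 * (r - r') * p ^+ 2 * p' in let Y := - (3 * (r - r') * p * p' ^+ 2) in
  cubic_rel f (((fb f)%:~R + u * X + v * Y) / 3) ((- (fc f)%:~R - r * u * X - r' * v * Y) / 3).
Proof.
move=> uv vv uu ea eb ec ed X Y.
rewrite /cubic_rel; move: ea eb ec ed; move: (fa f)%:~R (fb f)%:~R (fc f)%:~R (fd f)%:~R => a b c d ea eb ec ed.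
have i9 : 9 != 0 :> L by [].
have lin (x y z x' y' z' : L) : x = x' -> y = y' -> z = z' -> x + u * y + v * z = x' + u * y' + v * z' by move=> -> -> ->.
set w := _ / 3; set t := _ / 3.
have w3 : 3 * w = b + u * X + v * Y by rewrite /w mulrC divfK.
have t3 : 3 * t = - c - r * u * X - r' * v * Y by rewrite /t mulrC divfK.
split; apply: (mulfI i9).
- transitivity ((3 * w) * (3 * t)); first by ring.
  rewrite w3 t3.
  transitivity (- b * c - (r + r') * X * Y * (u * v) + u * (- b * r * X - c * X)
      - r' * Y ^+ 2 * v ^+ 2 + v * (- b * r' * Y - c * Y) - r * X ^+ 2 * u ^+ 2); first by ring.
  rewrite uv uu vv.
  transitivity ((- b * c - (r + r') * X * Y) + u * (- b * r * X - c * X - r' * Y ^+ 2) + v * (- b * r' * Y - c * Y - r * X ^+ 2)); first by ring.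
  transitivity ((- 9 * a * d) + u * 0 + v * 0); last by ring.
  by apply: lin; rewrite eb ?ea ec ?ed /X /Y; ring.
- transitivity ((3 * w) ^+ 2); first by ring.
  transitivity ((- 9 * a * c) + (3 * b) * (3 * w) - (3 * a) * (3 * t)); last by ring.
  rewrite w3 t3.
  transitivity (b ^+ 2 + 2 * X * Y * (u * v) + u * (2 * b * X) + Y ^+ 2 * v ^+ 2 + v * (2 * b * Y) + X ^+ 2 * u ^+ 2); first by ring.
  rewrite uv uu vv.
  transitivity (b ^+ 2 + 2 * X * Y + u * (2 * b * X + Y ^+ 2) + v * (2 * b * Y + X ^+ 2)); first by ring.
  transitivity ((- 9 * a * c + 3 * b * b + 3 * a * c) + u * (3 * b * X + 3 * a * r * X) + v * (3 * b * Y + 3 * a * r' * Y)); last by ring.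
  by apply: lin; rewrite eb ?ea ?ec /X /Y; ring.
- transitivity ((3 * t) ^+ 2); first by ring.
  transitivity ((- 9 * b * d) + (3 * d) * (3 * w) - (3 * c) * (3 * t)); last by ring.
  rewrite w3 t3.
  transitivity (c ^+ 2 + 2 * r * r' * X * Y * (u * v) + u * (2 * c * r * X) + r' ^+ 2 * Y ^+ 2 * v ^+ 2
      + v * (2 * c * r' * Y) + r ^+ 2 * X ^+ 2 * u ^+ 2); first by ring.
  rewrite uv uu vv.
  transitivity ((c ^+ 2 + 2 * r * r' * X * Y) + u * (2 * c * r * X + r' ^+ 2 * Y ^+ 2) + v * (2 * c * r' * Y + r ^+ 2 * X ^+ 2)); first by ring.
  transitivity ((- 9 * b * d + 3 * d * b + 3 * c * c) + u * (3 * d * X + 3 * c * r * X) + v * (3 * d * Y + 3 * c * r' * Y)); last by ring.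
  by apply: lin; rewrite ?eb ?ec ?ed /X /Y; ring.
Qed.

Lemma cubic_rel_morph (R : numFieldType) (L : numFieldType) (phi : {rmorphism R -> L}) f (p p' r r' : R) (u v : L) :
  u * v = 1 -> v ^+ 2 = u -> u ^+ 2 = v ->
  (fa f)%:~R = p ^+ 3 + p' ^+ 3 -> (fb f)%:~R = - 3 * (r * p ^+ 3 + r' * p' ^+ 3) ->
  (fc f)%:~R = 3 * (r ^+ 2 * p ^+ 3 + r' ^+ 2 * p' ^+ 3) -> (fd f)%:~R = - (r ^+ 3 * p ^+ 3 + r' ^+ 3 * p' ^+ 3) ->
  let X := 3 * (r - r') * p ^+ 2 * p' in let Y := - (3 * (r - r') * p * p' ^+ 2) in
  cubic_rel f ((phi (fb f)%:~R + u * phi X + v * phi Y) / 3) ((- phi (fc f)%:~R - phi r * u * phi X - phi r' * v * phi Y) / 3).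
Proof.
move=> uv vv uu ea eb ec ed X Y.
have e (n : int) x : n%:~R = x -> n%:~R = phi x by move=> <-; rewrite rmorph_int.
have eX : phi X = 3 * (phi r - phi r') * phi p ^+ 2 * phi p'.
  by rewrite /X !(rmorphM, rmorphB, rmorphXn) /= rmorph_nat.
have eY : phi Y = - (3 * (phi r - phi r') * phi p * phi p' ^+ 2).
  by rewrite /Y rmorphN !(rmorphM, rmorphB, rmorphXn) /= rmorph_nat.
rewrite eX eY !rmorph_int; apply: cubic_rel_root => //.
- by rewrite (e _ _ ea) !(rmorphD, rmorphXn).
- by rewrite (e _ _ eb) rmorphM rmorphN rmorph_nat !(rmorphD, rmorphM, rmorphXn).
- by rewrite (e _ _ ec) rmorphM rmorph_nat !(rmorphD, rmorphM, rmorphXn).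
- by rewrite (e _ _ ed) rmorphN !(rmorphD, rmorphM, rmorphXn).
Qed.

Section ComplexReal.
Variable R : realType.
Local Notation C := R[i].
Local Notation rc := (real_complex R).
Implicit Types (z : C) (x y : R).

Lemma Im_mulr z x : complex.Im (z * rc x) = complex.Im z * x.
Proof. by case: z => u v /=; ring. Qed.
Lemma ImD z z' : complex.Im (z + z') = complex.Im z + complex.Im z'.
Proof. by case: z; case: z'. Qed.
Lemma div_rc z : z / 3 = z * rc 3^-1.
Proof. by rewrite fmorphV rmorph_nat. Qed.
Lemma Im_rc x : complex.Im (rc x) = 0. Proof. by []. Qed.

Lemma normc_sqr x y : Normc.normc (Complex x y) ^+ 2 = x ^+ 2 + y ^+ 2.
Proof. by rewrite /= sqr_sqrtr// addr_ge0 ?sqr_ge0. Qed.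

Lemma ord3_sum (F : 'I_3 -> R) : \sum_i F i = F 0 + F 1 + F 2%:R.
Proof.
rewrite !big_ord_recl big_ord0 addr0 addrA.
by congr (F _ + F _ + F _); apply: val_inj.
Qed.

(** Orthogonality of characters: the cross terms cancel because the cube roots of unity have sum
    0. *)
Lemma sum_zet x y : \sum_k Normc.normc (zet R k * rc x + zet R k ^+ 2 * rc y) ^+ 2 = 3 * (x ^+ 2 + y ^+ 2).
Proof.
have zc (u v u' v' : R) : Complex u v * rc x + Complex u' v' * rc y = Complex (u * x + u' * y) (v * x + v' * y).
  by congr Complex; rewrite /=; ring.
rewrite ord3_sum zet_sqr0 zet_sqr1 zet_sqr2 zet0 zet1 zet2.
rewrite (_ : 1 = Complex 1 0)// !zc !normc_sqr.
transitivity ((x + y) ^+ 2 + (x + y) ^+ 2 / 2 + (Num.sqrt 3) ^+ 2 * (x - y) ^+ 2 / 2 : R); first by field.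
by rewrite sqrt3_sqr; field.
Qed.

End ComplexReal.

(** * Embeddings and shape of the field of an apolar form *)

Section RealCubic.
Variables (R : realType) (Q : bqf int).
Hypotheses (q0 : qa Q < 0) (q1 : qb Q < 0) (q2 : qc Q < 0) (D0 : 0 < qdisc Q) (pQ : primQ Q).
Local Notation s1 := (slo R Q).
Local Notation s2 := (shi R Q).
Local Notation C := R[i].
Definition r1 : R := - s1 / 3.
Definition r2 : R := - s2 / 3.

Lemma r12 : r2 < r1.
Proof. by have := slo_shi R q0 D0; rewrite /r1 /r2; lra. Qed.

Lemma sum_r : (qb Q)%:~R = - (qa Q)%:~R * (r1 + r2) :> R.
Proof.
have a0 : (qa Q)%:~R != 0 :> R by rewrite intr_eq0 lt_eqF.
by rewrite /r1 /r2 /slo /shi; field.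
Qed.

Lemma prod_r : (qc Q)%:~R = (qa Q)%:~R * (r1 * r2) :> R.
Proof.
have a0 : (qa Q)%:~R != 0 :> R by rewrite intr_eq0 lt_eqF.
have h := sqr_sD R D0; set sD := Num.sqrt _ in h.
transitivity (((qb Q)%:~R ^+ 2 - sD ^+ 2) / (4 * (qa Q)%:~R) : R); first by rewrite h; field.
by rewrite /r1 /r2 /slo /shi -/sD; field.
Qed.

Lemma disc_r : (qdisc Q)%:~R = (qa Q)%:~R ^+ 2 * (r1 - r2) ^+ 2 :> R.
Proof. transitivity ((qb Q)%:~R ^+ 2 - 4 * (qa Q)%:~R * (qc Q)%:~R : R); first by rewrite /qdisc; ring.
by rewrite sum_r prod_r; ring. Qed.

Definition cone (a b : R) := [/\ 0 < a, s1 * a < b & b < s2 * a].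
(* A form apolar to Q is cP (x - r1 y)^3 + cP' (x - r2 y)^3. *)
Definition cP (a b : R) := (s2 * a - b) / (s2 - s1).
Definition cP' (a b : R) := (b - s1 * a) / (s2 - s1).

Lemma cP_gt0 a b : cone a b -> 0 < cP a b /\ 0 < cP' a b.
Proof. by move=> [? ? ?]; split; rewrite divr_gt0 ?subr_gt0// slo_shi. Qed.

Definition tof (a b : R) := ln (cP' a b / cP a b) / 3.

Lemma expR_tof a b : cone a b -> expR (3 * tof a b) = cP' a b / cP a b.
Proof.
move=> /cP_gt0[p0 p0']; rewrite /tof mulrC divfK// lnK// posrE divr_gt0//.
Qed.

Lemma slope_tof t a b : cone a b -> (slope s1 s2 t * a <= b) = (t <= tof a b).
Proof.
move=> cn; have [p0 p0'] := cP_gt0 cn; have s12 := slo_shi R q0 D0.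
rewrite -[RHS](ler_pM2l (x := 3))// -[RHS]ler_expR expR_tof// ler_pdivlMr//.
have e0 := expR_gt0 (3 * t); rewrite /slope /cP /cP' mulrAC ler_pdivrMr; last by lra.
rewrite mulrA ler_pM2r ?invr_gt0 ?subr_gt0//.
by apply/idP/idP; nra.
Qed.

Variables (f : bcf) (ap : apolar Q f) (cn : cone (fa f)%:~R (fb f)%:~R).
Let a : R := (fa f)%:~R.
Let b : R := (fb f)%:~R.
Definition pp : R := expR (ln (cP a b) / 3).
Definition pp' : R := expR (ln (cP' a b) / 3).

Lemma pp_gt0 : 0 < pp /\ 0 < pp'. Proof. by split; apply: expR_gt0. Qed.
Lemma pp3 : pp ^+ 3 = cP a b /\ pp' ^+ 3 = cP' a b.
Proof.
have [p0 p0'] := cP_gt0 cn.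
by split; rewrite -expRM_natl -mulr_natl mulrC divfK// lnK.
Qed.

Lemma expR_tofE : expR (tof a b) = pp' / pp.
Proof.
have [p0 p0'] := cP_gt0 cn.
by rewrite /pp /pp' -expRB -mulrBl /tof ln_div ?posrE.
Qed.

Lemma cubic_coefs : [/\ a = pp ^+ 3 + pp' ^+ 3, b = - 3 * (r1 * pp ^+ 3 + r2 * pp' ^+ 3),
  (fc f)%:~R = 3 * (r1 ^+ 2 * pp ^+ 3 + r2 ^+ 2 * pp' ^+ 3) &
  (fd f)%:~R = - (r1 ^+ 3 * pp ^+ 3 + r2 ^+ 3 * pp' ^+ 3)].
Proof.
have [-> ->] := pp3; have s12 := slo_shi R q0 D0.
have a0 : (qa Q)%:~R != 0 :> R by rewrite intr_eq0 lt_eqF.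
have ea : a = cP a b + cP' a b by rewrite /cP /cP'; field; lra.
have eb : b = - 3 * (r1 * cP a b + r2 * cP' a b) by rewrite /cP /cP' /r1 /r2; field; lra.
move: ea eb; move: (cP a b) (cP' a b) => P P' ea eb.
have [e1 e2] : (qa Q)%:~R * (fc f)%:~R = (qb Q)%:~R * b - 3 * (qc Q)%:~R * a :> R /\
   (qa Q)%:~R * (fd f)%:~R = ((qb Q)%:~R * (fc f)%:~R - (qc Q)%:~R * b) / 3 :> R.
  case: ap => h1 h2; split.
    transitivity ((qb Q * fb f - 3 * qc Q * fa f)%:~R : R); last by rewrite /a /b; ring.
    by rewrite -rmorphM; congr intmul; lia.
  transitivity ((qb Q * fc f - qc Q * fb f)%:~R / 3 : R); last by rewrite /a /b; congr (_ / _); ring.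
  apply: (canRL (mulfK _)) => //; rewrite -rmorphM -[3]/(3%:~R) -rmorphM; congr intmul; lia.
have ec : (fc f)%:~R = 3 * (r1 ^+ 2 * P + r2 ^+ 2 * P') :> R.
  by apply: (mulfI a0); rewrite e1 sum_r prod_r eb ea; ring.
split=> //; apply: (mulfI a0).
by rewrite e2 sum_r prod_r ec eb; field.
Qed.

Local Notation dl := (r1 - r2).
Definition cX : R := 3 * dl * pp ^+ 2 * pp'.
Definition cY : R := - (3 * dl * pp * pp' ^+ 2).

Lemma cX_cY : cY < 0 < cX.
Proof.
have [p0 p0'] := pp_gt0; have h := r12.
by rewrite /cX /cY oppr_lt0 !mulr_gt0 ?exprn_gt0 ?subr_gt0.
Qed.

Local Notation rc := (real_complex R).
Definition wk k : C := (rc b + zet R k * rc cX + zet R k ^+ 2 * rc cY) / 3.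
Definition tk k : C := (- rc (fc f)%:~R - rc r1 * zet R k * rc cX - rc r2 * zet R k ^+ 2 * rc cY) / 3.

Lemma rc_int (n : int) : (n%:~R : C) = rc n%:~R. Proof. by rewrite rmorph_int. Qed.

Lemma wk_rel k : cubic_rel f (wk k) (tk k).
Proof.
have [uv vv] := zet_sqr R k; have [ea eb ec ed] := cubic_coefs.
rewrite /wk /tk /cX /cY.
exact: (@cubic_rel_morph R C (rc : {rmorphism R -> C}) f pp pp' r1 r2 _ _ uv vv (erefl _) ea eb ec ed).
Qed.

Lemma Im_wk k : complex.Im (wk k) = (complex.Im (zet R k) * cX + complex.Im (zet R k ^+ 2) * cY) / 3.
Proof. by rewrite /wk div_rc Im_mulr !ImD !Im_mulr Im_rc add0r. Qed.

Lemma Im_wk012 : [/\ complex.Im (wk 0) = 0, complex.Im (wk 1) = Num.sqrt 3 / 6 * (cX - cY) &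
  complex.Im (wk 2%:R) = - (Num.sqrt 3 / 6 * (cX - cY))].
Proof.
rewrite !Im_wk zet_sqr0 zet_sqr1 zet_sqr2 zet0 zet1 zet2 /=; split; by field.
Qed.

Lemma wk_gap : 0 < Num.sqrt 3 / 6 * (cX - cY).
Proof.
have /andP[y0 x0] := cX_cY; have s3 : 0 < Num.sqrt 3 :> R by rewrite sqrtr_gt0.
by rewrite mulr_gt0 ?divr_gt0//; lra.
Qed.

Lemma wk_inj : injective wk.
Proof.
move=> i j /(congr1 (@complex.Im R)); have [e0 e1 e2] := Im_wk012; have g := wk_gap.
by case: (zetE i) => ->; case: (zetE j) => ->; rewrite ?e0 ?e1 ?e2 //; move=> h; exfalso; move: h g; lra.
Qed.

(** Removing the trace cancels the rational parts, so only the two resolvents remain, each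
    multiplied by a real linear form in (x, y). *)
Lemma perp_comb_root k (x y : R) :
  - rc (b * x) + rc ((fc f)%:~R * y) + rc (3 * x) * wk k + rc (3 * y) * tk k =
  zet R k * rc (cX * (x - r1 * y)) + zet R k ^+ 2 * rc (cY * (x - r2 * y)).
Proof.
have aux (L : numFieldType) (phi : {rmorphism R -> L}) (B c r r' X Y : R) (u v : L) :
   - phi (B * x) + phi (c * y) + phi (3 * x) * ((phi B + u * phi X + v * phi Y) / 3)
     + phi (3 * y) * ((- phi c - phi r * u * phi X - phi r' * v * phi Y) / 3)
   = u * phi (X * (x - r * y)) + v * phi (Y * (x - r' * y)).
  by rewrite !(rmorphM, rmorphB) /= !rmorph_nat; field.
exact: (aux C (rc : {rmorphism R -> C})).
Qed.

Section FieldSide.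
Variables (K : fieldExtType rat) (om th : K).
Hypotheses (d3 : \dim {:K} = 3%N) (ib : integral_basis om th) (rel : cubic_rel f om th).

Let bX : basis_of {:K} [tuple 1; om; th] := integral_basis_basis d3 ib.
Let a0 : fa f != 0.
Proof. by case: cn => h _ _; rewrite -(intr_eq0 R) gt_eqF. Qed.

Lemma field_embeddings : exists s : 'I_3 -> {rmorphism K -> C},
  [/\ enumerates_embeddings s, forall k, s k om = wk k, forall k, s k th = tk k &
    forall j, real_embedding (s j) <-> j = 0].
Proof.
have [s [es so st]] := embeddings a0 bX rel wk_inj wk_rel.
have [e0 e1 e2] := Im_wk012; have g := wk_gap.
exists s; split=> // j; split=> [h|->].
  have := h om; rewrite so; case: (zetE j) => -> //; rewrite ?e1 ?e2 => h'; exfalso; move: h' g; lra.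
move=> x; have [u [v [w ->]]] := cubic_coords bX x.
have rr (q : rat) : (ratr q : C) = rc (ratr q) by rewrite -(fmorph_eq_rat (rc \o (ratr : {rmorphism rat -> R}))).
rewrite !rmorphD !rmorphM /= !rmorph_io so st !rr !ImD [rc _ * wk 0]mulrC [rc _ * tk 0]mulrC !Im_mulr Im_rc e0.
have -> : complex.Im (tk 0) = 0 by rewrite /tk zet_sqr0 zet0 !mulr1 div_rc Im_mulr /=; ring.
by ring.
Qed.

Lemma field_complex : complex_cubic R K.
Proof.
by split=> //; have [s [es _ _ h]] := field_embeddings; exists s => //; exists 0.
Qed.

(** Coefficients of 3 (cX^2 (x - r1 y)^2 + cY^2 (x - r2 y)^2), which [sum_zet] produces from
    [perp_comb_root]. *)
Definition shape_form : bqf R :=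
  BQF (3 * (cX ^+ 2 + cY ^+ 2)) (- 6 * (cX ^+ 2 * r1 + cY ^+ 2 * r2)) (3 * (cX ^+ 2 * r1 ^+ 2 + cY ^+ 2 * r2 ^+ 2)).

Lemma sum_embeddings (s : 'I_3 -> {rmorphism K -> C}) : enumerates_embeddings s -> forall x y : int,
  \sum_(i < 3) Normc.normc (s i (perp_comb om th x y)) ^+ 2 = qeval shape_form x%:~R y%:~R.
Proof.
move=> [si sc] x y; have [s' [[si' sc'] so st _]] := field_embeddings.
have [h hh] := choice (fun i => sc (s' i)).
have hi : injective h.
  by move=> i j e; apply: si' => z; rewrite (hh i) (hh j) e.
rewrite (reindex_inj hi) /=.
transitivity (\sum_k Normc.normc (zet R k * rc (cX * (x%:~R - r1 * y%:~R)) + zet R k ^+ 2 * rc (cY * (x%:~R - r2 * y%:~R))) ^+ 2).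
  apply: eq_bigr => k _; rewrite -hh -perp_comb_root (perp_combE bX rel).
  have gen (u v w : rat) : s' k (io u + io v * om + io w * th) = ratr u + ratr v * wk k + ratr w * tk k.
    by rewrite !rmorphD !rmorphM /= !rmorph_io so st.
  rewrite gen; congr (Normc.normc _ ^+ 2).
  have ri (m : int) : (ratr m%:~R : C) = rc m%:~R by rewrite ratr_int rmorph_int.
  have e1 : ratr (- ((fb f)%:~R * x%:~R) + (fc f)%:~R * y%:~R) = - rc (b * x%:~R) + rc ((fc f)%:~R * y%:~R) :> C.
    by rewrite /b -!intrM -!rc_int -!intrN -!intrD ratr_int.
  have e2 (m : int) : ratr (3 * m%:~R) = rc (3 * m%:~R) :> C.
    by rewrite -[3 in LHS]/(3%:~R) -[3 in RHS]/(3%:~R) -!intrM ri.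
  by rewrite e1 !e2.
by rewrite sum_zet /qeval /=; ring.
Qed.

Lemma is_shape_form w : is_shape K w <-> quotient_image [set z_of shape_form] w.
Proof.
have pd : posdef shape_form.
  have /andP[y0 x0] := cX_cY; have h := r12.
  have x2 : 0 < cX ^+ 2 by rewrite exprn_gt0.
  have y2 : 0 < cY ^+ 2 by rewrite exprn_even_gt0//= lt_eqF.
  split=> /=; first by lra.
  rewrite /qdisc /= (_ : _ - _ = - (36 * (cX ^+ 2 * cY ^+ 2 * (r1 - r2) ^+ 2))); last by ring.
  have d2 : 0 < (r1 - r2) ^+ 2 by rewrite exprn_gt0 ?subr_gt0.
  by have := mulr_gt0 (mulr_gt0 x2 y2) d2; lra.
split; last first.
  move=> h; have [s [es _ _ _]] := field_embeddings.
  by exists om, th, s, shape_form; split=> // x y; rewrite sum_embeddings.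
move=> [al1 [al2 [s [M [ib' es hM]]]]].
have [g [k1 [k2 [gu e1 e2]]]] := integral_basis_transition ib ib'.
have eM (x y : int) : qeval M x%:~R y%:~R = qeval (qact shape_form g) x%:~R y%:~R.
  rewrite hM e1 e2 qeval_act -!rmorphM -!rmorphD /= -(sum_embeddings es).
  by apply: eq_bigr => i _; rewrite perp_comb_change//; apply: Tr1 bX.
have -> : M = qact shape_form g.
  have [x0 [x1 x2]] := (eM 1 0, (eM 0 1, eM 1 1)); move: x0 x1 x2; rewrite /qeval.
  case: M {hM eM} => ? ? ?; case: (qact _ _) => ? ? ? /= x0 x1 x2.
  by congr BQF; lra.
have pN := posdef_act pd gu.
move=> /(quotient_image_z_of _ pN)[gw [h hu ew]]; apply/(quotient_image_z_of _ pd).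
by split=> //; exists (zmul g h); [exact: unimodM|rewrite qactM].
Qed.

End FieldSide.

End RealCubic.

(** * Fields attached to lattice points of the cone *)

Section Geodesic.
Variables (R : realType) (Q : bqf int).
Hypotheses (q0 : qa Q < 0) (q1 : qb Q < 0) (q2 : qc Q < 0) (D0 : 0 < qdisc Q) (pQ : primQ Q).
Local Notation r1 := (r1 R Q).
Local Notation r2 := (r2 R Q).

Definition Mt (t : R) : bqf R :=
  BQF (expR (- t) + expR t) (- 2 * (expR (- t) * r1 + expR t * r2))
      (expR (- t) * r1 ^+ 2 + expR t * r2 ^+ 2).

Lemma qeval_Mt t x y : qeval (Mt t) x y = expR (- t) * (x - r1 * y) ^+ 2 + expR t * (x - r2 * y) ^+ 2.
Proof. by rewrite /qeval /=; ring. Qed.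

(** Divided by minus the common discriminant 4 (r1 - r2)^2, this is cosh(s - t): t is arc length. *)
Lemma qpol_Mt s t : qpol (Mt s) (Mt t) = 4 * (r1 - r2) ^+ 2 * ((expR (s - t) + expR (- (s - t))) / 2).
Proof. by rewrite /qpol /= opprB !expRD; field. Qed.

Lemma qdisc_Mt t : qdisc (Mt t) = - (4 * (r1 - r2) ^+ 2).
Proof.
have e := expRxMexpNx_1 t; rewrite /qdisc /=.
transitivity (- (4 * (r1 - r2) ^+ 2 * (expR t * expR (- t)))); first by ring.
by rewrite e mulr1.
Qed.

Lemma posdef_Mt t : posdef (Mt t).
Proof.
have h := r12 R q0 D0; split; first by rewrite /= addr_gt0 ?expR_gt0.
by rewrite qdisc_Mt oppr_lt0 mulr_gt0 ?exprn_gt0 ?subr_gt0.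
Qed.

Lemma z_of_scale (c : R) M : 0 < c -> posdef M -> z_of (qscale c M) = z_of M.
Proof.
move=> c0 [a0 d0]; rewrite /z_of /=; congr Complex; first by field; apply/andP; split; lra.
rewrite (_ : _ - _ = c ^+ 2 * (4 * qa M * qc M - qb M ^+ 2)); last by ring.
by rewrite sqrtrM ?sqr_ge0// sqrtr_sqr gtr0_norm//; field; apply/andP; split; lra.
Qed.

Lemma posdef_scale (c : R) M : 0 < c -> posdef M -> posdef (qscale c M).
Proof.
move=> c0 [a0 d0]; split; first by rewrite /= mulr_gt0.
rewrite (_ : qdisc _ = c ^+ 2 * qdisc M); last by rewrite /qdisc /=; ring.
by rewrite pmulr_rlt0 ?exprn_gt0.
Qed.

(* [attached K a b]: O_K is the cubic ring of an integral cubic form (a, b, _, _) whose Hessian is a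
   positive multiple of Q. *)
Definition attached (K : fieldExtType rat) (a b : nat) :=
  \dim {:K} = 3%N /\ exists f (om th : K) n,
    [/\ integral_basis om th, cubic_rel f om th, fa f = a, fb f = b & 0 < n /\ hess f = qscale n Q].

Lemma attached_facts K a b : attached K a b -> \dim {:K} = 3%N /\ exists f (om th : K) n,
    [/\ integral_basis om th, cubic_rel f om th, fa f = a, fb f = b &
    [/\ 0 < n, hess f = qscale n Q, apolar Q f, nform (slo R Q) (shi R Q) (kQ R Q) a b = n%:~R & cone Q (a%:R : R) b%:R]].
Proof.
move=> [d3 [f [om [th [n [ib rel ea eb [n0 hn]]]]]]]; split=> //.
have ap : apolar Q f by apply: apolar_of_hess hn; rewrite gt_eqF.
have en := nform_hess R q0 D0 pQ ea eb ap hn.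
exists f, om, th, n; split=> //; split=> //.
have k0 := kQ_gt0 R q0; have s1 := slo_gt0 R q0 q1 q2 D0; have s12 := slo_shi R q0 D0.
have : 0 < nform (slo R Q) (shi R Q) (kQ R Q) a b by rewrite en ltr0z.
rewrite /nform -mulrA pmulr_rgt0//.
have a0 : (0 : R) <= a%:R by []; have b0 : (0 : R) <= b%:R by [].
move: s1 s12 a0 b0; set s := slo _ _; set s' := shi _ _; move: (a%:R) (b%:R) => A B s1 s12 A0 B0 h.
have A1 : 0 < A.
  rewrite lt_neqAle A0 andbT eq_sym; apply/eqP => A1; move: h; rewrite A1 !mulr0 subr0 sub0r mulrN.
  by have := sqr_ge0 B; nra.
have h1 : s * A < B.
  rewrite ltNge; apply/negP => h1; move: h; rewrite ltNge => /negP; apply.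
  by apply: mulr_le0_ge0; nra.
split=> //; have hB : 0 < B - s * A by lra.
by rewrite -/s'; move: h; rewrite pmulr_rgt0//; lra.
Qed.

Lemma attached_good K a b : attached K a b -> good_all Q a b.
Proof.
move=> /attached_facts[d3 [f [om [th [n [ib rel ea eb [n0 hn ap _ _]]]]]]].
apply/asboolP; exists f; split=> // p pp _; exact: pmax_of_basis pp rel ib.
Qed.

Lemma attached_trace K a b : attached K a b -> trace_class K Q.
Proof.
move=> [d3 [f [om [th [n [ib rel ea eb [n0 hn]]]]]]]; exact: (trace_class_of d3 ib rel n0 hn pQ).
Qed.

Lemma attached_complex K a b : attached K a b -> complex_cubic R K.
Proof.
move=> /attached_facts[d3 [f [om [th [n [ib rel ea eb [n0 hn ap _ cn]]]]]]].
have cn' : cone Q ((fa f)%:~R : R) (fb f)%:~R by rewrite ea eb; exact: cn.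
exact: (field_complex q0 q1 q2 D0 ap cn' d3 ib rel).
Qed.

Lemma attached_shape K a b w : attached K a b -> is_shape K w <->
  gauss_domain w /\ exists2 g, unimod g & w = z_of (qact (Mt (tof Q a%:R b%:R)) g).
Proof.
move=> /attached_facts[d3 [f [om [th [n [ib rel ea eb [n0 hn ap _ cn]]]]]]].
have cn' : cone Q ((fa f)%:~R : R) (fb f)%:~R by rewrite ea eb; exact: cn.
rewrite (is_shape_form q0 q1 q2 D0 ap cn' d3 ib rel).
set t := tof _ _ _; have pM := posdef_Mt t.
have /andP[y0 x0] := cX_cY R q0 D0 f; set c := 3 * cX R Q f ^+ 2 * expR t.
have c0 : 0 < c by rewrite /c mulr_gt0 ?expR_gt0// mulr_gt0// exprn_gt0.
have [p0 p0'] := cP_gt0 q0 D0 cn'.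
have et : expR t = pp' R Q f / pp R Q f by rewrite -(expR_tofE q0 D0 cn') ea eb.
have [pp0 pp0'] := pp_gt0 R Q f.
have e1 : shape_form R Q f = qscale c (Mt t).
  have eY : cY R Q f ^+ 2 = cX R Q f ^+ 2 * expR t ^+ 2.
    by rewrite et /cX /cY; field; rewrite gt_eqF.
  have eE : expR (- t) * expR t = 1 by rewrite mulrC expRxMexpNx_1.
  congr BQF; rewrite /c /= eY.
  - transitivity (3 * cX R Q f ^+ 2 * (expR (- t) * expR t + expR t ^+ 2)); [by rewrite eE; ring|by ring].
  - transitivity (- 6 * cX R Q f ^+ 2 * (expR (- t) * expR t * r1 + expR t ^+ 2 * r2)); [by rewrite eE; ring|by ring].
  - transitivity (3 * cX R Q f ^+ 2 * (expR (- t) * expR t * r1 ^+ 2 + expR t ^+ 2 * r2 ^+ 2)); [by rewrite eE; ring|by ring].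
rewrite e1; have pc := posdef_scale c0 pM; rewrite (quotient_image_z_of w pc).
split=> -[gw [g gu ew]]; split=> //; exists g => //; rewrite ew.
  by rewrite qact_scale z_of_scale//; exact: posdef_act.
by rewrite qact_scale z_of_scale//; exact: posdef_act.
Qed.

Lemma attached_disc K a b X : attached K a b ->
  absdisc_lt K X <-> nform (slo R Q) (shi R Q) (kQ R Q) a b ^+ 2 * (qdisc Q)%:~R / 3 < X.
Proof.
move=> /attached_facts[d3 [f [om [th [n [ib rel ea eb [n0 hn ap en cn]]]]]]].
rewrite (absdisc_cubic d3 X ib rel) en.
have e : (cdisc f)%:~R = - (n%:~R ^+ 2 * (qdisc Q)%:~R / 3) :> R.
  have : qdisc (hess f) = n ^+ 2 * qdisc Q by rewrite hn /qdisc /=; ring.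
  rewrite qdisc_hess => /(congr1 (fun x : int => x%:~R : R)).
  by rewrite !intrM intrN -rmorphXn /= expr2 => h; move: h; rewrite !intrM; lra.
rewrite e normrN ger0_norm// divr_ge0// mulr_ge0 ?sqr_ge0// ler0z ltW//.
Qed.

(** Excluding n = 1 guarantees irreducibility, through [no_root_of_pmax]; maximality at all primes
    then identifies the ring of f with the ring of integers. *)
Lemma attached_exists (a b : nat) : good_all Q a b -> cone Q (a%:R : R) b%:R ->
  nform (slo R Q) (shi R Q) (kQ R Q) a b != 1 -> exists K, attached K a b.
Proof.
move=> /asboolP[f [ea eb ap pm]] cn n1.
have [n hn _] := apolar_hess (ltr0_neq0 q0) pQ ap.
have en := nform_hess R q0 D0 pQ ea eb ap hn.
have [a1 a2 a3] := cn.
have n0 : 0 < n.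
  by rewrite -(ltr0z R) -en /nform !mulr_gt0 ?subr_gt0 ?kQ_gt0.
have n2 : 1 < n.
  by rewrite en -[1]/(1%:~R) eqr_int in n1; lia.
have a0 : fa f != 0 by rewrite ea; move: a1; rewrite ltr0n; lia.
have pm' p : prime p -> pmax f p by move=> pp; exact: pm.
have [K [om [th [d3 bX rel]]]] := field_of_cubic a0 (no_root_of_pmax a0 pm' hn n2).
exists K; split=> //; exists f, om, th, n; split=> //.
exact: integral_basis_of_pmax d3 bX rel pm'.
Qed.

Lemma attached_iso K K' a b : attached K a b -> attached K' a b -> field_iso K K'.
Proof.
move=> /attached_facts[d3 [f [om [th [n [ib rel ea eb [n0 hn ap _ _]]]]]]].
move=> /attached_facts[d3' [f' [om' [th' [n' [ib' rel' ea' eb' [n0' hn' ap' _ _]]]]]]].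
have ff : f = f' by apply: apolar_uniq ap ap' _ _ => //; rewrite ?ea ?eb.
subst f'; exact: (cubic_iso (integral_basis_basis d3 ib) rel (integral_basis_basis d3' ib') rel').
Qed.

Lemma cact_opp f : cscale 1 (cact f (ZM (-1) 0 0 (-1))) = BCF (- fa f) (- fb f) (- fc f) (- fd f).
Proof. by rewrite /cscale /cact /ceval /=; congr BCF; ring. Qed.

Lemma hess_cone f n : 0 < n -> hess f = qscale n Q ->
  cone Q ((fa f)%:~R : R) (fb f)%:~R \/ cone Q (- (fa f)%:~R : R) (- (fb f)%:~R).
Proof.
move=> n0 hn.
have ap : apolar Q f by apply: apolar_of_hess hn; rewrite gt_eqF.
have [n' hn' en'] := apolar_hess (ltr0_neq0 q0) pQ ap.
have nn : n = n'.
  by move: hn'; rewrite hn => -[h _ _]; exact: (mulIf (ltr0_neq0 q0) h).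
have s1 := slo_gt0 R q0 q1 q2 D0; have s12 := slo_shi R q0 D0.
have q0R : (qa Q)%:~R < 0 :> R by rewrite ltrz0.
have h : 0 < - ((fb f)%:~R - slo R Q * (fa f)%:~R) * ((fb f)%:~R - shi R Q * (fa f)%:~R) :> R.
  have : 0 < (qa Q ^+ 2 * n)%:~R :> R by rewrite ltr0z mulr_gt0// exprn_even_gt0//= lt_eqF.
  rewrite nn en' -/(Nab Q (fa f) (fb f)).
  have -> : (Nab Q (fa f) (fb f))%:~R = (qa Q)%:~R * (((fb f)%:~R - slo R Q * (fa f)%:~R) * ((fb f)%:~R - shi R Q * (fa f)%:~R)) :> R.
    have e1 := sum_r R q0; have e2 := prod_r R q0 D0.
    rewrite NabE; transitivity ((qa Q)%:~R * (fb f)%:~R ^+ 2 - 3 * (qb Q)%:~R * (fa f)%:~R * (fb f)%:~R + 9 * (qc Q)%:~R * (fa f)%:~R ^+ 2 : R); first by ring.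
    by rewrite e1 e2 /r1 /r2; field.
  by rewrite nmulr_rgt0// mulNr oppr_gt0.
move: h s1 s12; set s := slo _ _; set s' := shi _ _; move: ((fa f)%:~R) ((fb f)%:~R) => A B h s1 s12.
have [A0|A0|A0] := ltrgt0P A.
- left; split=> //.
    have [//|h1] := ltP (s * A) B; exfalso.
    have : 0 <= (s * A - B) * (s' * A - B) by apply: mulr_ge0; nra.
    by nra.
  have [//|h1] := ltP B (s' * A); exfalso.
  have : 0 <= (B - s * A) * (B - s' * A) by apply: mulr_ge0; nra.
  by nra.
- right; split; first by lra.
    have [//|h1] := ltP (s * - A) (- B); exfalso.
    have : 0 <= (s * - A - - B) * (s' * - A - - B) by apply: mulr_ge0; nra.
    by nra.
  have [//|h1] := ltP (- B) (s' * - A); exfalso.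
  have : 0 <= (- B - s * - A) * (- B - s' * - A) by apply: mulr_ge0; nra.
  by nra.
- by exfalso; move: h; rewrite A0 !mulr0 !subr0; have := sqr_ge0 B; nra.
Qed.

Lemma cone_nat (u v : int) : cone Q (u%:~R : R) v%:~R -> exists a b : nat, u = a /\ v = b.
Proof.
move=> [a0 a1 _]; have s1 := slo_gt0 R q0 q1 q2 D0.
have u0 : 0 < u by rewrite -(ltr0z R).
have v0 : 0 < v by rewrite -(ltr0z R); apply: lt_trans a1; rewrite mulr_gt0.
by exists `|u|%N, `|v|%N; split; lia.
Qed.

(** Changing the sign of both basis elements replaces f by -f and preserves the Hessian, which
    brings the leading coefficients into the cone of naturals. *)
Lemma attached_of_form (K : fieldExtType rat) f (om th : K) n : \dim {:K} = 3%N -> integral_basis om th ->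
  cubic_rel f om th -> 0 < n -> hess f = qscale n Q ->
  exists a b : nat, attached K a b /\
   ((fa f)%:~R = a%:R :> R /\ (fb f)%:~R = b%:R :> R \/ (fa f)%:~R = - a%:R :> R /\ (fb f)%:~R = - b%:R :> R).
Proof.
move=> d3 ib rel n0 hn; have [cn|cn] := hess_cone n0 hn.
  have [a [b [ea eb]]] := cone_nat cn; exists a, b; split; last by left; rewrite ea eb.
  by split=> //; exists f, om, th, n.
rewrite -!intrN in cn; have [a [b [ea eb]]] := cone_nat cn; exists a, b.
have gu : unimod (ZM (-1) 0 0 (-1)) by [].
have [om' [th' [ib' rel' _]]] := rebase_cubic ib rel gu.
rewrite cact_opp in rel'; split; last first.
  by right; rewrite -[fa f]opprK -[fb f]opprK ea eb !intrN.
split=> //; exists (BCF (- fa f) (- fb f) (- fc f) (- fd f)), om', th', n; split=> //; split=> //.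
by rewrite -hn /hess /=; congr BQF; ring.
Qed.

Lemma trace_class_attached (K : fieldExtType rat) : \dim {:K} = 3%N -> trace_class K Q -> exists a b, attached K a b.
Proof.
move=> d3 /(trace_class_cubic d3)[_ [f [om [th [n [ib rel n0 hn]]]]]].
by have [a [b [h _]]] := attached_of_form d3 ib rel n0 hn; exists a, b.
Qed.

End Geodesic.

(** * Arcs of the geodesic *)

Lemma z_of_inj (R : realType) (M N : bqf R) : posdef M -> posdef N -> qdisc M = qdisc N -> z_of M = z_of N -> M = N.
Proof.
case: M N => a b c [a' b' c'] [/= a0 d0] [/= a0' d0'] eD [e1 e2].
rewrite /qdisc /= in d0 d0' eD.
have eS : 4 * a * c - b ^+ 2 = 4 * a' * c' - b' ^+ 2 by lra.
rewrite eS in e2; set S := Num.sqrt _ in e2.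
have S0 : 0 < S by rewrite sqrtr_gt0; lra.
have ea : a = a'.
  have : S * (2 * a') = S * (2 * a).
    move/(congr1 (fun x => x * (2 * a) * (2 * a'))): e2; rewrite divfK; last by rewrite gt_eqF// mulr_gt0.
    by rewrite mulrAC divfK// gt_eqF// mulr_gt0.
  by move/(mulfI (lt0r_neq0 S0)); lra.
subst a'.
have eb : b = b'.
  move/(congr1 (fun x => x * (2 * a))): e1; rewrite !divfK// gt_eqF// mulr_gt0//.
subst b'; congr BQF; apply: (mulfI (lt0r_neq0 a0)); lra.
Qed.

Lemma exists_outside (R : realType) (s : seq R) (a b : R) : a < b -> exists2 t, a < t < b & t \notin s.
Proof.
move=> ab; suff [a' [b' [h1 h2 h3 h4]]] : exists a' b', [/\ a <= a', a' < b', b' <= b & forall t, a' < t < b' -> t \notin s].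
  exists ((a' + b') / 2); last by apply: h4; lra.
  by lra.
elim: s a b ab => [|x s ih] a b ab; first by exists a, b; split.
have [a' [b' [h1 h2 h3 h4]]] := ih a b ab.
have [xm|xm] := leP x ((a' + b') / 2).
  exists ((a' + b') / 2), b'; split; [lra|lra|by []|move=> t /andP[t1 t2]].
  by rewrite inE negb_or h4 ?andbT; [apply/eqP => e; lra|lra].
exists a', ((a' + b') / 2); split; [by []|lra|lra|move=> t /andP[t1 t2]].
by rewrite inE negb_or h4 ?andbT; [apply/eqP => e; lra|lra].
Qed.

Lemma next_above (R : realType) (Ob : set R) (t0 : R) : (forall C, finite_set (Ob `&` [set v | `|v| <= C])) ->
  (exists2 v, Ob v & t0 < v) -> exists v, [/\ Ob v, t0 < v & forall v', Ob v' -> t0 < v' -> v <= v'].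
Proof.
move=> fin [v1 hv1 h1]; pose C := `|v1| + `|t0|.
have fB : finite_set (Ob `&` [set v | `|v| <= C] `&` [set v | t0 < v]).
  by apply: sub_finite_set (fin C) => x [].
have nB : (Ob `&` [set v | `|v| <= C] `&` [set v | t0 < v]) !=set0.
  by exists v1; split=> //; split=> //=; rewrite lerDl.
have [v [[hv _] ho] hmin] := finite_argmin id fB nB.
exists v; split=> // v' hv' ho'; have [h|h] := leP `|v'| C; first exact: hmin.
apply: (@le_trans _ _ v1); first by apply: hmin; split=> //; split=> //=; rewrite lerDl.
have := ler_norm v1; have := ler_norm (- t0); rewrite normrN /C in h * => h3 h4.
have [p|p] := ger0P v'; first by rewrite (ger0_norm p) in h; have := normr_ge0 t0; lra.
by rewrite (ltr0_norm p) in h; have := normr_ge0 v1; have := normr_ge0 t0; lra.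
Qed.

Lemma breakpoints (R : realType) (E : seq R) (c0 c1 : R) : c0 < c1 -> exists n (b : nat -> R),
  [/\ (0 < n)%N, b 0%N = c0, b n = c1, forall i, (i < n)%N -> b i < b i.+1 &
   forall i e, (i < n)%N -> e \in E -> ~ (b i < e < b i.+1)].
Proof.
move=> c01; pose l := [:: c0, c1 & [seq e <- E | c0 < e < c1]].
pose bs := sort <=%O (undup l).
have srt : sorted <%O bs by rewrite /bs sort_lt_sorted undup_uniq.
have mem x : (x \in bs) = (x \in l) by rewrite mem_sort mem_undup.
have lb x : x \in bs -> c0 <= x <= c1.
  by rewrite mem !inE mem_filter => /or3P[/eqP ->|/eqP ->|/andP[/andP[h1 h2] _]]; rewrite ?lexx ?ltW.
have c0b : c0 \in bs by rewrite mem inE eqxx.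
have c1b : c1 \in bs by rewrite mem !inE eqxx orbT.
have mono := lt_sorted_ltn_nth c0 srt.
pose b := nth c0 bs.
have sz : (0 < size bs)%N by case: (bs) c0b.
have mono' i j : (i < size bs)%N -> (j < size bs)%N -> (b i < b j) = (i < j)%N by move=> hi hj; apply: mono.
have b0 : b 0%N = c0.
  have := index_mem c0 bs; rewrite c0b => hk.
  have e : b (index c0 bs) = c0 by rewrite /b nth_index.
  have [/andP[h _]] := lb (b 0%N) (mem_nth _ sz).
  case: (posnP (index c0 bs)) e => [-> //|k0 e].
  by have := mono' 0%N _ sz hk; rewrite k0 e => h'; move: h; rewrite leNgt h'.
have bn : b (size bs).-1 = c1.
  have := index_mem c1 bs; rewrite c1b => hk.
  have e : b (index c1 bs) = c1 by rewrite /b nth_index.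
  have hl : ((size bs).-1 < size bs)%N by rewrite prednK.
  have [/andP[_ h]] := lb (b (size bs).-1) (mem_nth _ hl).
  have [k0|k0] := ltnP (index c1 bs) (size bs).-1.
    by have := mono' _ _ hk hl; rewrite k0 e => h'; move: h; rewrite leNgt h'.
  by rewrite -[RHS]e; congr b; apply/eqP; rewrite eqn_leq k0 /= -ltnS prednK.
exists (size bs).-1, b; split=> //.
- by rewrite lt0n; apply/eqP => e; move: c01; rewrite -bn -b0 e ltxx.
- by move=> i hi; rewrite mono' ?ltnS//; lia.
- move=> i e hi eE /andP[h1 h2].
  have eb : e \in bs.
    have hi1 : (i < size bs)%N by lia. 
    have hi2 : (i.+1 < size bs)%N by lia.
    have /andP[x1 _] := lb _ (mem_nth c0 hi1); have /andP[_ x2] := lb _ (mem_nth c0 hi2).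
    by rewrite mem !inE mem_filter eE (le_lt_trans x1 h1) (lt_le_trans h2 x2) !orbT.
  have ek : b (index e bs) = e by rewrite /b nth_index.
  have hk : (index e bs < size bs)%N by rewrite index_mem.
  move: h1 h2; rewrite -ek !mono'; lia.
Qed.

Section ExpLinear.
Variable R : realType.
Implicit Types (al be s : R).
(** Coefficients of [Mt s] moved by a fixed matrix, and its pairings with fixed forms, have this
    shape in s. Unless identically zero it vanishes at most once, at [xzero]; when there is no zero,
    the default value of [xzero] only adds a harmless breakpoint. *)
Definition xlin al be s := al * expR (- s) + be * expR s.
Definition xzero al be : R := ln (- al / be) / 2.

Lemma xlinE al be s : xlin al be s = expR (- s) * (al + be * expR (s * 2)).
Proof. by rewrite /xlin mulrDr mulrCA -expRD (_ : - s + s * 2 = s); ring. Qed.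

Lemma xlin_zero al be s : xlin al be s = 0 -> (al != 0) || (be != 0) -> s = xzero al be.
Proof.
rewrite xlinE => /eqP; rewrite mulf_eq0 gt_eqF ?expR_gt0//= => /eqP e nz.
have b0 : be != 0 by apply: contraTneq nz => b0; rewrite b0 eqxx orbF negbK; move: e; rewrite b0 mul0r addr0 => ->.
have e2 : - al / be = expR (s * 2) by apply: (mulIf b0); rewrite divfK//; lra.
by rewrite /xzero e2 expRK mulfK.
Qed.

Lemma xlin_sign al be (x y m s : R) : x < m < y -> x <= s <= y ->
  ~ (x < xzero al be < y) -> 0 <= xlin al be m -> 0 <= xlin al be s.
Proof.
move=> /andP[xm my] /andP[xs sy] nz; rewrite !xlinE !pmulr_rge0 ?expR_gt0// => hm.
rewrite leNgt; apply/negP => hs.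
have [b0|b0|b0] := ltrgt0P be.
- have h1 : expR (s * 2) < - al / be by rewrite ltr_pdivlMr// mulrC; lra.
  have h2 : - al / be <= expR (m * 2) by rewrite ler_pdivrMr// mulrC; lra.
  have p0 : 0 < - al / be by apply: lt_trans h1; exact: expR_gt0.
  have e : expR (xzero al be * 2) = - al / be by rewrite /xzero divfK// lnK.
  by rewrite -e ltr_expR in h1; rewrite -e ler_expR in h2; apply: nz; apply/andP; split; lra.
- have h1 : - al / be < expR (s * 2) by rewrite ltr_ndivrMr// mulrC; lra.
  have h2 : expR (m * 2) <= - al / be by rewrite ler_ndivlMr// mulrC; lra.
  have p0 : 0 < - al / be by apply: lt_le_trans h2; exact: expR_gt0.
  have e : expR (xzero al be * 2) = - al / be by rewrite /xzero divfK// lnK.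
  by rewrite -e ltr_expR in h1; rewrite -e ler_expR in h2; apply: nz; apply/andP; split; lra.
- by move: hm hs; rewrite b0 !mul0r !addr0; lra.
Qed.

End ExpLinear.

Lemma near_midpoints (R : realType) (a t0 om op : R) : om < t0 -> t0 < op ->
  `|a - t0| <= `|a - op| -> `|a - t0| <= `|a - om| -> (t0 + om) / 2 <= a <= (t0 + op) / 2.
Proof.
move=> h1 h2; case: (ger0P (a - t0)) => h3; case: (ger0P (a - op)) => h4; case: (ger0P (a - om)) => h5 h6 h7;
  apply/andP; split; lra.
Qed.

Lemma midpoints_near (R : realType) (a w t0 om op : R) : om < t0 -> t0 < op -> (t0 + om) / 2 <= a <= (t0 + op) / 2 ->
  [\/ w = t0, op <= w | w <= om] -> `|a - t0| <= `|a - w|.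
Proof.
move=> h1 h2 /andP[h3 h4]; case=> [->//|h5|h5];
  by case: (ger0P (a - t0)) => h6; case: (ger0P (a - w)) => h7; lra.
Qed.

Lemma midpoints_near_eq (R : realType) (a w t0 om op : R) : om < t0 -> t0 < op -> (t0 + om) / 2 < a < (t0 + op) / 2 ->
  [\/ w = t0, op <= w | w <= om] -> `|a - w| <= `|a - t0| -> w = t0.
Proof.
move=> h1 h2 /andP[h3 h4]; case=> [->//|h5|h5];
  by case: (ger0P (a - t0)) => h6; case: (ger0P (a - w)) => h7 h8; lra.
Qed.

(** * The stabilizer of the geodesic and a fundamental segment *)

Section Geom.
Variables (R : realType) (Q : bqf int).
Hypotheses (q0 : qa Q < 0) (q1 : qb Q < 0) (q2 : qc Q < 0) (D0 : 0 < qdisc Q) (pQ : primQ Q).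
Hypothesis Dns : forall e : int, qdisc Q != e ^+ 2.
Local Notation r1 := (r1 R Q).
Local Notation r2 := (r2 R Q).
Local Notation Mt := (@Mt R Q).
Implicit Types (s t : R) (g h : zmat).

Lemma pMt t : posdef (Mt t). Proof. exact: posdef_Mt. Qed.
Lemma r21 : r2 < r1. Proof. exact: r12. Qed.

Lemma red_subproof t : {g | unimod g /\ gauss_domain (z_of (qact (Mt t) g))}.
Proof. by apply: cid; have [g gu hg] := gauss_reduction (pMt t); exists g. Qed.

(** A reducing matrix picked by choice; by [pt_unique] the point [pt t] does not depend on it. *)
Definition gr t := sval (red_subproof t).
Definition pt t : R[i] := z_of (qact (Mt t) (gr t)).

Lemma gr_unimod t : unimod (gr t). Proof. by case: (svalP (red_subproof t)). Qed.
Lemma pt_gauss t : gauss_domain (pt t). Proof. by case: (svalP (red_subproof t)). Qed.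

Lemma pt_unique t g : unimod g -> gauss_domain (z_of (qact (Mt t) g)) -> z_of (qact (Mt t) g) = pt t.
Proof.
move=> gu hg; have ru := gr_unimod t; pose h := zmul (zinv (gr t)) g.
have hu : unimod h by apply: unimodM => //; exact: unimodV.
have e : qact (Mt t) g = qact (qact (Mt t) (gr t)) h.
  by rewrite -qactM /h zmulA zmulV// [in RHS]qactM qact1.
rewrite e; apply: gauss_unique_form => //; [exact: posdef_act (pMt t) ru|exact: pt_gauss|by rewrite -e].
Qed.

Lemma pt_eq s t : pt s = pt t <-> exists2 g, unimod g & qact (Mt s) g = Mt t.
Proof.
split=> [e|[g gu e]].
  have us := gr_unimod s; have ut := gr_unimod t.
  exists (zmul (gr s) (zinv (gr t))); first by apply: unimodM => //; exact: unimodV.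
  rewrite qactM; have -> : qact (Mt s) (gr s) = qact (Mt t) (gr t).
    apply: z_of_inj e; [exact: posdef_act (pMt s) us|exact: posdef_act (pMt t) ut|].
    by rewrite !qdisc_act// !qdisc_Mt.
  by rewrite qactVK.
rewrite -(@pt_unique s (zmul g (gr t))); first by rewrite qactM e.
  by apply: unimodM => //; exact: gr_unimod.
by rewrite qactM e; exact: pt_gauss.
Qed.

(* Action on the parameter of the geodesic: qact (Mt t) g = Mt (al g t) when g preserves Q up to sign. *)
Definition al g t : R := ln (qeval (qact (Mt t) g) r1 1 / (r1 - r2) ^+ 2).

Lemma al_eq g s t : qact (Mt s) g = Mt t -> al g s = t.
Proof.
move=> e; rewrite /al e qeval_Mt mulr1 subrr expr0n /= mulr0 add0r mulr1 mulfK ?expRK//.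
by rewrite expf_neq0// subr_eq0 gt_eqF// r21.
Qed.

(** Stabilizer of the geodesic in GL_2(Z): Q and -Q have the same geodesic, so both signs occur. *)
Definition autg g := unimod g /\ (qact Q g = Q \/ qact Q g = qscale (-1) Q).

(** Such a g fixes or exchanges the lines x = r1 y and x = r2 y, and multiplies the linear forms by
    A1 and A2 with A1 A2 = 1 or -1. Fixing them translates t by -ln(A1^2); exchanging them reflects
    t. *)
Lemma autg_lin g : autg g -> exists (e : R) (c : R), (e = 1 \/ e = -1) /\ forall t, qact (Mt t) g = Mt (e * t + c).
Proof.
move=> [gu hQ].
have [ep [ep1 eQ]] : exists ep : R, ep ^+ 2 = 1 /\ qact (bqf_real R Q) g = qscale ep (bqf_real R Q).
  case: hQ => /(congr1 (@bqf_real R)); rewrite bqf_realact => ->.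
    by exists 1; rewrite expr1n; split=> //; case: (bqf_real R Q) => *; congr BQF; rewrite mul1r.
  exists (-1); rewrite sqrrN expr1n; split=> //; by congr BQF; rewrite /= ?mulN1r intrN.
pose A : R := (za g)%:~R; pose B : R := (zb g)%:~R; pose G : R := (zc g)%:~R; pose H : R := (zd g)%:~R.
pose A1 : R := A - r1 * G; pose B1 : R := B - r1 * H; pose A2 : R := A - r2 * G; pose B2 : R := B - r2 * H.
have q0n : (qa Q)%:~R != 0 :> R by rewrite intr_eq0 lt_eqF.
have eb := sum_r R q0; have ec := prod_r R q0 D0.
have [h0 h1 h2] : [/\ A1 * A2 = ep, A1 * B2 + A2 * B1 = - ep * (r1 + r2) & B1 * B2 = ep * (r1 * r2)].
  have e0 := congr1 (@qa _) eQ; have e1 := congr1 (@qb _) eQ; have e2 := congr1 (@qc _) eQ.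
  rewrite /= /qeval /= eb ec -/A -/B -/G -/H in e0 e1 e2.
  split; apply: (mulfI q0n).
  - transitivity (ep * (qa Q)%:~R); last by ring.
    by rewrite -e0 /A1 /A2; ring.
  - transitivity (ep * (- (qa Q)%:~R * (r1 + r2))); last by ring.
    by rewrite -e1 /A1 /A2 /B1 /B2; ring.
  - transitivity (ep * ((qa Q)%:~R * (r1 * r2))); last by ring.
    by rewrite -e2 /B1 /B2; ring.
have ep0 : ep != 0 by apply/eqP => e0; move: ep1; rewrite e0 expr0n /= => /eqP; rewrite eq_sym oner_eq0.
have A10 : A1 != 0 by apply: contraNneq ep0 => e; rewrite -h0 e mul0r.
have A20 : A2 != 0 by apply: contraNneq ep0 => e; rewrite -h0 e mulr0.
have A12 : 0 < A1 ^+ 2 by rewrite exprn_even_gt0.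
have AA : A1 ^+ 2 * A2 ^+ 2 = 1 by rewrite -exprMn h0.
have A2E : A2 ^+ 2 = expR (- ln (A1 ^+ 2)) by rewrite expRN lnK// -[RHS]mulr1 -AA mulKf// gt_eqF.
have A1E : A1 ^+ 2 = expR (ln (A1 ^+ 2)) by rewrite lnK.
have act t : qact (Mt t) g = BQF (expR (- t) * A1 ^+ 2 + expR t * A2 ^+ 2)
   (2 * (expR (- t) * A1 * B1 + expR t * A2 * B2)) (expR (- t) * B1 ^+ 2 + expR t * B2 ^+ 2).
  by congr BQF; rewrite /= /qeval /= -/A -/B -/G -/H /A1 /A2 /B1 /B2; ring.
have : (B1 + r1 * A1) * (B1 + r2 * A1) = 0.
  apply: (mulfI A20); rewrite mulr0.
  transitivity (B1 * (A1 * B2 + A2 * B1 + (r1 + r2) * (A1 * A2)) - A1 * (B1 * B2 - r1 * r2 * (A1 * A2))); first by ring.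
  by rewrite h0 h1 h2; ring.
move/eqP; rewrite mulf_eq0 => /orP[]/eqP e1.
  have b1 : B1 = - r1 * A1 by lra.
  have b2 : B2 = - r2 * A2.
    apply: (mulfI A10); transitivity (- ep * (r1 + r2) - A2 * B1); first by rewrite -h1; ring.
    by rewrite b1 -h0; ring.
  exists 1, (- ln (A1 ^+ 2)); split; first by left.
  move=> t; rewrite act b1 b2 /Mt mul1r opprD opprK !expRD -A2E -A1E; congr BQF; ring.
have b1 : B1 = - r2 * A1 by lra.
have b2 : B2 = - r1 * A2.
  apply: (mulfI A10); transitivity (- ep * (r1 + r2) - A2 * B1); first by rewrite -h1; ring.
  by rewrite b1 -h0; ring.
exists (-1), (ln (A1 ^+ 2)); split; first by right.
by move=> t; rewrite act b1 b2 /Mt mulN1r opprD opprK !expRD -A2E -A1E; congr BQF; ring.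
Qed.

Lemma al_lin g : autg g -> exists (e : R) (c : R), (e = 1 \/ e = -1) /\ forall t, al g t = e * t + c.
Proof. by move=> /autg_lin[e [c [he h]]]; exists e, c; split=> // t; apply: al_eq. Qed.

Lemma al_spec g t : autg g -> qact (Mt t) g = Mt (al g t).
Proof. by move=> /autg_lin[e [c [he h]]]; rewrite (al_eq (h t)). Qed.

Lemma al_dist g s t : autg g -> `|al g s - al g t| = `|s - t|.
Proof.
move=> /al_lin[e [c [he h]]]; rewrite !h opprD addrACA subrr addr0 -mulrBr normrM.
by case: he => ->; rewrite ?normrN normr1 mul1r.
Qed.

Lemma qscaleN (A : comNzRingType) (M : bqf A) : qscale (-1) (qscale (-1) M) = M.
Proof. by case: M => *; congr BQF; rewrite /= !mulN1r opprK. Qed.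

Lemma autg_mul g h : autg g -> autg h -> autg (zmul g h).
Proof.
move=> [gu hg] [hu hh]; split; first exact: unimodM.
rewrite qactM; case: hg => ->; case: hh => hh; rewrite ?qact_scale hh; [by left|by right|by right|].
by left; rewrite qscaleN.
Qed.

Lemma autg_inv g : autg g -> autg (zinv g).
Proof.
move=> [gu hg]; split; first exact: unimodV.
by case: hg => hg; [left|right]; rewrite -[in RHS](qactVK Q gu) hg// qact_scale qscaleN.
Qed.

Lemma autg1 : autg zone. Proof. by split=> //; left; rewrite qact1. Qed.

Lemma al1 t : al zone t = t. Proof. by apply: al_eq; rewrite qact1. Qed.

Lemma alM g h t : autg g -> autg h -> al (zmul g h) t = al h (al g t).
Proof.
move=> ag ah; apply: al_eq; rewrite qactM (al_spec _ ag) (al_spec _ ah)//.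
Qed.

Lemma alK g t : autg g -> al (zinv g) (al g t) = t.
Proof.
by move=> ag; rewrite -(alM t ag (autg_inv ag)) zmulV ?al1//; case: ag.
Qed.

Lemma alVK g t : autg g -> al g (al (zinv g) t) = t.
Proof.
by move=> ag; rewrite -(alM t (autg_inv ag) ag) zmulVg ?al1//; case: ag.
Qed.

Lemma pt_al g t : autg g -> pt (al g t) = pt t.
Proof. by move=> ag; apply/esym/pt_eq; exists g; [case: ag|exact: al_spec]. Qed.

Lemma expR_norm_ge (L s : R) : `|s| <= L -> expR (- L) <= expR s <= expR L.
Proof. by rewrite ler_norml => /andP[h1 h2]; rewrite !ler_expR h1. Qed.

Lemma qeval_Mt_ge (L s : R) x y : `|s| <= L -> expR (- L) * qeval (Mt 0) x y <= qeval (Mt s) x y.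
Proof.
move=> hs; have /andP[h1 _] := expR_norm_ge hs.
have /andP[h2 _] : expR (- L) <= expR (- s) <= expR L by apply: expR_norm_ge; rewrite normrN.
rewrite !qeval_Mt oppr0 expR0 !mul1r mulrDr.
by apply: lerD; rewrite ler_wpM2r ?sqr_ge0.
Qed.

(* Columns of g are short vectors of [Mt 0], so only finitely many g move a compact range of times
   to forms with bounded diagonal. *)
Lemma finite_moves (L C : R) : finite_set [set g | exists2 s, `|s| <= L &
  qa (qact (Mt s) g) <= C /\ qc (qact (Mt s) g) <= C].
Proof.
have fin := posdef_finite (C * expR L) (pMt 0).
pose F (x : (int * int) * (int * int)) := ZM x.1.1 x.2.1 x.1.2 x.2.2.
apply: sub_finite_set (finite_image F (finite_setX fin fin)).
move=> g [s hs [h1 h2]]; exists ((za g, zc g), (zb g, zd g)); last by case: g {h1 h2}.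
have key x y : qeval (Mt s) x y <= C -> qeval (Mt 0) x y <= C * expR L.
  move=> h; rewrite -ler_pdivrMr ?expR_gt0// -expRN mulrC.
  exact: le_trans (qeval_Mt_ge x y hs) h.
by split=> /=; apply: key.
Qed.

Lemma finite_bound (T : Type) (S : set T) (P : T -> R -> Prop) : finite_set S ->
  (forall x L L', P x L -> L <= L' -> P x L') -> (forall x, S x -> exists L, P x L) ->
  exists L, forall x, S x -> P x L.
Proof.
move=> fS mono; have /finite_seqP[s es] : finite_set (S : set {classic T}) := fS.
rewrite {S fS}es; elim: s => [|x s ih] h; first by exists 0.
have [L hL] : exists L, forall y, [set` s] y -> P y L by apply: ih => y ys; apply: h; rewrite /= inE ys orbT.
have [L' hL'] := h x (mem_head _ _).
exists (Num.max L L') => y; rewrite /= inE => /orP[/eqP ->|ys].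
  by apply: mono hL' _; rewrite le_max lexx orbT.
by apply: mono (hL y ys) _; rewrite le_max lexx.
Qed.

Lemma reduced_qa (M : bqf R) : posdef M -> gauss_domain (z_of M) -> 3 * qa M ^+ 2 <= - qdisc M.
Proof.
move=> pM /(gauss_z_of pM)[b0 b1 b2]; have [a0 _] := pM; rewrite /qdisc; nra.
Qed.

(** Apolarity reads 2 (a t + c r) = b s. When a c > 0, the inequality of the means and s <= r <= t
    give 16 a c <= b^2, so the discriminant controls b^2; otherwise it does so directly. The bound
    on a c follows. *)
Lemma reduced_apolar (M : bqf R) (F : bqf R) : posdef M -> gauss_domain (z_of M) -> qpol F M = 0 -> 0 < qdisc F ->
  3 * qb F ^+ 2 <= 4 * qdisc F /\ `|qa F * qc F| <= qdisc F.
Proof.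
move=> pM /(gauss_z_of pM)[s0 sr rt] ap dF; have [r0 _] := pM.
case: F ap dF => a b c; case: M pM r0 s0 sr rt => r s t pM /= r0 s0 sr rt; rewrite /qpol /qdisc /= => ap dF.
have e : 2 * (a * t + c * r) = b * s by lra.
have t0 : 0 < t by lra.
have key : 3 * b ^+ 2 <= 4 * (b ^+ 2 - a * c *+ 4).
  have [ac|ac] := leP (a * c) 0; first by nra.
  have h1 : 16 * (a * c) * (r * t) <= b ^+ 2 * s ^+ 2.
    rewrite -exprMn -e; have := sqr_ge0 (a * t - c * r); lra.
  have h2 : b ^+ 2 * s ^+ 2 <= b ^+ 2 * (r * t).
    by rewrite ler_wpM2l ?sqr_ge0// expr2; apply: ler_pM => //; lra.
  have : 16 * (a * c) <= b ^+ 2.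
    by rewrite -(ler_pM2r (mulr_gt0 r0 t0)); apply: le_trans h1 h2.
  by lra.
split=> //; rewrite ler_norml; have := sqr_ge0 b => ?; apply/andP; split; lra.
Qed.

Lemma form_box_finite (C : R) : finite_set [set F : bqf int |
  [/\ `|(qa F)%:~R : R| <= C, `|(qb F)%:~R : R| <= C & `|(qc F)%:~R : R| <= C]].
Proof.
pose G (x : int * (int * int)) := BQF x.1 x.2.1 x.2.2.
apply: sub_finite_set (finite_image G (finite_setX (finite_int_box C) (finite_int2_box C))).
by move=> [a b c] [/= h1 h2 h3]; exists (a, (b, c)).
Qed.

Lemma qa_neq0 (F : bqf int) : (forall e : int, qdisc F != e ^+ 2) -> qa F != 0 /\ qc F != 0.
Proof.
move=> h; split; apply/eqP => e; have := h (qb F); rewrite /qdisc e ?mul0r ?mulr0 mul0rn subr0 eqxx//.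
Qed.

Lemma qpol_Q_Mt t : qpol (bqf_real R Q) (Mt t) = 0.
Proof. by rewrite /qpol /= (sum_r R q0) (prod_r R q0 D0); ring. Qed.

Lemma finite_forms : finite_set [set F | exists t, F = qact Q (gr t)].
Proof.
apply: sub_finite_set (form_box_finite ((qdisc Q)%:~R * 2 + 2)) => F [t ->].
have gu := gr_unimod t; have pM := posdef_act (pMt t) gu.
have dF : qdisc (qact Q (gr t)) = qdisc Q by rewrite qdisc_act.
have dR : qdisc (bqf_real R (qact Q (gr t))) = (qdisc Q)%:~R.
  by rewrite -dF /qdisc /=; ring.
have ap : qpol (bqf_real R (qact Q (gr t))) (qact (Mt t) (gr t)) = 0.
  by rewrite bqf_realact qpol_act// qpol_Q_Mt.
have DR : 0 < (qdisc Q)%:~R :> R by rewrite ltr0z.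
have [] := reduced_apolar pM (pt_gauss t) ap; first by rewrite dR.
(* As D is not a square, the outer coefficients are nonzero integers, so the bound on their product
   bounds each of them. *)
have [a0 c0] : qa (qact Q (gr t)) != 0 /\ qc (qact Q (gr t)) != 0.
  by apply: qa_neq0 => e; rewrite dF.
rewrite dR; move: (qact Q (gr t)) a0 c0 => [a b c] /= a0 c0; set D : R := (qdisc Q)%:~R in DR *.
have h1 (x : int) : x != 0 -> 1 <= `|x%:~R : R| by move=> x0; rewrite -intr_norm -[1]/(1%:~R) ler_int; lia.
have {a0}a1 := h1 _ a0; have {c0}c1 := h1 _ c0.
rewrite normrM => hb hac; split.
- by have : `|a%:~R : R| * 1 <= `|a%:~R : R| * `|c%:~R : R| by [apply: ler_wpM2l]; lra.
- have := @norm_le_of_sqr R b%:~R (4 / 3 * D) ltac:(lra); lra.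
- by have : 1 * `|c%:~R : R| <= `|a%:~R : R| * `|c%:~R : R| by [apply: ler_wpM2r]; lra.
Qed.

(** A vector on neither root line has values under [Mt s] growing like e^|s|. *)
Lemma vector_time_bound (x y C : R) : (x - r1 * y) * (x - r2 * y) != 0 ->
  exists L, forall s, qeval (Mt s) x y <= C -> `|s| <= L.
Proof.
rewrite mulf_eq0 negb_or => /andP[m1 m2].
have u1 : 0 < (x - r1 * y) ^+ 2 by rewrite exprn_even_gt0.
have u2 : 0 < (x - r2 * y) ^+ 2 by rewrite exprn_even_gt0.
pose U := Num.min ((x - r1 * y) ^+ 2) ((x - r2 * y) ^+ 2).
have U0 : 0 < U by rewrite lt_min u1.
exists (`|C| / U) => s; rewrite qeval_Mt => h.
have hx : expR `|s| * U <= C.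
  apply: le_trans h; have [s0|s0] := ger0P s.
    apply: (@le_trans _ _ (expR s * (x - r2 * y) ^+ 2)).
      by rewrite ler_pM2l ?expR_gt0// ge_min lexx orbT.
    by rewrite lerDr mulr_ge0 ?sqr_ge0// ltW// expR_gt0.
  apply: (@le_trans _ _ (expR (- s) * (x - r1 * y) ^+ 2)).
    by rewrite ler_pM2l ?expR_gt0// ge_min lexx.
  by rewrite lerDl mulr_ge0 ?sqr_ge0// ltW// expR_gt0.
rewrite ler_pdivlMr//; apply: le_trans (le_trans hx (ler_norm C)); rewrite ler_pM2r//.
by have := expR_ge1Dx `|s|; lra.
Qed.

(* Gauss reduction leaves finitely many shapes for Q o gr t, so the automorphs of Q act cocompactly. *)
Lemma cocompact : exists L : R, forall t, exists g, [/\ unimod g, qact Q g = Q & `|al g t| <= L].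
Proof.
pose P (F : bqf int) (L : R) := forall t, F = qact Q (gr t) -> exists g, [/\ unimod g, qact Q g = Q & `|al g t| <= L].
have mono F L L' : P F L -> L <= L' -> P F L'.
  by move=> h LL t /h[g [? ? ?]]; exists g; split=> //; exact: le_trans LL.
suff ex F : (exists t, F = qact Q (gr t)) -> exists L, P F L.
  have [L hL] := finite_bound finite_forms mono ex.
  by exists L => t; apply: (hL (qact Q (gr t))) => //; exists t.
case=> u eF.
have uu := gr_unimod u.
have nz : ((za (gr u))%:~R - r1 * (zc (gr u))%:~R) * ((za (gr u))%:~R - r2 * (zc (gr u))%:~R) != 0.
  have : qa (qact Q (gr u)) != 0 by apply: (qa_neq0 _).1 => e; rewrite qdisc_act.
  apply: contraNneq => e; rewrite -(intr_eq0 R).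
  have -> : (qa (qact Q (gr u)))%:~R = qa (bqf_real R (qact Q (gr u))) :> R by [].
  rewrite bqf_realact /= /qeval /= (sum_r R q0) (prod_r R q0 D0); apply/eqP.
  transitivity ((qa Q)%:~R * (((za (gr u))%:~R - r1 * (zc (gr u))%:~R) * ((za (gr u))%:~R - r2 * (zc (gr u))%:~R))); first by ring.
  by rewrite e mulr0.
(* A reduced leading coefficient A satisfies 3 A^2 <= 4 (r1 - r2)^2, and A <= A^2 + 1. *)
have [L hL] := vector_time_bound (4 * (r1 - r2) ^+ 2 / 3 + 1) nz.
exists L => t et; have ut := gr_unimod t.
(* Both reductions carry Q to the same form F, so their quotient is an automorph of Q; it sends t to
   a time at which [gr u] reduces. *)
pose g := zmul (gr t) (zinv (gr u)).
have gu : unimod g by apply: unimodM => //; exact: unimodV.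
have gQ : qact Q g = Q by rewrite /g qactM -et eF qactVK.
have ag : autg g by split=> //; left.
exists g; split=> //; apply: hL.
have e : qact (Mt (al g t)) (gr u) = qact (Mt t) (gr t).
  by rewrite -al_spec// /g -qactM -zmulA zmulVg// zmul1.
rewrite -[qeval _ _ _]/(qa (qact (Mt (al g t)) (gr u))) e.
have pM := posdef_act (pMt t) ut; have := reduced_qa pM (pt_gauss t).
rewrite qdisc_act// qdisc_Mt opprK => h.
have [a0 _] := pM; have := sqr_ge0 (qa (qact (Mt t) (gr t)) - 1); lra.
Qed.

Lemma Mt_coef (L s : R) : `|s| <= L -> qa (Mt s) <= expR L * (2 + r1 ^+ 2 + r2 ^+ 2) /\
  qc (Mt s) <= expR L * (2 + r1 ^+ 2 + r2 ^+ 2).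
Proof.
move=> hs; have /andP[_ h1] := expR_norm_ge hs.
have /andP[_ h2] : expR (- L) <= expR (- s) <= expR L by apply: expR_norm_ge; rewrite normrN.
have a1 := sqr_ge0 r1; have a2 := sqr_ge0 r2; have e0 := expR_gt0 L.
by split=> /=; nra.
Qed.

Lemma finite_autg (s C : R) : finite_set [set g | autg g /\ `|al g s| <= C].
Proof.
apply: sub_finite_set (finite_moves `|s| (expR C * (2 + r1 ^+ 2 + r2 ^+ 2))) => g [ag hg].
by exists s => //; rewrite al_spec//; exact: Mt_coef.
Qed.

(** Only the reflections t -> c - t with fixed point c/2 have to be avoided, and those with fixed
    point in (0, 1) are finitely many by [finite_autg]. *)
Lemma generic_point : exists t0 : R, forall g, autg g -> al g t0 = t0 -> forall t, al g t = t.
Proof.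
have /finite_seqP[l el] : finite_set ((fun g => al g 0 / 2) @` [set g | autg g /\ `|al g 0| <= 2]).
  exact/finite_image/finite_autg.
have [t0 /andP[h0 h1] nl] := @exists_outside R l 0 1 ltr01.
exists t0 => g ag fx t; have [e [c [he h]]] := al_lin ag.
rewrite !h in fx *; case: he => ee; rewrite ee in fx *.
  by rewrite (_ : c = 0) ?addr0 ?mul1r//; lra.
exfalso; case/negP: nl.
suff : [set` l] t0 by [].
rewrite -el; exists g; last by rewrite h mulr0 add0r; lra.
by split=> //; rewrite h mulr0 add0r ger0_norm; lra.
Qed.

(** Dirichlet cell of a generic point t0: its ends are the midpoints between t0 and its two
    neighbours in the orbit. They exist because the orbit is discrete and, by cocompactness,
    unbounded on both sides. *)
Lemma cell : exists (c0 c1 : R), [/\ c0 < c1,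
  forall t, exists2 h, autg h & c0 <= al h t <= c1 &
  forall h s, autg h -> c0 < s < c1 -> c0 <= al h s <= c1 -> forall t, al h t = t].
Proof.
have [t0 tz] := generic_point; have [L hL] := cocompact.
pose Ob : set R := [set v | exists2 g, autg g & v = al g t0].
have finOb C : finite_set (Ob `&` [set v | `|v| <= C]).
  apply: sub_finite_set (finite_image (fun g => al g t0) (finite_autg t0 C)).
  by move=> _ [[g ag ->] /= h]; exists g.
have far t : exists2 v, Ob v & `|t - v| <= L + `|t0|.
  have [g [gu gQ hg]] := hL t; have ag : autg g by split=> //; left.
  exists (al (zinv g) t0); first by exists (zinv g) => //; exact: autg_inv.
  rewrite -(al_dist _ _ ag) alVK//; apply: le_trans (ler_normB _ _) _.
  by rewrite lerD2r.
have L0 : 0 <= L by have [g [_ _ h]] := hL 0; apply: le_trans h.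
have t0n := normr_ge0 t0.
have [op [hOp hop minp]] : exists v, [/\ Ob v, t0 < v & forall v', Ob v' -> t0 < v' -> v <= v'].
  apply: next_above finOb _; have [v hv h] := far (t0 + (L + `|t0| + 1)).
  by exists v => //; move: h; rewrite ler_norml => /andP[]; lra.
have [om [hOm hom minm]] : exists v, [/\ Ob v, v < t0 & forall v', Ob v' -> v' < t0 -> v' <= v].
  have finN C : finite_set ([set v | Ob (- v)] `&` [set v | `|v| <= C]).
    apply: sub_finite_set (finite_image (fun x => - x) (finOb C)).
    by move=> v [/= h1 h2]; exists (- v); [split=> //=; rewrite normrN|rewrite opprK].
  have exN : exists2 v, [set v | Ob (- v)] v & - t0 < v.
    have [v hv h] := far (t0 - (L + `|t0| + 1)); exists (- v); rewrite /= ?opprK//.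
    by move: h; rewrite ler_norml => /andP[]; lra.
  have [v [hv ho hmin]] := next_above finN exN.
  exists (- v); split=> //; first by lra.
  by move=> v' hv' h; rewrite lerNr; apply: hmin; rewrite /= ?opprK//; lra.
exists ((t0 + om) / 2), ((t0 + op) / 2); split; first by lra.
  move=> t; pose C := `|t| + `|t - t0|.
  have nB : (Ob `&` [set v | `|v| <= C]) !=set0.
    exists t0; split; first by exists zone; [exact: autg1|rewrite al1].
    rewrite /= /C; have := ler_normB t (t - t0); rewrite (_ : t - (t - t0) = t0)//; ring.
  have [v [[g ag ev] _] hmin] := finite_argmin (fun v => `|t - v|) (finOb C) nB.
  have {}hmin v' : Ob v' -> `|t - v| <= `|t - v'|.
    move=> hv'; have [h|h] := leP `|v'| C; first exact: hmin.
    apply: (@le_trans _ _ `|t - t0|).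
      apply: hmin; split; first by exists zone; [exact: autg1|rewrite al1].
      rewrite /= /C; have := ler_normB t (t - t0); rewrite (_ : t - (t - t0) = t0)//; ring.
    have : `|v'| <= `|t| + `|t - v'|.
      by have := ler_normB t (t - v'); rewrite (_ : t - (t - v') = v')//; ring.
    by move: h; rewrite /C; lra.
  have agi := autg_inv ag; exists (zinv g) => //.
  set s := al (zinv g) t; have ts : t = al g s by rewrite /s alVK.
  have key v' : Ob v' -> `|s - t0| <= `|s - v'|.
    move=> [g' ag' ->]; rewrite -(al_dist s t0 ag) -(al_dist s _ ag) -ts -ev -alM//.
    by apply: hmin; exists (zmul g' g) => //; exact: autg_mul.
  exact: near_midpoints hom hop (key _ hOp) (key _ hOm).
move=> h s ah hs hs'.
have orbh g : autg g -> Ob (al g t0) by exists g.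
have tri v : Ob v -> [\/ v = t0, op <= v | v <= om].
  move=> hv; have [h1|h1|h1] := ltrgtP v t0; [apply: Or33|apply: Or32|apply: Or31] => //; [exact: minm|exact: minp].
have ahi := autg_inv ah.
have k1 : `|al h s - t0| <= `|s - t0|.
  by rewrite -(al_dist s t0 ah); exact: midpoints_near hom hop hs' (tri _ (orbh _ ah)).
have k2 : `|al h s - t0| = `|s - al (zinv h) t0| by rewrite -(al_dist s _ ah) alVK.
have e : al (zinv h) t0 = t0.
  by rewrite k2 in k1; exact: midpoints_near_eq hom hop hs (tri _ (orbh _ ahi)) k1.
by move=> t; rewrite -[in LHS](tz _ ahi e t) alVK.
Qed.

(** The squares of x - r1 y and, below, of x - r2 y: [Mt s] is e^(-s) [U1] + e^s [U2]. *)
Definition U1 : bqf R := BQF 1 (- 2 * r1) (r1 ^+ 2).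
Definition U2 : bqf R := BQF 1 (- 2 * r2) (r2 ^+ 2).

Lemma qact_Mt s g :
  [/\ qa (qact (Mt s) g) = xlin (qa (qact U1 g)) (qa (qact U2 g)) s,
      qb (qact (Mt s) g) = xlin (qb (qact U1 g)) (qb (qact U2 g)) s &
      qc (qact (Mt s) g) = xlin (qc (qact U1 g)) (qc (qact U2 g)) s].
Proof. by rewrite /xlin /= /qeval /=; split; ring. Qed.

Lemma qpol_Mt_lin (F : bqf R) s : qpol F (Mt s) = xlin (qpol F U1) (qpol F U2) s.
Proof. by rewrite /xlin /qpol /=; ring. Qed.

(** Pairing with [U1] or [U2] is twice the value of F at the corresponding root of Q. Hence F is
    proportional to Q, and equal discriminants leave only the sign. *)
Lemma qpol_U (F : bqf int) : qdisc F = qdisc Q -> qpol (bqf_real R F) U1 = 0 -> qpol (bqf_real R F) U2 = 0 ->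
  F = Q \/ F = qscale (-1) Q.
Proof.
case: F => a b c; rewrite /qpol /= => dF h1 h2.
have r := r21; have dr : r1 - r2 != 0 by rewrite subr_eq0 gt_eqF.
have eb : b%:~R = - a%:~R * (r1 + r2) :> R.
  apply: (mulfI dr); apply: (mulfI (_ : 2 != 0)) => //; lra.
have ec : c%:~R = a%:~R * (r1 * r2) :> R by rewrite eb in h1; lra.
have : (a%:~R - (qa Q)%:~R) * (a%:~R + (qa Q)%:~R) = 0 :> R.
  have d1 := disc_r R q0 D0; have d2 : (qdisc (BQF a b c))%:~R = a%:~R ^+ 2 * (r1 - r2) ^+ 2 :> R.
    transitivity (b%:~R ^+ 2 - 4 * a%:~R * c%:~R : R); first by rewrite /qdisc /=; ring.
    by rewrite eb ec; ring.
  have dr2 : (r1 - r2) ^+ 2 != 0 by rewrite expf_neq0.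
  apply: (mulIf dr2); rewrite mul0r; transitivity (a%:~R ^+ 2 * (r1 - r2) ^+ 2 - (qa Q)%:~R ^+ 2 * (r1 - r2) ^+ 2); first by ring.
  by rewrite -d1 -d2 dF subrr.
have eb' := sum_r R q0; have ec' := prod_r R q0 D0.
have ii (x y : int) : x%:~R = y%:~R :> R -> x = y by move/eqP; rewrite eqr_int => /eqP.
move=> /eqP; rewrite mulf_eq0 => /orP[]/eqP e; [left|right].
  have ea : a = qa Q by apply: ii; lra.
  have eb2 : b = qb Q by apply: ii; rewrite eb eb' ea.
  have ec2 : c = qc Q by apply: ii; rewrite ec ec' ea.
  by rewrite ea eb2 ec2; case: (Q).
have ea : a = - qa Q by apply: ii; rewrite intrN; lra.
have eb2 : b = - qb Q by apply: ii; rewrite eb intrN eb' ea intrN; ring.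
have ec2 : c = - qc Q by apply: ii; rewrite ec intrN ec' ea intrN; ring.
by rewrite ea eb2 ec2; congr BQF; rewrite /= mulN1r.
Qed.

Lemma vector_ge (L s : R) (x y : int) : `|s| <= L -> (x != 0) || (y != 0) ->
  expR (- L) * ((r1 - r2) ^+ 2 / (2 + r1 ^+ 2 + r2 ^+ 2)) <= qeval (Mt s) x%:~R y%:~R.
Proof.
move=> hs nz; apply: le_trans (qeval_Mt_ge _ _ hs); rewrite ler_pM2l ?expR_gt0//.
have b1 := posdef_bound_x x%:~R y%:~R (pMt 0); have b2 := posdef_bound_y x%:~R y%:~R (pMt 0).
rewrite qdisc_Mt opprK in b1 b2.
have k0 : 0 < 2 + r1 ^+ 2 + r2 ^+ 2 by have := sqr_ge0 r1; have := sqr_ge0 r2; lra.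
rewrite ler_pdivrMr//; set v := qeval _ _ _ in b1 b2 *.
have v0 : 0 <= v by rewrite /v qeval_Mt addr_ge0// mulr_ge0 ?sqr_ge0// ltW// expR_gt0.
have d0 : 0 <= (r1 - r2) ^+ 2 by exact: sqr_ge0.
have ca : qa (Mt 0) = 2 by rewrite /= oppr0 expR0.
have cc : qc (Mt 0) = r1 ^+ 2 + r2 ^+ 2 by rewrite /= oppr0 expR0 !mul1r.
have sq1 (z : int) : z != 0 -> 1 <= (z%:~R : R) ^+ 2.
  move=> z0; rewrite -rmorphXn /= -[1]/(1%:~R) ler_int; have : 0 < z ^+ 2 by rewrite exprn_even_gt0.
  by lia.
rewrite ca in b2; rewrite cc in b1.
have a1 := sqr_ge0 r1; have a2 := sqr_ge0 r2.
have p1 : 0 <= v * (r1 ^+ 2 + r2 ^+ 2) by rewrite mulr_ge0// addr_ge0.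
case/orP: nz => /sq1 h.
  have : 1 * (4 * (r1 - r2) ^+ 2) <= x%:~R ^+ 2 * (4 * (r1 - r2) ^+ 2) by apply: ler_wpM2r => //; lra.
  by lra.
have : 1 * (4 * (r1 - r2) ^+ 2) <= y%:~R ^+ 2 * (4 * (r1 - r2) ^+ 2) by apply: ler_wpM2r => //; lra.
by lra.
Qed.

(** The leading coefficient is a value of [Mt s] at a nonzero integral vector, hence bounded below
    on a compact range of times; the product of the outer coefficients is bounded by the
    discriminant. *)
Lemma reduced_bound (L : R) : exists C, forall s g, `|s| <= L -> unimod g -> gauss_domain (z_of (qact (Mt s) g)) ->
  qa (qact (Mt s) g) <= C /\ qc (qact (Mt s) g) <= C.
Proof.
have r := r21; have k0 : 0 < 2 + r1 ^+ 2 + r2 ^+ 2 by have := sqr_ge0 r1; have := sqr_ge0 r2; lra.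
have d0 : 0 < (r1 - r2) ^+ 2 by rewrite exprn_gt0// subr_gt0.
set m := expR (- L) * ((r1 - r2) ^+ 2 / (2 + r1 ^+ 2 + r2 ^+ 2)).
have m0 : 0 < m by rewrite mulr_gt0 ?expR_gt0// divr_gt0.
exists ((r1 - r2) ^+ 2 * 4 / m + (r1 - r2) ^+ 2 * 4 + 1) => s g hs gu hg.
have pM := posdef_act (pMt s) gu.
have h1 := reduced_qa pM hg; have [x0 x1 x2] := (gauss_z_of pM).1 hg.
have h2 : m <= qa (qact (Mt s) g) by apply: (vector_ge hs); exact: unimod_col.
have dd : qdisc (qact (Mt s) g) = - (4 * (r1 - r2) ^+ 2) by rewrite qdisc_act// qdisc_Mt.
rewrite dd opprK in h1; move: h1 x0 x1 x2 h2 dd; case: (qact _ _) => a b c; rewrite /qdisc /= => h1 x0 x1 x2 h2 dd.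
have hc : c * m <= (r1 - r2) ^+ 2 * 4.
  have : c * m <= c * a by apply: ler_wpM2l => //; lra.
  have : 3 * (a * c) <= 4 * (r1 - r2) ^+ 2.
    have : b * b <= a * c by apply: ler_pM => //; lra.
    by rewrite -expr2; lra.
  lra.
rewrite -ler_pdivlMr// in hc; split; last by lra.
have : 0 <= (r1 - r2) ^+ 2 * 4 / m by rewrite divr_ge0//; lra.
have := sqr_ge0 (a - 1); lra.
Qed.

(* The finitely many times at which an inequality of Gauss reduction degenerates, or at which the
   geodesic crosses one of its translates. *)
Definition events (g : zmat) : seq R :=
  [:: xzero (qb (qact U1 g)) (qb (qact U2 g));
      xzero (qa (qact U1 g) - qb (qact U1 g)) (qa (qact U2 g) - qb (qact U2 g));
      xzero (qc (qact U1 g) - qa (qact U1 g)) (qc (qact U2 g) - qa (qact U2 g));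
      xzero (qpol (bqf_real R (qact Q (zinv g))) U1) (qpol (bqf_real R (qact Q (zinv g))) U2)].

Lemma gauss_stays g x y m s : unimod g -> gauss_domain (z_of (qact (Mt m) g)) -> x < m < y -> x <= s <= y ->
  (forall e, e \in events g -> ~ (x < e < y)) -> gauss_domain (z_of (qact (Mt s) g)).
Proof.
move=> gu hg xmy xsy hE; have pM t := posdef_act (pMt t) gu.
have [h1 h2 h3] := (gauss_z_of (pM m)).1 hg; apply/(gauss_z_of (pM s)).
have e1 t : qb (qact (Mt t) g) = xlin (qb (qact U1 g)) (qb (qact U2 g)) t by case: (qact_Mt t g).
have e2 t : qa (qact (Mt t) g) - qb (qact (Mt t) g) = xlin (qa (qact U1 g) - qb (qact U1 g)) (qa (qact U2 g) - qb (qact U2 g)) t.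
  by case: (qact_Mt t g) => -> -> _; rewrite /xlin; ring.
have e3 t : qc (qact (Mt t) g) - qa (qact (Mt t) g) = xlin (qc (qact U1 g) - qa (qact U1 g)) (qc (qact U2 g) - qa (qact U2 g)) t.
  by case: (qact_Mt t g) => -> _ ->; rewrite /xlin; ring.
have mem k : (k < 4)%N -> nth 0 (events g) k \in events g by move=> ?; apply: mem_nth.
split.
- by rewrite e1; apply: (xlin_sign xmy xsy (hE _ (mem 0%N isT))); rewrite -e1.
- by rewrite -subr_ge0 e2; apply: (xlin_sign xmy xsy (hE _ (mem 1%N isT))); rewrite -e2 subr_ge0.
- by rewrite -subr_ge0 e3; apply: (xlin_sign xmy xsy (hE _ (mem 2%N isT))); rewrite -e3 subr_ge0.
Qed.

(** [Mt s] lies on the geodesic of Q moved by the inverse of g. Either this geodesic is that of Q,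
    and g stabilizes it, or the two meet at the single time recorded as the last event of g. *)
Lemma cross_time g s t : unimod g -> qact (Mt s) g = Mt t -> autg g \/ s \in events g.
Proof.
move=> gu e; have vu := unimodV gu.
have h0 : qpol (bqf_real R (qact Q (zinv g))) (Mt s) = 0.
  rewrite bqf_realact -[Mt s](qactVK _ gu) qpol_act// e; exact: qpol_Q_Mt.
have dF : qdisc (qact Q (zinv g)) = qdisc Q by rewrite qdisc_act.
have [z1|z1] := eqVneq (qpol (bqf_real R (qact Q (zinv g))) U1) 0; last first.
  right; rewrite qpol_Mt_lin in h0.
  by rewrite (xlin_zero h0) ?z1// !inE eqxx !orbT.
have [z2|z2] := eqVneq (qpol (bqf_real R (qact Q (zinv g))) U2) 0; last first.
  right; rewrite qpol_Mt_lin in h0.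
  by rewrite (xlin_zero h0) ?z2 ?orbT// !inE eqxx !orbT.
left; split=> //; case: (qpol_U dF z1 z2) => hQ; [left|right].
  by rewrite -{1}hQ qactKV.
by rewrite -[in LHS](qscaleN Q) -hQ qact_scale qactKV.
Qed.

(* A fundamental segment for the stabilizer of the geodesic, cut into finitely many arcs, each carried
   by a single reduction matrix, on which [pt] is injective. *)
Theorem arcs : exists n (x y : 'I_n -> R) (g : 'I_n -> zmat),
  [/\ (0 < n)%N, forall i, x i < y i,
      forall i, unimod (g i) /\ forall s, x i <= s <= y i -> gauss_domain (z_of (qact (Mt s) (g i))),
      forall t, exists2 h, autg h & exists i, x i <= al h t <= y i &
      (forall i j s s', x i < s < y i -> x j <= s' <= y j -> pt s = pt s' -> i = j /\ s = s') /\
      (forall i h s, x i < s < y i -> autg h -> al h s = s -> forall t, al h t = t)].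
Proof.
have [c0 [c1 [c01 cov inj]]] := cell.
pose L := `|c0| + `|c1|.
have inL s : c0 <= s <= c1 -> `|s| <= L.
  move=> /andP[s0 s1]; rewrite /L ler_norml; have := ler_norm c1; have := ler_norm (- c0); rewrite normrN.
  by have := normr_ge0 c0; have := normr_ge0 c1; move=> *; apply/andP; split; lra.
have [C hC] := reduced_bound L.
(* Large enough for the reducing matrices and also for any matrix carrying one form of the segment
   to another. *)
pose C' := Num.max C (expR L * (2 + r1 ^+ 2 + r2 ^+ 2)).
have [G eG] : exists G : seq {classic zmat}, [set g | exists2 s, `|s| <= L &
  qa (qact (Mt s) g) <= C' /\ qc (qact (Mt s) g) <= C'] = [set` G].
  by apply/finite_seqP; exact: (finite_moves L C').
have inG s (g : {classic zmat}) : c0 <= s <= c1 -> qa (qact (Mt s) g) <= C' /\ qc (qact (Mt s) g) <= C' -> g \in G.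
  by move=> hs hg; suff : [set` G] g by []; rewrite -eG; exists s => //; exact: inL.
have [n [b [n0 b0 bn blt bE]]] := breakpoints (flatten [seq events g | g <- G]) c01.
have bmono i j : (i <= j)%N -> (j <= n)%N -> b i <= b j.
  elim: j => [|j ih]; first by rewrite leqn0 => /eqP ->.
  rewrite leq_eqVlt => /orP[/eqP -> //|ij] jn.
  by apply: le_trans (ih ij (ltnW jn)) (ltW (blt j jn)).
have hE (g : {classic zmat}) i e : g \in G -> (i < n)%N -> e \in events g -> ~ (b i < e < b i.+1).
  move=> gG hi eg; apply: bE => //; apply/flattenP; exists (events g) => //; exact: map_f.
pose mid (i : 'I_n) := (b i + b i.+1) / 2.
have hmid (i : 'I_n) : b i < mid i < b i.+1 by have := blt i (ltn_ord i); rewrite /mid; lra.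
have arcI (i : 'I_n) s : b i <= s <= b i.+1 -> c0 <= s <= c1.
  move=> /andP[h1 h2]; rewrite -b0 -bn (le_trans (bmono 0%N i _ _) h1) ?(le_trans h2 (bmono _ _ _ _))//.
  exact: ltnW.
have midI i : c0 <= mid i <= c1 by apply: (arcI i); have := hmid i; lra.
have gG i : (gr (mid i) : {classic zmat}) \in G.
  apply: (inG (mid i)) => //; have [h1 h2] := hC _ _ (inL _ (midI i)) (gr_unimod (mid i)) (pt_gauss (mid i)).
  by rewrite /C' !le_max h1 h2.
have opI (i : 'I_n) s : b i < s < b i.+1 -> c0 < s < c1.
  move=> /andP[h1 h2]; rewrite -b0 -bn (le_lt_trans (bmono 0%N i _ _) h1) ?(lt_le_trans h2 (bmono _ _ _ _))//.
  exact: ltnW.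
exists n, (fun i => b i), (fun i => b i.+1), (fun i => gr (mid i)); split.
- exact: n0.
- by move=> i; exact: blt.
- move=> i; split; first exact: gr_unimod.
  move=> s hs; apply: (gauss_stays (gr_unimod _) (pt_gauss (mid i)) (hmid i) hs) => e eE.
  exact: hE (gG i) (ltn_ord i) eE.
- move=> t; have [h ah /andP[h1 h2]] := cov t; exists h => //.
  have ex : exists k, (k <= n)%N && (al h t <= b k) by exists n; rewrite leqnn bn.
  case: (ex_minnP ex) => k /andP[kn hk] kmin; case: k kn hk kmin => [|k] kn hk kmin.
    exists (Ordinal n0) => /=; rewrite b0 in hk *; rewrite h1 (le_trans hk)//.
    by rewrite -b0; apply: ltW; apply: blt.
  exists (Ordinal kn) => /=; rewrite hk andbT leNgt; apply/negP => hlt.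
  by have := kmin k; rewrite (ltnW kn) (ltW hlt) => /(_ isT); rewrite ltnn.
split.
  move=> i j s s' hs hs' /pt_eq[g gu e].
  have ss : s = s'.
    have gGs : (g : {classic zmat}) \in G.
      apply: (inG s) (_ : _ /\ _); first by apply: (arcI i); lra.
      rewrite e /C' !le_max; have [-> ->] := Mt_coef (inL _ (arcI j _ hs')); by rewrite !orbT.
    case: (cross_time gu e) => [ag|eE]; last by case: (hE g i s gGs (ltn_ord i) eE).
    have es : al g s = s' by exact: al_eq.
    by rewrite -es; apply/esym; apply: (inj g s) => //; [exact: opI hs|rewrite es; exact: arcI hs'].
  split=> //; subst s'; apply: val_inj; case: (ltngtP i j) => //= ij; exfalso.
    by have := bmono i.+1 j ij (ltnW (ltn_ord j)); lra.
  by have := bmono j.+1 i ij (ltnW (ltn_ord i)); lra.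
move=> i h s hs ah fx; apply: (inj h s) => //; first exact: opI hs.
by rewrite fx; have := opI i s hs; lra.
Qed.

End Geom.

(** * Hausdorff measure on the geodesic *)

Section Hausdorff.
Variable R : realType.
Implicit Types (A W : set R[i]) (z w : R[i]) (d : R).

Lemma hyp_diam_le A d : 0 <= d -> (forall z w, A z -> A w -> hyp_dist z w <= d) -> (hyp_diam A <= d%:E)%E.
Proof.
move=> d0 h; apply: ge_ereal_sup => _ [->|[z [w [Az Aw ->]]]]; first by rewrite lee_fin.
by rewrite lee_fin; exact: h.
Qed.

Lemma hyp_diam_ge A z w : A z -> A w -> ((hyp_dist z w)%:E <= hyp_diam A)%E.
Proof. by move=> Az Aw; apply: ereal_sup_ubound; right; exists z, w. Qed.

Lemma hyp_diam_ge0 A : (0 <= hyp_diam A)%E.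
Proof. by apply: ereal_sup_ubound; left. Qed.

Lemma hyp_diam0 : hyp_diam (set0 : set R[i]) = 0%E.
Proof.
apply/eqP; rewrite eq_le hyp_diam_ge0 andbT; apply: hyp_diam_le => //.
Qed.

Lemma nneseries_le_fin (u : nat -> \bar R) (b : \bar R) : (forall k, (0 <= u k)%E) ->
  (forall n, (\sum_(0 <= k < n) u k <= b)%E) -> (\sum_(0 <= k <oo) u k <= b)%E.
Proof.
move=> u0 h; apply: lime_le; first by apply: is_cvg_nneseries => k _ _; exact: u0.
by near=> n; exact: h.
Unshelve. all: by end_near. Qed.

Lemma hyp_length_le_fin W (b : \bar R) : (forall d, 0 < d -> exists (I : finType) (U : I -> set R[i]),
   [/\ forall i, U i `<=` upper_half_plane (R:=R), forall i, (hyp_diam (U i) <= d%:E)%E,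
       forall w, W w -> exists i, U i w & (\sum_i hyp_diam (U i) <= b)%E]) -> (hyp_length W <= b)%E.
Proof.
move=> h; apply: ge_ereal_sup => _ [d d0 ->].
have [I [U [Uh Ud Uc Us]]] := h _ d0.
(* The finite cover is continued by the empty set, whose diameter is 0. *)
pose V (k : nat) : set R[i] := if insub k is Some j then U (enum_val (j : 'I_#|I|)) else set0.
apply: ge_ereal_inf; exists (\sum_(0 <= k <oo) hyp_diam (V k))%E.
  exists V => //; split.
  - by move=> k; rewrite /V; case: (insub k) => [j|//]; exact: Uh.
  - by move=> k; rewrite /V; case: (insub k) => [j|]; [exact: Ud|rewrite hyp_diam0 lee_fin ltW].
  - move=> w /Uc[i Ui]; exists (enum_rank i) => //; rewrite /V /=.
    by rewrite valK enum_rankK.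
apply: nneseries_le_fin => [k|m]; first exact: hyp_diam_ge0.
apply: le_trans Us; apply: (@le_trans _ _ (\sum_(0 <= k < maxn m #|I|) hyp_diam (V k))%E).
  rewrite [leRHS](@big_cat_nat _ _ _ m)//= ?leq_maxl//.
  by rewrite leeDl// sume_ge0// => k _; exact: hyp_diam_ge0.
rewrite (@big_cat_nat _ _ _ #|I|)//= ?leq_maxr// [X in (_ + X)%E]big1_seq ?adde0; last first.
  move=> k; rewrite mem_index_iota => /andP[_ /andP[hk _]]; rewrite /V insubF ?hyp_diam0//.
  by rewrite ltnNge hk.
rewrite big_mkord (reindex_onto enum_rank enum_val) /=; last by move=> i _; rewrite enum_valK.
rewrite le_eqVlt; apply/orP; left; apply/eqP; apply: eq_big => [i|i _]; first by rewrite enum_rankK eqxx.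
by rewrite /V valK enum_rankK.
Qed.

Lemma hyp_length_mono A W : A `<=` W -> (hyp_length A <= hyp_length W)%E.
Proof.
move=> AW; apply: ge_ereal_sup => _ [d d0 ->].
apply: le_trans (ereal_sup_ubound _); last by exists d.
apply: le_ereal_inf => _ [U [Uh Ud Uc] <-]; exists U => //; split=> //.
exact: subset_trans Uc.
Qed.

Lemma cosh_z_of (M N : bqf R) D : posdef M -> posdef N -> qdisc M = - D -> qdisc N = - D ->
  1 + Normc.normc (z_of M - z_of N) ^+ 2 / (2 * complex.Im (z_of M) * complex.Im (z_of N)) = qpol M N / D.
Proof.
move=> pM pN eM eN; have [r0 dM] := pM; have [r0' dN] := pN.
have D0 : 0 < D by rewrite -oppr_lt0 -eM.
have hM : 4 * qa M * qc M - qb M ^+ 2 = D by move: eM; rewrite /qdisc; lra.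
have hN : 4 * qa N * qc N - qb N ^+ 2 = D by move: eN; rewrite /qdisc; lra.
rewrite /z_of hM hN /=.
set h := Num.sqrt D; have h2 : h ^+ 2 = D by rewrite sqr_sqrtr// ltW.
have h0 : 0 < h by rewrite sqrtr_gt0.
rewrite sqr_sqrtr ?addr_ge0 ?sqr_ge0//.
have ec : qc M = (h ^+ 2 + qb M ^+ 2) / (4 * qa M) by rewrite h2 -hM; field; rewrite gt_eqF.
have ec' : qc N = (h ^+ 2 + qb N ^+ 2) / (4 * qa N) by rewrite h2 -hN; field; rewrite gt_eqF.
rewrite /qpol ec ec' -h2; field; rewrite !gt_eqF//=.
Qed.

Lemma arcosh_le (c c' : R) : 1 <= c -> c <= c' -> arcosh c <= arcosh c'.
Proof.
move=> c1 cc; rewrite /arcosh ler_ln ?posrE; last 2 first.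
- by rewrite ltr_pwDl ?sqrtr_ge0//; lra.
- by rewrite ltr_pwDl ?sqrtr_ge0//; lra.
by rewrite lerD// ler_wsqrtr// lerB// ler_pXn2r ?nnegrE//; lra.
Qed.

Lemma arcosh_gt0 (c : R) : 1 < c -> 0 < arcosh c.
Proof.
move=> c1; rewrite /arcosh ln_gt0//; apply: lt_le_trans c1 _.
by rewrite lerDl sqrtr_ge0.
Qed.

Lemma nbhs_normc z (B : set R[i]) : nbhs (z : R[i]^o) B ->
  exists2 e : R, 0 < e & forall w, Normc.normc (z - w) < e -> B w.
Proof.
move=> /nbhs_ballP[e /= e0 h]; exists (complex.Re e); first by move: e0; rewrite ltcE => /andP[].
move=> w hw; apply: h; rewrite -ball_normE /=.
move: e0; rewrite !ltcE /= => /andP[ei _]; rewrite ei /=; move: hw.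
by case: (z - w).
Qed.

Lemma itv_widen (a b c d s : R) : a <= c -> d <= b -> c <= s <= d -> a <= s <= b.
Proof. by move=> ac db /andP[cs sd]; rewrite (le_trans ac cs) (le_trans sd db). Qed.

Lemma itv_widen_oo (a b c d s : R) : a <= c -> d <= b -> c < s < d -> a < s < b.
Proof. by move=> ac db /andP[cs sd]; rewrite (le_lt_trans ac cs) (lt_le_trans sd db). Qed.

Lemma itv_oo_cc (a b s : R) : a < s < b -> a <= s <= b.
Proof. by move=> /andP[? ?]; rewrite !ltW. Qed.

Lemma itv_oo_co (a b s : R) : a < s < b -> a <= s < b.
Proof. by move=> /andP[? ?]; rewrite ltW. Qed.

Lemma itv_diam (a b d s t : R) : b - a < d -> a <= s <= b -> a <= t <= b -> `|s - t| < d.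
Proof. by move=> h /andP[? ?] /andP[? ?]; rewrite ltr_norml; lra. Qed.

Lemma normc_sub_gt0 z w : z <> w -> 0 < Normc.normc (z - w) ^+ 2.
Proof.
move=> zw; rewrite lt_neqAle sqr_ge0 andbT eq_sym expf_eq0 /=; apply/eqP => /Normc.eq0_normc /eqP.
by rewrite subr_eq0 => /eqP.
Qed.

Lemma le_of_loss (N : nat) (r : R) (M : \bar R) : (forall e, 0 < e -> ((r - N%:R * (2 * e))%:E <= M)%E) -> (r%:E <= M)%E.
Proof.
move=> h; apply/lee_addgt0Pr => e e0.
have N0 : (0 : R) < N.+1%:R by rewrite ltr0n.
have c0 : 0 < e / (2 * N.+1%:R) by rewrite divr_gt0// mulr_gt0.
apply: le_trans (leeD2r e%:E (h _ c0)); rewrite -EFinD lee_fin -addrA lerDl.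
have -> : N%:R * (2 * (e / (2 * N.+1%:R))) = e * (N%:R / N.+1%:R) :> R by field; rewrite gt_eqF.
have h1 : N%:R / N.+1%:R <= 1 :> R by rewrite ler_pdivrMr// mul1r ler_nat.
by rewrite addrC subr_ge0 ger_pMr.
Qed.

Lemma measurable_finU (F : finType) (K : F -> Prop) (B : F -> set R) :
  (forall j, measurable (B j)) -> measurable [set s | exists j, K j /\ B j s].
Proof.
move=> mB; have -> : [set s | exists j, K j /\ B j s] = \bigcup_(j in [set j | K j]) B j.
  by apply/seteqP; split=> [s [j [? ?]]|s [j ? ?]]; exists j.
by apply: fin_bigcup_measurable => //; exact: finite_finset.
Qed.

Lemma sum_le_measure (F : finType) (K : pred F) (a b : F -> R) (A : set R) : measurable A ->
  (forall j s, K j -> a j <= s < b j -> A s) ->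
  (forall j j' s, K j -> K j' -> a j <= s < b j -> a j' <= s < b j' -> j = j') ->
  ((\sum_(j | K j) (b j - a j))%:E <= lebesgue_measure A)%E.
Proof.
move=> mA hA dis.
pose G j : set R := `[a j, b j[%classic.
have := @measure_fin_bigcup _ _ _ (@lebesgue_measure R) F [set` enum K] G (finite_seq _).
have tr : trivIset [set` enum K] G.
  move=> j j' /=; rewrite !mem_enum => Kj Kj' [s [/= ]]; rewrite /G /= !in_itv => h h'.
  exact: dis h h'.
move=> /(_ tr) h; apply: (@le_trans _ _ (lebesgue_measure (\bigcup_(i in [set` enum K]) G i))); last first.
  apply: le_measure; rewrite ?inE//; first by apply: fin_bigcup_measurable; [exact: finite_seq|move=> i _; exact: measurable_itv].
  by move=> s [j /=]; rewrite mem_enum => Kj; rewrite /G /= in_itv; exact: hA.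
rewrite h => [|i _]; last exact: measurable_itv.
rewrite -fsbig_seq ?enum_uniq// -sumEFin big_enum /=.
apply: lee_sum => j _.
have e1 := @lebesgue_measure_itv R `[a j, b j[; apply: le_trans; last by rewrite le_eqVlt; apply/orP; left; apply/eqP; symmetry; exact: e1.
rewrite /= lte_fin; case: ifP => [_|/negbT]; first by rewrite EFinB.
by rewrite -leNgt lee_fin subr_le0.
Qed.

End Hausdorff.

Section Measure.
Variables (R : realType) (Q : bqf int).
Hypotheses (q0 : qa Q < 0) (D0 : 0 < qdisc Q).
Local Notation r1 := (r1 R Q).
Local Notation r2 := (r2 R Q).
Local Notation Mt := (@Mt R Q).
Local Notation p := (@pt R Q q0 D0).
Variables (n : nat) (x y : 'I_n -> R) (g : 'I_n -> zmat).
Hypotheses (xy : forall i, x i < y i)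
  (hg : forall i, unimod (g i) /\ forall s, x i <= s <= y i -> gauss_domain (z_of (qact (Mt s) (g i))))
  (inj : forall i j s s', x i < s < y i -> x j <= s' <= y j -> p s = p s' -> i = j /\ s = s').
Implicit Types (s t : R) (i : 'I_n).
Local Notation dD := (4 * (r1 - r2) ^+ 2).

Lemma dD_gt0 : 0 < dD.
Proof. by rewrite mulr_gt0// exprn_gt0// subr_gt0 r12. Qed.

Lemma pE i s : x i <= s <= y i -> p s = z_of (qact (Mt s) (g i)).
Proof. by move=> hs; have [gu h] := hg i; rewrite (pt_unique q0 D0 gu (h s hs)). Qed.

Lemma p_upper s : upper_half_plane (p s).
Proof. by have [] := pt_gauss q0 D0 s. Qed.

Lemma dist_arcs i j s t : x i <= s <= y i -> x j <= t <= y j ->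
  hyp_dist (p s) (p t) = arcosh (qpol (qact (Mt s) (g i)) (qact (Mt t) (g j)) / dD).
Proof.
move=> hs ht; rewrite (pE hs) (pE ht); have [gi _] := hg i; have [gj _] := hg j.
apply: hyp_dist_z_of; rewrite ?qdisc_act ?qdisc_Mt//; apply: posdef_act => //; exact: posdef_Mt.
Qed.

Lemma qpol_arc i s t : qpol (qact (Mt s) (g i)) (qact (Mt t) (g i)) / dD = (expR (s - t) + expR (- (s - t))) / 2.
Proof.
have [gi _] := hg i; rewrite qpol_act// qpol_Mt mulrC mulKf// gt_eqF// dD_gt0//.
Qed.

Lemma dist_arc i s t : x i <= s <= y i -> x i <= t <= y i -> hyp_dist (p s) (p t) = `|s - t|.
Proof. by move=> hs ht; rewrite (dist_arcs hs ht) qpol_arc arcosh_cosh. Qed.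

(** [pt] is isometric on each arc, so cutting every interval into N equal parts makes the diameters
    of the covering sets small while their sum stays bounded by the total length. *)
Lemma length_arcs_le (F : finType) (k : F -> 'I_n) (u v : F -> R) (W : set R[i]) :
  (forall j : F, x (k j) <= u j /\ u j <= v j <= y (k j)) ->
  (forall w, W w -> exists j : F, exists2 s, u j <= s <= v j & w = p s) ->
  (hyp_length W <= (\sum_(j : F) (v j - u j))%:E)%E.
Proof.
move=> uv hW; apply: hyp_length_le_fin => d d0.
have uv0 (j : F) : 0 <= v j - u j by have [_ /andP[? _]] := uv j; rewrite subr_ge0.
pose N := (Num.trunc (\sum_(j : F) (v j - u j) / d)).+1.
have N0 : (0 : R) < N%:R by rewrite ltr0n.
pose h (j : F) := (v j - u j) / N%:R.
have h0 (j : F) : 0 <= h j by rewrite divr_ge0.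
have hd (j : F) : h j <= d.
  rewrite /h ler_pdivrMr// mulrC -ler_pdivrMr//; apply: le_trans (ltW (truncnS_gt _)).
  by rewrite (bigD1 j)//= lerDl sumr_ge0// => j' _; rewrite divr_ge0// ltW.
have hN (j : F) : u j + N%:R * h j = v j by rewrite /h mulrC divfK ?gt_eqF//; ring.
pose U (jl : F * 'I_N) : set R[i] := p @` [set s | u jl.1 + jl.2%:R * h jl.1 <= s <= u jl.1 + jl.2.+1%:R * h jl.1].
have arc (j : F) (l : nat) s : (l < N)%N -> u j + l%:R * h j <= s <= u j + l.+1%:R * h j -> x (k j) <= s <= y (k j).
  move=> lN /andP[h1 h2]; have [xu /andP[_ vy]] := uv j; apply/andP; split.
    by apply: le_trans h1; apply: le_trans xu _; rewrite lerDl mulr_ge0.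
  by apply: le_trans h2 _; apply: le_trans vy; rewrite -(hN j) lerD2l ler_wpM2r// ler_nat.
have dU jl : (hyp_diam (U jl) <= (h jl.1)%:E)%E.
  case: jl => j l; apply: hyp_diam_le => //= _ _ [s hs <-] [t ht <-] /=.
  rewrite (dist_arc (arc _ _ _ (ltn_ord l) hs) (arc _ _ _ (ltn_ord l) ht)).
  move: hs ht => /=; rewrite -natr1 mulrDl mul1r => /andP[a1 a2] /andP[a3 a4].
  by rewrite ler_norml; lra.
exists (F * 'I_N)%type, U; split.
- by move=> [j l] _ [s _ <-]; exact: p_upper.
- by move=> jl; apply: le_trans (dU jl) _; rewrite lee_fin.
- move=> w /hW[j [s /andP[s1 s2] ->]].
  have ex : exists l, (l < N)%N && (s <= u j + l.+1%:R * h j) by exists N.-1; rewrite /= leqnn hN.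
  case: (ex_minnP ex) => l /andP[lN hl] lmin.
  exists (j, Ordinal lN); exists s => //=; rewrite hl andbT.
  case: l lN hl lmin => [|l] lN hl lmin; first by rewrite mul0r addr0.
  rewrite leNgt; apply/negP => hlt; have := lmin l; rewrite (ltnW lN) (ltW hlt) => /(_ isT).
  by rewrite ltnn.
apply: (@le_trans _ _ (\sum_(jl : F * 'I_N) (h jl.1)%:E)%E); first by apply: lee_sum => jl _.
rewrite sumEFin lee_fin -(pair_bigA _ (fun (j : F) (l : 'I_N) => h j)) /=.
apply: ler_sum => j _; rewrite sumr_const card_ord -mulr_natl -(hN j); lra.
Qed.

Lemma pairing_gt1 i (j : 'I_n) s t : x i < s < y i -> x j < t < y j -> i != j ->
  1 < qpol (qact (Mt s) (g i)) (qact (Mt t) (g j)) / dD.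
Proof.
move=> hs ht ij; have hs' : x i <= s <= y i by lra.
have ht' : x j <= t <= y j by lra.
have [gi _] := hg i; have [gj _] := hg j.
have pM : posdef (qact (Mt s) (g i)) by apply: posdef_act => //; exact: posdef_Mt.
have pN : posdef (qact (Mt t) (g j)) by apply: posdef_act => //; exact: posdef_Mt.
rewrite -(cosh_z_of pM pN); rewrite ?qdisc_act ?qdisc_Mt//.
rewrite -(pE hs') -(pE ht') ltrDl; apply: divr_gt0.
  by apply: normc_sub_gt0 => e; have [e1 _] := inj hs ht' e; rewrite e1 eqxx in ij.
  have h1 : 0 < complex.Im (p s) := p_upper s.
  have h2 : 0 < complex.Im (p t) := p_upper t.
  by apply: mulr_gt0 => //; exact: mulr_gt0.
Qed.

(* By compactness of products of shortened arcs. *)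
Lemma separation e : 0 < e -> exists2 d, 0 < d & forall i j s t, x i + e <= s <= y i - e ->
  x j + e <= t <= y j - e -> hyp_dist (p s) (p t) < d -> i = j.
Proof.
move=> e0.
(* The separation is expressed by the inverse of the distance because [finite_bound] yields upper
   bounds. *)
pose P (ij : 'I_n * 'I_n) (L : R) := 0 < L /\ forall s t, x ij.1 + e <= s <= y ij.1 - e ->
  x ij.2 + e <= t <= y ij.2 - e -> hyp_dist (p s) (p t) < L^-1 -> ij.1 = ij.2.
have [L hL] : exists L, forall ij, [set: 'I_n * 'I_n] ij -> P ij L.
  apply: finite_bound => [|ij L L' [L0 h] LL|[i j] _].
  - exact: finite_finset.
  - split=> [|s t hs ht hd]; first exact: lt_le_trans LL.
    by apply: h hs ht _; apply: lt_le_trans hd _; rewrite lef_pV2 ?posrE//; exact: lt_le_trans LL.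
  have [ij|ij] := eqVneq i j; first by exists 1; split.
  have [ne|ne] := pselect ((x i + e <= y i - e) && (x j + e <= y j - e)); last first.
    exists 1; split=> // s t /andP[/= a1 a2] /andP[a3 a4] _; case: ne; apply/andP; split; [exact: le_trans a2|exact: le_trans a4].
  have /andP[ne1 ne2] := ne.
  pose f (v : 'rV[R]_2) := qpol (qact (Mt (v ord0 ord0)) (g i)) (qact (Mt (v ord0 ord_max)) (g j)) / dD.
  pose A (l : 'I_2) : set R := if l == ord0 then `[x i + e, y i - e]%classic else `[x j + e, y j - e]%classic.
  have cf : continuous f.
    have ce (c : 'I_2) : continuous (fun v : 'rV[R]_2 => expR (v ord0 c)).
      by move=> v; apply: continuous_comp; [exact: coord_continuous|exact: continuous_expR].
    have cn (c : 'I_2) : continuous (fun v : 'rV[R]_2 => expR (- v ord0 c)).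
      move=> v; apply: continuous_comp; last exact: continuous_expR.
      by apply: continuousN; exact: coord_continuous.
    pose a := qact (U1 R Q) (g i); pose b := qact (U2 R Q) (g i).
    pose a' := qact (U1 R Q) (g j); pose b' := qact (U2 R Q) (g j).
    have -> : f = (fun v => (qpol a a' / dD) * (expR (- v ord0 ord0) * expR (- v ord0 ord_max))
       + (qpol a b' / dD) * (expR (- v ord0 ord0) * expR (v ord0 ord_max))
       + (qpol b a' / dD) * (expR (v ord0 ord0) * expR (- v ord0 ord_max))
       + (qpol b b' / dD) * (expR (v ord0 ord0) * expR (v ord0 ord_max))).
      apply/funext => v; rewrite /f {1}/qpol.
      have [-> -> ->] := qact_Mt Q (v ord0 ord0) (g i); have [-> -> ->] := qact_Mt Q (v ord0 ord_max) (g j).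
      by rewrite /xlin /qpol -/a -/b -/a' -/b'; ring.
    have cm (F G : 'rV[R]_2 -> R) (c : R) : continuous F -> continuous G -> continuous (fun v => c * (F v * G v)).
      by move=> hF hG v; apply: (@cvgM R _ (nbhs v)); [exact: cvg_cst|apply: (@cvgM R _ (nbhs v)); [exact: hF|exact: hG]].
    have ad (F G : 'rV[R]_2 -> R) : continuous F -> continuous G -> continuous (fun v => F v + G v).
      by move=> hF hG v; apply: (@cvgD R _ _ (nbhs v)); [exact: hF|exact: hG].
    apply: (ad); last exact: cm.
    by apply: (ad); [apply: (ad)|]; exact: cm.
  have [||v + hv] := @compact_EVT_min _ _ f [set v : 'rV[R]_2 | forall l, A l (v ord0 l)] _ _ (continuous_subspaceT cf).
  - exists (\row_l (if l == ord0 then x i + e else x j + e)) => l /=; rewrite mxE /A.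
    by case: ifP => _ /=; rewrite in_itv /= lexx.
  - by apply: rV_compact => l; rewrite /A; case: ifP => _; exact: segment_compact.
  rewrite inE /= => vA.
  have va : x i < v ord0 ord0 < y i.
    by have := vA ord0; rewrite /A eqxx /= in_itv /=; lra.
  have vb : x j < v ord0 ord_max < y j.
    by have := vA ord_max; rewrite /A /= in_itv /=; lra.
  have f1 := pairing_gt1 va vb ij.
  have d0 := arcosh_gt0 f1.
  exists (arcosh (f v))^-1; split; first by rewrite invr_gt0.
  move=> s t /= hs ht; rewrite invrK ltNge => /negP []; rewrite (@dist_arcs i j); try lra.
  apply: arcosh_le; first exact: ltW.
  pose w : 'rV[R]_2 := \row_l (if l == ord0 then s else t).
  have := hv w; rewrite /f !mxE /=; apply; rewrite inE /= => l; rewrite /w mxE /A.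
  by case: ifP => _ /=; rewrite in_itv.
have [L0|L0] := ltP 0 L; last first.
  by exists 1 => // i j s t _ _ _; have [] := hL (i, j) Logic.I; rewrite ltNge L0.
exists L^-1; first by rewrite invr_gt0.
by move=> i j s t hs ht hd; have [_ h] := hL (i, j) Logic.I; apply: h hs ht hd.
Qed.

(** A covering set of diameter below the separation meets a single shortened arc, on which [pt] is
    isometric; its preimage therefore fits in an interval of the same length, and countable
    subadditivity of Lebesgue measure concludes. *)
Lemma length_ge e (A : set R) : 0 < e -> measurable A ->
  (forall s, A s -> exists i, x i + e <= s <= y i - e) ->
  (lebesgue_measure A <= hyp_length (p @` A))%E.
Proof.
move=> e0 mA hA; have [d d0 hd] := separation e0.
apply: le_trans (ereal_sup_ubound _); last by exists (d / 2); [rewrite divr_gt0|].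
apply: le_ereal_inf_tmp => _ [U [Uh Ud Uc] <-].
pose d_ k := fine (hyp_diam (U k)).
have dfin k : hyp_diam (U k) = (d_ k)%:E.
  by rewrite /d_ fineK// ge0_fin_numE ?hyp_diam_ge0//; apply: le_lt_trans (Ud k) _; rewrite ltry.
have d_ge0 k : 0 <= d_ k by rewrite -lee_fin -dfin hyp_diam_ge0.
pose T k := [set s | A s /\ U k (p s)].
have close k s t : T k s -> T k t -> `|s - t| <= d_ k.
  move=> [As Us] [At Ut]; have [i hi] := hA _ As; have [j hj] := hA _ At.
  have hst : hyp_dist (p s) (p t) <= d_ k by rewrite -lee_fin -dfin hyp_diam_ge.
  have hst' : hyp_dist (p s) (p t) < d.
    apply: le_lt_trans hst _; rewrite -lte_fin -dfin; apply: le_lt_trans (Ud k) _.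
    by rewrite lte_fin ltr_pdivrMr//; lra.
  have ij := hd _ _ _ _ hi hj hst'; subst j.
  by rewrite -(@dist_arc i); lra.
have ex : forall k, exists a, forall s, T k s -> a <= s <= a + d_ k.
  move=> k.
  have [[s0 Ts0]|nT] := pselect (exists s, T k s); last by exists 0 => s Ts; case: nT; exists s.
  have low t : T k t -> t - d_ k \in lbound (T k).
    by move=> Tt; rewrite inE => s Ts; have := close k _ _ Ts Tt; rewrite ler_norml => /andP[? _]; lra.
  have hi : has_inf (T k) by split; [exists s0|exists (s0 - d_ k); have := low _ Ts0; rewrite inE].
  exists (inf (T k)) => s Ts; apply/andP; split; first by apply: ge_inf => //; case: hi.
  rewrite -lerBlDr; apply: lb_le_inf => //; first by exists s0.
  by have := low _ Ts; rewrite inE.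
have [a ha] := choice ex.
have sub : A `<=` \bigcup_k `[a k, a k + d_ k]%classic.
  move=> s As; have [k _ Uk] := Uc (p s) (imageP _ As).
  by exists k => //=; rewrite in_itv /=; apply: ha.
have := @measure_sigma_subadditive _ _ _ (@lebesgue_measure R) A (fun k => `[a k, a k + d_ k]%classic) _ mA sub.
move=> /(_ (fun k => measurable_itv _)) /le_trans; apply.
apply: lee_nneseries => [k _ _|k _]; first exact: measure_ge0.
have e1 := @lebesgue_measure_itv R `[a k, a k + d_ k]; apply: le_trans.
  by rewrite le_eqVlt; apply/orP; left; apply/eqP; exact: e1.
rewrite /= dfin lte_fin; case: ifP => _; last by rewrite lee_fin.
by rewrite -EFinD lee_fin addrC addKr.
Qed.

(** The arcs shortened at both ends, where distinct arcs may touch and [separation] would fail. *)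
Definition clip e := [set s | exists i, True /\ `[x i + e, y i - e]%classic s].

Lemma clip_measurable e : measurable (clip e).
Proof. by apply: measurable_finU => i; exact: measurable_itv. Qed.

Section Pieces.
Variables (F : finType) (k : F -> 'I_n) (u v : F -> R).
Hypotheses (uv : forall j, x (k j) <= u j /\ u j <= v j <= y (k j))
  (dis : forall j j' s, k j = k j' -> u j <= s < v j -> u j' <= s < v j' -> j = j').

Definition pieces (K : pred F) := [set s | exists j, K j /\ `[u j, v j]%classic s].

Lemma pieces_measurable K : measurable (pieces K).
Proof. by apply: measurable_finU => j; exact: measurable_itv. Qed.

Lemma pieces_clip (K : pred F) e : 0 < e ->
  ((\sum_(j | K j) (v j - u j) - #|F|%:R * (2 * e))%:E <= lebesgue_measure (pieces K `&` clip e))%E.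
Proof.
move=> e0.
(* Each piece is intersected with its shortened arc, which costs at most 2e. *)
pose a j := Num.max (u j) (x (k j) + e); pose b j := Num.min (v j) (y (k j) - e).
have ab j : [/\ u j <= a j, x (k j) + e <= a j, b j <= v j & b j <= y (k j) - e].
  by rewrite /a /b !le_max !ge_min !lexx ?orbT.
have uvb j : v j - u j - 2 * e <= b j - a j.
  have [h1 /andP[h2 h3]] := uv j.
  have [h4|h4] := leP (u j) (x (k j) + e).
    by rewrite /a /b (max_idPr h4); case: (leP (v j) (y (k j) - e)) => h5; lra.
  by rewrite /a /b (max_idPl (ltW h4)); case: (leP (v j) (y (k j) - e)) => h5; lra.
apply: (@le_trans _ _ (\sum_(j | K j) (b j - a j))%:E); last first.
  apply: sum_le_measure.
  - by apply: measurableI; [exact: pieces_measurable|exact: clip_measurable].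
  - move=> j s Kj /andP[h1 h2]; have [h3 h4 h5 h6] := ab j; split.
      by exists j; split=> //=; rewrite in_itv /=; lra.
    by exists (k j); split=> //=; rewrite in_itv /=; lra.
  - move=> j j' s _ _ h1 h2; have [h3 h4 h5 h6] := ab j; have [h3' h4' h5' h6'] := ab j'.
    have kk : k j = k j'.
      have m1 : x (k j) < s < y (k j) by lra.
      have m2 : x (k j') <= s <= y (k j') by lra.
      by have [] := inj m1 m2 erefl.
    by apply: (dis kk (s := s)); lra.
rewrite lee_fin; apply: (@le_trans _ _ (\sum_(j | K j) (v j - u j - 2 * e))); last exact: ler_sum.
rewrite [leRHS]sumrB lerB// sumr_const -[_ *+ _]mulr_natl ler_wpM2r ?mulr_ge0//; first exact: ltW.
by rewrite ler_nat max_card.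
Qed.

Lemma pieces_ge (K : pred F) : ((\sum_(j | K j) (v j - u j))%:E <= lebesgue_measure (pieces K))%E.
Proof.
apply: (@le_of_loss _ #|F|) => e e0; apply: le_trans (pieces_clip K e0) _.
apply: le_measure; [rewrite inE|rewrite inE|by move=> s []].
- by apply: measurableI; [exact: pieces_measurable|exact: clip_measurable].
- exact: pieces_measurable.
Qed.

Variable W : set R[i].

Lemma pieces_le_length (K : pred F) : (forall j s, K j -> u j <= s <= v j -> W (p s)) ->
  ((\sum_(j | K j) (v j - u j))%:E <= hyp_length W)%E.
Proof.
move=> hK; apply: (@le_of_loss _ #|F|) => e e0; apply: le_trans (pieces_clip K e0) _.
apply: le_trans (length_ge e0 _ _) _.
- by apply: measurableI; [exact: pieces_measurable|exact: clip_measurable].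
- by move=> s [_ [i [_ /= ]]]; rewrite in_itv /= => hs; exists i.
- by apply: hyp_length_mono => _ [s [[j [Kj /=]] + _] <-]; rewrite in_itv /=; exact: hK.
Qed.

Lemma length_le_pieces (K : pred F) : (forall w, W w -> exists j s, [/\ K j, u j <= s <= v j & w = p s]) ->
  (hyp_length W <= (\sum_(j | K j) (v j - u j))%:E)%E.
Proof.
move=> hK; pose v' j := if K j then v j else u j.
apply: le_trans (@length_arcs_le F k u v' W _ _) _.
- by move=> j; rewrite /v'; have [h1 /andP[h2 h3]] := uv j; case: ifP => _; lra.
- by move=> w /hK[j [s [Kj hs ->]]]; exists j, s => //; rewrite /v' Kj.
rewrite lee_fin [leRHS]big_mkcond /=; apply: ler_sum => j _; rewrite /v'; case: ifP => //.
by rewrite subrr.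
Qed.

End Pieces.

Lemma cosh_close (c : R) : 0 < c -> exists2 d, 0 < d & forall h : R, `|h| < d -> (expR h + expR (- h)) / 2 - 1 < c.
Proof.
move=> c0; pose f (h : R) := (expR h + expR (- h)) / 2.
have cf : f @ (0 : R) --> (1 : R).
  have -> : (1 : R) = f 0 by rewrite /f oppr0 expR0; field.
  apply: (@cvgMl R _ (nbhs (0 : R))); apply: (@cvgD R _ _ (nbhs (0 : R))); first exact: continuous_expR.
  apply: (@continuous_comp _ _ _ (fun h : R => - h)); last exact: continuous_expR.
  exact: (@cvgN R _ _ (nbhs (0 : R))).
have /nbhs_ballP[d /= d0 hd] : \forall h \near (0 : R), `|1 - f h| < c by move/cvgrPdist_lt: cf; apply.
exists d => // h hh; have := hd h; rewrite -ball_normE /= sub0r normrN => /(_ hh).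
by rewrite /f ltr_norml; lra.
Qed.

(** Let I and J be the imaginary parts and r the Euclidean distance. Then r^2 = 2 I J (cosh |s - t|
    - 1) and J <= I + r, so r is small when cosh |s - t| is close to 1. *)
Lemma p_close s (e : R) : 0 < e -> exists2 d, 0 < d & forall i t, x i <= s <= y i -> x i <= t <= y i ->
  `|s - t| < d -> Normc.normc (p s - p t) < e.
Proof.
move=> e0; have I0 : 0 < complex.Im (p s) := p_upper s.
move eI : (complex.Im (p s)) I0 => I I0.
(* Chosen so that r >= e implies 2 I (I + r) <= r^2 K. *)
pose K := 2 * I ^+ 2 / e ^+ 2 + 2 * I / e.
have K0 : 0 < K.
  by apply: addr_gt0; apply: divr_gt0 => //; try apply: mulr_gt0 => //; exact: exprn_gt0.
have Ki : 0 < K^-1 by rewrite invr_gt0.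
have [d d0 hd] := cosh_close Ki; exists d => // i t hs ht st.
have [gi _] := hg i.
have pM s' : posdef (qact (Mt s') (g i)) by apply: posdef_act => //; exact: posdef_Mt.
have := cosh_z_of (pM s) (pM t) (D := dD); rewrite !qdisc_act ?qdisc_Mt// => /(_ erefl erefl).
rewrite -(pE hs) -(pE ht) qpol_arc eI; have hc := hd _ st.
have J0 : 0 < complex.Im (p t) := p_upper t.
have IJ : complex.Im (p t) <= I + Normc.normc (p s - p t).
  rewrite -eI; case: (p s) (p t) => [a b] [a' b'] /=.
  have : `|b - b'| <= Num.sqrt ((a - a') ^+ 2 + (b - b') ^+ 2).
    by rewrite -sqrtr_sqr ler_wsqrtr// lerDr sqr_ge0.
  by rewrite ler_norml; lra.
have : 0 <= Normc.normc (p s - p t) by case: (p s - p t) => ? ?; exact: sqrtr_ge0.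
move: IJ J0 hc.
move: (complex.Im (p t)) (Normc.normc _) ((expR _ + _) / 2) => J r c IJ J0 hc r0 er.
rewrite ltNge; apply/negP => er'.
have rp : 0 < r by apply: lt_le_trans er'.
have e2 : r ^+ 2 = 2 * I * J * (c - 1) by rewrite -er; field; rewrite !gt_eqF.
have c1 : 0 <= c - 1 by rewrite -er addrAC subrr add0r divr_ge0 ?sqr_ge0// !mulr_ge0// ltW.
have h1 : r ^+ 2 <= 2 * I * (I + r) * (c - 1).
  by rewrite e2 ler_wpM2r// ler_wpM2l// mulr_ge0// ltW.
have h2 : 2 * I * (I + r) <= r ^+ 2 * K.
  have re : 1 <= r / e by rewrite ler_pdivlMr ?mul1r.
  have -> : r ^+ 2 * K = 2 * I * (I * (r / e) ^+ 2 + r * (r / e)) by rewrite /K; field; rewrite gt_eqF.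
  rewrite ler_wpM2l ?mulr_ge0 ?(ltW I0)// lerD// ler_peMr ?(ltW I0) ?(ltW rp)//.
  by rewrite exprn_ege1.
have h3 : 2 * I * (I + r) * (c - 1) < r ^+ 2 * K * K^-1.
  apply: (@le_lt_trans _ _ (r ^+ 2 * K * (c - 1))); first by rewrite ler_wpM2r.
  by rewrite ltr_pM2l// mulr_gt0// exprn_gt0.
move: h3; rewrite mulfK ?gt_eqF// => h3.
by have := le_lt_trans h1 h3; rewrite ltxx.
Qed.

Definition node (m : nat) i (l : nat) : R := x i + l%:R * ((y i - x i) / 2 ^+ m).

Lemma node_le m i (l l' : nat) : (l <= l')%N -> node m i l <= node m i l'.
Proof.
by move=> ll; rewrite /node lerD2l ler_wpM2r ?ler_nat// divr_ge0 ?exprn_ge0// subr_ge0 ltW.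
Qed.

Lemma node0 m i : node m i 0 = x i. Proof. by rewrite /node mul0r addr0. Qed.
Lemma node_end m i : node m i (2 ^ m) = y i.
Proof. by rewrite /node natrX mulrC divfK ?expf_neq0//; ring. Qed.

Lemma node_double m i (l : nat) : node m.+1 i l.*2 = node m i l.
Proof. by rewrite /node -mul2n natrM exprS; field; rewrite expf_neq0. Qed.

Definition dyad m := ('I_n * 'I_(2 ^ m))%type.
Definition dl m (j : dyad m) := node m j.1 j.2.
Definition dr m (j : dyad m) := node m j.1 j.2.+1.

Lemma dlr m (j : dyad m) : x j.1 <= dl j /\ dl j <= dr j <= y j.1.
Proof.
rewrite /dl /dr -(node0 m j.1) -[X in _ /\ _ <= _ <= X](node_end m j.1).
by rewrite !node_le.
Qed.

Lemma dyad_disj m (j j' : dyad m) s : j.1 = j'.1 -> dl j <= s < dr j -> dl j' <= s < dr j' -> j = j'.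
Proof.
case: j j' => [i l] [i' l'] /= <-; rewrite /dl /dr /= => /andP[h1 h2] /andP[h3 h4].
congr pair; apply/val_inj => /=; apply/eqP; rewrite eqn_leq.
apply/andP; split; rewrite leqNgt; apply/negP => hl.
- by have := lt_le_trans h4 (node_le m i hl); rewrite ltNge h1.
- by have := lt_le_trans h2 (node_le m i hl); rewrite ltNge h3.
Qed.

Lemma dyad_cover m i s : x i <= s <= y i -> exists2 j : dyad m, j.1 = i & dl j <= s <= dr j.
Proof.
move=> /andP[h1 h2].
have ex : exists l, (l < 2 ^ m)%N && (s <= node m i l.+1).
  by exists (2 ^ m).-1; rewrite prednK ?expn_gt0// node_end leqnn.
case: (ex_minnP ex) => l /andP[lN hl] lmin.
exists (i, Ordinal lN) => //; rewrite /dl /dr /= hl andbT.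
case: l lN hl lmin => [|l] lN hl lmin; first by rewrite node0.
rewrite leNgt; apply/negP => hlt; have := lmin l; rewrite (ltnW lN) (ltW hlt) => /(_ isT).
by rewrite ltnn.
Qed.

Lemma dyad_parent m (j : dyad m.+1) : exists j' : dyad m, j'.1 = j.1 /\ dl j' <= dl j /\ dr j <= dr j'.
Proof.
case: j => i l; have hl : (l./2 < 2 ^ m)%N by rewrite ltn_half_double -mul2n -expnS.
exists (i, Ordinal hl); rewrite /dl /dr /= -(node_double m i l./2) -(node_double m i l./2.+1); split=> //; split; apply: node_le.
- by rewrite -[X in (_ <= X)%N](odd_double_half l) leq_addl.
- by rewrite doubleS -[X in (X < _)%N](odd_double_half l); case: (odd l).
Qed.

Lemma dyad_small (d : R) : 0 < d -> exists m, forall j : dyad m, dr j - dl j < d.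
Proof.
move=> d0; pose L := \sum_i (y i - x i).
have yx0 i : 0 <= y i - x i by rewrite subr_ge0 ltW.
have L0 : 0 <= L by rewrite sumr_ge0.
exists (Num.trunc (L / d)).+1 => j; set m := _.+1.
have -> : dr j - dl j = (y j.1 - x j.1) / 2 ^+ m by rewrite /dr /dl /node -natr1; ring.
rewrite ltr_pdivrMr ?exprn_gt0//; apply: (@le_lt_trans _ _ L).
  by move: (j.1) => i; rewrite /L (bigD1 i)//= lerDl sumr_ge0.
rewrite mulrC -ltr_pdivrMr//; apply: lt_trans (truncnS_gt _) _.
by rewrite -/m -natrX ltr_nat ltn_expl.
Qed.

(** * Dyadic approximation of continuity sets *)

Section Sandwich.
Variables (Y W : set R[i]).
Hypotheses (Yp : forall s, Y (p s)) (Wp : forall w, W w -> exists i s, x i <= s <= y i /\ w = p s)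
  (bW : hyp_length (boundary_in Y W) = 0%E).

Definition dhit m (j : dyad m) : bool := `[< exists2 s, dl j <= s <= dr j & W (p s) >].
Definition dmiss m (j : dyad m) : bool := `[< exists2 s, dl j <= s <= dr j & ~ W (p s) >].
Definition din m (j : dyad m) := ~~ dmiss j.
Definition dmix m (j : dyad m) := dhit j && dmiss j.

Lemma dmix_parent m (j : dyad m.+1) : dmix j -> exists j' : dyad m, dmix j' /\ dl j' <= dl j /\ dr j <= dr j'.
Proof.
move=> /andP[/asboolP[s hs Ws] /asboolP[t ht Wt]]; have [j' [_ [h1 h2]]] := dyad_parent j.
exists j'; split; last by split.
by apply/andP; split; apply/asboolP; [exists s|exists t] => //; exact: itv_widen h1 h2 _.
Qed.

Lemma dmix_boundary s : (forall m, exists2 j : dyad m, dmix j & dl j <= s <= dr j) -> boundary_in Y W (p s).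
Proof.
move=> hs.
have near (B : set R[i]) : nbhs (p s : R[i]^o) B -> exists t t', [/\ W (p t), B (p t), ~ W (p t') & B (p t')].
  move=> /nbhs_normc[e e0 hB]; have [d d0 hd] := p_close s e0; have [m hm] := dyad_small d0.
  have [j /andP[/asboolP[t ht Wt] /asboolP[t' ht' Wt']] hj] := hs m.
  have [h1 /andP[_ h2]] := dlr j; have h3 := hm j.
  have close t0 : dl j <= t0 <= dr j -> B (p t0).
    move=> ht0; apply: hB; apply: (hd j.1).
    - exact: itv_widen h1 h2 hj.
    - exact: itv_widen h1 h2 ht0.
    - exact: itv_diam h3 hj ht0.
  by exists t, t'; split=> //; exact: close.
split; first by split=> // B /near[t [t' [h1 h2 _ _]]]; exists (p t).
by move=> B /near[t [t' [_ _ h1 h2]]]; exists (p t').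
Qed.

Definition Zm m := pieces (@dl m) (@dr m) (@dmix m).

Lemma Zm_sub m : Zm m.+1 `<=` Zm m.
Proof.
move=> s [j [/dmix_parent[j' [h1 [h2 h3]]] /=]]; rewrite in_itv /= => hs.
by exists j'; split=> //=; rewrite in_itv /=; lra.
Qed.

Lemma Zm_meas m : measurable (Zm m). Proof. exact: pieces_measurable. Qed.

(** On the shortened arcs [length_ge] bounds the measure by the length of the boundary of W, which
    is 0; what is missed by all of them is the finite set of ends. *)
Lemma Zcap_null : lebesgue_measure (\bigcap_m Zm m) = 0%E.
Proof.
have mZ : measurable (\bigcap_m Zm m) by apply: bigcap_measurable => // m _; exact: Zm_meas.
pose N (k : nat) := (\bigcap_m Zm m) `&` clip (k.+1%:R^-1).
have nN k : (@lebesgue_measure R).-negligible (N k).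
  have mN : measurable (N k) by apply: measurableI => //; exact: clip_measurable.
  apply/negligibleP => //; apply/eqP; rewrite eq_le measure_ge0 andbT -bW.
  apply: le_trans (@length_ge (k.+1%:R^-1) _ _ mN _) _; first by rewrite invr_gt0 ltr0n.
  - by move=> s [_ [i [_ /=]]]; rewrite in_itv /= => hs; exists i.
  - apply: hyp_length_mono => _ [s [hs _] <-]; apply: dmix_boundary => m.
    by have [j [hj /=]] := hs m Logic.I; rewrite in_itv /= => h; exists j.
have nE : (@lebesgue_measure R).-negligible ((x @` [set: 'I_n]) `|` (y @` [set: 'I_n])).
  have cE : countable ((x @` [set: 'I_n]) `|` (y @` [set: 'I_n])).
    by apply: finite_set_countable; rewrite finite_setU; split; apply: finite_image; exact: finite_finset.
  apply/negligibleP; last exact: countable_lebesgue_measure0.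
  exact: countable_measurable.
apply/negligibleP => //.
apply: negligibleS (negligibleU (negligible_bigcup nN) nE) => s hs.
have [j [_ /=]] := hs 0%N Logic.I; rewrite in_itv /= => hj; have [h1 h2] := dlr j.
have [e1|e1] := eqVneq s (x j.1); first by right; left; exists j.1.
have [e2|e2] := eqVneq s (y j.1); first by right; right; exists j.1.
have h3 : x j.1 < s by rewrite lt_neqAle eq_sym e1; lra.
have h4 : s < y j.1 by rewrite lt_neqAle e2; lra.
left; pose c := Num.min (s - x j.1) (y j.1 - s).
have c0 : 0 < c by rewrite lt_min; lra.
have [c1 c2] : c <= s - x j.1 /\ c <= y j.1 - s by rewrite !ge_min !lexx orbT.
(* A shortening by at most the distance [c] of s to the nearer end. *)
exists (Num.trunc c^-1) => //; split=> //; exists j.1; split=> //=; rewrite in_itv /=.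
have : (Num.trunc c^-1).+1%:R^-1 <= c.
  by rewrite -[leRHS]invrK lef_pV2 ?posrE ?ltr0n ?invr_gt0//; exact: ltW (truncnS_gt _).
by move: (_.+1%:R^-1) => r hr; lra.
Qed.

(** The mixed pieces decrease with m to a null set, so continuity of the measure from above makes
    their total length small. *)
Lemma sandwich (e : R) : 0 < e -> exists m,
  [/\ \sum_(j | dmix j) (@dr m j - dl j) < e,
      ((\sum_(j | din j) (@dr m j - dl j))%:E <= hyp_length W)%E &
      (hyp_length W <= (\sum_(j | din j || dmix j) (@dr m j - dl j))%:E)%E].
Proof.
move=> e0.
have cvg : lebesgue_measure (Zm m) @[m --> \oo] --> lebesgue_measure (\bigcap_m Zm m).
  apply: nonincreasing_cvg_mu.
  - pose M := \sum_i (`|x i| + `|y i|).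
    have hM i : `|x i| + `|y i| <= M by rewrite /M (bigD1 i)//= lerDl sumr_ge0// => k _; rewrite addr_ge0.
    have sub : Zm 0 `<=` `[- M, M]%classic.
      move=> s [j [_ /=]]; rewrite !in_itv /=; have [h1 h2] := dlr j; have := hM j.1.
      by have := ler_norm (- x j.1); have := ler_norm (y j.1); rewrite normrN; have := normr_ge0 (x j.1); have := normr_ge0 (y j.1); lra.
    have h1 : (lebesgue_measure (Zm 0) <= lebesgue_measure (`[(- M)%R, M]%classic : set R))%E.
      by apply: le_measure; [rewrite inE; exact: Zm_meas|rewrite inE; exact: measurable_itv|].
    have e1 := @lebesgue_measure_itv R `[- M, M]; apply: (le_lt_trans h1).
    apply: le_lt_trans; first by rewrite le_eqVlt; apply/orP; left; apply/eqP; exact: e1.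
    by rewrite /=; case: ifP => _; rewrite ?ltry// -EFinD ltry.
  - by move=> m; exact: Zm_meas.
  - by apply: bigcap_measurable => // m _; exact: Zm_meas.
  - move=> a b ab; apply/subsetPset; elim: b ab => [|b ih]; first by rewrite leqn0 => /eqP ->.
    rewrite leq_eqVlt => /predU1P[->//|ab]; apply: subset_trans (ih _) => //; exact: Zm_sub.
have [m _ hm] : \forall m \near \oo, (lebesgue_measure (Zm m) < e%:E)%E.
  move: cvg; rewrite Zcap_null => /fine_cvgP[fin /cvgrPdist_lt/(_ _ e0) cv].
  near=> m; have : lebesgue_measure (Zm m) \is a fin_num by near: m.
  move=> /fineK <-; rewrite lte_fin; have : `|0 - fine (lebesgue_measure (Zm m))| < e by near: m.
  by rewrite sub0r normrN; exact: le_lt_trans (ler_norm _).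
exists m; split.
- rewrite -lte_fin; apply: le_lt_trans (hm m (leqnn m)).
  apply: pieces_ge; [exact: dlr|exact: dyad_disj].
- apply: (pieces_le_length (k := fun j : dyad m => j.1)) => [j|j j' s|j s]; [exact: dlr|exact: dyad_disj|].
  by move=> /asboolPn hn hs; apply: contrapT => nW; apply: hn; exists s.
- apply: (length_le_pieces (k := fun j : dyad m => j.1)) => [j|w]; [exact: dlr|].
  move=> Ww; have [i [s [hs ws]]] := Wp Ww; have [j _ hj] := dyad_cover m hs.
  exists j, s; split=> //; have hh : dhit j by apply/asboolP; exists s => //; rewrite -ws.
  by rewrite /din /dmix hh; case: (dmiss j).
Unshelve. all: by end_near. Qed.

End Sandwich.

End Measure.

(** * Non-pure fields *)

Section CubicField.
Variables (R : realType) (K : fieldExtType rat).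
Hypothesis hK : complex_cubic R K.
Local Notation C := R[i].
Local Notation io := (@io K).

Lemma dim_cubic : \dim {:K} = 3%N. Proof. by case: hK. Qed.

Lemma real_and_nonreal : exists phi psi : {rmorphism K -> C}, real_embedding phi /\ ~ real_embedding psi.
Proof.
case: hK => _ [s _ [i hi]]; exists (s i), (s (lift i ord0)); split; first exact/hi.
by move/hi/eqP; rewrite eq_sym (negPf (neq_lift _ _)).
Qed.

Variables (f : bcf) (om th : K).
Hypotheses (bX : basis_of {:K} [tuple 1; om; th]) (rel : cubic_rel f om th).

Lemma om_irrational (u v : rat) : io u + io v * om = 0 -> u = 0 /\ v = 0.
Proof.
move=> h; have e : io u + io v * om + io 0 * th = io 0 + io 0 * om + io 0 * th.
  by rewrite !rmorph0 !mul0r !addr0.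
by have [] := cubic_coords_inj bX e.
Qed.

Lemma fa_neq0 : fa f != 0.
Proof.
apply/eqP => a0; have [_ h _] := rel.
have /eqP : om * (om - (fb f)%:~R) = 0 by rewrite mulrBr -expr2 h a0; ring.
rewrite mulf_eq0 => /orP[]/eqP e.
  have : io 0 + io 1 * om = 0 by rewrite e mulr0 rmorph0 addr0.
  by move/om_irrational => [_ /eqP].
have : io (- (fb f)%:~R) + io 1 * om = 0 by rewrite rmorphN rmorph1 mul1r io_int addrC.
by move/om_irrational => [_ /eqP].
Qed.

(** The roots are u + iv, u - iv and b - 2u, so the discriminant is minus the square of 2v ((b -
    3u)^2 + v^2). *)
Lemma disc_of_nonreal_root (a b c d : R) (u v : R) : v != 0 ->
  (Complex u v) ^+ 3 - real_complex R b * (Complex u v) ^+ 2 + real_complex R c * Complex u v - real_complex R d = 0 ->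
  b ^+ 2 * c ^+ 2 - 4 * c ^+ 3 - 4 * b ^+ 3 * d - 27 * d ^+ 2 + 18 * b * c * d < 0.
Proof.
move=> v0; rewrite exprS expr2 => /eqP; rewrite eq_complex /= => /andP[/eqP e1 /eqP e2].
have ec : c = v ^+ 2 - 3 * u ^+ 2 + 2 * u * b by apply: (mulfI v0); lra.
have ed : d = u ^+ 3 - 3 * u * v ^+ 2 - b * (u ^+ 2 - v ^+ 2) + c * u by lra.
rewrite ed ec; clear e1 e2 ec ed.
rewrite (_ : _ + _ = - (2 * v * ((b - 3 * u) ^+ 2 + v ^+ 2)) ^+ 2); last by ring.
rewrite oppr_lt0 exprn_even_gt0//= !mulf_neq0//.
by rewrite gt_eqF// ltr_wpDl ?sqr_ge0// exprn_even_gt0.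
Qed.

(** An embedding with real value at [om] agrees with its conjugate and is real; the nonreal one thus
    gives a nonreal root of the characteristic polynomial. *)
Lemma cdisc_lt0 : cdisc f < 0.
Proof.
have [_ [psi [_ nr]]] := real_and_nonreal.
have := rel_char (rel_morph rel psi); case ew : (psi om) => [u v].
have v0 : v != 0.
  apply/eqP => v0; apply: nr => x.
  have : (conjc \o psi : {rmorphism K -> C}) =1 psi.
    by apply: (embedding_eq fa_neq0 bX rel); rewrite /= ew v0 /= oppr0.
  by move=> /(_ x) /=; case: (psi x) => p q /= [e]; lra.
rewrite -!intrM -!rmorphXn /= -!intrM -[(fb f)%:~R](rmorph_int (real_complex R)) -[(fa f * fc f)%:~R](rmorph_int (real_complex R)).
rewrite -[(_ * fd f)%:~R](rmorph_int (real_complex R)).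
move=> /(disc_of_nonreal_root 0 v0).
rewrite (_ : _ + _ = (fa f)%:~R ^+ 2 * (cdisc f)%:~R); last by rewrite /cdisc; ring.
by rewrite pmulr_rlt0 ?ltrz0// exprn_even_gt0//= intr_eq0 fa_neq0.
Qed.

Lemma qdisc_gt0 (Q : bqf int) n : 0 < n -> hess f = qscale n Q -> 0 < qdisc Q.
Proof.
move=> n0 h; have := qdisc_hess f; rewrite h.
have -> : qdisc (qscale n Q) = n ^+ 2 * qdisc Q by rewrite /qdisc /=; ring.
move=> e; rewrite -(pmulr_rgt0 _ (_ : 0 < n ^+ 2)) ?exprn_gt0// e.
by have := cdisc_lt0; lia.
Qed.

Lemma cube_pencil (L : comNzRingType) (j : {rmorphism rat -> L}) (a s t p p' : rat) (w : L) :
  j p * (j (a * s) + j 1 * w) ^+ 3 + j p' * (j (a * t) + j 1 * w) ^+ 3 =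
  j (p + p') * w ^+ 3 + j (3 * a * (p * s + p' * t)) * w ^+ 2
    + j (3 * a ^+ 2 * (p * s ^+ 2 + p' * t ^+ 2)) * w + j (a ^+ 3 * (p * s ^+ 3 + p' * t ^+ 3)).
Proof. by ring. Qed.

Lemma cube_inj (x y : R) : x ^+ 3 = y ^+ 3 -> x = y.
Proof.
move=> e; have /eqP : (x - y) * ((x + y / 2) ^+ 2 + 3 / 4 * y ^+ 2) = 0.
  by transitivity (x ^+ 3 - y ^+ 3); [field|rewrite e subrr].
rewrite mulf_eq0 subr_eq0 => /orP[/eqP//|/eqP h].
have h1 := sqr_ge0 (x + y / 2); have h2 := sqr_ge0 y.
have /eqP : y ^+ 2 = 0 by lra.
have /eqP : (x + y / 2) ^+ 2 = 0 by lra.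
by rewrite !expf_eq0 /= => /eqP e1 /eqP e2; lra.
Qed.

(** A square discriminant makes the roots s, t of Q rational, so f = P (x - s y)^3 + P' (x - t y)^3
    over the rationals. Evaluated at om this says that (om + a s) / (om + a t) is a cube root of -P'
    / P; it is irrational, hence generates K. *)
Lemma pure_of_square (Q : bqf int) (e : int) : qa Q != 0 -> qdisc Q = e ^+ 2 -> e != 0 -> apolar Q f -> pure K.
Proof.
move=> q0 eD e0 [ap1 ap2].
have a0 := fa_neq0; have c3 := rel_char rel.
pose a : rat := (fa f)%:~R; pose b : rat := (fb f)%:~R; pose c : rat := (fc f)%:~R; pose d : rat := (fd f)%:~R.
have c3' : om ^+ 3 = io b * om ^+ 2 - io (a * c) * om + io (a ^+ 2 * d).
  apply/eqP; rewrite -subr_eq0 -c3 /a /b /c /d !(rmorphM io, rmorphXn io) /= !io_int; apply/eqP; ring.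
pose k0 : rat := (qa Q)%:~R; pose k1 : rat := (qb Q)%:~R; pose k2 : rat := (qc Q)%:~R; pose er : rat := e%:~R.
have an : a != 0 by rewrite intr_eq0.
have kn : k0 != 0 by rewrite intr_eq0.
have en : er != 0 by rewrite intr_eq0.
have kD : er ^+ 2 = k1 ^+ 2 - 4 * k0 * k2.
  transitivity ((qdisc Q)%:~R : rat); first by rewrite eD /er; ring.
  by rewrite /qdisc /k0 /k1 /k2; ring.
have k2E : k2 = (k1 ^+ 2 - er ^+ 2) / (4 * k0) by rewrite kD; field.
have r1 : k0 * c = k1 * b - 3 * k2 * a.
  transitivity ((qa Q * fc f)%:~R : rat); first by rewrite /k0 /c; ring.
  rewrite (_ : qa Q * fc f = qb Q * fb f - 3 * qc Q * fa f); last by lia.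
  by rewrite /k1 /k2 /a /b; ring.
have r2 : 3 * k0 * d = k1 * c - k2 * b.
  transitivity ((3 * qa Q * fd f)%:~R : rat); first by rewrite /k0 /d; ring.
  rewrite (_ : 3 * qa Q * fd f = qb Q * fc f - qc Q * fb f); last by lia.
  by rewrite /k1 /k2 /c /b; ring.
have cE : c = (k1 * b - 3 * k2 * a) / k0 by rewrite -r1; field.
have dE : d = (k1 * c - k2 * b) / (3 * k0) by rewrite -r2; field.
pose s := (- k1 + er) / (2 * k0); pose t := (- k1 - er) / (2 * k0).
have st : s - t = er / k0 by rewrite /s /t; field.
have stn : s - t != 0 by rewrite st mulf_neq0// invr_neq0.
pose P := (- b / 3 - t * a) / (s - t); pose P' := (s * a + b / 3) / (s - t).
have aP : a = P + P' by rewrite /P /P'; field.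
have bP : b = - 3 * (s * P + t * P') by rewrite /P /P'; field.
have cP : c = 3 * (s ^+ 2 * P + t ^+ 2 * P').
  by rewrite cE bP aP k2E /s /t; field.
have dP : d = - (s ^+ 3 * P + t ^+ 3 * P').
  by rewrite dE cP bP k2E /s /t; field.
clearbody P P' s t; clearbody a b c d.
pose A := io (a * s) + io 1 * om; pose B := io (a * t) + io 1 * om.
have A0 : A != 0 by apply/eqP => /om_irrational[_ /eqP].
have B0 : B != 0 by apply/eqP => /om_irrational[_ /eqP].
have rAB : io P * A ^+ 3 + io P' * B ^+ 3 = 0.
  have -> : io P * A ^+ 3 + io P' * B ^+ 3 = io (P + P') * om ^+ 3 + io (3 * a * (P * s + P' * t)) * om ^+ 2
    + io (3 * a ^+ 2 * (P * s ^+ 2 + P' * t ^+ 2)) * om + io (a ^+ 3 * (P * s ^+ 3 + P' * t ^+ 3)).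
    exact: cube_pencil.
  rewrite -aP c3' (_ : 3 * a * _ = - (a * b)); last by rewrite bP; ring.
  rewrite (_ : 3 * a ^+ 2 * _ = a * (a * c)); last by rewrite cP; ring.
  rewrite (_ : a ^+ 3 * _ = - (a * (a ^+ 2 * d))); last by rewrite dP; ring.
  by ring.
have P0 : P != 0.
  apply/eqP => p0; move: rAB; rewrite p0 rmorph0 mul0r add0r => /eqP.
  rewrite mulf_eq0 expf_eq0 /= (negPf B0) orbF fmorph_eq0 => /eqP p0'.
  by move: an; rewrite aP p0 p0' addr0 eqxx.
pose eta := A / B; pose m := - P' / P.
have em : eta ^+ 3 = m%:A.
  rewrite -ioE /eta /m expr_div_n; apply: (mulfI (_ : io P * B ^+ 3 != 0)).
    by rewrite mulf_neq0 ?expf_neq0// fmorph_eq0.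
  have -> : io P * B ^+ 3 * (A ^+ 3 / B ^+ 3) = io P * A ^+ 3 by field.
  rewrite rmorphM rmorphN fmorphV.
  have -> : io P * B ^+ 3 * (- io P' / io P) = - (io P' * B ^+ 3) by field; rewrite fmorph_eq0.
  by apply/eqP; rewrite -addr_eq0 rAB.
have eI (q : rat) : eta <> io q.
  move=> h; have hA : A = io q * B by rewrite -h /eta mulfVK.
  have : io (a * s - q * (a * t)) + io (1 - q) * om = 0.
    move/eqP: hA; rewrite -subr_eq0 => /eqP <-.
    by rewrite /A /B !(rmorphB io) !(rmorphM io) rmorph1; ring.
  move=> /om_irrational[h1 h2]; have q1 : q = 1 by lra.
  move: h1; rewrite q1 mul1r -mulrBr => /eqP; rewrite mulf_eq0 (negPf an) (negPf stn)//.
exists m, K, eta; split=> //.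
(* If q^3 = m, the real embedding sends [eta] and q to real numbers with the same cube, so [eta]
   would be rational. *)
- move=> q qm; have [phi [_ [hphi _]]] := real_and_nonreal.
  apply: (eI q); apply: (fmorph_inj phi).
  have h3 : phi eta ^+ 3 = phi (io q) ^+ 3 by rewrite -!rmorphXn /= em -qm -ioE rmorphXn.
  have h1 := hphi eta; have h2 := hphi (io q).
  case: (phi eta) (phi (io q)) h1 h2 h3 => [x x'] [y y'] /= -> ->.
  rewrite !exprS !expr0 => /eqP; rewrite eq_complex /= => /andP[/eqP e3 _].
  by congr Complex; apply: cube_inj; rewrite !exprS !expr0; lra.
- apply/eqP; rewrite eqEdim subvf /=.
  have d3 := dim_cubic; have := field_dimS (subvf <<1%VS; eta>>%AS); rewrite d3 => hd.
  have : (\dim <<1%VS; eta>>%VS \in divisors 3) by rewrite -dvdn_divisors.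
  rewrite !inE => /orP[/eqP d1|/eqP ->//].
  have /eqP e1 : (1%VS == <<1%VS; eta>>%VS) by rewrite eqEdim subv_adjoin d1 dimv1.
  have := memv_adjoin 1%VS eta; rewrite -e1 => /vlineP[q eq].
  by case: (eI q); rewrite ioE.
- by exists idfun; exists idfun.
Qed.

End CubicField.

(** A large shear w makes 2 A w + B and A w^2 + B w + C negative; w = |B| + |C| + 1 is enough since
    A <= -1. *)
Lemma shear_neg (P : bqf int) : qa P < 0 -> exists2 h, unimod h &
  [/\ qa (qact P h) < 0, qb (qact P h) < 0 & qc (qact P h) < 0].
Proof.
case: P => A B C A0; pose w := `|B| + `|C| + 1; rewrite /= in A0; exists (ZM 1 w 0 1); first by rewrite /unimod /zdet /=; ring.
rewrite qact_int /qeval /= /w {w}.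
have b1 : B <= `|B| := ler_norm _; have c1 : C <= `|C| := ler_norm _.
have b2 := normr_ge0 B; have c2 := normr_ge0 C.
have hA (v : int) : 0 <= v -> A * v <= - v by move=> v0; rewrite -mulN1r ler_wpM2r//; lia.
move: b1 c1 b2 c2; move: (`|B|) (`|C|) => B' C' b1 c1 b2 c2; split; first by lia.
  have h1 := hA (B' + C' + 1); rewrite [ltLHS](_ : _ = 2 * (A * (B' + C' + 1)) + B); last by ring.
  by move: h1; move: (A * _) => z; lia.
rewrite [ltLHS](_ : _ = A * (B' + C' + 1) ^+ 2 + B * (B' + C' + 1) + C); last by ring.
have w0 : 0 <= B' + C' + 1 by lia.
have h1 : B * (B' + C' + 1) <= B' * (B' + C' + 1) by rewrite ler_wpM2r.
have h2 := hA _ (sqr_ge0 (B' + C' + 1)).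
have h3 : 0 <= B' * C' by rewrite mulr_ge0.
have h4 : 0 <= C' * C' by rewrite mulr_ge0.
have e : B' * (B' + C' + 1) - (B' + C' + 1) ^+ 2 = - (B' * C') - C' * C' - B' - 2 * C' - 1 by ring.
by lia.
Qed.

Lemma neg_form (Q : bqf int) : qa Q != 0 -> 0 < qdisc Q -> exists2 g, unimod g &
  [/\ qa (qact Q g) < 0, qb (qact Q g) < 0 & qc (qact Q g) < 0].
Proof.
move=> q0 D0.
have [[x y] /= hxy] : exists z : int * int, qeval Q z.1 z.2 < 0.
  have [q0'|q0'] := ltP (qa Q) 0; first by exists (1, 0); rewrite /qeval /=; lia.
  (* At this vector Q takes the value minus [qa Q] times [qdisc Q]. *)
  exists (- qb Q, 2 * qa Q); rewrite /qeval /=.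
  rewrite (_ : _ + _ = - (qa Q * qdisc Q)); last by rewrite /qdisc; ring.
  by rewrite oppr_lt0 mulr_gt0// lt_neqAle eq_sym q0.
pose k := gcdz x y.
have k0 : k != 0.
  by apply/eqP => /eqP; rewrite gcdz_eq0 => /andP[/eqP e1 /eqP e2]; move: hxy; rewrite e1 e2 /qeval; lia.
have [x' ex] : exists x', x = x' * k by apply/dvdzP; exact: dvdz_gcdl.
have [y' ey] : exists y', y = y' * k by apply/dvdzP; exact: dvdz_gcdr.
have kp : 0 < k by rewrite lt_neqAle eq_sym k0.
have c1 : gcdz x' y' = 1.
  have : gcdz x y = gcdz x' y' * k by rewrite {1}ex {1}ey -mulz_gcdl// gtr0_norm.
  by rewrite -/k => e; apply: (mulIf k0); rewrite mul1r -e.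
have [g gu [g1 g2]] := primitive_extend c1.
pose P := qact Q g.
have P0 : qa P < 0.
  rewrite /P qact_int /= g1 g2; move: hxy; rewrite ex ey /qeval => h.
  have e : qa Q * (x' * k) ^+ 2 + qb Q * (x' * k) * (y' * k) + qc Q * (y' * k) ^+ 2 =
    (qa Q * x' ^+ 2 + qb Q * x' * y' + qc Q * y' ^+ 2) * k ^+ 2 by ring.
  by rewrite e pmulr_llt0 ?exprn_gt0// in h.
have [h hu hP] := shear_neg P0; exists (zmul g h); first exact: unimodM.
by rewrite -qactM in hP.
Qed.

Lemma nonpure_form (R : realType) (Q : bqf int) (K : fieldExtType rat) :
  complex_cubic R K -> ~ pure K -> trace_class K Q ->
  [/\ primQ Q, 0 < qdisc Q & forall e : int, qdisc Q != e ^+ 2].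
Proof.
move=> hK np tc; have d3 := dim_cubic hK.
have [pQ [f [om [th [n [ib rel n0 hn]]]]]] := trace_class_cubic d3 tc.
have bX := integral_basis_basis d3 ib.
have D0 := qdisc_gt0 hK bX rel n0 hn; split=> // e; apply/eqP => eD.
have e0 : e != 0 by apply/eqP => e0; move: D0; rewrite eD e0.
(* [pure_of_square] divides by the leading coefficient, so Q is first moved within its class if
   needed. *)
have [g gu q0] : exists2 g, unimod g & qa (qact Q g) != 0.
  have [q0|q0] := eqVneq (qa Q) 0; last by exists zone => //; rewrite qact1.
  have [q2|q2] := eqVneq (qc Q) 0.
    exists (ZM 1 0 1 1) => //; rewrite qact_int /qeval /= q0 q2.
    apply/eqP => h; have q1 : qb Q = 0 by lia.
    by move: D0; rewrite /qdisc q0 q1 mul0r expr0n.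
  by exists (ZM 0 1 1 0) => //; rewrite qact_int /qeval /= q0; apply: contra q2 => /eqP h; apply/eqP; lia.
have [_ [f' [om' [th' [n' [ib' rel' n0' hn']]]]]] := trace_class_cubic d3 (trace_class_act gu tc).
apply: np; apply: (pure_of_square hK (integral_basis_basis d3 ib') rel' q0 (e := e)) => //.
  by rewrite qdisc_act.
by apply: apolar_of_hess hn'; rewrite gt_eqF.
Qed.

(** * Isomorphism classes *)

Lemma field_iso_refl (K : fieldExtType rat) : field_iso K K.
Proof. by exists idfun; exists idfun. Qed.

Lemma field_iso_sym (K L : fieldExtType rat) : field_iso K L -> field_iso L K.
Proof.
move=> [f [g fK gK]].
have gm : zmod_morphism g by move=> x y; apply: (can_inj fK); rewrite gK rmorphB !gK.
have gm' : monoid_morphism g.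
  by split=> [|x y]; apply: (can_inj fK); rewrite gK ?rmorph1// rmorphM !gK.
pose gA := GRing.isZmodMorphism.Build L K g gm.
pose gM := GRing.isMonoidMorphism.Build L K g gm'.
pose g' : {rmorphism L -> K} := HB.pack g gA gM.
by exists g'; exists f.
Qed.

Lemma field_iso_trans (K L M : fieldExtType rat) : field_iso K L -> field_iso L M -> field_iso K M.
Proof. by move=> [f bf] [g bg]; exists (g \o f); exact: bij_comp. Qed.

Lemma iso_class_count_le P m (F : 'I_m -> fieldExtType rat) : (forall i, P (F i)) ->
  (forall K, P K -> exists i, field_iso K (F i)) -> exists2 n, iso_class_count P n & (n <= m)%N.
Proof.
elim: m F => [|m ih] F PF cov; first by exists 0%N => //; exists F; split=> // -[].
have [[i [j [ij iso]]]|dis] := pselect (exists i j, i <> j /\ field_iso (F i) (F j)); last first.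
  exists m.+1 => //; exists F; split=> // i j h; apply: contrapT => ne.
  by apply: dis; exists i, j.
have [||n hn nm] := ih (fun l => F (lift i l)); [by move=> l|move=> K PK|by exists n => //; exact: leqW].
have [l hl] := cov K PK.
have [li|li] := eqVneq i l; last by have [l' el _] := unlift_some li; exists l'; rewrite -el.
have ij' : i != j by apply/eqP.
have [l' el _] := unlift_some ij'.
by exists l'; rewrite -el; apply: field_iso_trans iso; rewrite li.
Qed.

Lemma iso_class_count_inj P n m (F : 'I_m -> fieldExtType rat) : iso_class_count P n -> (forall i, P (F i)) ->
  (forall i j, field_iso (F i) (F j) -> i = j) -> (m <= n)%N.
Proof.
move=> [G [PG dis cov]] PF disF.
have [h hh] := choice (fun i => cov _ (PF i)).
have hi : injective h.
  move=> i j e; apply: disF; apply: field_iso_trans (hh i) _; rewrite e; exact: field_iso_sym.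
by have := leq_card h hi; rewrite !card_ord.
Qed.

Lemma iso_class_count_uniq P n m : iso_class_count P n -> iso_class_count P m -> n = m.
Proof.
move=> hn hm; apply/eqP; rewrite eqn_leq; apply/andP; split.
  by have [F [PF dF _]] := hn; exact: iso_class_count_inj hm PF dF.
by have [F [PF dF _]] := hm; exact: iso_class_count_inj hn PF dF.
Qed.

Lemma num_iso_classesE P n : iso_class_count P n -> num_iso_classes P = n.
Proof.
move=> hn; rewrite /num_iso_classes; apply: (iso_class_count_uniq _ hn).
exact: (getI hn).
Qed.

(* [T] encodes the fields of the family [P] (through the relation [A]) by pairs of naturals. *)
Section CountPairs.
Variables (P : fieldExtType rat -> Prop) (A : fieldExtType rat -> nat -> nat -> Prop).
Hypothesis Aiso : forall K K' a b, A K a b -> A K' a b -> field_iso K K'.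

Lemma count_le N (T : nat -> nat -> bool) :
  (forall K, P K -> exists K' a b, [/\ field_iso K K', P K', A K' a b & [/\ (a < N)%N, (b < N)%N & T a b]]) ->
  exists2 n, iso_class_count P n & (n <= cnt N T)%N.
Proof.
move=> cov.
pose S := [pred x : 'I_N * 'I_N | T x.1 x.2 && `[< exists K, P K /\ A K x.1 x.2 >]].
have hS (x : 'I_N * 'I_N) : x \in S -> exists K, P K /\ A K x.1 x.2.
  by rewrite inE => /andP[_ /asboolP].
have ex (l : 'I_#|S|) : exists K, P K /\ A K (enum_val l).1 (enum_val l).2 by apply: hS; exact: enum_valP.
have [F hF] := choice ex.
have [||n hn nS] := @iso_class_count_le P #|S| F.
- by move=> l; have [] := hF l.
- move=> K /cov[K' [a [b [i1 PK' AK [aN bN Tab]]]]].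
  have xS : (Ordinal aN, Ordinal bN) \in S by rewrite inE /=; apply/andP; split=> //; apply/asboolP; exists K'.
  exists (enum_rank_in xS (Ordinal aN, Ordinal bN)); apply: field_iso_trans i1 _.
  by apply: (Aiso AK); have [_] := hF (enum_rank_in xS (Ordinal aN, Ordinal bN)); rewrite enum_rankK_in.
exists n => //; apply: leq_trans nS _; rewrite cnt_card; apply: subset_leq_card.
by apply/fintype.subsetP => x; rewrite !inE => /andP[].
Qed.

Lemma count_ge n N (T : nat -> nat -> bool) : iso_class_count P n ->
  (forall a b, (a < N)%N -> (b < N)%N -> T a b -> exists K, P K /\ A K a b) ->
  (forall K K' a b a' b', T a b -> T a' b' -> A K a b -> A K' a' b' -> field_iso K K' -> a = a' /\ b = b') ->
  (cnt N T <= n)%N.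
Proof.
move=> [G [PG dis cov]] ex inj; case: n G PG dis cov => [|n] G PG dis cov.
  rewrite leqn0; apply/eqP; rewrite /cnt big1// => a _; rewrite big1// => b _; apply/eqP; rewrite eqb0.
  by apply/negP => Tab; have [K [PK _]] := ex a b (ltn_ord a) (ltn_ord b) Tab; have [[]] := cov K PK.
have exl (x : nat * nat) : exists l : 'I_n.+1, (x.1 < N)%N -> (x.2 < N)%N -> T x.1 x.2 -> exists2 K, A K x.1 x.2 & field_iso K (G l).
  have [h|h] := pselect ([/\ (x.1 < N)%N, (x.2 < N)%N & T x.1 x.2]); last by exists ord0 => h1 h2 h3; case: h.
  case: h => h1 h2 h3; have [K [PK AK]] := ex _ _ h1 h2 h3; have [l hl] := cov K PK.
  by exists l => _ _ _; exists K.
have [h hh] := choice exl.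
have -> : n.+1 = #|'I_n.+1| by rewrite card_ord.
apply: (@cnt_inj _ N T (fun a b => h (a, b))) => a b a' b' aN bN aN' bN' Tab Tab' e.
have [K AK iK] := hh (a, b) aN bN Tab; have [K' AK' iK'] := hh (a', b') aN' bN' Tab'.
apply: (inj K K') => //; apply: field_iso_trans iK _; rewrite e; exact: field_iso_sym.
Qed.

End CountPairs.

Lemma cnt_widen N N0 (T : nat -> nat -> bool) : (N0 <= N)%N -> (forall a b, T a b -> (a < N0)%N /\ (b < N0)%N) -> cnt N T = cnt N0 T.
Proof.
move=> NN hT; rewrite !cnt_card.
pose w (x : 'I_N0 * 'I_N0) := (widen_ord NN x.1, widen_ord NN x.2).
have wi : injective w by move=> [a b] [a' b'] [e1 e2]; congr pair; exact: val_inj.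
rewrite -(fintype.card_image wi); apply: eq_card => -[a b]; rewrite !inE /=; apply/idP/fintype.imageP.
  move=> Tab; have [aN bN] := hT _ _ Tab; exists (Ordinal aN, Ordinal bN) => //.
  by congr pair; exact: val_inj.
by move=> [[a' b']]; rewrite inE /= => Tab [-> ->].
Qed.

(** * Automorphs of Q acting on attached fields *)

Section Fields.
Variables (R : realType) (Q : bqf int).
Hypotheses (q0 : qa Q < 0) (q1 : qb Q < 0) (q2 : qc Q < 0) (D0 : 0 < qdisc Q) (pQ : primQ Q).
Local Notation r1 := (r1 R Q).
Local Notation r2 := (r2 R Q).
Local Notation Mt := (@Mt R Q).
Local Notation tf a b := (tof Q (a%:R : R) b%:R).
Local Notation nf := (nform (slo R Q) (shi R Q) (kQ R Q)).
Implicit Types (f : bcf) (g h : zmat) (K : fieldExtType rat).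

Definition cev f (x y : R) : R :=
  (fa f)%:~R * x ^+ 3 + (fb f)%:~R * x ^+ 2 * y + (fc f)%:~R * x * y ^+ 2 + (fd f)%:~R * y ^+ 3.

Lemma cev_act f g x y : cev (cact f g) x y =
  cev f ((za g)%:~R * x + (zb g)%:~R * y) ((zc g)%:~R * x + (zd g)%:~R * y).
Proof. by rewrite /cev /cact /ceval /=; ring. Qed.

Lemma cev_scale (e : int) f x y : cev (cscale e f) x y = e%:~R * cev f x y.
Proof. by rewrite /cev /cscale /=; ring. Qed.

Lemma cev_homog f x y l : cev f (x * l) (y * l) = l ^+ 3 * cev f x y.
Proof. by rewrite /cev; ring. Qed.

(** With P and P' the coefficients of the two cubes, f(r1, 1) = P' (r1 - r2)^3 and f(r2, 1) = -P (r1
    - r2)^3. This form of e^(3t) makes the action of automorphs visible through their action on the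
    roots. *)
Lemma tof_cev f : apolar Q f -> cone Q ((fa f)%:~R : R) (fb f)%:~R ->
  cev f r2 1 != 0 /\ expR (3 * tof Q (fa f)%:~R (fb f)%:~R) = - cev f r1 1 / cev f r2 1.
Proof.
move=> ap cn; have [p0 p0'] := cP_gt0 q0 D0 cn; have [e1 e2] := pp3 q0 D0 cn.
have [ea eb ec ed] := cubic_coefs q0 q1 q2 D0 ap cn; rewrite expR_tof//.
rewrite e1 e2 in ea eb ec ed; move: p0 p0' ea eb ec ed {e1 e2}.
have r := r12 R q0 D0; move: (cP _ _ _) (cP' _ _ _) => P P' P0 P0' ea eb ec ed.
have e1 : cev f r1 1 = P' * (r1 - r2) ^+ 3 by rewrite /cev ea eb ec ed; ring.
have e2 : cev f r2 1 = - (P * (r1 - r2) ^+ 3) by rewrite /cev ea eb ec ed; ring.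
have d0 : r1 - r2 != 0 by rewrite subr_eq0 gt_eqF.
rewrite e1 e2; split; first by rewrite oppr_eq0 mulf_neq0// ?expf_neq0// gt_eqF.
by field; rewrite d0 gt_eqF.
Qed.

Lemma root_map g : unimod g -> qact Q g = Q -> exists l l' : R, (l * l') ^+ 2 = 1 /\
  ([/\ (za g)%:~R * r1 + (zb g)%:~R = r1 * l, (zc g)%:~R * r1 + (zd g)%:~R = l,
       (za g)%:~R * r2 + (zb g)%:~R = r2 * l' & (zc g)%:~R * r2 + (zd g)%:~R = l'] \/
   [/\ (za g)%:~R * r1 + (zb g)%:~R = r2 * l, (zc g)%:~R * r1 + (zd g)%:~R = l,
       (za g)%:~R * r2 + (zb g)%:~R = r1 * l' & (zc g)%:~R * r2 + (zd g)%:~R = l']).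
Proof.
move=> gu hg; exists ((zc g)%:~R * r1 + (zd g)%:~R), ((zc g)%:~R * r2 + (zd g)%:~R).
have qe (x y : R) : qeval (bqf_real R Q) x y = (qa Q)%:~R * ((x - r1 * y) * (x - r2 * y)).
  by rewrite /qeval /= (sum_r R q0) (prod_r R q0 D0); ring.
have a0 : (qa Q)%:~R != 0 :> R by rewrite intr_eq0 lt_eqF.
have inv (x : R) : qeval (bqf_real R Q) ((za g)%:~R * x + (zb g)%:~R) ((zc g)%:~R * x + (zd g)%:~R) = qeval (bqf_real R Q) x 1.
  by rewrite -[X in _ = qeval (bqf_real R X) _ _]hg bqf_realact qeval_act !mulr1.
have m (x : R) : (x - r1) * (x - r2) = 0 -> (za g)%:~R * x + (zb g)%:~R = r1 * ((zc g)%:~R * x + (zd g)%:~R) \/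
    (za g)%:~R * x + (zb g)%:~R = r2 * ((zc g)%:~R * x + (zd g)%:~R).
  move=> hx; have := inv x; rewrite !qe !mulr1 hx mulr0 => /eqP.
  by rewrite mulf_eq0 (negPf a0) /= mulf_eq0 !subr_eq0 => /orP[]/eqP; [left|right].
have h1 : (r1 - r1) * (r1 - r2) = 0 by rewrite subrr mul0r.
have h2 : (r2 - r1) * (r2 - r2) = 0 by rewrite subrr mulr0.
have d0 : r1 - r2 != 0 by rewrite subr_eq0 gt_eqF// r12.
have det : ((za g)%:~R * (zd g)%:~R - (zb g)%:~R * (zc g)%:~R) ^+ 2 = 1 :> R := unimodR R gu.
have cross : ((za g)%:~R * r1 + (zb g)%:~R) * ((zc g)%:~R * r2 + (zd g)%:~R) - ((za g)%:~R * r2 + (zb g)%:~R) * ((zc g)%:~R * r1 + (zd g)%:~R)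
   = ((za g)%:~R * (zd g)%:~R - (zb g)%:~R * (zc g)%:~R) * (r1 - r2) :> R by ring.
have [e1|e1] := m _ h1; have [e2|e2] := m _ h2; move: cross; rewrite e1 e2 => cross.
- exfalso; have : ((za g)%:~R * (zd g)%:~R - (zb g)%:~R * (zc g)%:~R) * (r1 - r2) = 0 :> R by rewrite -cross; ring.
  by move/eqP; rewrite mulf_eq0 (negPf d0) orbF => /eqP z; move: det; rewrite z expr0n => /eqP; rewrite eq_sym oner_eq0.
- split; last by left.
  rewrite -[RHS]det; congr (_ ^+ 2); apply: (mulIf d0); rewrite -cross.
  by move: ((zc g)%:~R * r1 + _) ((zc g)%:~R * r2 + _) => l l'; ring.
- split; last by right.
  rewrite -[RHS]det -[RHS]sqrrN; congr (_ ^+ 2); apply: (mulIf d0); rewrite mulNr -cross.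
  by move: ((zc g)%:~R * r1 + _) ((zc g)%:~R * r2 + _) => l l'; ring.
- exfalso; have : ((za g)%:~R * (zd g)%:~R - (zb g)%:~R * (zc g)%:~R) * (r1 - r2) = 0 :> R by rewrite -cross; ring.
  by move/eqP; rewrite mulf_eq0 (negPf d0) orbF => /eqP z; move: det; rewrite z expr0n => /eqP; rewrite eq_sym oner_eq0.
Qed.

(** l l' is 1 or -1; the value -1 would give l / l' = - l^2 and a nonpositive x, so l / l' = l^2. *)
Lemma cube_ratio (l l' x y : R) : (l * l') ^+ 2 = 1 -> 0 < x -> 0 < y -> x = (l / l') ^+ 3 * y -> x = (l ^+ 2) ^+ 3 * y.
Proof.
move=> /eqP ll x0 y0 e.
have l0' : l' != 0 by apply: contraTneq ll => ->; rewrite mulr0 expr0n eq_sym oner_eq0.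
have l0 : l != 0 by apply: contraTneq ll => ->; rewrite mul0r expr0n eq_sym oner_eq0.
move: ll; rewrite sqrf_eq1 => /orP[/eqP ll|/eqP ll].
  by rewrite e (_ : l' = l^-1) ?invrK -?expr2//; apply: (mulfI l0); rewrite ll mulfV.
exfalso; move: x0; rewrite e pmulr_lgt0// ltNge => /negP; apply.
have -> : l / l' = - l ^+ 2.
  by apply: (mulIf l0'); rewrite mulfVK// mulNr expr2 -mulrA ll mulrN1 opprK.
move: (sqr_ge0 l); move: (l ^+ 2) => u u0.
by rewrite (_ : _ ^+ 3 = - u ^+ 3); [rewrite oppr_le0 exprn_ge0|ring].
Qed.

(** Everything is read at the roots of Q, which g fixes or exchanges up to factors l and l'. The
    ratio e^(3t) of cubic values acquires (l / l')^3, the quadratic value defining [al] acquires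
    l^2, and [cube_ratio] identifies the two. An exchange of the roots moreover inverts e^(3t). *)
Lemma tof_act f f' g (e : int) : unimod g -> qact Q g = Q -> e != 0 -> f' = cscale e (cact f g) ->
  apolar Q f -> apolar Q f' -> cone Q ((fa f)%:~R : R) (fb f)%:~R -> cone Q ((fa f')%:~R : R) (fb f')%:~R ->
  tof Q ((fa f')%:~R : R) (fb f')%:~R = al Q g (tof Q ((fa f)%:~R : R) (fb f)%:~R).
Proof.
move=> gu hg e0 ef ap ap' cn cn'; have [n1 h1] := tof_cev ap cn; have [n1' h1'] := tof_cev ap' cn'.
have d0 : r1 - r2 != 0 by rewrite subr_eq0 gt_eqF// r12.
have [l [l' [ll hl]]] := root_map gu hg.
have l0 : l != 0 by apply/eqP => z; move/eqP: ll; rewrite z mul0r expr0n eq_sym oner_eq0.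
have l0' : l' != 0 by apply/eqP => z; move/eqP: ll; rewrite z mulr0 expr0n eq_sym oner_eq0.
have l2 : 0 < l ^+ 2 by rewrite exprn_even_gt0.
have er : (e%:~R : R) != 0 by rewrite intr_eq0.
set t := tof Q (fa f)%:~R _ in h1 *; set t' := tof Q (fa f')%:~R _ in h1' *.
have fin (c : R) : expR (3 * t') = (l / l') ^+ 3 * expR (3 * c) -> t' = c + ln (l ^+ 2).
  move=> /(cube_ratio ll (expR_gt0 _) (expR_gt0 _)) h.
  have : 3 * t' = 3 * (c + ln (l ^+ 2)).
    by apply: expR_inj; rewrite h mulrDr expRD mulrC; congr (_ * _); rewrite expRM_natl lnK.
  by move=> h3; apply: (mulfI _ h3); rewrite pnatr_eq0.
have evs (x y c c' : R) (m : R) : x * m = c -> y * m = c' -> cev f c c' = m ^+ 3 * cev f x y.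
  by move=> <- <-; exact: cev_homog.
have n2 : cev f r1 1 != 0.
  by apply/eqP => z; move: h1; rewrite z oppr0 mul0r => /eqP; rewrite gt_eqF// expR_gt0.
have qM (c c' x : R) m : x * m = c -> 1 * m = c' -> qeval (Mt t) c c' = m ^+ 2 * qeval (Mt t) x 1.
  by move=> <- <-; rewrite /qeval; ring.
rewrite /al qeval_act !mulr1; case: hl => -[a1 a2 a3 a4].
- rewrite (qM _ _ r1 l) ?a1 ?a2 ?mul1r// qeval_Mt !mulr1 subrr expr0n /= mulr0 add0r.
  rewrite mulrA mulfK ?expf_neq0// mulrC lnM ?posrE ?expR_gt0// expRK.
  apply: fin; rewrite h1' h1 ef !cev_scale !cev_act !mulr1 a1 a2 a3 a4.
  rewrite (evs r1 1 (r1 * l) l l) ?mul1r// (evs r2 1 (r2 * l') l' l') ?mul1r//.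
  by field; do ?[apply/andP; split].
- rewrite (qM _ _ r2 l) ?a1 ?a2 ?mul1r// qeval_Mt !mulr1 subrr expr0n /= mulr0 addr0.
  rewrite -[r2 - r1]opprB sqrrN mulrA mulfK ?expf_neq0// mulrC lnM ?posrE ?expR_gt0// expRK.
  apply: fin; rewrite mulrN expRN h1 h1' ef !cev_scale !cev_act !mulr1 a1 a2 a3 a4.
  rewrite (evs r2 1 (r2 * l) l l) ?mul1r// (evs r1 1 (r1 * l') l' l') ?mul1r//.
  by field; do ?[apply/andP; split].
Qed.

(** Of the moved form and its opposite, both carried by bases of the same ring, one has its leading
    coefficients in the cone. *)
Lemma attached_move K a b g : attached Q K a b -> unimod g -> qact Q g = Q ->
  exists a' b', attached Q K a' b' /\ tf a' b' = al Q g (tf a b).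
Proof.
move=> /(attached_facts R q0 q1 q2 D0 pQ)[d3 [f [om [th [n [ib rel ea eb [n0 hn ap _ cn]]]]]]] gu hg.
have cnf : cone Q ((fa f)%:~R : R) (fb f)%:~R by rewrite ea eb; exact: cn.
have eta (e : int) : e ^+ 2 = 1 -> hess (cscale e (cact f g)) = qscale n Q.
  move=> e2; rewrite hess_scale e2 hess_act// hn qact_scale hg.
  by congr BQF; rewrite /=; ring.
have [om' [th' [ib' rel' _]]] := rebase_cubic ib rel gu.
have d1 : zdet g ^+ 2 = 1 := gu.
have fin (e : int) (om1 th1 : K) : e ^+ 2 = 1 -> integral_basis om1 th1 -> cubic_rel (cscale e (cact f g)) om1 th1 ->
   cone Q ((fa (cscale e (cact f g)))%:~R : R) (fb (cscale e (cact f g)))%:~R ->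
   exists a' b', attached Q K a' b' /\ tf a' b' = al Q g (tf a b).
  move=> e2 ib1 rel1 cn1; have hn1 := eta e e2.
  have ap1 : apolar Q (cscale e (cact f g)) by apply: apolar_of_hess hn1; rewrite gt_eqF.
  have e0 : e != 0 by apply: contra_eq_neq e2 => ->; rewrite expr0n.
  have [a' [b' [ea' eb']]] := cone_nat q0 q1 q2 D0 cn1.
  exists a', b'; split; first by split=> //; exists (cscale e (cact f g)), om1, th1, n.
  have := tof_act gu hg e0 (erefl _) ap ap1 cnf cn1.
  by rewrite ea' eb' ea eb.
have [cn1|cn1] := hess_cone R q0 q1 q2 D0 pQ n0 (eta _ d1); first exact: fin d1 ib' rel' cn1.
have gu1 : unimod (ZM (-1) 0 0 (-1)) by [].
have [om2 [th2 [ib2 rel2 _]]] := rebase_cubic ib' rel' gu1.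
apply: (fin (- zdet g)) ib2 _ _; first by rewrite sqrrN.
- rewrite cact_opp in rel2; move: rel2; congr (cubic_rel _ _ _).
  by rewrite /cscale /=; congr BCF; ring.
- by move: cn1; rewrite /cscale /= !mulNr !intrN.
Qed.

Lemma attached_iso_move K K' a b a' b' : attached Q K a b -> attached Q K' a' b' -> field_iso K K' ->
  exists2 g, unimod g /\ qact Q g = Q & tf a' b' = al Q g (tf a b) /\ nf a' b' = nf a b.
Proof.
move=> /(attached_facts R q0 q1 q2 D0 pQ)[d3 [f [om [th [n [ib rel ea eb [n0 hn ap en cn]]]]]]].
move=> /(attached_facts R q0 q1 q2 D0 pQ)[d3' [f' [om' [th' [n' [ib' rel' ea' eb' [n0' hn' ap' en' cn']]]]]]] iso.
have Dn : qdisc Q != 0 by rewrite gt_eqF.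
have [g gu [hg enn ef]] := cubic_iso_automorph d3' ib rel ib' rel' n0 n0' hn hn' Dn iso.
exists g => //; rewrite en en' enn; split=> //.
have e0 : zdet g != 0 by apply: contra_eq_neq gu => ->; rewrite expr0n.
have cnf : cone Q ((fa f)%:~R : R) (fb f)%:~R by rewrite ea eb; exact: cn.
have cnf' : cone Q ((fa f')%:~R : R) (fb f')%:~R by rewrite ea' eb'; exact: cn'.
by have := tof_act gu hg e0 ef ap ap' cnf cnf'; rewrite ea eb ea' eb'.
Qed.

(** t and n are coordinates on the cone: t fixes the ratio of the two linear factors and n,
    quadratic and positive, the scale. *)
Lemma tof_nform_inj (a b a' b' : nat) : cone Q (a%:R : R) b%:R -> cone Q (a'%:R : R) b'%:R ->
  tf a b = tf a' b' -> nf a b = nf a' b' -> a = a' /\ b = b'.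
Proof.
move=> cn cn' et en; have := expR_tof q0 D0 cn; have := expR_tof q0 D0 cn'; rewrite -et.
have k0 := kQ_gt0 R q0; have s12 := slo_shi R q0 D0.
have E0 := expR_gt0 (3 * tf a b); move: (expR _) E0 => E E0.
move: en; rewrite /nform /cP /cP'; case: cn => [a0 h1 h2]; case: cn' => [a0' h1' h2'].
move: a0 h1 h2 a0' h1' h2' s12 k0; move: (slo R Q) (shi R Q) (kQ R Q) => s s' k.
have nat_eq (c c' : nat) : (c%:R : R) = c'%:R -> c = c' by move/eqP; rewrite eqr_nat => /eqP.
suff main (A B A' B' : R) : 0 < A -> s * A < B -> B < s' * A -> 0 < A' -> s * A' < B' -> B' < s' * A' ->
  s < s' -> 0 < k -> k * (B - s * A) * (s' * A - B) = k * (B' - s * A') * (s' * A' - B') ->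
  E = (B' - s * A') / (s' - s) / ((s' * A' - B') / (s' - s)) -> E = (B - s * A) / (s' - s) / ((s' * A - B) / (s' - s)) ->
  A = A' /\ B = B'.
  move=> a0 h1 h2 a0' h1' h2' s12 k0 en e1 e2.
  by have [/nat_eq ? /nat_eq ?] := main _ _ _ _ a0 h1 h2 a0' h1' h2' s12 k0 en e1 e2.
move=> A0 h1 h2 A0' h1' h2' s12 k0 en e1 e2.
have d0 : s' - s != 0 by rewrite subr_eq0 gt_eqF.
have u0 : 0 < s' * A - B by lra.
have u0' : 0 < s' * A' - B' by lra.
have {}e2 : B - s * A = E * (s' * A - B) by rewrite e2; field; rewrite d0 gt_eqF.
have {}e1 : B' - s * A' = E * (s' * A' - B') by rewrite e1; field; rewrite d0 gt_eqF.
have uu : s' * A - B = s' * A' - B'.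
  have : (s' * A - B) ^+ 2 = (s' * A' - B') ^+ 2.
    apply: (mulfI (_ : k * E != 0)); first by rewrite mulf_neq0 ?gt_eqF.
    by move: en; rewrite e1 e2 !expr2 !mulrA.
  by move/eqP; rewrite eqf_sqr => /orP[/eqP//|/eqP]; lra.
have AA : (s' - s) * A = (s' - s) * A' by move: e1 e2; rewrite uu; lra.
have eA := mulfI d0 AA; split=> //; move: uu; rewrite eA; lra.
Qed.

Lemma region_tof t1 t2 B (a b : nat) : t1 <= t2 -> region (slo R Q) (shi R Q) (kQ R Q) t1 t2 B a b <->
  [/\ cone Q (a%:R : R) b%:R, t1 <= tf a b < t2 & nf a b < B ^+ 2].
Proof.
move=> t12; split=> [rg|[cn /andP[h1 h2] h3]].
  have [a0 [b1 b2]] := region_slope q0 q1 q2 D0 t12 rg.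
  have cn : cone Q (a%:R : R) b%:R by split=> //; rewrite ltr0n.
  move: rg => /and3P[_ /andP[c1 c2] c3]; split=> //.
  by rewrite -(slope_tof q0 D0 _ cn) c1 ltNge -(slope_tof q0 D0 _ cn) -ltNge.
have [a0 _ _] := cn; rewrite /region -(ltr0n R) a0 h3 andbT /= /inI (slope_tof q0 D0 _ cn) h1 /=.
by rewrite ltNge (slope_tof q0 D0 _ cn) -ltNge.
Qed.

End Fields.

(** * Counting fields *)

Section Counting.
Variables (R : realType) (Q : bqf int).
Hypotheses (q0 : qa Q < 0) (q1 : qb Q < 0) (q2 : qc Q < 0) (D0 : 0 < qdisc Q) (pQ : primQ Q).
Local Notation p := (@pt R Q q0 D0).
Local Notation al := (@al R Q).
Local Notation tf a b := (tof Q (a%:R : R) b%:R).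
Local Notation nf := (nform (slo R Q) (shi R Q) (kQ R Q)).
Local Notation bx := (box (slo R Q) (shi R Q) (kQ R Q)).
Local Notation rg := (region (slo R Q) (shi R Q) (kQ R Q)).
Implicit Types (K : fieldExtType rat) (W : set R[i]) (B : R).

(* Representatives of the automorphisms of Q up to sign, as isometries of the line, modulo those
   coming from automorphisms of Q. *)
Lemma sign_cosets : exists c (psi : 'I_c -> zmat), [/\ (0 < c)%N, forall i, autg Q (psi i),
   forall h, autg Q h -> exists i h', [/\ unimod h', qact Q h' = Q & forall t, al h' t = al (psi i) (al h t)] &
   forall i j g, unimod g -> qact Q g = Q -> (forall t, al (psi j) t = al g (al (psi i) t)) -> i = j].
Proof.
(* Either some stabilizing matrix acts on the line like no automorph of Q, and then it carries Q to
   -Q and c = 2, or c = 1. *)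
have [[h0 [a0 h0N]]|none] := pselect (exists h0, autg Q h0 /\ forall h', unimod h' -> qact Q h' = Q -> ~ forall t, al h' t = al h0 t).
  have e0 : qact Q h0 = qscale (-1) Q.
    by case: a0 => u0 [e|//]; case: (h0N h0 u0 e).
  have ai := autg_inv a0.
  exists 2%N, (fun i : 'I_2 => if (i : nat) is 0%N then zone else zinv h0); split=> //.
  - by case=> -[|l] hl //; exact: autg1.
  - move=> h [hu [hh|hh]]; first by exists ord0, h; split=> // t; rewrite /= al1.
    exists ord_max, (zmul h (zinv h0)); split.
    + by apply: unimodM => //; exact: unimodV a0.1.
    + rewrite qactM hh qact_scale -[X in qact X _](qscaleN Q) -e0 qact_scale qactVK; last by case: a0.
      by rewrite qscaleN.
    + by move=> t; rewrite /= alM//; split=> //; right.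
  - have aut g : unimod g -> qact Q g = Q -> autg Q g by move=> gu hg; split=> //; left.
    move=> i j g gu hg; have ag := aut g gu hg.
    case: i => [[|[|//]] hi]; case: j => [[|[|//]] hj] //= h; try exact: val_inj.
    + exfalso; have vu := unimodV gu; have hv : qact Q (zinv g) = Q by rewrite -[in LHS]hg qactVK.
      apply: (h0N (zinv g) vu hv) => t.
      have := h (al h0 t); rewrite (alK q0 D0 _ a0) al1// => e; rewrite [in LHS]e (alK q0 D0 _ ag)//.
    + exfalso; apply: (h0N g gu hg) => t.
      by have := h (al h0 t); rewrite al1// (alK q0 D0 _ a0).
exists 1%N, (fun=> zone); split=> //; first by move=> i; exact: autg1.
- move=> h ah; apply: contrapT => no; apply: none; exists h; split=> // h' hu hh' e; apply: no.
  by exists ord0, h'; split=> // t; rewrite al1.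
- by move=> i j; rewrite !ord1.
Qed.

Lemma al_interval h u v : autg Q h -> u <= v -> exists t1 t2 : R, [/\ t2 - t1 = v - u,
  forall s, u <= s <= v -> t1 <= al h s <= t2 & forall t, t1 < t < t2 -> exists2 s, u < s < v & t = al h s].
Proof.
move=> ah uv; have [e [c [[->|->] hc]]] := al_lin R q0 D0 ah.
  exists (u + c), (v + c); split; first by ring.
    by move=> s hs; rewrite hc; lra.
  by move=> t ht; exists (t - c); [lra|rewrite hc; ring].
exists (c - v), (c - u); split; first by ring.
  by move=> s hs; rewrite hc; lra.
by move=> t ht; exists (c - t); [lra|rewrite hc; ring].
Qed.

(** The bound on the discriminant is parametrised by B so that it reads n < B^2. *)
Definition family W B K := [/\ complex_cubic R K, trace_class K Q,
  exists2 w, is_shape K w & W w & absdisc_lt K (B ^+ 4 * (qdisc Q)%:~R / 3)].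

Lemma familyP W B K a b : 0 < B -> attached Q K a b -> family W B K <-> W (p (tf a b)) /\ nf a b < B ^+ 2.
Proof.
move=> B0 hK; have [_ [f [om [th [n [_ _ _ _ [n0 _ _ en _]]]]]]] := attached_facts R q0 q1 q2 D0 pQ hK.
have Dp : (0 : R) < (qdisc Q)%:~R / 3 by rewrite divr_gt0// ltr0z.
have nf0 : 0 < nf a b by rewrite en ltr0z.
have hd : absdisc_lt K (B ^+ 4 * (qdisc Q)%:~R / 3) <-> nf a b < B ^+ 2.
  rewrite (attached_disc q0 q1 q2 D0 pQ _ hK) -2!mulrA ltr_pM2r// -[4%N]/(2 * 2)%N exprM.
  by rewrite ltr_pXn2r// nnegrE ?sqr_ge0// ltW.
have hs w : is_shape K w <-> w = p (tf a b).
  rewrite (attached_shape q0 q1 q2 D0 pQ w hK); split=> [[gw [g gu e]]|->].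
    by rewrite e; apply: pt_unique => //; rewrite -e.
  split; first exact: pt_gauss.
  by exists (gr q0 D0 (tf a b)); [exact: gr_unimod|].
split=> [[_ _ [w /hs -> Ww] /hd ?]//|[Ww hn]]; split.
- exact: (attached_complex R q0 q1 q2 D0 pQ hK).
- exact: (attached_trace pQ hK).
- by exists (p (tf a b)) => //; apply/hs.
- exact/hd.
Qed.

Lemma family_attached W B K : family W B K -> exists a b, attached Q K a b.
Proof. by move=> [[d3 _] tc _ _]; exact: (trace_class_attached R q0 q1 q2 D0 pQ d3 tc). Qed.

Section Pieces.
Variables (n : nat) (x y : 'I_n -> R).
Hypotheses (xy : forall i, x i < y i)
  (cov : forall t, exists2 h, autg Q h & exists i, x i <= al h t <= y i)
  (inj : forall i j s s', x i < s < y i -> x j <= s' <= y j -> p s = p s' -> i = j /\ s = s')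
  (stab : forall i h s, x i < s < y i -> autg Q h -> al h s = s -> forall t, al h t = t).
Variables (c : nat) (psi : 'I_c -> zmat).
Hypotheses (psiA : forall i, autg Q (psi i))
  (psiC : forall h, autg Q h -> exists i h', [/\ unimod h', qact Q h' = Q & forall t, al h' t = al (psi i) (al h t)])
  (psiS : forall i j g, unimod g -> qact Q g = Q -> (forall t, al (psi j) t = al g (al (psi i) t)) -> i = j).
Variables (k1 : R).
Hypotheses (k0 : 0 < k1) (dens : forall T1 T2, T1 <= T2 ->
  let F B := (cnt (bx T1 T2 B) (fun a b => good_all Q a b && rg T1 T2 B a b))%:R : R in
  ub F (k1 * (T2 - T1)) /\ lb F (k1 * (T2 - T1))).
Local Notation lft := (@dl R n x y _).
Local Notation rgt := (@dr R n x y _).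

Lemma dlr_lt m (j : dyad n m) : lft j < rgt j.
Proof.
rewrite /dl /dr /node ltrD2l ltr_pM2r ?ltr_nat// divr_gt0 ?exprn_gt0// subr_gt0//.
Qed.

(** Images of open pieces under the coset representatives are inequivalent under automorphs of Q.
    Injectivity of [pt] on the arcs determines j and s; then an element of the stabilizer fixes an
    interior point, so it acts trivially, and the two cosets coincide. *)
Lemma piece_key m (j j' : dyad n m) i i' s s' g : lft j < s < rgt j -> lft j' < s' < rgt j' ->
  unimod g -> qact Q g = Q -> al (psi i') s' = al g (al (psi i) s) -> [/\ i = i', j = j' & s = s'].
Proof.
move=> hs hs' gu hg e; have ag : autg Q g by split=> //; left.
have [h1 /andP[_ h2]] := dlr xy j; have [h3 /andP[_ h4]] := dlr xy j'.
have ps : p s = p s'.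
  by rewrite -(pt_al q0 D0 s' (psiA i')) e !pt_al.
have m1 : x j.1 < s < y j.1 by exact: itv_widen_oo h1 h2 hs.
have m2 : x j'.1 <= s' <= y j'.1 by exact/itv_oo_cc/(itv_widen_oo h3 h4 hs').
have [jj ss] := inj m1 m2 ps.
have jE : j = j'.
  by apply: (dyad_disj xy (s := s) jj); [exact: itv_oo_co|rewrite ss; exact: itv_oo_co].
split; [ |exact: jE|exact: ss].
have ai := autg_inv (psiA i').
have ah : autg Q (zmul (psi i) g) by exact: autg_mul.
have ah' : autg Q (zmul (zmul (psi i) g) (zinv (psi i'))) by exact: autg_mul.
have h : forall t, al (zmul (zmul (psi i) g) (zinv (psi i'))) t = t.
  apply: stab m1 ah' _; rewrite (alM q0 D0 _ ah ai) (alM q0 D0 _ (psiA i) ag) -e.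
  by rewrite (alK q0 D0 _ (psiA i')) ss.
apply: (psiS gu hg) => t; have e1 := h t.
rewrite (alM q0 D0 _ ah ai) (alM q0 D0 _ (psiA i) ag) in e1.
by rewrite -[RHS](alVK q0 D0 _ (psiA i')) e1.
Qed.

Lemma pieces_image m : exists T : 'I_c * dyad n m -> R * R, forall ij, [/\ (T ij).2 - (T ij).1 = rgt ij.2 - lft ij.2,
  forall s, lft ij.2 <= s <= rgt ij.2 -> (T ij).1 <= al (psi ij.1) s <= (T ij).2 &
  forall t, (T ij).1 < t < (T ij).2 -> exists2 s, lft ij.2 < s < rgt ij.2 & t = al (psi ij.1) s].
Proof.
have ex (ij : 'I_c * dyad n m) : exists T : R * R, [/\ T.2 - T.1 = rgt ij.2 - lft ij.2,
  forall s, lft ij.2 <= s <= rgt ij.2 -> T.1 <= al (psi ij.1) s <= T.2 &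
  forall t, T.1 < t < T.2 -> exists2 s, lft ij.2 < s < rgt ij.2 & t = al (psi ij.1) s].
  by have [t1 [t2 h]] := al_interval (psiA ij.1) (ltW (dlr_lt ij.2)); exists (t1, t2).
by have [T hT] := choice ex; exists T.
Qed.

Lemma sum_pieces m (S : pred (dyad n m)) (f : dyad n m -> R) :
  \sum_(ij <- enum [pred ij : 'I_c * dyad n m | S ij.2]) f ij.2 = c%:R * \sum_(j | S j) f j.
Proof.
rewrite big_enum /= -(pair_big xpredT S (fun i j => f j)) /=.
by rewrite sumr_const card_ord mulr_natl.
Qed.

(** Every field of the family is moved by an automorph of Q into the image of some selected piece.
    The margin eta makes the half-open counting region contain the closed image. *)
Lemma family_ub W m (S : pred (dyad n m)) eta : 0 < eta ->
  (forall i s, x i <= s <= y i -> W (p s) -> exists j : dyad n m, S j /\ lft j <= s <= rgt j) ->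
  exists2 F, ub F (k1 * (c%:R * \sum_(j | S j) (rgt j - lft j + eta))) &
    forall B, 0 < B -> exists2 N, iso_class_count (family W B) N & N%:R <= F B.
Proof.
move=> e0 hS; have [T hT] := pieces_image m.
pose s := enum [pred ij : 'I_c * dyad n m | S ij.2].
pose G ij B a b := good_all Q a b && rg (T ij).1 ((T ij).2 + eta) B a b.
pose bb ij B := bx (T ij).1 ((T ij).2 + eta) B.
have T12 ij : (T ij).1 <= (T ij).2 + eta by have [e _ _] := hT ij; have := dlr_lt ij.2; lra.
have sm j : S j.2 -> j \in s by rewrite mem_enum.
exists (fun B => \sum_(ij <- s) (cnt (bb ij B) (G ij B))%:R).
  rewrite -sum_pieces mulr_sumr; apply: ub_sum => ij.
  by have [e _ _] := hT ij; rewrite -e; have [h _] := dens (T12 ij); move: h; congr ub; ring.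
move=> B B0; pose N := \max_(ij : 'I_c * dyad n m) bb ij B.
have s10 := slo_gt0 R q0 q1 q2 D0; have s12 := slo_shi R q0 D0; have kk := kQ_gt0 R q0.
have rb ij a b : rg (T ij).1 ((T ij).2 + eta) B a b -> (a < bb ij B)%N /\ (b < bb ij B)%N.
  exact: (box_region s10 s12 kk (T12 ij)).
have [||M hM MN] := @count_le (family W B) (attached Q) _ N (fun a b => has (fun ij => G ij B a b) s).
- by move=> K K' a b; exact: (attached_iso R q0 q1 q2 D0 pQ).
- move=> K fK; have [a [b aK]] := family_attached fK.
  have [Wt _] := (familyP W B0 aK).1 fK.
  have [h ah [i hi]] := cov (tf a b).
  have [j [Sj hj]] := hS i _ hi (eq_ind_r W Wt (pt_al q0 D0 _ ah)).
  have [i' [h' [hu hh' eh']]] := psiC ah.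
  have [a' [b' [aK' et]]] := attached_move R q0 q1 q2 D0 pQ aK hu hh'.
  have [_ nb] := (familyP W B0 aK').1 fK.
  have rij : rg (T (i', j)).1 ((T (i', j)).2 + eta) B a' b'.
    apply/(region_tof q0 q1 q2 D0 _ _ _ (T12 (i', j))); split=> //.
      by have [_ [f [om [th [l [_ _ _ _ [_ _ _ _ cn]]]]]]] := attached_facts R q0 q1 q2 D0 pQ aK'.
    by have [_ h1 _] := hT (i', j); have := h1 _ hj; rewrite et eh' /=; lra.
  have [aN bN] := rb _ _ _ rij.
  exists K, a', b'; split=> //; first exact: field_iso_refl.
  split; [exact: leq_trans aN (leq_bigmax _)|exact: leq_trans bN (leq_bigmax _)|].
  apply/hasP; exists (i', j); first exact: sm.
  by rewrite /G rij andbT; exact: (attached_good R q0 q1 q2 D0 pQ aK').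
exists M => //; rewrite -natr_sum ler_nat; apply: leq_trans MN _.
apply: leq_trans (@cnt_bigor _ s N _ (fun ij => G ij B) _) _; first by move=> a b _ _ /hasP.
apply: leq_sum => ij _; rewrite (@cnt_widen N (bb ij B))//; first exact: leq_bigmax.
by move=> a b /andP[_ /rb].
Qed.

(** Points with n = 1 lie in the fixed region n < 4, so discarding them costs a bounded number. *)
Lemma dens_ne1 T1 T2 : lb (fun B => (cnt (bx T1 T2 B) (fun a b =>
   [&& T1 <= T2, good_all Q a b, rg T1 T2 B a b & nf a b != 1]))%:R) (k1 * (T2 - T1)).
Proof.
have [h12|h12] := leP T1 T2; last first.
  apply: (@lb_le _ _ (fun=> - 0)); first by exists 0 => B _; rewrite oppr0.
  by apply: lb_weak (lb_const (- 0)); rewrite pmulr_rle0// subr_le0 ltW.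
have [_ hl] := dens h12.
have s10 := slo_gt0 R q0 q1 q2 D0; have s12 := slo_shi R q0 D0; have kk := kQ_gt0 R q0.
pose C := (bx T1 T2 2 * bx T1 T2 2)%N.
have := lb_add hl (lb_const (- C%:R)); rewrite addr0; apply: lb_le; exists 2 => B B2.
have B0 : 0 < B by lra.
rewrite lerBlDr -natrD ler_nat.
apply: leq_trans (@cnt_or _ _ (fun a b => [&& true, good_all Q a b, rg T1 T2 B a b & nf a b != 1]) (fun a b => rg T1 T2 2 a b) _) _.
  move=> a b _ _ /andP[-> rr]; rewrite rr /=; case: eqP => [e1|//] /=.
  move: rr => /and3P[a0 i0 _]; apply/and3P; split=> //; rewrite e1; lra.
rewrite leq_add2l; have [hB|hB] := leqP (bx T1 T2 2) (bx T1 T2 B).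
  rewrite (cnt_widen hB) => [|a b]; last by apply: (box_region s10 s12 kk h12) => //; lra.
  by rewrite cnt_card; apply: leq_trans (max_card _) _; rewrite card_prod card_ord.
rewrite cnt_card; apply: leq_trans (max_card _) _; rewrite card_prod card_ord.
by apply: leq_mul; exact: ltnW.
Qed.

(** Removing eta at both ends leaves parameters coming from the interior of the pieces, as
    [piece_key] requires; distinct lattice points then give non-isomorphic fields. *)
Lemma family_lb W m (S : pred (dyad n m)) eta : 0 < eta ->
  (forall j s, S j -> lft j <= s <= rgt j -> W (p s)) ->
  exists2 F, lb F (k1 * (c%:R * \sum_(j | S j) (rgt j - lft j - 2 * eta))) &
    forall B N, 0 < B -> iso_class_count (family W B) N -> F B <= N%:R.
Proof.
move=> e0 hS; have [T hT] := pieces_image m.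
pose s := enum [pred ij : 'I_c * dyad n m | S ij.2].
pose u ij := (T ij).1 + eta; pose v ij := (T ij).2 - eta.
pose G ij B a b := [&& u ij <= v ij, good_all Q a b, rg (u ij) (v ij) B a b & nf a b != 1].
pose bb ij B := bx (u ij) (v ij) B.
exists (fun B => \sum_(ij <- s) (cnt (bb ij B) (G ij B))%:R).
  rewrite -sum_pieces mulr_sumr; apply: lb_sum => ij.
  by have [e _ _] := hT ij; rewrite -e; have := dens_ne1 (u ij) (v ij); congr lb; rewrite /u /v; ring.
move=> B N B0 hN; pose M := \max_(ij : 'I_c * dyad n m) bb ij B.
have s10 := slo_gt0 R q0 q1 q2 D0; have s12 := slo_shi R q0 D0; have kk := kQ_gt0 R q0.
have rb ij a b : G ij B a b -> (a < bb ij B)%N /\ (b < bb ij B)%N.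
  by move=> /and4P[h _ r _]; exact: (box_region s10 s12 kk h) r.
have Gs ij a b : G ij B a b -> [/\ cone Q (a%:R : R) b%:R, nf a b < B ^+ 2 &
    exists2 s0, lft ij.2 < s0 < rgt ij.2 & tf a b = al (psi ij.1) s0].
  move=> /and4P[h _ /(region_tof q0 q1 q2 D0 _ _ _ h)[cn ht hn] _]; split=> //.
  by have [_ _ h2] := hT ij; apply: h2; rewrite /u /v in ht; lra.
have dis ij ij' a b : ij \in s -> ij' \in s -> G ij B a b -> G ij' B a b -> ij = ij'.
  move=> _ _ /Gs[_ _ [s1 hs1 e1]] /Gs[_ _ [s2 hs2 e2]].
  have [||] := piece_key (i := ij.1) (i' := ij'.1) (g := zone) hs1 hs2 unimod1.
  - exact: qact1.
  - by rewrite -e2 -e1 (al1 q0 D0).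
  - by case: ij ij' {e1 e2 hs1 hs2} => [i j] [i' j'] /= -> ->.
apply: (@le_trans _ _ (cnt M (fun a b => has (fun ij => G ij B a b) s))%:R); last first.
  rewrite ler_nat; apply: (@count_ge (family W B) (attached Q) N M _ hN).
  - move=> a b _ _ /hasP[ij]; rewrite mem_enum => Sij Gij; have [cn hn [s0 hs0 et]] := Gs _ _ _ Gij.
    move: Gij => /and4P[_ gd _ n1]; have [K aK] := attached_exists q0 q1 q2 D0 pQ gd cn n1.
    exists K; split=> //; apply/(familyP W B0 aK); split=> //.
    by rewrite et pt_al//; apply: hS Sij _; lra.
  - move=> K K' a b a' b' /hasP[ij _ /Gs[cn _ [s0 hs0 et]]] /hasP[ij' _ /Gs[cn' _ [s0' hs0' et']]] aK aK' iso.
    have [g [gu hg] [tg ng]] := attached_iso_move R q0 q1 q2 D0 pQ aK aK' iso.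
    have [|e1 e2 e3] := piece_key (i := ij.1) (i' := ij'.1) hs0 hs0' gu hg; first by rewrite -et -et' tg.
    by apply: (tof_nform_inj q0 D0 cn cn'); rewrite ?et ?et' ?e1 ?e3.
rewrite -natr_sum ler_nat.
apply: leq_trans (@cnt_disj _ s M _ (fun ij => G ij B) (enum_uniq _) _ dis).
  by apply: leq_sum => ij _; rewrite (@cnt_widen M (bb ij B))//; [exact: leq_bigmax|exact: rb].
by move=> ij a b ijs _ _ Gij; apply/hasP; exists ij.
Qed.

Variable g : 'I_n -> zmat.
Hypothesis hg : forall i, unimod (g i) /\ forall s, x i <= s <= y i -> gauss_domain (z_of (qact (Mt Q s) (g i))).
Local Notation Y := [set w | exists s, w = p s].

Lemma arc_point t : exists i s, x i <= s <= y i /\ p t = p s.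
Proof. by have [h ah [i hi]] := cov t; exists i, (al h t); split; [exact: hi|rewrite pt_al]. Qed.

Lemma sum_split m W (f : dyad n m -> R) : (\sum_(j | din q0 D0 x y W j || dmix q0 D0 x y W j) f j =
  \sum_(j | din q0 D0 x y W j) f j + \sum_(j | dmix q0 D0 x y W j) f j).
Proof.
rewrite [LHS]big_mkcond [X in _ = X + _]big_mkcond [X in _ = _ + X]big_mkcond -big_split /=.
apply: eq_bigr => j _; rewrite /din /dmix.
by case: (dmiss _ _ _ _ _ j); case: (dhit _ _ _ _ _ j); rewrite /= ?addr0 ?add0r.
Qed.

(** Pieces inside W bound the count from below, those inside or mixed from above. Both sums differ
    from the length of W by at most the mixed part, and the margins eta contribute at most their
    size times the number of pieces. *)
Lemma count_asymptotics W : W `<=` Y -> hyp_length (boundary_in Y W) = 0%E ->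
  [/\ (hyp_length W < +oo)%E,
   ub (fun B => (Ncount Q (B ^+ 4 * (qdisc Q)%:~R / 3) W)%:R) (k1 * c%:R * fine (hyp_length W)) &
   lb (fun B => (Ncount Q (B ^+ 4 * (qdisc Q)%:~R / 3) W)%:R) (k1 * c%:R * fine (hyp_length W))].
Proof.
move=> WY bW.
have Yp s : Y (p s) by exists s.
have Wp w : W w -> exists i s, x i <= s <= y i /\ w = p s.
  by move=> /WY[t ->]; have [i [s [hs e]]] := arc_point t; exists i, s.
have sw e : 0 < e -> exists m, \sum_(j : dyad n m | dmix q0 D0 x y W j) (rgt j - lft j) < e /\
   exists2 l : R, hyp_length W = l%:E & \sum_(j : dyad n m | din q0 D0 x y W j) (rgt j - lft j) <= l /\
     l <= \sum_(j : dyad n m | din q0 D0 x y W j) (rgt j - lft j) + \sum_(j : dyad n m | dmix q0 D0 x y W j) (rgt j - lft j).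
  move=> e0; have [m [h1 h2 h3]] := sandwich xy hg inj Yp Wp bW e0.
  exists m; split=> //; exists (fine (hyp_length W)).
    rewrite fineK// fin_numElt; apply/andP; split; first exact: lt_le_trans (ltNyr _) h2.
    exact: le_lt_trans h3 (ltry _).
  have fl : hyp_length W = (fine (hyp_length W))%:E.
    rewrite fineK// fin_numElt; apply/andP; split; first exact: lt_le_trans (ltNyr _) h2.
    exact: le_lt_trans h3 (ltry _).
  by rewrite -sum_split; move: h2 h3; rewrite {1 2}fl !lee_fin.
have [_ [_ [l el _]]] := sw 1 ltr01.
have Ne B N : iso_class_count (family W B) N -> Ncount Q (B ^+ 4 * (qdisc Q)%:~R / 3) W = N.
  exact: num_iso_classesE.
pose C := k1 * c%:R; have C0 : 0 <= C by rewrite mulr_ge0// ltW.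
have [C1 C1p CC] : exists2 C1, 0 < C1 & C <= C1 by exists (C + 1); lra.
have small e (k : nat) : 0 < e -> exists2 eta, 0 < eta & C * (k%:R * eta) <= e.
  move=> e0; have k0' : (0 : R) < k.+1%:R by rewrite ltr0n.
  have z0 : 0 < e / (C1 * k.+1%:R) by rewrite divr_gt0// mulr_gt0.
  exists (e / (C1 * k.+1%:R)) => //.
  apply: (@le_trans _ _ (C1 * (k.+1%:R * (e / (C1 * k.+1%:R))))).
    apply: ler_pM => //; first by rewrite mulr_ge0// ltW.
    by rewrite ler_wpM2r ?ler_nat// ltW.
  by rewrite le_eqVlt; apply/orP; left; apply/eqP; field; rewrite !gt_eqF.
have sum_eta m (P : pred (dyad n m)) (z : R) : 0 <= z -> \sum_(j | P j) z <= #|{: dyad n m}|%:R * z.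
  by move=> z0; rewrite sumr_const -[leLHS]mulr_natl ler_wpM2r// ler_nat max_card.
rewrite el ltry; split=> //=.
- apply: ub_approx => e e0; have e2 : 0 < e / 2 by lra.
  have [e1 e10 he1] := small _ 1%N e2.
  have [m [h1 [l' el' [h2 h3]]]] := sw _ e10.
  have ll : l' = l by move: el'; rewrite el => -[].
  have [eta eta0 heta] := small _ #|{: dyad n m}| e2.
  have [|F hF hN] := @family_ub W m (fun j => din q0 D0 x y W j || dmix q0 D0 x y W j) eta eta0.
    move=> i s hs Ws; have [j _ hj] := dyad_cover m hs.
    exists j; split=> //; have hh : dhit q0 D0 x y W j by apply/asboolP; exists s.
    by rewrite /din /dmix hh; case: (dmiss _ _ _ _ _ j).
  apply: (ub_le (G := F)).
    exists 1 => B B1; have B0 : 0 < B by lra.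
    by have [N iN hle] := hN B B0; rewrite (Ne _ _ iN); exact: hle.
  apply: ub_weak hF; rewrite mulrA -/C big_split /= sum_split -ll.
  have h4 := sum_eta m (fun j => din q0 D0 x y W j || dmix q0 D0 x y W j) _ (ltW eta0).
  apply: (@le_trans _ _ (C * (l' + 1%:R * e1 + #|{: dyad n m}|%:R * eta))).
    by rewrite ler_wpM2l// mul1r lerD// lerD// ltW.
  by rewrite !mulrDr; lra.
- apply: lb_approx => e e0; have e2 : 0 < e / 2 by lra.
  have [e1 e10 he1] := small _ 1%N e2.
  have [m [h1 [l' el' [h2 h3]]]] := sw _ e10.
  have ll : l' = l by move: el'; rewrite el => -[].
  have [eta eta0 heta] := small _ (#|{: dyad n m}| * 2)%N e2.
  have [|F hF hN] := @family_lb W m (fun j => din q0 D0 x y W j) eta eta0.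
    by move=> j s /asboolPn hn hs; apply: contrapT => nW; apply: hn; exists s.
  apply: (lb_le (G := F)).
    exists 1 => B B1; have B0 : 0 < B by lra.
    (* The upper count is invoked only for the existence of the number of classes, so that [Ncount]
       is not a default value. *)
    have [|F' _ hN'] := @family_ub W m (fun j => dhit q0 D0 x y W j) 1 ltr01.
      move=> i s hs Ws; have [j _ hj] := dyad_cover m hs.
      by exists j; split=> //; apply/asboolP; exists s.
    by have [N iN _] := hN' B B0; rewrite (Ne _ _ iN); exact: hN.
  apply: lb_weak hF; rewrite mulrA -/C sumrB -ll.
  have h4 := sum_eta m (fun j => din q0 D0 x y W j) _ (mulr_ge0 (ler0n R 2) (ltW eta0)).
  apply: (@le_trans _ _ (C * (l' - 1%:R * e1 - (#|{: dyad n m}| * 2)%:R * eta))).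
    by rewrite !mulrBr; lra.
  rewrite ler_wpM2l// mul1r natrM -mulrA; lra.
Qed.

End Pieces.
End Counting.

(** * Limits and conclusion *)

Section Limits.
Variable R : realType.

(** Substituting X = B^4 d / 3 gives B^2 = sqrt(3 / d) sqrt(X), which is the source of the factor
    sqrt(3 / d). *)
Lemma limit_of_bounds (N : R -> R) (c d l : R) : 0 < d -> ub (fun B => N (B ^+ 4 * d / 3)) (c * l) ->
  lb (fun B => N (B ^+ 4 * d / 3)) (c * l) ->
  (N X - c * Num.sqrt (3 / d) * l * Num.sqrt X) / Num.sqrt X @[X --> +oo] --> (0 : R).
Proof.
move=> d0 hu hl; apply/cvgrPdist_le => e e0.
pose r := Num.sqrt (3 / d); have r0 : 0 < r by rewrite sqrtr_gt0 divr_gt0.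
have e1 : 0 < e / r by rewrite divr_gt0.
have [B1 h1] := hu _ e1; have [B2 h2] := hl _ e1.
pose B0 := Num.max 1 (Num.max B1 B2).
have [B01 B02 B03] : [/\ 1 <= B0, B1 <= B0 & B2 <= B0] by rewrite /B0 !le_max !lexx !orbT.
exists (B0 ^+ 4 * d / 3); split; first exact: num_real.
move=> X hX /=; pose B := Num.sqrt (Num.sqrt (3 * X / d)).
have X0 : 0 < X by apply: le_lt_trans hX; rewrite divr_ge0// mulr_ge0 ?ltW// exprn_gt0//; lra.
have z0 : 0 <= 3 * X / d by apply: divr_ge0; [apply: mulr_ge0 => //; exact: ltW|exact: ltW].
have B2e : B ^+ 2 = Num.sqrt (3 * X / d) by rewrite sqr_sqrtr ?sqrtr_ge0.
have B4e : B ^+ 4 = 3 * X / d by rewrite -[4%N]/(2 * 2)%N exprM B2e sqr_sqrtr.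
have XE : B ^+ 4 * d / 3 = X by rewrite B4e; field; rewrite gt_eqF.
have B2X : B ^+ 2 = r * Num.sqrt X by rewrite B2e /r -sqrtrM ?divr_ge0 ?ltW//; congr Num.sqrt; field; rewrite gt_eqF.
have BB : B0 <= B.
  rewrite -(@ler_pXn2r _ 4)// ?nnegrE ?sqrtr_ge0//; last by lra.
  rewrite B4e ler_pdivlMr// -ler_pdivrMl ?ltr0n//; apply: le_trans (ltW hX).
  by rewrite mulrC.
have := h1 B (le_trans B02 BB); have := h2 B (le_trans B03 BB); rewrite XE B2X.
have s0 : 0 < Num.sqrt X by rewrite sqrtr_gt0.
move=> a1 a2; rewrite sub0r normrN normrM [`|_^-1|]ger0_norm ?invr_ge0 ?(ltW s0)// ler_pdivrMr// ler_norml.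
have er : e / r * r = e by rewrite divfK// gt_eqF.
have e2 : (c * l + e / r) * (r * Num.sqrt X) = c * r * l * Num.sqrt X + e * Num.sqrt X by rewrite -[in RHS]er; ring.
have e3 : (c * l - e / r) * (r * Num.sqrt X) = c * r * l * Num.sqrt X - e * Num.sqrt X by rewrite -[in RHS]er; ring.
rewrite e2 in a2; rewrite e3 in a1; rewrite -/r; apply/andP; split; lra.
Qed.

Lemma ratio_limit (N M : R -> R) (C l k : R) : C != 0 -> k != 0 ->
  (N X - C * l * Num.sqrt X) / Num.sqrt X @[X --> +oo] --> (0 : R) ->
  (M X - C * k * Num.sqrt X) / Num.sqrt X @[X --> +oo] --> (0 : R) ->
  N X / M X @[X --> +oo] --> l / k.
Proof.
move=> C0 k0 hN hM.
have lim (G : R -> R) z : (G X - C * z * Num.sqrt X) / Num.sqrt X @[X --> +oo] --> (0 : R) ->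
    G X / Num.sqrt X @[X --> +oo] --> C * z.
  move=> h; have := cvgD h (cvg_cst (C * z)); rewrite add0r => h2.
  apply: (@cvg_trans _ ((fun X => (G X - C * z * Num.sqrt X) / Num.sqrt X + C * z) @ +oo)); last exact: h2.
  apply: near_eq_cvg; near=> X; have s0 : 0 < Num.sqrt X by rewrite sqrtr_gt0; near: X; exact: nbhs_pinfty_gt.
  by rewrite /=; field; rewrite gt_eqF.
have Ck : C * k != 0 by rewrite mulf_neq0.
have := cvgM (lim _ _ hN) (cvgV Ck (lim _ _ hM)).
have -> : C * l * (C * k)^-1 = l / k by field; rewrite C0 k0.
move=> h2; apply: (@cvg_trans _ ((fun X => (N X / Num.sqrt X) * (M X / Num.sqrt X)^-1) @ +oo)); last exact: h2.
apply: near_eq_cvg; near=> X.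
have s0 : Num.sqrt X != 0 by rewrite gt_eqF// sqrtr_gt0; near: X; exact: nbhs_pinfty_gt.
by rewrite /= invfM invrK mulrACA mulVf// mulr1.
Unshelve. all: by end_near. Qed.

End Limits.

(** * Invariance under a change of Q in its class *)

Section Transfer.
Variable R : realType.

Lemma geodesic_class_act (Q : bqf int) g : unimod g -> qa Q != 0 -> qa (qact Q g) != 0 -> 0 < qdisc Q ->
  geodesic_class (qact Q g) = geodesic_class Q :> set R[i].
Proof.
move=> gu a0 a0' D0; have D0' : 0 < qdisc (qact Q g) by rewrite qdisc_act.
have sub (P : bqf int) h w : unimod h -> qa P != 0 -> qa (qact P h) != 0 -> 0 < qdisc P ->
    geodesic_class P w -> geodesic_class (qact P h) (w : R[i]).
  move=> hu p0 p0' P0; have P0' : 0 < qdisc (qact P h) by rewrite qdisc_act.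
  move=> /(geodesic_classP _ p0 P0)[gw [M [pM e [k ku ew]]]].
  apply/(geodesic_classP _ p0' P0'); split=> //; exists (qact M h); split.
  - exact: posdef_act.
  - by rewrite bqf_realact qpol_act.
  - exists (zmul (zinv h) k); first by apply: unimodM => //; exact: unimodV.
    by rewrite ew qactM qactVK.
apply/seteqP; split=> w; last exact: sub.
by move=> /(sub _ (zinv g) w (unimodV gu) a0'); rewrite qactVK//; apply.
Qed.

Lemma trace_class_actE (K : fieldExtType rat) (Q : bqf int) g : unimod g ->
  trace_class K (qact Q g) = trace_class K Q.
Proof.
move=> gu; apply/propext; split; last exact: trace_class_act.
by move=> /(trace_class_act (unimodV gu)); rewrite qactVK.
Qed.

Lemma Ncount_act (Q : bqf int) g X (W : set R[i]) : unimod g -> Ncount (qact Q g) X W = Ncount Q X W.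
Proof.
by move=> gu; rewrite /Ncount; congr num_iso_classes; apply/funext => K; rewrite trace_class_actE.
Qed.

End Transfer.

Lemma exp_means (R : realType) (A B : R) : 0 < A -> 0 < B ->
  exists c t, [/\ 0 < c, c * expR t = B & c * expR (- t) = A].
Proof.
move=> A0 B0; pose t := ln (B / A) / 2; pose c := Num.sqrt (A * B); exists c, t.
have c0 : 0 < c by rewrite sqrtr_gt0 mulr_gt0.
have cc : c ^+ 2 = A * B by rewrite sqr_sqrtr// mulr_ge0// ltW.
have et : expR t ^+ 2 = B / A by rewrite /t -expRM_natl mulrC divfK// lnK// posrE divr_gt0.
have cB : c * expR t = B.
  have : (c * expR t) ^+ 2 = B ^+ 2 by rewrite exprMn et cc; field; rewrite gt_eqF.
  by move/eqP; rewrite eqf_sqr => /orP[/eqP//|/eqP e]; have := mulr_gt0 c0 (expR_gt0 t); rewrite e; lra.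
split=> //.
have : (c * expR (- t)) * (c * expR t) = A * B by rewrite mulrACA -expRD addNr expR0 mulr1 -expr2.
by rewrite cB; move/mulIf; apply; rewrite gt_eqF.
Qed.

Section Negative.
Variables (R : realType) (Q : bqf int).
Hypotheses (q0 : qa Q < 0) (q1 : qb Q < 0) (q2 : qc Q < 0) (D0 : 0 < qdisc Q) (pQ : primQ Q).
Hypothesis Dns : forall e : int, qdisc Q != e ^+ 2.
Local Notation p := (@pt R Q q0 D0).
Local Notation r1 := (r1 R Q).
Local Notation r2 := (r2 R Q).

(** A form apolar to Q is a combination of (x - r1 y)^2 and (x - r2 y)^2, with coefficients M(r2, 1)
    and M(r1, 1) over (r1 - r2)^2; both are positive, so c and t come from their geometric mean and
    their ratio. *)
Lemma apolar_Mt (M : bqf R) : posdef M -> qpol (bqf_real R Q) M = 0 -> exists c t, 0 < c /\ M = qscale c (Mt Q t).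
Proof.
move=> pM; rewrite /qpol /= (sum_r R q0) (prod_r R q0 D0) => h.
have r := r12 R q0 D0; have d0 : r1 - r2 != 0 by rewrite subr_eq0 gt_eqF.
have a0 : (qa Q)%:~R != 0 :> R by rewrite intr_eq0 lt_eqF.
have m0 (z : R) : 0 < qeval M z 1 by apply: qeval_pos => //; rewrite oner_neq0 orbT.
pose A := qeval M r2 1 / (r1 - r2) ^+ 2; pose B := qeval M r1 1 / (r1 - r2) ^+ 2.
have dp : 0 < (r1 - r2) ^+ 2 by rewrite exprn_even_gt0.
have A0 : 0 < A by rewrite divr_gt0.
have B0 : 0 < B by rewrite divr_gt0.
have [c [t [c0 cB cA]]] := exp_means A0 B0.
exists c, t; split=> //; have ec : qc M = - (qa M * (r1 * r2)) - qb M * (r1 + r2) / 2.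
  apply: (mulfI a0); lra.
rewrite {}/A {}/B in A0 B0 cA cB *.
case: M pM h m0 A0 B0 cB cA ec => ra rb rc pM h m0 A0 B0 cB cA /= ec.
congr BQF; rewrite /=.
- by rewrite mulrDr cA cB /qeval /= ec; field.
- transitivity (-2 * ((c * expR (- t)) * r1 + (c * expR t) * r2)); last by ring.
  by rewrite cA cB /qeval /= ec; field.
- transitivity ((c * expR (- t)) * r1 ^+ 2 + (c * expR t) * r2 ^+ 2); last by ring.
  by rewrite cA cB /qeval /= ec; field.
Qed.

Lemma geodesic_class_pt : geodesic_class Q = [set w | exists s, w = p s].
Proof.
have a0 : qa Q != 0 by rewrite lt_eqF.
apply/seteqP; split=> w.
  move=> /(geodesic_classP _ a0 D0)[gw [M [pM e [g gu ew]]]].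
  have [c [t [c0 eM]]] := apolar_Mt pM e; exists t.
  have zz : w = z_of (qact (Mt Q t) g).
    by rewrite ew eM qact_scale z_of_scale//; apply: posdef_act => //; exact: posdef_Mt.
  by rewrite zz; apply: pt_unique => //; rewrite -zz.
move=> [s ->]; apply/(geodesic_classP _ a0 D0); split; first exact: pt_gauss.
exists (Mt Q s); split; [exact: posdef_Mt|exact: qpol_Q_Mt|].
by exists (gr q0 D0 s) => //; exact: gr_unimod.
Qed.

Lemma equidistribution (a0 b0 : nat) : good_all Q a0 b0 ->
  [/\ (0 < mu Q (geodesic_class Q : set R[i]) < +oo)%E,
      forall W : set R[i], mu_continuity_set Q W ->
        ((Ncount Q X W)%:R / (Ncount Q X (geodesic_class Q : set R[i]))%:R : R)
          @[X --> +oo] -->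
        fine (mu Q W) / fine (mu Q (geodesic_class Q : set R[i]))
    & exists2 C : R, 0 < C &
        forall W : set R[i], mu_continuity_set Q W ->
          (((Ncount Q X W)%:R - C * fine (mu Q W) * Num.sqrt X) / Num.sqrt X : R)
            @[X --> +oo] --> (0 : R)].
Proof.
move=> gd; have [d d0 dens] := good_density R q0 q1 q2 D0 pQ gd.
have [n [x [y [g [n0 xy hg cov [inj stab]]]]]] := arcs R q0 q1 q2 D0 Dns.
have [c [psi [c0 psiA psiC psiS]]] := sign_cosets R q0 D0.
set k1 := _ * d in dens; have k0 : 0 < k1.
  apply: mulr_gt0 => //.
  exact: (kappa_gt0 (slo_gt0 R q0 q1 q2 D0) (slo_shi R q0 D0) (kQ_gt0 R q0) (lexx (0 : R))).
have asy := count_asymptotics q1 q2 pQ xy cov inj stab psiA psiC psiS k0 dens hg.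
set Y := [set w | exists s, w = p s] in asy.
have gY : geodesic_class Q = Y := geodesic_class_pt.
have uv i : x i <= x i /\ x i <= y i <= y i by rewrite !lexx ltW.
have disj (i j : 'I_n) (s : R) : i = j -> x i <= s < y i -> x j <= s < y j -> i = j by [].
have len0 : hyp_length (set0 : set R[i]) = 0%E.
  apply/eqP; rewrite eq_le; apply/andP; split.
    by have := @length_le_pieces _ _ _ _ _ _ _ _ hg _ id x y uv set0 pred0; rewrite big_pred0_eq; apply.
  by have := @pieces_le_length _ _ _ _ _ _ _ _ hg inj _ id x y uv disj set0 pred0; rewrite big_pred0_eq; apply.
(* Relative to itself the whole class has an empty boundary, so it is a continuity set and the
   denominators obey the same asymptotics. *)
have bYY : hyp_length (boundary_in Y Y) = 0%E.
  by rewrite /boundary_in setDv closure0 setI0.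
have muE W : W `<=` Y -> mu Q W = hyp_length W by move=> WY; rewrite /mu gY setIidl.
have lenY : (0 < hyp_length Y)%E.
  have := @pieces_le_length _ _ _ _ _ _ _ _ hg inj _ id x y uv disj Y predT; move=> h.
  apply: lt_le_trans (h _); last by move=> j s _ _; exists s.
  rewrite lte_fin (bigD1 (Ordinal n0))//= ltr_pwDl ?subr_gt0// sumr_ge0// => j _.
  by rewrite subr_ge0 ltW.
have asyW W : mu_continuity_set Q W -> [/\ mu Q W = hyp_length W,
    ub (fun B => (Ncount Q (B ^+ 4 * (qdisc Q)%:~R / 3) W)%:R) (k1 * c%:R * fine (hyp_length W)) &
    lb (fun B => (Ncount Q (B ^+ 4 * (qdisc Q)%:~R / 3) W)%:R) (k1 * c%:R * fine (hyp_length W))].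
  rewrite /mu_continuity_set gY => -[WY _ bW].
  have bWY : hyp_length (boundary_in Y W) = 0%E by rewrite -muE// => w [[]].
  by have [_ h1 h2] := asy W WY bWY; split=> //; exact: muE.
have [Yfin hu hl] := asy Y (fun _ h => h) bYY.
have Dp : (0 : R) < (qdisc Q)%:~R by rewrite ltr0z.
(* [k1] is area times density, [c] the number of sign cosets, and the square root converts B^2 into
   sqrt(X). *)
pose C := k1 * c%:R * Num.sqrt (3 / (qdisc Q)%:~R).
have C0 : 0 < C.
  by apply: mulr_gt0; [apply: mulr_gt0 => //; rewrite ltr0n|rewrite sqrtr_gt0 divr_gt0].
have limW W : mu_continuity_set Q W ->
    (((Ncount Q X W)%:R - C * fine (mu Q W) * Num.sqrt X) / Num.sqrt X : R) @[X --> +oo] --> (0 : R).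
  by move=> /asyW[e h1 h2]; rewrite e; exact: (limit_of_bounds Dp h1 h2).
rewrite gY; split.
- by rewrite muE// lenY.
- move=> W hW; apply: (ratio_limit (C := C)); [by rewrite gt_eqF| |exact: limW|].
    rewrite muE// gt_eqF// fine_gt0// lenY//.
  by rewrite muE//; exact: (limit_of_bounds Dp hu hl).
- by exists C.
Qed.

End Negative.

(** Counts, geodesic and measure depend only on the class of Q, which allows negative coefficients;
    the given field then provides the good pair from which the sieve starts. *)
Theorem theoremE (R : realType) (Q : bqf int)
    (hQ : exists K : fieldExtType rat,
        [/\ complex_cubic R K, ~ pure K & trace_class K Q]) :
  [/\ (0 < mu Q (geodesic_class Q : set R[i]) < +oo)%E,
      forall W : set R[i], mu_continuity_set Q W ->
        ((Ncount Q X W)%:R / (Ncount Q X (geodesic_class Q : set R[i]))%:R : R)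
          @[X --> +oo] -->
        fine (mu Q W) / fine (mu Q (geodesic_class Q : set R[i]))
    & exists2 C : R, 0 < C &
        forall W : set R[i], mu_continuity_set Q W ->
          (((Ncount Q X W)%:R - C * fine (mu Q W) * Num.sqrt X) / Num.sqrt X : R)
            @[X --> +oo] --> (0 : R)].
Proof.
have [K [hK np tc]] := hQ.
have [pQ D0 Dns] := nonpure_form hK np tc; have [a0 _] := qa_neq0 Dns.
have [g gu [n0 n1 n2]] := neg_form a0 D0.
have D0' : 0 < qdisc (qact Q g) by rewrite qdisc_act.
have Dns' (e : int) : qdisc (qact Q g) != e ^+ 2 by rewrite qdisc_act.
have pQ' := primQ_act gu pQ.
have [a [b aK]] := trace_class_attached R n0 n1 n2 D0' pQ' (dim_cubic hK) (trace_class_act gu tc).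
have gd := attached_good R n0 n1 n2 D0' pQ' aK.
have := equidistribution R n0 n1 n2 D0' pQ' Dns' gd.
have eG : geodesic_class (qact Q g) = geodesic_class Q :> set R[i].
  by apply: geodesic_class_act => //; rewrite lt_eqF.
have eN : Ncount (qact Q g) = Ncount Q :> (R -> set R[i] -> nat).
  by apply/funext => X; apply/funext => W; exact: Ncount_act.
have em : mu (qact Q g) = mu Q :> (set R[i] -> \bar R) by apply/funext => W; rewrite /mu eG.
by rewrite /mu_continuity_set eN em eG.
Qed.
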